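(* There is an absolute constant $c>0$ such that the following holds. Let $\theta>0$ be given. Then for all $T$ large enough, and all Dirichlet polynomials $$M_\theta(s)=\sum_{n\le T^\theta}\frac{a(n)}{n^s}\quad\text{with } a(n)\ll n^{\varepsilon}\text{ and } a(1)=1,$$ we have $$\mathcal{I}(M_\theta):=\frac1T\int_T^{2T}\left|1-\zeta(\tfrac12+it)M_\theta(\tfrac12+it)\right|^2dt\ \ge\ \frac{c}{\theta}.$$
   Context: $\zeta$ is the Riemann zeta-function. The coefficients $a(n)$ are complex and may depend on $T$. The condition $a(n)\ll n^\varepsilon$ means: for every $\varepsilon>0$ there is a constant $C_\varepsilon$, independent of $T$, with $|a(n)|\le C_\varepsilon n^\varepsilon$ for all $n\le T^\theta$. ''$T$ large enough'' may depend on $\theta$ and on the constants $C_\varepsilon$; the constant $c$ depends on nothing. *)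

(* Defs.v *)
From Stdlib Require Import Reals ZArith Lra Lia.
From Coquelicot Require Import Coquelicot.
Open Scope R_scope.

Definition Cexp (z : C) : C := (exp (Re z) * cos (Im z), exp (Re z) * sin (Im z)).

(* [x^s = exp (s log x)] for real [x > 0]. *)
Definition cpow (x : R) (s : C) : C := Cexp (s * ln x)%C.

(* Coquelicot's [Series] is real-valued. *)
Definition CSeries (a : nat -> C) : C :=
  (Series (fun n => Re (a n)), Series (fun n => Im (a n))).

(* [x^(-s) - \int_x^(x+1) u^(-s) du] *)
Definition zeta_term (s : C) (x : R) : C :=
  (cpow x (- s) - (cpow (x + 1) (1 - s) - cpow x (1 - s)) / (1 - s))%C.

(* The Riemann zeta-function on [Re s > 0], [s <> 1]:
     zeta(s) = 1/(s-1) + \sum_(n >= 1) (n^(-s) - \int_n^(n+1) u^(-s) du).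
   By [zeta_is_riemann_zeta] below this is the analytic continuation of
   [\sum_(n >= 1) n^(-s)] to that domain; values elsewhere are junk. *)
Definition zeta (s : C) : C :=
  (/ (s - 1) + CSeries (fun n => zeta_term s (INR (S n))))%C.

Definition is_riemann_zeta (Z : C -> C) : Prop :=
  (forall s : C, 0 < Re s -> s <> 1 ->
     @ex_derive C_AbsRing C_NormedModule Z s) /\
  (forall s : C, 1 < Re s ->
     @is_series C_AbsRing C_NormedModule
       (fun n => (1 / cpow (INR (S n)) s)%C) (Z s)).

Definition nat_floor (x : R) : nat := Z.to_nat (Int_part x).

Definition dirichlet_poly (a : nat -> C) (x : R) (s : C) : C :=
  sum_n_m (fun n => (a n / cpow (INR n) s)%C) 1 (nat_floor x).

Definition mollified_moment (M : C -> C) (T : R) : R :=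
  / T * RInt (fun t => let s := (RtoC (1 / 2) + Ci * RtoC t)%C in
                 Cmod (1 - zeta s * M s)%C ^ 2) T (2 * T).

(* Everything below serves [zeta_is_riemann_zeta]. *)

Lemma Cexp_plus (z w : C) : Cexp (z + w) = (Cexp z * Cexp w)%C.
Proof.
unfold Cexp, Cmult, Cplus, Re, Im; simpl.
rewrite exp_plus, cos_plus, sin_plus; f_equal; ring.
Qed.

Lemma Cmod_Cexp (z : C) : Cmod (Cexp z) = exp (Re z).
Proof.
unfold Cmod, Cexp; simpl.
replace (_ + _) with (exp (Re z) * exp (Re z) * (Rsqr (sin (Im z)) + Rsqr (cos (Im z))))
  by (unfold Rsqr; ring).
rewrite sin2_cos2, Rmult_1_r; apply sqrt_square, Rlt_le, exp_pos.
Qed.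

Lemma Cexp_0 : Cexp 0 = 1.
Proof. unfold Cexp; simpl; rewrite exp_0, cos_0, sin_0; apply injective_projections; simpl; ring. Qed.

Lemma cpow_plus (x : R) (a b : C) : cpow x (a + b) = (cpow x a * cpow x b)%C.
Proof. unfold cpow; rewrite <- Cexp_plus; f_equal; ring. Qed.

Lemma cpow_0 (x : R) : cpow x 0 = 1.
Proof. unfold cpow; rewrite Cmult_0_l; apply Cexp_0. Qed.

Lemma cpow_1_l (s : C) : cpow 1 s = 1.
Proof. unfold cpow; rewrite ln_1, Cmult_0_r; apply Cexp_0. Qed.

Lemma cpow_neq_0 (x : R) (a : C) : cpow x a <> 0.
Proof.
unfold cpow; apply Cmod_gt_0; rewrite Cmod_Cexp; apply exp_pos.
Qed.

Lemma cpow_opp (x : R) (a : C) : cpow x (- a) = (/ cpow x a)%C.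
Proof.
assert (H : (cpow x (- a) * cpow x a)%C = 1).
{ rewrite <- cpow_plus, <- (cpow_0 x); f_equal; ring. }
pose proof (cpow_neq_0 x a) as H0.
replace (cpow x (- a)) with (cpow x (- a) * cpow x a / cpow x a)%C by (field; exact H0).
rewrite H; field; exact H0.
Qed.

Lemma cpow_1_r (x : R) : 0 < x -> cpow x 1 = x.
Proof.
intros Hx; unfold cpow, Cexp; simpl.
replace (1 * ln x - 0 * 0) with (ln x) by ring.
replace (1 * 0 + 0 * ln x) with 0 by ring.
rewrite exp_ln, cos_0, sin_0 by exact Hx; apply injective_projections; simpl; ring.
Qed.

Lemma Cmod_cpow (x : R) (a : C) : Cmod (cpow x a) = exp (Re a * ln x).
Proof. unfold cpow; rewrite Cmod_Cexp; f_equal; unfold Re; simpl; ring. Qed.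

Definition dC (f : R -> C) (t : R) (l : C) : Prop :=
  is_derive (fun x => Re (f x)) t (Re l) /\ is_derive (fun x => Im (f x)) t (Im l).

Lemma dC_eq f t l l' : dC f t l -> l = l' -> dC f t l'.
Proof. intros H <-; exact H. Qed.

Lemma dC_const (z : C) t : dC (fun _ => z) t 0.
Proof.
split; [exact (is_derive_const (Re z) t) | exact (is_derive_const (Im z) t)].
Qed.

Lemma dC_RtoC (f : R -> R) t l : is_derive f t l -> dC (fun x => RtoC (f x)) t (RtoC l).
Proof. intros H; split; [exact H | exact (is_derive_const 0 t)]. Qed.

Lemma dC_plus f g t l m : dC f t l -> dC g t m -> dC (fun x => (f x + g x)%C) t (l + m)%C.
Proof.
intros [F1 F2] [G1 G2]; split; simpl.
- exact (is_derive_plus _ _ _ _ _ F1 G1).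
- exact (is_derive_plus _ _ _ _ _ F2 G2).
Qed.

Lemma is_derive_Rmult (f g : R -> R) t l m :
  is_derive f t l -> is_derive g t m ->
  is_derive (fun x => f x * g x) t (l * g t + f t * m).
Proof. intros F G; apply (is_derive_mult f g t l m F G); intros; apply Rmult_comm. Qed.

Lemma dC_mult f g t l m : dC f t l -> dC g t m ->
  dC (fun x => (f x * g x)%C) t (l * g t + f t * m)%C.
Proof.
intros [F1 F2] [G1 G2]; split; simpl.
- eapply filterdiff_ext_lin.
  apply (is_derive_minus (V := R_NormedModule)); apply is_derive_Rmult; eassumption.
  intros y; simpl; unfold scal, minus, plus, opp; simpl; unfold mult; simpl.
  unfold Re, Im; ring.
- eapply filterdiff_ext_lin.
  apply (is_derive_plus (V := R_NormedModule)); apply is_derive_Rmult; eassumption.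
  intros y; simpl; unfold scal, minus, plus, opp; simpl; unfold mult; simpl.
  unfold Re, Im; ring.
Qed.

Lemma dC_Cexp f t l : dC f t l -> dC (fun x => Cexp (f x)) t (l * Cexp (f t))%C.
Proof.
intros [F1 F2].
assert (E : is_derive (fun x => exp (Re (f x))) t (Re l * exp (Re (f t)))).
{ apply (is_derive_comp exp (fun x => Re (f x)) t); [apply is_derive_exp | exact F1]. }
assert (Cs : is_derive (fun x => cos (Im (f x))) t (Im l * - sin (Im (f t)))).
{ apply (is_derive_comp cos (fun x => Im (f x)) t); [apply is_derive_cos | exact F2]. }
assert (Sn : is_derive (fun x => sin (Im (f x))) t (Im l * cos (Im (f t)))).
{ apply (is_derive_comp sin (fun x => Im (f x)) t); [apply is_derive_sin | exact F2]. }
split; simpl.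
- eapply filterdiff_ext_lin; [apply is_derive_Rmult; eassumption |].
  intros y; unfold scal; simpl; unfold mult; simpl; unfold Re, Im; ring.
- eapply filterdiff_ext_lin; [apply is_derive_Rmult; eassumption |].
  intros y; unfold scal; simpl; unfold mult; simpl; unfold Re, Im; ring.
Qed.

Lemma dC_ln t : 0 < t -> dC (fun u => RtoC (ln u)) t (RtoC (/ t)).
Proof. intros Ht; apply dC_RtoC, is_derive_ln, Ht. Qed.

Lemma dC_cpow a t : 0 < t -> dC (fun u => cpow u a) t (a * cpow t (a - 1))%C.
Proof.
intros Ht; unfold cpow at 1.
eapply dC_eq.
- apply dC_Cexp, dC_mult; [apply dC_const | apply dC_ln, Ht].
- unfold Cminus; rewrite cpow_plus, cpow_opp, cpow_1_r by exact Ht.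
  rewrite RtoC_inv by lra.
  change (cpow t a) with (Cexp (a * ln t)).
  field; intros H; apply RtoC_inj in H; lra.
Qed.

Lemma dC_MVT (f df : R -> C) (a b B : R) : a < b ->
  (forall t, a <= t <= b -> dC f t (df t)) ->
  (forall t, a <= t <= b -> Cmod (df t) <= B) ->
  Cmod (f b - f a) <= B * (b - a).
Proof.
intros Hab Hd HB.
set (w := (f b - f a)%C).
assert (Hpsi : forall t, a <= t <= b -> is_derive
  (fun t => Re w * Re (f t) + Im w * Im (f t)) t (Re w * Re (df t) + Im w * Im (df t))).
{ intros t Ht; destruct (Hd t Ht) as [D1 D2].
  apply (is_derive_plus (V := R_NormedModule)).
  - exact (is_derive_scal (fun x => Re (f x)) t (Re w) _ D1).
  - exact (is_derive_scal (fun x => Im (f x)) t (Im w) _ D2). }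
destruct (MVT_gen (fun t => Re w * Re (f t) + Im w * Im (f t)) a b
  (fun t => Re w * Re (df t) + Im w * Im (df t))) as [c [Hc E]].
- rewrite Rmin_left, Rmax_right by lra; intros; apply Hpsi; lra.
- rewrite Rmin_left, Rmax_right by lra; intros x Hx.
  apply continuity_pt_filterlim.
  apply (ex_derive_continuous (V := R_NormedModule)
    (fun t => Re w * Re (f t) + Im w * Im (f t)) x).
  eexists; apply Hpsi, Hx.
- rewrite Rmin_left, Rmax_right in Hc by lra.
  assert (E2 : Cmod w ^ 2 = (Re w * Re (df c) + Im w * Im (df c)) * (b - a)).
  { rewrite <- E; unfold Cmod; rewrite pow2_sqrt by nra.
    unfold w, Cminus, Cplus, Copp, Re, Im; simpl; ring. }
  assert (E3 : Re w * Re (df c) + Im w * Im (df c) <= Cmod w * Cmod (df c)).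
  { rewrite <- (Cmod_conj w), <- Cmod_mult.
    eapply Rle_trans; [| apply (Rle_trans _ _ _ (Rle_abs _) (re_le_Cmod _))].
    unfold Cconj, Cmult, Re, Im; simpl; lra. }
  pose proof (Cmod_ge_0 w) as W.
  pose proof (HB c Hc) as Bc.
  destruct (Req_dec (Cmod w) 0) as [Z | NZ].
  + rewrite Z; pose proof (Cmod_ge_0 (df c)); nra.
  + apply (Rmult_le_reg_l (Cmod w)); [lra |].
    assert (Cmod w * Cmod (df c) <= Cmod w * B) by (apply Rmult_le_compat_l; lra).
    nra.
Qed.

Lemma dC_MVT2 (H r dr : R -> C) (x B : R) :
  (forall u, x <= u <= x + 1 -> dC H u (r x - r u)%C) ->
  (forall u, x <= u <= x + 1 -> dC r u (dr u)) ->
  (forall u, x <= u <= x + 1 -> Cmod (dr u) <= B) ->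
  Cmod (H (x + 1) - H x) <= B.
Proof.
intros HH Hr HB.
assert (B0 : 0 <= B).
{ apply (Rle_trans _ (Cmod (dr x))); [apply Cmod_ge_0 | apply HB; lra]. }
replace B with (B * (x + 1 - x)) by ring.
apply (dC_MVT H (fun u => (r x - r u)%C)); [lra | exact HH |].
intros u Hu.
replace (r x - r u)%C with (- (r u - r x))%C by ring; rewrite Cmod_opp.
destruct (Req_dec u x) as [-> | Hne].
- replace (r x - r x)%C with (RtoC 0) by ring; rewrite Cmod_0; exact B0.
- apply (Rle_trans _ (B * (u - x))); [| nra].
  apply (dC_MVT r dr); [lra | intros; apply Hr; lra | intros; apply HB; lra].
Qed.

Lemma Cmod_Cexp_le (z : C) (t : R) : 0 <= t <= 1 -> Cmod (Cexp (t * z)) <= exp (Cmod z).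
Proof.
intros Ht; rewrite Cmod_Cexp.
destruct (Rle_lt_or_eq_dec _ _ (Rle_trans _ _ _ (Rle_abs _) (re_le_Cmod (t * z)%C))) as [L|L];
rewrite Cmod_mult, Cmod_R, (Rabs_pos_eq t) in L by lra; pose proof (Cmod_ge_0 z).
- apply Rlt_le, exp_increasing; nra.
- rewrite L. destruct (Req_dec (t * Cmod z) (Cmod z)) as [-> | N]; [lra |].
  apply Rlt_le, exp_increasing; nra.
Qed.

Lemma dC_Cexp_line (z : C) (t : R) :
  dC (fun t => Cexp (t * z)) t (z * Cexp (t * z))%C.
Proof.
eapply dC_eq.
- apply dC_Cexp, dC_mult; [apply (dC_RtoC (fun x => x)), (is_derive_id (K := R_AbsRing)) | apply dC_const].
- cbv beta; change (RtoC one) with (RtoC 1); ring.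
Qed.

Lemma Cexp_sub_1 (z : C) (t : R) : 0 <= t <= 1 ->
  Cmod (Cexp (t * z) - 1) <= Cmod z * exp (Cmod z).
Proof.
intros Ht; pose proof (Cmod_ge_0 z); pose proof (exp_pos (Cmod z)).
rewrite <- Cexp_0.
replace (Cexp 0) with (Cexp (RtoC 0 * z)) by (f_equal; ring).
destruct (Req_dec t 0) as [-> | N].
- replace (_ - _)%C with (RtoC 0) by ring; rewrite Cmod_0; nra.
- apply (Rle_trans _ (Cmod z * exp (Cmod z) * (t - 0))).
  + apply (dC_MVT (fun t => Cexp (t * z)) (fun t => (z * Cexp (t * z))%C)); [lra | |].
    * intros; apply dC_Cexp_line.
    * intros u Hu; rewrite Cmod_mult; apply Rmult_le_compat_l; [lra |].
      apply Cmod_Cexp_le; lra.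
  + assert (0 <= Cmod z * exp (Cmod z)) by nra; nra.
Qed.

Lemma Cexp_sub_1_1 (z : C) : Cmod (Cexp z - 1) <= Cmod z * exp (Cmod z).
Proof. rewrite <- (Cmult_1_l z) at 1; apply Cexp_sub_1; lra. Qed.

Lemma Cexp_sub_2 (z : C) : Cmod (Cexp z - 1 - z) <= Cmod z ^ 2 * exp (Cmod z).
Proof.
pose proof (Cmod_ge_0 z).
replace (Cexp z - 1 - z)%C with
  ((Cexp (RtoC 1 * z) - RtoC 1 * z) - (Cexp (RtoC 0 * z) - RtoC 0 * z))%C.
2:{ rewrite Cmult_1_l, Cmult_0_l, Cexp_0; ring. }
replace (Cmod z ^ 2 * exp (Cmod z)) with (Cmod z ^ 2 * exp (Cmod z) * (1 - 0)) by ring.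
apply (dC_MVT (fun t => (Cexp (t * z) - t * z)%C) (fun t => (z * (Cexp (t * z) - 1))%C)); [lra | |].
- intros t _; eapply dC_eq.
  + apply dC_plus; [apply dC_Cexp_line |].
    eapply (dC_eq (fun x => (- (x * z))%C) t (- z)%C); [| reflexivity].
    split; simpl.
    * auto_derive; [trivial | unfold Re, Im; simpl; ring].
    * auto_derive; [trivial | unfold Re, Im; simpl; ring].
  + ring.
- intros t Ht; rewrite Cmod_mult; simpl; rewrite Rmult_1_r, Rmult_assoc.
  apply Rmult_le_compat_l; [lra | apply Cexp_sub_1, Ht].
Qed.

Lemma dC_id u : dC (fun u => RtoC u) u 1.
Proof. exact (dC_RtoC (fun x => x) u 1 (is_derive_id (K := R_AbsRing) u)). Qed.

Lemma dC_opp f t l : dC f t l -> dC (fun x => (- f x)%C) t (- l)%C.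
Proof.
intros [F1 F2]; split; simpl.
- exact (is_derive_opp _ _ _ F1).
- exact (is_derive_opp _ _ _ F2).
Qed.

Lemma dC_minus f g t l m : dC f t l -> dC g t m -> dC (fun x => (f x - g x)%C) t (l - m)%C.
Proof. intros; apply dC_plus; [| apply dC_opp]; assumption. Qed.

Lemma dC_divc f (z : C) t l : dC f t l -> dC (fun x => (f x / z)%C) t (l / z)%C.
Proof.
intros H; eapply dC_eq; [apply dC_mult; [exact H | apply dC_const] |].
unfold Cdiv; ring.
Qed.

Section Term.

Variable x : R.
Hypothesis Hx : 1 <= x.

Let F (s : C) (u : R) : C := (u * cpow x (- s) - cpow u (1 - s) / (1 - s))%C.
Let G (s : C) (u : R) : C :=
  (- (u * (ln x * cpow x (- s))) + ln u * cpow u (1 - s) / (1 - s)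
   - cpow u (1 - s) / ((1 - s) * (1 - s)))%C.

Definition zeta_dterm (s : C) : C := (G s (x + 1) - G s x)%C.

Lemma zeta_term_F (s : C) : zeta_term s x = (F s (x + 1) - F s x)%C.
Proof. unfold zeta_term, F, Cdiv; rewrite RtoC_plus; ring. Qed.

Lemma dC_F (s : C) (u : R) : s <> 1 -> x <= u -> dC (F s) u (cpow x (- s) - cpow u (- s))%C.
Proof.
intros Hs Hu; unfold F; eapply dC_eq.
- apply dC_minus.
  + apply dC_mult; [apply dC_id | apply dC_const].
  + apply dC_divc, dC_cpow; lra.
- replace (1 - s - 1)%C with (- s)%C by ring.
  field; intros E; apply Hs, (proj2 (Ceq_minus s 1)).
  replace (s - 1)%C with (- (1 - s))%C by ring; rewrite E; ring.
Qed.

Lemma dC_G (s : C) (u : R) : s <> 1 -> x <= u ->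
  dC (G s) u (- (ln x * cpow x (- s)) - - (ln u * cpow u (- s)))%C.
Proof.
intros Hs Hu; unfold G; eapply dC_eq.
- apply dC_minus.
  + apply dC_plus.
    * apply dC_opp, dC_mult; [apply dC_id | apply dC_const].
    * apply dC_divc, dC_mult; [apply dC_ln | apply dC_cpow]; lra.
  + apply dC_divc, dC_cpow; lra.
- replace (1 - s - 1)%C with (- s)%C by ring.
  replace (cpow u (1 - s)) with (u * cpow u (- s))%C.
  2:{ unfold Cminus; rewrite cpow_plus, cpow_1_r by lra; reflexivity. }
  rewrite RtoC_inv by lra.
  field; split.
  + intros E; apply Hs, (proj2 (Ceq_minus s 1)).
    replace (s - 1)%C with (- (1 - s))%C by ring; rewrite E; ring.
  + intros E; apply RtoC_inj in E; lra.
Qed.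

Lemma ln_nonneg u : 1 <= u -> 0 <= ln u.
Proof.
intros Hu; destruct (Rle_lt_or_eq_dec _ _ Hu) as [L | <-].
- rewrite <- ln_1; apply Rlt_le, ln_increasing; lra.
- rewrite ln_1; lra.
Qed.

Lemma exp_le a b : a <= b -> exp a <= exp b.
Proof.
intros H; destruct (Rle_lt_or_eq_dec _ _ H) as [L | ->]; [| lra].
apply Rlt_le, exp_increasing, L.
Qed.

Lemma ln_le_mono u : x <= u -> ln x <= ln u.
Proof.
intros H; destruct (Rle_lt_or_eq_dec _ _ H) as [L | ->]; [| lra].
apply Rlt_le, ln_increasing; lra.
Qed.

Lemma ln_exp_bound (eta e L : R) : 0 < eta -> 0 <= L ->
  L * exp e <= / eta * exp (e + eta * L).
Proof.
intros He HL; rewrite exp_plus.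
assert (eta * L <= exp (eta * L)).
{ pose proof (exp_ineq1_le (eta * L)); lra. }
apply (Rmult_le_reg_l eta); [exact He |].
replace (eta * (/ eta * (exp e * exp (eta * L)))) with (exp e * exp (eta * L)) by (field; lra).
pose proof (exp_pos e); nra.
Qed.

Variable s : C.
Hypothesis Hs0 : 0 < Re s.
Hypothesis Hs1 : s <> 1.

Let del := Re s / 4.
Let eta := Re s / 8.
Let bnd := exp (- (1 + del) * ln x).

Lemma bnd_le (u e : R) : x <= u -> e <= - (1 + del) -> exp (e * ln u) <= bnd.
Proof.
intros Hu He; apply exp_le.
pose proof (ln_le_mono u Hu); pose proof (ln_nonneg x Hx).
unfold del in *; nra.
Qed.

Lemma zeta_term_bound : Cmod (zeta_term s x) <= Cmod s * bnd.
Proof.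
rewrite zeta_term_F.
apply (dC_MVT2 (F s) (fun u => cpow u (- s)) (fun u => (- s * cpow u (- s - 1))%C)).
- intros u Hu; apply dC_F; [exact Hs1 | lra].
- intros u Hu; apply dC_cpow; lra.
- intros u Hu; rewrite Cmod_mult, Cmod_opp, Cmod_cpow.
  apply Rmult_le_compat_l; [apply Cmod_ge_0 |].
  apply bnd_le; [lra |]; unfold del; unfold Re in *; simpl; lra.
Qed.

Lemma zeta_dterm_bound : Cmod (zeta_dterm s) <= (1 + / eta * Cmod s) * bnd.
Proof.
unfold zeta_dterm.
apply (dC_MVT2 (G s) (fun u => (- (ln u * cpow u (- s)))%C)
  (fun u => (- ((1 - s * ln u) * cpow u (- s - 1)))%C)).
- intros u Hu; apply dC_G; [exact Hs1 | lra].
- intros u Hu; eapply dC_eq.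
  + apply dC_opp, dC_mult; [apply dC_ln | apply dC_cpow]; lra.
  + cbv beta; replace (cpow u (- s)) with (u * cpow u (- s - 1))%C.
    2:{ rewrite <- (cpow_1_r u) at 1 by lra; rewrite <- cpow_plus; f_equal; ring. }
    rewrite RtoC_inv by lra.
    field; intros E; apply RtoC_inj in E; lra.
- intros u Hu; rewrite Cmod_opp, Cmod_mult, Cmod_cpow.
  assert (L0 := ln_nonneg u ltac:(lra)).
  set (e := Re (- s - 1)%C * ln u).
  assert (He : exp e <= bnd).
  { apply bnd_le; [lra |]; unfold del, Re in *; simpl; lra. }
  assert (He2 : exp (e + eta * ln u) <= bnd).
  { unfold e; rewrite <- Rmult_plus_distr_r; apply bnd_le; [lra |].
    unfold del, eta, Re in *; simpl; lra. }
  assert (E : Cmod (1 - s * ln u) <= 1 + Cmod s * ln u).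
  { eapply Rle_trans; [apply Cmod_triangle |].
    rewrite Cmod_1, Cmod_opp, Cmod_mult, Cmod_R, Rabs_pos_eq by exact L0; lra. }
  pose proof (exp_pos e) as P; pose proof (Cmod_ge_0 s) as S0.
  apply (Rle_trans _ ((1 + Cmod s * ln u) * exp e)); [nra |].
  assert (Q := ln_exp_bound eta e (ln u) ltac:(unfold eta; lra) L0).
  assert (0 < / eta) by (apply Rinv_0_lt_compat; unfold eta; lra).
  assert (ln u * exp e <= / eta * bnd) by nra.
  nra.
Qed.

Variable h : C.
Hypothesis Hh : Cmod h <= Re s / 2.
Hypothesis Hsh : (s + h)%C <> 1.

Lemma zeta_remainder_bound :
  Cmod (zeta_term (s + h) x - zeta_term s x - h * zeta_dterm s)
  <= Cmod h ^ 2 * ((Cmod s * (/ eta * / eta) + / eta) * bnd).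
Proof.
rewrite !zeta_term_F; unfold zeta_dterm.
replace (_ - _ - _)%C with
  ((F (s + h) (x + 1) - F s (x + 1) - h * G s (x + 1))
   - (F (s + h) x - F s x - h * G s x))%C by ring.
apply (dC_MVT2 (fun u => F (s + h) u - F s u - h * G s u)%C
  (fun u => (cpow u (- (s + h)) - cpow u (- s) + h * (ln u * cpow u (- s)))%C)
  (fun u => ((- s * (Cexp (- h * ln u) - 1 - (- h * ln u))
              - h * (Cexp (- h * ln u) - 1)) * cpow u (- s - 1))%C)).
- intros u Hu; eapply dC_eq.
  + apply dC_minus; [apply dC_minus; apply dC_F; try assumption; lra |].
    apply dC_mult; [apply dC_const | apply dC_G; [exact Hs1 | lra]].
  + cbv beta; ring.
- intros u Hu; eapply dC_eq.
  + apply dC_plus; [apply dC_minus; apply dC_cpow; lra |].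
    apply dC_mult; [apply dC_const |].
    apply dC_mult; [apply dC_ln | apply dC_cpow]; lra.
  + fold (cpow u (- h)).
    replace (cpow u (- (s + h) - 1)) with (cpow u (- h) * cpow u (- s - 1))%C
      by (rewrite <- cpow_plus; f_equal; ring).
    replace (cpow u (- s)) with (u * cpow u (- s - 1))%C.
    2:{ rewrite <- (cpow_1_r u) at 1 by lra; rewrite <- cpow_plus; f_equal; ring. }
    rewrite RtoC_inv by lra.
    field; intros E; apply RtoC_inj in E; lra.
- intros u Hu; rewrite Cmod_mult, Cmod_cpow.
  assert (L0 := ln_nonneg u ltac:(lra)).
  set (e := Re (- s - 1)%C * ln u).
  pose proof (Cmod_ge_0 s) as S0; pose proof (Cmod_ge_0 h) as H0.
  set (L := ln u) in *.
  assert (Eh : Cmod (- h * L) = Cmod h * L).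
  { rewrite Cmod_mult, Cmod_opp, Cmod_R, Rabs_pos_eq by exact L0; reflexivity. }
  pose proof (Cexp_sub_2 (- h * L)%C) as B2; pose proof (Cexp_sub_1_1 (- h * L)%C) as B1.
  rewrite Eh in B1, B2.
  set (X := exp (Cmod h * L)) in *.
  assert (A : Cmod (- s * (Cexp (- h * L) - 1 - (- h * L)) - h * (Cexp (- h * L) - 1))
              <= Cmod h ^ 2 * ((Cmod s * (L * L) + L) * X)).
  { eapply Rle_trans; [apply Cmod_triangle |].
    rewrite Cmod_opp, !Cmod_mult, Cmod_opp.
    apply (Rmult_le_compat_l _ _ _ S0) in B2; apply (Rmult_le_compat_l _ _ _ H0) in B1.
    eapply Rle_trans; [apply Rplus_le_compat; [exact B2 | exact B1] |].
    apply Req_le; ring. }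
  pose proof (exp_pos e) as P.
  apply (Rle_trans _ (Cmod h ^ 2 * ((Cmod s * (L * L) + L) * X) * exp e)); [nra |].
  rewrite Rmult_assoc; apply Rmult_le_compat_l; [apply pow2_ge_0 |].
  rewrite Rmult_assoc; unfold X; rewrite <- exp_plus.
  set (e' := Cmod h * L + e).
  assert (Heta : 0 < eta) by (unfold eta; lra).
  assert (0 < / eta) by (apply Rinv_0_lt_compat, Heta).
  assert (Q1 := ln_exp_bound eta e' L Heta L0).
  assert (Q2 := ln_exp_bound eta (e' + eta * L) L Heta L0).
  assert (He1 : exp (e' + eta * L) <= bnd).
  { unfold e', e; rewrite <- !Rmult_plus_distr_r; apply bnd_le; [lra |].
    unfold del, eta, Re in *; simpl; lra. }
  assert (He2 : exp (e' + eta * L + eta * L) <= bnd).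
  { unfold e', e; rewrite <- !Rmult_plus_distr_r; apply bnd_le; [lra |].
    unfold del, eta, Re in *; simpl; lra. }
  assert (R1 : L * exp e' <= / eta * bnd) by nra.
  assert (R2 : L * L * exp e' <= / eta * / eta * bnd).
  { apply (Rle_trans _ (/ eta * (L * exp (e' + eta * L)))).
    - apply (Rmult_le_compat_l L) in Q1; [| exact L0].
      eapply Rle_trans; [| eapply Rle_trans; [exact Q1 |]]; apply Req_le; ring.
    - rewrite Rmult_assoc; apply Rmult_le_compat_l; [lra | nra]. }
  replace ((Cmod s * (L * L) + L) * exp e')
    with (Cmod s * (L * L * exp e') + L * exp e') by ring.
  apply (Rmult_le_compat_l _ _ _ S0) in R2; lra.
Qed.

End Term.

Lemma is_lim_exp_ln (d : R) : 0 < d ->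
  is_lim_seq (fun n => exp (- d * ln (INR (S n)))) 0.
Proof.
intros Hd.
apply (is_lim_comp_seq exp (fun n => - d * ln (INR (S n))) m_infty 0).
- apply is_lim_exp_m.
- exists 0%nat; intros; discriminate.
- replace m_infty with (Rbar_mult (- d) p_infty).
  2:{ simpl; case Rle_dec; [intros; exfalso; lra | reflexivity]. }
  apply is_lim_seq_scal_l.
  apply (is_lim_comp_seq ln (fun n => INR (S n)) p_infty p_infty).
  + apply is_lim_ln_p.
  + exists 0%nat; intros; discriminate.
  + apply is_lim_seq_incr_1 with (u := INR), is_lim_seq_INR.
Qed.

Lemma is_series_telescope (g : nat -> R) : is_lim_seq g 0 ->
  is_series (fun n => g n - g (S n)) (g 0%nat).
Proof.
intros Hg.
assert (E : forall n, g 0%nat - g (S n) = sum_n (fun n => g n - g (S n)) n).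
{ induction n; [rewrite sum_O; reflexivity |].
  rewrite sum_Sn, <- IHn; unfold plus; simpl; ring. }
apply (is_lim_seq_ext _ _ (g 0%nat) E).
replace (g 0%nat) with (g 0%nat - 0) at 1 by ring.
apply is_lim_seq_minus'; [apply is_lim_seq_const |].
apply is_lim_seq_incr_1 in Hg; exact Hg.
Qed.

Lemma ex_series_pow (d : R) : 0 < d ->
  ex_series (fun n => exp (- (1 + d) * ln (INR (S n)))).
Proof.
intros Hd; apply ex_series_incr_1.
set (g := fun n => exp (- d * ln (INR (S n)))).
apply (ex_series_le (K := R_AbsRing) (V := R_CompleteNormedModule) _
  (fun n => / d * (g n - g (S n)))).
- intros n; unfold norm; simpl norm; unfold abs; simpl.
  rewrite Rabs_pos_eq by (apply Rlt_le, exp_pos).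
  change (match n with 0%nat => 1 | S _ => INR n + 1 end) with (INR (S n)).
  set (y := INR (S n)).
  assert (Hy : 1 <= y) by (unfold y; rewrite S_INR; pose proof (pos_INR n); lra).
  assert (HG : g n - g (S n) = exp (- d * ln y) - exp (- d * ln (y + 1))).
  { unfold g, y; rewrite (S_INR (S n)); reflexivity. }
  rewrite HG.
  destruct (MVT_gen (fun u => exp (- d * ln u)) y (y + 1)
    (fun u => - d * exp (- (1 + d) * ln u))) as [c [Hc E]].
  + intros u; rewrite Rmin_left, Rmax_right by lra; intros Hu.
    auto_derive; [lra |].
    replace (- (1 + d) * ln u) with (- d * ln u + - ln u) by ring.
    rewrite exp_plus, exp_Ropp, exp_ln by lra; field; lra.
  + intros u; rewrite Rmin_left, Rmax_right by lra; intros Hu.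
    apply continuity_pt_filterlim.
    apply (ex_derive_continuous (V := R_NormedModule) (fun u => exp (- d * ln u)) u).
    auto_derive; lra.
  + rewrite Rmin_left, Rmax_right in Hc by lra.
    apply (Rle_trans _ (exp (- (1 + d) * ln c))).
    * apply exp_le; assert (ln c <= ln (y + 1)) by (apply ln_le_mono; lra); nra.
    * apply Req_le; apply (Rmult_eq_reg_l d); [| lra].
      rewrite <- Rmult_assoc, Rinv_r, Rmult_1_l by lra; lra.
- apply (ex_series_scal (V := R_NormedModule)); exists (g 0%nat).
  apply is_series_telescope, is_lim_exp_ln, Hd.
Qed.

Notation is_Cseries := (@is_series C_AbsRing C_NormedModule).

Lemma Re_sum_n (a : nat -> C) n :
  Re (sum_n (G := C_NormedModule) a n) = sum_n (fun k => Re (a k)) n.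
Proof. induction n; [rewrite !sum_O; reflexivity |]. rewrite !sum_Sn, <- IHn; reflexivity. Qed.

Lemma Im_sum_n (a : nat -> C) n :
  Im (sum_n (G := C_NormedModule) a n) = sum_n (fun k => Im (a k)) n.
Proof. induction n; [rewrite !sum_O; reflexivity |]. rewrite !sum_Sn, <- IHn; reflexivity. Qed.

Lemma Cmod_le_sum (z : C) : Cmod z <= Rabs (Re z) + Rabs (Im z).
Proof.
replace z with (RtoC (Re z) + Ci * RtoC (Im z))%C at 1.
2:{ apply injective_projections; unfold Re, Im; simpl; ring. }
eapply Rle_trans; [apply Cmod_triangle |].
rewrite Cmod_mult, !Cmod_R.
assert (Cmod Ci = 1) as ->; [| lra].
unfold Cmod, Ci; simpl; rewrite Rmult_0_l, !Rmult_1_l, Rplus_0_l; apply sqrt_1.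
Qed.

Lemma im_le_Cmod (z : C) : Rabs (Im z) <= Cmod z.
Proof. eapply Rle_trans; [apply Rmax_r | apply Rmax_Cmod]. Qed.

Lemma is_Cseries_parts (a : nat -> C) (l : C) :
  is_Cseries a l <->
  is_series (fun n => Re (a n)) (Re l) /\ is_series (fun n => Im (a n)) (Im l).
Proof.
split.
- intros H; split; apply filterlim_locally; intros eps.
  + generalize (proj1 (filterlim_locally_ball_norm _ _) H eps); apply filter_imp; intros n Hn.
    rewrite <- Re_sum_n.
    apply (Rle_lt_trans _ _ _ (re_le_Cmod (sum_n (G := C_NormedModule) a n - l)%C) Hn).
  + generalize (proj1 (filterlim_locally_ball_norm _ _) H eps); apply filter_imp; intros n Hn.
    rewrite <- Im_sum_n.
    apply (Rle_lt_trans _ _ _ (im_le_Cmod (sum_n (G := C_NormedModule) a n - l)%C) Hn).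
- intros [H1 H2]; apply filterlim_locally_ball_norm; intros eps.
  generalize (filter_and _ _
    (proj1 (filterlim_locally _ _) H1 (pos_div_2 eps))
    (proj1 (filterlim_locally _ _) H2 (pos_div_2 eps))).
  apply filter_imp; intros n [B1 B2].
  rewrite <- Re_sum_n in B1; rewrite <- Im_sum_n in B2.
  apply (Rle_lt_trans _ _ _ (Cmod_le_sum (sum_n (G := C_NormedModule) a n - l)%C)).
  change (Rabs (Re (sum_n (G := C_NormedModule) a n) - Re l) < eps / 2) in B1.
  change (Rabs (Im (sum_n (G := C_NormedModule) a n) - Im l) < eps / 2) in B2.
assert (R1 : forall z w : C, Re (z - w) = Re z - Re w) by reflexivity.
assert (R2 : forall z w : C, Im (z - w) = Im z - Im w) by reflexivity.
rewrite R1, R2; lra.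
Qed.

Lemma CSeries_unique (a : nat -> C) (l : C) : is_Cseries a l -> CSeries a = l.
Proof.
intros H; apply is_Cseries_parts in H; destruct H as [H1 H2].
apply is_series_unique in H1; apply is_series_unique in H2.
apply injective_projections; simpl; assumption.
Qed.

Section Dominated.

Variables (a : nat -> C) (b : nat -> R).
Hypothesis Hab : forall n, Cmod (a n) <= b n.
Hypothesis Hb : ex_series b.

Lemma CSeries_correct : is_Cseries a (CSeries a).
Proof.
apply is_Cseries_parts; split; apply Series_correct;
  apply (ex_series_le (K := R_AbsRing) (V := R_CompleteNormedModule) _ b); auto;
  intros n; eapply Rle_trans; [apply re_le_Cmod | apply Hab | apply im_le_Cmod | apply Hab].
Qed.

Lemma CSeries_bound : Cmod (CSeries a) <= 2 * Series b.
Proof.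
assert (K : forall f : nat -> R, (forall n, Rabs (f n) <= b n) -> Rabs (Series f) <= Series b).
{ intros f Hf.
  assert (ex_series (fun n => Rabs (f n))).
  { apply (ex_series_le (K := R_AbsRing) (V := R_CompleteNormedModule) _ b); auto.
    intros n; unfold norm; simpl; unfold abs; simpl; rewrite Rabs_Rabsolu; auto. }
  eapply Rle_trans; [apply Series_Rabs; assumption |].
  apply Series_le; auto; intros n; split; [apply Rabs_pos | auto]. }
eapply Rle_trans; [apply Cmod_le_sum |]; simpl.
assert (Rabs (Series (fun n => Re (a n))) <= Series b).
{ apply K; intros n; eapply Rle_trans; [apply re_le_Cmod | apply Hab]. }
assert (Rabs (Series (fun n => Im (a n))) <= Series b).
{ apply K; intros n; eapply Rle_trans; [apply im_le_Cmod | apply Hab]. }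
lra.
Qed.

End Dominated.

Lemma INR_S_ge_1 n : 1 <= INR (S n).
Proof. rewrite S_INR; pose proof (pos_INR n); lra. Qed.

Lemma zeta_series (s : C) : 0 < Re s -> s <> 1 ->
  is_Cseries (fun n => zeta_term s (INR (S n))) (CSeries (fun n => zeta_term s (INR (S n)))).
Proof.
intros H0 H1.
apply CSeries_correct with
  (b := fun n => Cmod s * exp (- (1 + Re s / 4) * ln (INR (S n)))).
- intros n; apply zeta_term_bound; auto using INR_S_ge_1.
- apply (ex_series_scal (V := R_NormedModule)), ex_series_pow; lra.
Qed.

Lemma zeta_dirichlet_series (s : C) : 1 < Re s ->
  is_Cseries (fun n => (1 / cpow (INR (S n)) s)%C) (zeta s).
Proof.
intros H.
assert (H1 : s <> 1) by (intros ->; simpl in H; lra).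
assert (H2 : (1 - s)%C <> 0).
{ intros E; apply H1, (proj2 (Ceq_minus s 1)); replace (s - 1)%C with (- (1 - s))%C by ring.
  rewrite E; ring. }
set (g := fun n => (- (cpow (INR (S n)) (1 - s) / (1 - s)))%C).
assert (Hlim : forall n, Cmod (g n) = / Cmod (1 - s) * exp (- (Re s - 1) * ln (INR (S n)))).
{ intros n; unfold g; rewrite Cmod_opp, Cmod_div, Cmod_cpow by exact H2.
  unfold Rdiv; rewrite Rmult_comm; f_equal; f_equal; f_equal; unfold Re; simpl; ring. }
assert (L0 : is_lim_seq (fun n => Cmod (g n)) 0).
{ apply (is_lim_seq_ext (fun n => / Cmod (1 - s) * exp (- (Re s - 1) * ln (INR (S n))))).
  - intros n; symmetry; apply Hlim.
  - replace (Finite 0) with (Rbar_mult (/ Cmod (1 - s)) 0) by (simpl; f_equal; ring).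
    apply is_lim_seq_scal_l, is_lim_exp_ln; lra. }
assert (Hg : is_Cseries (fun n => (g n - g (S n))%C) (g 0%nat)).
{ apply is_Cseries_parts; split.
  - apply (is_series_telescope (fun n => Re (g n))), is_lim_seq_abs_0.
    apply (is_lim_seq_le_le (fun _ => 0) _ (fun n => Cmod (g n))); auto using is_lim_seq_const.
    intros n; split; [apply Rabs_pos | apply re_le_Cmod].
  - apply (is_series_telescope (fun n => Im (g n))), is_lim_seq_abs_0.
    apply (is_lim_seq_le_le (fun _ => 0) _ (fun n => Cmod (g n))); auto using is_lim_seq_const.
    intros n; split; [apply Rabs_pos | apply im_le_Cmod]. }
assert (E0 : g 0%nat = (/ (s - 1))%C).
{ unfold g; change (INR 1) with 1; rewrite cpow_1_l; field; split; auto.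
  intros E; apply H1, (proj2 (Ceq_minus s 1)), E. }
unfold zeta; rewrite <- E0.
eapply is_series_ext; [| exact (is_series_plus _ _ _ _ Hg (zeta_series s ltac:(lra) H1))].
intros n.
change ((g n - g (S n)) + zeta_term s (INR (S n)) = 1 / cpow (INR (S n)) s)%C.
unfold g; rewrite (S_INR (S n)); unfold zeta_term, Cdiv; rewrite cpow_opp; ring.
Qed.

Lemma zeta_derivable (s : C) : 0 < Re s -> s <> 1 ->
  @ex_derive C_AbsRing C_NormedModule zeta s.
Proof.
intros H0 H1.
set (d := Re s / 4); set (eta := Re s / 8).
set (b := fun n => exp (- (1 + d) * ln (INR (S n)))).
assert (Hb : ex_series b) by (apply ex_series_pow; unfold d; lra).
set (D := CSeries (fun n => zeta_dterm (INR (S n)) s)).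
assert (HD : is_Cseries (fun n => zeta_dterm (INR (S n)) s) D).
{ apply CSeries_correct with (b := fun n => (1 + / eta * Cmod s) * b n).
  - intros n; apply zeta_dterm_bound; auto using INR_S_ge_1.
  - apply (ex_series_scal (V := R_NormedModule)), Hb. }
assert (N1 : (s - 1)%C <> 0) by (intros E; apply H1, (proj2 (Ceq_minus s 1)), E).
assert (M1 : 0 < Cmod (s - 1)) by (apply Cmod_gt_0, N1).
set (K := Cmod s * (/ eta * / eta) + / eta).
set (K' := 2 / Cmod (s - 1) ^ 3 + 2 * (K * Series b)).
exists (D - / ((s - 1) * (s - 1)))%C.
assert (Main : forall h : C, Cmod h <= Re s / 2 -> Cmod h <= Cmod (s - 1) / 2 ->
  Cmod (zeta (s + h) - zeta s - h * (D - / ((s - 1) * (s - 1)))) <= K' * Cmod h ^ 2).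
{ intros h Hh1 Hh2.
  assert (M2 : Cmod (s - 1) / 2 <= Cmod (s + h - 1)).
  { pose proof (Cmod_triangle (s + h - 1) (- h)) as Tr.
    rewrite Cmod_opp in Tr.
    replace (s + h - 1 + - h)%C with (s - 1)%C in Tr by ring; lra. }
  assert (N2 : (s + h - 1)%C <> 0) by (apply Cmod_gt_0; lra).
  assert (H2 : (s + h)%C <> 1) by (intros E; apply N2; rewrite E; ring).
  assert (R2 : 0 < Re (s + h)%C).
  { pose proof (Rabs_le_between (Re h) (Cmod h)) as [B' _].
    specialize (B' (re_le_Cmod h)); unfold Re in *; simpl; lra. }
  set (r := fun n => (zeta_term (s + h) (INR (S n)) - zeta_term s (INR (S n))
                      - h * zeta_dterm (INR (S n)) s)%C).
  assert (Hr : is_Cseries r (CSeries (fun n => zeta_term (s + h) (INR (S n)))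
                - CSeries (fun n => zeta_term s (INR (S n))) - h * D)%C).
  { exact (is_series_minus _ _ _ _
      (is_series_minus _ _ _ _ (zeta_series (s + h) R2 H2) (zeta_series s H0 H1))
      (is_series_scal (K := C_AbsRing) (V := C_NormedModule) h _ _ HD)). }
  apply CSeries_unique in Hr.
  assert (Br : Cmod (CSeries r) <= 2 * Series (fun n => Cmod h ^ 2 * (K * b n))).
  { apply CSeries_bound.
    - intros n; apply zeta_remainder_bound; auto using INR_S_ge_1.
    - apply (ex_series_scal (V := R_NormedModule)), (ex_series_scal (V := R_NormedModule)), Hb. }
  rewrite !Series_scal_l in Br.
  replace (_ - _ - _)%C with
    (h * h / ((s - 1) * (s - 1) * (s + h - 1)) + CSeries r)%C.
  2:{ rewrite Hr; unfold zeta; field; auto. }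
  eapply Rle_trans; [apply Cmod_triangle |].
  assert (Q : Cmod (h * h / ((s - 1) * (s - 1) * (s + h - 1)))
              <= 2 / Cmod (s - 1) ^ 3 * Cmod h ^ 2).
  { rewrite Cmod_div by (repeat apply Cmult_neq_0; auto).
    rewrite !Cmod_mult.
    apply (Rle_trans _ (Cmod h * Cmod h / (Cmod (s - 1) * Cmod (s - 1) * (Cmod (s - 1) / 2)))).
    - apply Rmult_le_compat_l; [pose proof (Cmod_ge_0 h); nra |].
      apply Rinv_le_contravar; [repeat apply Rmult_lt_0_compat; lra |].
      apply Rmult_le_compat_l; [nra | exact M2].
    - apply Req_le; field; lra. }
  unfold K'; nra. }
split; [apply is_linear_scal_l |].
intros y Hy.
apply (is_filter_lim_locally_unique (V := AbsRing_NormedModule C_AbsRing)) in Hy as <-.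
intros eps.
assert (HK : 0 < Rabs K' + 1) by (pose proof (Rabs_pos K'); lra).
set (rad := Rmin (Rmin (Re s / 2) (Cmod (s - 1) / 2)) (eps / (Rabs K' + 1))).
assert (Hrad : 0 < rad).
{ repeat apply Rmin_pos; try lra; apply Rdiv_lt_0_compat; [apply cond_pos | exact HK]. }
exists (mkposreal _ Hrad); intros z Hz.
change (Cmod (z - s) < rad) in Hz.
change (Cmod (zeta z - zeta s - (z - s) * (D - / ((s - 1) * (s - 1)))) <= eps * Cmod (z - s)).
set (h := (z - s)%C) in *.
replace z with (s + h)%C by (unfold h; ring).
assert (rad <= Re s / 2)
  by (eapply Rle_trans; [apply Rmin_l | apply Rmin_l]).
assert (rad <= Cmod (s - 1) / 2)
  by (eapply Rle_trans; [apply Rmin_l | apply Rmin_r]).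
assert (Hr3 : rad <= eps / (Rabs K' + 1)) by apply Rmin_r.
eapply Rle_trans; [apply Main; lra |].
pose proof (Cmod_ge_0 h) as P; pose proof (Rle_abs K').
assert (Cmod h * (Rabs K' + 1) <= eps).
{ apply (Rmult_le_reg_r (/ (Rabs K' + 1))); [apply Rinv_0_lt_compat, HK |].
  rewrite Rmult_assoc, Rinv_r by lra; unfold Rdiv in Hr3; lra. }
simpl; rewrite Rmult_1_r, <- Rmult_assoc; apply Rmult_le_compat_r; [exact P | nra].
Qed.

Theorem zeta_is_riemann_zeta : is_riemann_zeta zeta.
Proof. split; [exact zeta_derivable | exact zeta_dirichlet_series]. Qed.

(* Main.v *)
(* Put F = 1 - zeta M.

   For small theta use duality. Let z = T^theta, x = T^(1/20), and H(s) = sum k^(s-1) over the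
   1 < k <= x free of divisors in [2, z]. Moving the line of integration from 1/2 to 2, where only
   the terms with nm = k survive, shows that the mean of Re(F H) on the critical line is close to
   - V with V = sum 1/k: the k are rough, so only m = 1 contributes, and a(1) = 1. The mean of
   |H|^2 is close to V as well. Since |F|^2 >= - 2 Re(F H) - |H|^2, the moment is at least about V,
   which by a sieve and a Mertens-type bound is >> log x / log z >> 1 / theta.

   For the other theta a bound >> 1 / (1 + theta) suffices. Let d = r / log T with r a small multiple
   of 1 / (1 + theta), and G = M (2 - zeta M), so that zeta G = 1 - F^2. Jensen's inequality bounds
   the means of log |zeta(1/2 + d + it)| and of log |G(1/2 - d + it)| from below by about 0, whereas
   the functional equation makes |zeta(1/2 - d + it)| larger than |zeta(1/2 + d + it)| by a factor
   e^r. Hence log |1 - F^2| has mean at least about r on the line 1/2 - d, so |F|^2 has mean >> r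
   there, and convexity in the abscissa carries this over to the critical line. *)

Require Import Defs.
From Stdlib Require Import Reals ZArith Lra Lia FunctionalExtensionality.
From Coquelicot Require Import Coquelicot.
Open Scope R_scope.

(** No contour integral occurs: the analysis is calculus on the segment T <= t <= 2T under a smooth
    weight [w] vanishing at both ends. After integration by parts against [w], subharmonicity
    becomes convexity of weighted means in the abscissa, which yields both the Jensen inequality and
    the convexity bound, and the Cauchy-Riemann equations become the movement of a line. This takes
    up to two continuous derivatives, so [zeta] is replaced by the explicit [Zp N] with N a large
    power of T. The gamma factors are compared without Stirling's formula: elementary inequalities
    such as e^y >= 1 + y are integrated against the Mellin kernel. The theta relation behind the
    functional equation is a limit of finite Fourier inversion. Two regimes are needed because the
    convexity step runs from abscissa 1/4, where the a priori bound for the mollified product is a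
    power T^D with D = 6 + 4 theta; hence r is of order 1/D and stays bounded as theta tends to 0.
    Duality does produce 1/theta, but only once log x / log z outweighs the sieve constant
    exp(-8). *)

Fixpoint Rsum (f : nat -> R) (n : nat) : R :=
  match n with O => 0 | S k => Rsum f k + f k end.

Fixpoint Csum (f : nat -> C) (n : nat) : C :=
  match n with O => 0 | S k => Csum f k + f k end.

Lemma Rsum_ext f g n : (forall k, (k < n)%nat -> f k = g k) -> Rsum f n = Rsum g n.
Proof.
induction n as [|n IH]; intros H; [reflexivity | simpl].
rewrite IH, H by (intros; try apply H; lia); reflexivity.
Qed.

Lemma Csum_ext f g n : (forall k, (k < n)%nat -> f k = g k) -> Csum f n = Csum g n.
Proof.
induction n as [|n IH]; intros H; [reflexivity | simpl].
rewrite IH, H by (intros; try apply H; lia); reflexivity.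
Qed.

Lemma Rsum_le f g n : (forall k, (k < n)%nat -> f k <= g k) -> Rsum f n <= Rsum g n.
Proof.
induction n as [|n IH]; intros H; simpl; [lra |].
apply Rplus_le_compat; [apply IH; intros; apply H | apply H]; lia.
Qed.

Lemma Rsum_const c n : Rsum (fun _ => c) n = INR n * c.
Proof. induction n as [|n IH]; [simpl; ring |]. rewrite S_INR; simpl; rewrite IH; ring. Qed.

Lemma Rsum_plus f g n : Rsum (fun k => f k + g k) n = Rsum f n + Rsum g n.
Proof. induction n as [|n IH]; simpl; [ring | rewrite IH; ring]. Qed.

Lemma Rsum_scal c f n : Rsum (fun k => c * f k) n = c * Rsum f n.
Proof. induction n as [|n IH]; simpl; [ring | rewrite IH; ring]. Qed.

Lemma Csum_mod f n : Cmod (Csum f n) <= Rsum (fun k => Cmod (f k)) n.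
Proof.
induction n as [|n IH]; simpl; [rewrite Cmod_0; lra |].
eapply Rle_trans; [apply Cmod_triangle | lra].
Qed.

Lemma Csum_mult_l c f n : Csum (fun k => (c * f k)%C) n = (c * Csum f n)%C.
Proof. induction n as [|n IH]; simpl; [ring | rewrite IH; ring]. Qed.

Lemma Re_Csum f n : Re (Csum f n) = Rsum (fun k => Re (f k)) n.
Proof. induction n as [|n IH]; simpl; [reflexivity |]; rewrite <- IH; reflexivity. Qed.

Lemma Im_Csum f n : Im (Csum f n) = Rsum (fun k => Im (f k)) n.
Proof. induction n as [|n IH]; simpl; [reflexivity |]; rewrite <- IH; reflexivity. Qed.

Lemma Rsum_S_l f n : Rsum f (S n) = f 0%nat + Rsum (fun k => f (S k)) n.
Proof.
induction n as [|n IH]; [simpl; ring |].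
change (Rsum f (S (S n))) with (Rsum f (S n) + f (S n)); rewrite IH; simpl; ring.
Qed.

Lemma Csum_S_l f n : Csum f (S n) = (f 0%nat + Csum (fun k => f (S k)) n)%C.
Proof.
induction n as [|n IH]; [simpl; ring |].
change (Csum f (S (S n))) with (Csum f (S n) + f (S n))%C; rewrite IH; simpl; ring.
Qed.

Lemma Rsum_exchange (f : nat -> nat -> R) m n :
  Rsum (fun i => Rsum (f i) n) m = Rsum (fun j => Rsum (fun i => f i j) m) n.
Proof.
induction m as [|m IH]; simpl.
- rewrite Rsum_const; ring.
- rewrite IH, <- Rsum_plus; reflexivity.
Qed.

Definition indic (b : bool) : R := if b then 1 else 0.

Lemma indic_range b : 0 <= indic b <= 1.
Proof. destruct b; simpl; lra. Qed.

(** Serves three times: to keep the multiples of the group order in the finite Fourier inversion, to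
    remove the multiples of a prime in the sieve, and to count multiples of a prime in log n!. *)
Lemma Rsum_multiples (f : nat -> R) d n : (1 <= d)%nat ->
  Rsum (fun i => indic (S i mod d =? 0)%nat * f (S i)) n = Rsum (fun i => f (d * S i)%nat) (n / d).
Proof.
intros Hd; induction n as [|n IH]; [rewrite Nat.Div0.div_0_l; reflexivity |].
cbn [Rsum]; rewrite IH.
pose proof (Nat.div_mod_eq n d) as E; pose proof (Nat.mod_upper_bound n d ltac:(lia)) as M.
destruct (Nat.eq_dec (S (n mod d)) d) as [Q | Q].
- assert (E2 : S n = (d * S (n / d))%nat) by nia.
  assert (E3 : (S n / d = S (n / d))%nat) by (symmetry; apply (Nat.div_unique _ _ _ 0); lia).
  assert (E4 : (S n mod d = 0)%nat) by (symmetry; apply (Nat.mod_unique _ _ (S (n / d))); lia).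
  rewrite E3, E4; cbn [Rsum]; rewrite E2; simpl indic; ring.
- assert (E3 : (S n / d = n / d)%nat)
    by (symmetry; apply (Nat.div_unique _ _ _ (S (n mod d))); lia).
  assert (E4 : (S n mod d = S (n mod d))%nat) by (symmetry; apply (Nat.mod_unique _ _ (n / d)); lia).
  rewrite E3, E4; simpl indic; ring.
Qed.

Lemma is_series_Rsum f l : is_series f l <-> is_lim_seq (Rsum f) l.
Proof.
assert (E : forall n, sum_n f n = Rsum f (S n)).
{ induction n as [|n IH]; [rewrite sum_O; symmetry; apply Rplus_0_l |].
  rewrite sum_Sn, IH; reflexivity. }
split; intros H.
- apply is_lim_seq_incr_1; eapply is_lim_seq_ext; [exact E | exact H].
- apply is_lim_seq_incr_1 in H.
  assert (is_lim_seq (sum_n f) l); [| assumption].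
  eapply is_lim_seq_ext; [| exact H]; intros; symmetry; apply E.
Qed.

Lemma Rsum_le_Series f n : (forall k, 0 <= f k) -> ex_series f -> Rsum f n <= Series f.
Proof.
intros H0 [l Hl]; rewrite (is_series_unique _ _ Hl).
apply is_series_Rsum in Hl.
apply (is_lim_seq_incr_compare _ _ Hl); intros; simpl; specialize (H0 n0); lra.
Qed.

(** * Smooth functions on the upper half-plane *)

Definition cont2 (f : R -> R -> R) : Prop :=
  forall x y, 0 < y -> continuity_2d_pt f x y.

Definition Ccont (G : C -> C) : Prop :=
  cont2 (fun x y => Re (G (x, y))) /\ cont2 (fun x y => Im (G (x, y))).

(** Complex differentiability as two one-variable derivatives, the form that differentiation under
    an integral and integration by parts along a vertical line consume. The half-plane 0 < y
    contains the segments in use and avoids the pole at 1. *)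
Definition hol (G G' : C -> C) : Prop :=
  forall x y, 0 < y -> dC (fun u => G (u, y)) x (G' (x, y)) /\
                       dC (fun v => G (x, v)) y (Ci * G' (x, y))%C.

(** Derivatives are witnessed rather than computed, so closure under sums and products is a plain
    induction. Order 2 is for the Laplacian, order 1 for moving a line, order 0 for joint
    continuity. *)
Fixpoint smooth (n : nat) (G : C -> C) : Prop :=
  Ccont G /\ match n with O => True | S m => exists G', hol G G' /\ smooth m G' end.

Lemma cont2_mult f g : cont2 f -> cont2 g -> cont2 (fun x y => f x y * g x y).
Proof. intros F G x y H; apply continuity_2d_pt_mult; auto. Qed.

Lemma cont2_plus f g : cont2 f -> cont2 g -> cont2 (fun x y => f x y + g x y).
Proof. intros F G x y H; apply continuity_2d_pt_plus; auto. Qed.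

Lemma cont2_minus f g : cont2 f -> cont2 g -> cont2 (fun x y => f x y - g x y).
Proof. intros F G x y H; apply continuity_2d_pt_minus; auto. Qed.

Lemma cont2_const c : cont2 (fun _ _ => c).
Proof. intros x y H; apply continuity_2d_pt_const. Qed.

Lemma cont2_x : cont2 (fun x _ => x).
Proof. intros x y H; apply continuity_2d_pt_id1. Qed.

Lemma cont2_y : cont2 (fun _ y => y).
Proof. intros x y H; apply continuity_2d_pt_id2. Qed.

Lemma cont2_comp (h : R -> R) f : cont2 f ->
  (forall x y, 0 < y -> continuity_pt h (f x y)) -> cont2 (fun x y => h (f x y)).
Proof. intros F H x y Hy; apply continuity_1d_2d_pt_comp; auto. Qed.

Lemma cont2_slice f x y : cont2 f -> 0 < y -> continuous (fun t => f x t) y.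
Proof.
intros F Hy; apply continuity_pt_filterlim.
intros eps Heps; destruct (F x y Hy (mkposreal eps Heps)) as [d Hd].
exists d; split; [apply cond_pos |]; intros t [_ Ht].
apply Hd; [rewrite Rminus_diag, Rabs_R0; apply cond_pos | exact Ht].
Qed.

#[local] Hint Resolve cont2_mult cont2_plus cont2_minus cont2_const cont2_x cont2_y : cont2.

Lemma smooth_cont n G : smooth n G -> Ccont G.
Proof. destruct n; intros H; apply H. Qed.

Lemma smooth_S n G : smooth (S n) G -> smooth n G.
Proof.
revert G; induction n as [|n IH]; intros G [H [G' [H1 H2]]]; split; auto.
exists G'; split; auto.
Qed.

Lemma Ccont_plus F G : Ccont F -> Ccont G -> Ccont (fun s => F s + G s)%C.
Proof. intros [] []; split; simpl; auto with cont2. Qed.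

Lemma Ccont_mult F G : Ccont F -> Ccont G -> Ccont (fun s => F s * G s)%C.
Proof. intros [] []; split; simpl; auto with cont2. Qed.

Lemma smooth_plus n F G : smooth n F -> smooth n G -> smooth n (fun s => F s + G s)%C.
Proof.
revert F G; induction n as [|n IH]; intros F G [HF F'] [HG G'];
  (split; [apply Ccont_plus; assumption |]); trivial.
destruct F' as [F' [F1 F2]], G' as [G' [G1 G2]].
exists (fun s => F' s + G' s)%C; split; [| apply IH; assumption].
intros x y Hy; destruct (F1 x y Hy), (G1 x y Hy); split.
- apply dC_plus; assumption.
- eapply dC_eq; [apply dC_plus; eassumption | cbv beta; ring].
Qed.

Lemma smooth_mult n F G : smooth n F -> smooth n G -> smooth n (fun s => F s * G s)%C.
Proof.
revert F G; induction n as [|n IH]; intros F G HF HG;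
  (split; [apply Ccont_mult; eapply smooth_cont; eassumption |]); trivial.
pose proof (smooth_S _ _ HF) as SF; pose proof (smooth_S _ _ HG) as SG.
destruct HF as [_ [F' [F1 F2]]], HG as [_ [G' [G1 G2]]].
exists (fun s => F' s * G s + F s * G' s)%C; split.
2:{ apply smooth_plus; apply IH; assumption. }
intros x y Hy; destruct (F1 x y Hy), (G1 x y Hy); split.
- eapply dC_eq; [apply dC_mult; eassumption | cbv beta; ring].
- eapply dC_eq; [apply dC_mult; eassumption | cbv beta; ring].
Qed.

Lemma smooth_const n c : smooth n (fun _ => c).
Proof.
revert c; induction n as [|n IH]; intros c; (split; [split; simpl; auto with cont2 |]); trivial.
exists (fun _ => RtoC 0); split; [| apply IH].
intros x y _; split; [apply dC_const |].
eapply dC_eq; [apply dC_const | ring].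
Qed.

Lemma dC_pair_x x y : dC (fun u => (u, y)) x 1.
Proof. split; simpl; auto_derive; trivial. Qed.

Lemma dC_pair_y x y : dC (fun v => (x, v)) y Ci.
Proof. split; simpl; auto_derive; trivial. Qed.

Lemma continuity_pt_of_derive (f : R -> R) x l : is_derive f x l -> continuity_pt f x.
Proof.
intros H; apply continuity_pt_filterlim, (ex_derive_continuous f); eexists; exact H.
Qed.

Lemma smooth_Cexp n a b : smooth n (fun s => Cexp (a * s + b))%C.
Proof.
induction n as [|n IH].
- split; trivial.
  assert (C1 : cont2 (fun x y => fst a * x - snd a * y + fst b)).
  { apply cont2_plus, cont2_const; apply cont2_minus;
      apply cont2_mult; apply cont2_const || apply cont2_x || apply cont2_y. }
  assert (C2 : cont2 (fun x y => fst a * y + snd a * x + snd b)).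
  { apply cont2_plus, cont2_const; apply cont2_plus;
      apply cont2_mult; apply cont2_const || apply cont2_x || apply cont2_y. }
  split.
  + exact (cont2_mult _ _ (cont2_comp exp _ C1 (fun x y _ => continuity_pt_of_derive _ _ _ (is_derive_exp _)))
      (cont2_comp cos _ C2 (fun x y _ => continuity_pt_of_derive _ _ _ (is_derive_cos _)))).
  + exact (cont2_mult _ _ (cont2_comp exp _ C1 (fun x y _ => continuity_pt_of_derive _ _ _ (is_derive_exp _)))
      (cont2_comp sin _ C2 (fun x y _ => continuity_pt_of_derive _ _ _ (is_derive_sin _)))).
- split; [exact (smooth_cont _ _ IH) |].
  exists (fun s => a * Cexp (a * s + b))%C; split.
  + intros x y _; split.
    * eapply dC_eq.
      -- apply dC_Cexp, dC_plus; [apply dC_mult; [apply dC_const | apply dC_pair_x] | apply dC_const].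
      -- cbv beta; ring.
    * eapply dC_eq.
      -- apply dC_Cexp, dC_plus; [apply dC_mult; [apply dC_const | apply dC_pair_y] | apply dC_const].
      -- cbv beta; ring.
  + apply smooth_mult; [apply smooth_const | exact IH].
Qed.

Lemma smooth_ext n F G : (forall s, F s = G s) -> smooth n F -> smooth n G.
Proof. intros H; replace G with F; [auto | apply functional_extensionality, H]. Qed.

Lemma smooth_minus n F G : smooth n F -> smooth n G -> smooth n (fun s => F s - G s)%C.
Proof.
intros HF HG; eapply (smooth_ext n (fun s => F s + (- RtoC 1) * G s)%C).
- intros s; ring.
- apply smooth_plus; [assumption | apply smooth_mult; [apply smooth_const | assumption]].
Qed.

Lemma smooth_Csum n (F : nat -> C -> C) m : (forall k, smooth n (F k)) ->
  smooth n (fun s => Csum (fun k => F k s) m).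
Proof.
intros H; induction m as [|m IH]; simpl; [apply smooth_const | apply smooth_plus; auto].
Qed.

Lemma smooth_cpow_opp n x : smooth n (fun s => cpow x (- s)).
Proof.
eapply (smooth_ext n (fun s => Cexp (- ln x * s + 0))%C); [| apply smooth_Cexp].
intros s; unfold cpow; f_equal; ring.
Qed.

(** The derivative is the square of the function, so [smooth_mult] carries the induction on the
    order. *)
Lemma smooth_inv_1_minus n : smooth n (fun s => / (1 - s))%C.
Proof.
assert (P : forall x y, 0 < y -> (1 - x) * (1 - x) + y * y <> 0)
  by (intros x y Hy; pose proof (Rle_0_sqr (1 - x)); unfold Rsqr in *; apply Rgt_not_eq; nra).
induction n as [|n IH].
- split; trivial; split; intros x y Hy.
  + apply (continuity_2d_pt_ext (fun x y => (1 - x) * / ((1 - x) * (1 - x) + y * y))).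
    * intros u v; unfold Cinv, Cminus, Cplus, Copp, Re; simpl; unfold Rdiv; repeat (f_equal; try ring).
    * apply continuity_2d_pt_mult; [| apply continuity_2d_pt_inv; [| apply P, Hy]].
      -- exact (cont2_minus _ _ (cont2_const 1) cont2_x x y Hy).
      -- assert (Q : cont2 (fun x y => (1 - x) * (1 - x) + y * y)) by auto 6 with cont2.
         exact (Q x y Hy).
  + apply (continuity_2d_pt_ext (fun x y => y * / ((1 - x) * (1 - x) + y * y))).
    * intros u v; unfold Cinv, Cminus, Cplus, Copp, Im; simpl; unfold Rdiv; repeat (f_equal; try ring).
    * apply continuity_2d_pt_mult; [| apply continuity_2d_pt_inv; [| apply P, Hy]].
      -- exact (cont2_y x y Hy).
      -- assert (Q : cont2 (fun x y => (1 - x) * (1 - x) + y * y)) by auto 6 with cont2.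
         exact (Q x y Hy).
- split; [exact (smooth_cont _ _ IH) |].
  exists (fun s => / (1 - s) * / (1 - s))%C; split; [| apply smooth_mult; exact IH].
  intros x y Hy; specialize (P x y Hy); split; split;
    unfold Cinv, Cminus, Cplus, Copp, Cmult, Ci, Re, Im; simpl;
    (auto_derive; [nra | field; nra]).
Qed.

(** * Mean values of subharmonic functions on vertical segments *)

Lemma is_derive_RInt_p (f fx : R -> R -> R) (a b x : R) : 0 < a <= b ->
  cont2 f -> cont2 fx ->
  (forall x y, 0 < y -> is_derive (fun u => f u y) x (fx x y)) ->
  is_derive (fun x => RInt (f x) a b) x (RInt (fx x) a b).
Proof.
intros Hab Cf Cfx Hd.
assert (E : forall x, RInt (fx x) a b = RInt (fun t => Derive (fun u => f u t) x) a b).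
{ intros z; apply RInt_ext; intros t; rewrite Rmin_left by lra; intros Ht.
  symmetry; apply is_derive_unique, Hd; lra. }
rewrite E; apply (is_derive_RInt_param f).
- exists (mkposreal 1 Rlt_0_1); intros z _ t; rewrite Rmin_left by lra; intros Ht.
  eexists; apply Hd; lra.
- intros t; rewrite Rmin_left by lra; intros Ht.
  apply (continuity_2d_pt_ext_loc fx); [| apply Cfx; lra].
  assert (Ht2 : 0 < t / 2) by lra.
  exists (mkposreal _ Ht2); simpl; intros u v _ Hv.
  apply Rabs_def2 in Hv.
  symmetry; apply is_derive_unique, Hd; lra.
- exists (mkposreal 1 Rlt_0_1); intros z _.
  apply (ex_RInt_continuous (V := R_CompleteNormedModule)); intros t.
  rewrite Rmin_left by lra; intros Ht; apply cont2_slice; [exact Cf | lra].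
Qed.

Lemma ex_RInt_slice f x a b : 0 < a <= b -> cont2 f -> ex_RInt (f x) a b.
Proof.
intros Hab Cf; apply (ex_RInt_continuous (V := R_CompleteNormedModule)); intros t.
rewrite Rmin_left by lra; intros Ht; apply (cont2_slice f x t); [exact Cf | lra].
Qed.

Lemma RInt_FTC (f df : R -> R) a b : a <= b ->
  (forall t, a <= t <= b -> is_derive f t (df t)) ->
  (forall t, a <= t <= b -> continuous df t) -> RInt df a b = f b - f a.
Proof.
intros Hab H1 H2; apply is_RInt_unique.
apply (is_RInt_derive f df); intros t; rewrite Rmin_left, Rmax_right by lra; auto.
Qed.

Lemma ex_RInt_Rplus (f g : R -> R) a b :
  ex_RInt f a b -> ex_RInt g a b -> ex_RInt (fun t => f t + g t) a b.
Proof. exact (ex_RInt_plus (V := R_NormedModule) f g a b). Qed.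

Lemma RInt_Rplus (f g : R -> R) a b : ex_RInt f a b -> ex_RInt g a b ->
  RInt (fun t => f t + g t) a b = RInt f a b + RInt g a b.
Proof. exact (RInt_plus (V := R_CompleteNormedModule) f g a b). Qed.

Lemma ex_RInt_Rscal c (f : R -> R) a b : ex_RInt f a b -> ex_RInt (fun t => c * f t) a b.
Proof. exact (ex_RInt_scal (V := R_NormedModule) f a b c). Qed.

Lemma RInt_Rscal c (f : R -> R) a b : ex_RInt f a b -> RInt (fun t => c * f t) a b = c * RInt f a b.
Proof. exact (RInt_scal (V := R_CompleteNormedModule) f a b c). Qed.

Lemma RInt_Rconst (c a b : R) : RInt (fun _ => c) a b = (b - a) * c.
Proof. exact (RInt_const (V := R_CompleteNormedModule) a b c). Qed.

(** The three-chord inequality for a function convex up to [E]. The slopes of the two chords are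
    values [f1 c] and [f1 d] with c <= x1 <= d, and f'' >= - E lets the slope drop by at most E (x2
    - x0). *)
Lemma convex_approx (f f1 f2 : R -> R) (E x0 x1 x2 : R) : x0 < x1 < x2 -> 0 <= E ->
  (forall x, x0 <= x <= x2 -> is_derive f x (f1 x)) ->
  (forall x, x0 <= x <= x2 -> is_derive f1 x (f2 x)) ->
  (forall x, x0 <= x <= x2 -> - E <= f2 x) ->
  (x2 - x0) * f x1 <= (x2 - x1) * f x0 + (x1 - x0) * f x2 + E * (x2 - x0) ^ 3.
Proof.
intros Hx HE D1 D2 B.
assert (MV : forall (g g' : R -> R) a b, x0 <= a -> a < b -> b <= x2 ->
  (forall x, x0 <= x <= x2 -> is_derive g x (g' x)) ->
  exists c, a <= c <= b /\ g b - g a = g' c * (b - a)).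
{ intros g g' a b Ha Hab Hb Hd.
  destruct (MVT_gen g a b g') as [c [Hc Ec]].
  - rewrite Rmin_left, Rmax_right by lra; intros; apply Hd; lra.
  - rewrite Rmin_left, Rmax_right by lra; intros x Hxx.
    apply (continuity_pt_of_derive _ _ (g' x)), Hd; lra.
  - rewrite Rmin_left, Rmax_right in Hc by lra; exists c; auto. }
destruct (MV f f1 x0 x1) as [c [Hc Ec]]; try lra; auto.
destruct (MV f f1 x1 x2) as [d [Hd Ed]]; try lra; auto.
assert (M : - E * (x2 - x0) <= f1 d - f1 c).
{ destruct (Req_dec c d) as [-> | N]; [nra |].
  destruct (MV f1 f2 c d) as [e [He Ee]]; try lra; auto.
  rewrite Ee; specialize (B e ltac:(lra)); nra. }
assert (P : 0 <= (x2 - x1) * (x1 - x0)) by nra.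
assert (P2 : (x2 - x1) * (x1 - x0) <= (x2 - x0) * (x2 - x0)) by nra.
assert (Q : (x2 - x1) * (x1 - x0) * (f1 d - f1 c)
   = (x1 - x0) * (f x2 - f x1) - (x2 - x1) * (f x1 - f x0)) by (rewrite Ec, Ed; ring).
assert (P3 : (x2 - x1) * (x1 - x0) * (- E * (x2 - x0)) <= (x2 - x1) * (x1 - x0) * (f1 d - f1 c))
  by (apply Rmult_le_compat_l; assumption).
assert (P4 : (x2 - x1) * (x1 - x0) * (E * (x2 - x0)) <= (x2 - x0) * (x2 - x0) * (E * (x2 - x0)))
  by (apply Rmult_le_compat_r; nra).
simpl; rewrite Rmult_1_r; nra.
Qed.

(** [k] is the inverse of the length on which [w] varies and [e] an exponentially small defect.
    Bounding [w1] and [w2] by [w] itself, up to [e], allows an error integral of [w2] to be absorbed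
    into the weighted mean from which it arose. *)
Record weight (w w1 w2 : R -> R) (a b k e : R) : Prop := {
  weight_d1 : forall t, is_derive w t (w1 t);
  weight_d2 : forall t, is_derive w1 t (w2 t);
  weight_cont : forall t, continuous w2 t;
  weight_left : w a = 0;
  weight_right : w b = 0;
  weight_range : forall t, a <= t <= b -> 0 <= w t <= 1;
  weight_b1 : forall t, Rabs (w1 t) <= k * (w t + e);
  weight_b2 : forall t, Rabs (w2 t) <= 3 * k ^ 2 * (w t + e) }.

Section SubMean.

Variables (w w1 w2 : R -> R) (a b k e : R).
Hypothesis Hab : 0 < a < b.
Hypothesis Hw : weight w w1 w2 a b k e.

Lemma weight_cont2 : cont2 (fun _ t => w t) /\ cont2 (fun _ t => w1 t) /\ cont2 (fun _ t => w2 t).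
Proof.
destruct Hw; repeat split; apply cont2_comp; auto with cont2; intros x y _.
- eapply continuity_pt_of_derive; apply weight_d3.
- eapply continuity_pt_of_derive; apply weight_d4.
- apply continuity_pt_filterlim; apply weight_cont0.
Qed.

(** Differentiation under the integral gives the second derivative in x as the integral of w uxx,
    which is at least minus the integral of w uyy. Two integrations by parts in t move the
    derivatives to [w]; as only [w] vanishes at the ends, boundary terms with [w1] remain. *)
Lemma submean (u ux uxx uy uyy : R -> R -> R) :
  cont2 u -> cont2 ux -> cont2 uxx -> cont2 uy -> cont2 uyy ->
  (forall x y, 0 < y -> is_derive (fun x => u x y) x (ux x y)) ->
  (forall x y, 0 < y -> is_derive (fun x => ux x y) x (uxx x y)) ->
  (forall x y, 0 < y -> is_derive (fun y => u x y) y (uy x y)) ->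
  (forall x y, 0 < y -> is_derive (fun y => uy x y) y (uyy x y)) ->
  (forall x y, 0 < y -> 0 <= uxx x y + uyy x y) ->
  exists f1 f2 : R -> R, forall x,
    is_derive (fun x => RInt (fun t => w t * u x t) a b) x (f1 x) /\
    is_derive f1 x (f2 x) /\
    w1 b * u x b - w1 a * u x a - RInt (fun t => w2 t * u x t) a b <= f2 x.
Proof.
intros C0 C1 C2 C3 C4 D1 D2 D3 D4 L.
destruct weight_cont2 as [W0 [W1 W2]].
exists (fun x => RInt (fun t => w t * ux x t) a b), (fun x => RInt (fun t => w t * uxx x t) a b).
assert (Hab' : 0 < a <= b) by lra.
intros x; split; [| split].
- refine (is_derive_RInt_p (fun x t => w t * u x t) (fun x t => w t * ux x t) a b x Hab'
    (cont2_mult _ _ W0 C0) (cont2_mult _ _ W0 C1) _).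
  intros z y Hy; apply (is_derive_scal (fun x => u x y)); auto.
- refine (is_derive_RInt_p (fun x t => w t * ux x t) (fun x t => w t * uxx x t) a b x Hab'
    (cont2_mult _ _ W0 C1) (cont2_mult _ _ W0 C2) _).
  intros z y Hy; apply (is_derive_scal (fun x => ux x y)); auto.
- assert (I1 : ex_RInt (fun t => w t * uxx x t) a b)
    by (apply (ex_RInt_slice (fun x t => w t * uxx x t) x); [lra | auto with cont2]).
  assert (I2 : ex_RInt (fun t => w t * uyy x t) a b)
    by (apply (ex_RInt_slice (fun x t => w t * uyy x t) x); [lra | auto with cont2]).
  assert (I3 : ex_RInt (fun t => w2 t * u x t) a b)
    by (apply (ex_RInt_slice (fun x t => w2 t * u x t) x); [lra | auto with cont2]).
  assert (F : RInt (fun t => w t * uyy x t - w2 t * u x t) a b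
              = (w b * uy x b - w1 b * u x b) - (w a * uy x a - w1 a * u x a)).
  { apply (RInt_FTC (fun t => w t * uy x t - w1 t * u x t)); [lra | |].
    - intros t Ht; destruct Hw.
      evar_last.
      + apply (is_derive_minus (V := R_NormedModule));
          apply is_derive_Rmult; auto; [apply D4 | apply D3]; lra.
      + unfold minus, plus, opp; simpl; ring.
    - intros t Ht.
      apply (cont2_slice (fun x t => w t * uyy x t - w2 t * u x t)); auto with cont2; lra. }
  rewrite (weight_left _ _ _ _ _ _ _ Hw), (weight_right _ _ _ _ _ _ _ Hw) in F.
  assert (F2 : RInt (fun t => w t * uyy x t - w2 t * u x t) a b
     = RInt (fun t => w t * uyy x t) a b - RInt (fun t => w2 t * u x t) a b).
  { apply (RInt_minus (V := R_CompleteNormedModule)); assumption. }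
  assert (F3 : - RInt (fun t => w t * uyy x t) a b <= RInt (fun t => w t * uxx x t) a b).
  { rewrite <- (RInt_opp (V := R_CompleteNormedModule)) by assumption.
    apply RInt_le; [lra | apply (ex_RInt_opp (V := R_NormedModule)), I2 | exact I1 |].
    intros t Ht; unfold opp; simpl.
    pose proof (weight_range _ _ _ _ _ _ _ Hw t ltac:(lra)).
    specialize (L x t ltac:(lra)); nra. }
  lra.
Qed.

(** With q = |G|^2 the Laplacian of h(q) is 4 |G'|^2 (h'(q) + q h''(q)). The hypothesis on [h] is
    the sign of the last factor and covers both the regularised logarithm and the identity. *)
Lemma submean_hol (G : C -> C) (h h1 h2 : R -> R) : smooth 2 G ->
  (forall q, 0 <= q -> is_derive h q (h1 q) /\ is_derive h1 q (h2 q) /\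
     continuity_pt h2 q /\ 0 <= h1 q + q * h2 q) ->
  exists f1 f2 : R -> R, forall x,
    is_derive (fun x => RInt (fun t => w t * h (Cmod (G (x, t)) ^ 2)) a b) x (f1 x) /\
    is_derive f1 x (f2 x) /\
    w1 b * h (Cmod (G (x, b)) ^ 2) - w1 a * h (Cmod (G (x, a)) ^ 2)
      - RInt (fun t => w2 t * h (Cmod (G (x, t)) ^ 2)) a b <= f2 x.
Proof.
intros [[CG CG'] [G1 [H1 [[CG1 CG1'] [G2 [H2 [[CG2 CG2'] _]]]]]]] Hh.
set (q := fun x y => Re (G (x, y)) * Re (G (x, y)) + Im (G (x, y)) * Im (G (x, y))).
assert (Eq : forall x y, Cmod (G (x, y)) ^ 2 = q x y).
{ intros x y; unfold Cmod, q, Re, Im; rewrite pow2_sqrt; [ring | nra]. }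
assert (Q0 : forall x y, 0 <= q x y) by (intros; unfold q; nra).
set (qx := fun x y => 2 * (Re (G (x, y)) * Re (G1 (x, y)) + Im (G (x, y)) * Im (G1 (x, y)))).
set (qy := fun x y => 2 * (Im (G (x, y)) * Re (G1 (x, y)) - Re (G (x, y)) * Im (G1 (x, y)))).
set (n1 := fun x y => Re (G1 (x, y)) * Re (G1 (x, y)) + Im (G1 (x, y)) * Im (G1 (x, y))).
set (r2 := fun x y => Re (G (x, y)) * Re (G2 (x, y)) + Im (G (x, y)) * Im (G2 (x, y))).
set (qxx := fun x y => 2 * (n1 x y + r2 x y)).
set (qyy := fun x y => 2 * (n1 x y - r2 x y)).
assert (Cq : cont2 q) by (unfold q; auto with cont2).
assert (Cqx : cont2 qx) by (unfold qx; auto 6 with cont2).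
assert (Cqy : cont2 qy) by (unfold qy; auto 6 with cont2).
assert (Cqxx : cont2 qxx) by (unfold qxx, n1, r2; cbv beta; repeat (apply cont2_mult || apply cont2_plus); auto with cont2).
assert (Cqyy : cont2 qyy) by (unfold qyy, n1, r2; cbv beta; apply cont2_mult, cont2_minus; auto with cont2).
assert (Dqx : forall x y, 0 < y -> is_derive (fun x => q x y) x (qx x y)).
{ intros x y Hy; destruct (H1 x y Hy) as [[A B] _]; evar_last.
  - apply (is_derive_plus (V := R_NormedModule)); apply is_derive_Rmult; eassumption.
  - unfold qx, plus; simpl; ring. }
assert (Dqy : forall x y, 0 < y -> is_derive (fun y => q x y) y (qy x y)).
{ intros x y Hy; destruct (H1 x y Hy) as [_ [A B]]; evar_last.
  - apply (is_derive_plus (V := R_NormedModule)); apply is_derive_Rmult; eassumption.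
  - unfold qy, plus, Re, Im; simpl; ring. }
assert (Dqxx : forall x y, 0 < y -> is_derive (fun x => qx x y) x (qxx x y)).
{ intros x y Hy; destruct (H1 x y Hy) as [[A B] _], (H2 x y Hy) as [[A2 B2] _]; evar_last.
  - apply is_derive_scal, (is_derive_plus (V := R_NormedModule));
      apply is_derive_Rmult; eassumption.
  - unfold qxx, n1, r2, plus; simpl; ring. }
assert (Dqyy : forall x y, 0 < y -> is_derive (fun y => qy x y) y (qyy x y)).
{ intros x y Hy; destruct (H1 x y Hy) as [_ [A B]], (H2 x y Hy) as [_ [A2 B2]]; evar_last.
  - apply is_derive_scal, (is_derive_minus (V := R_NormedModule));
      apply is_derive_Rmult; eassumption.
  - unfold qyy, n1, r2, minus, plus, opp, Re, Im; simpl; ring. }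
assert (Dh : forall x y, is_derive h (q x y) (h1 (q x y))) by (intros; apply Hh, Q0).
assert (Dh1 : forall x y, is_derive h1 (q x y) (h2 (q x y))) by (intros; apply Hh, Q0).
assert (Ch : cont2 (fun x y => h (q x y))).
{ apply cont2_comp; [exact Cq |]; intros x y _.
  exact (continuity_pt_of_derive _ _ _ (Dh x y)). }
assert (Ch1 : cont2 (fun x y => h1 (q x y))).
{ apply cont2_comp; [exact Cq |]; intros x y _.
  exact (continuity_pt_of_derive _ _ _ (Dh1 x y)). }
assert (Ch2 : cont2 (fun x y => h2 (q x y))).
{ apply cont2_comp; [exact Cq |]; intros x y _; apply Hh, Q0. }
destruct (submean (fun x y => h (q x y)) (fun x y => qx x y * h1 (q x y))
  (fun x y => qxx x y * h1 (q x y) + qx x y * (qx x y * h2 (q x y)))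
  (fun x y => qy x y * h1 (q x y))
  (fun x y => qyy x y * h1 (q x y) + qy x y * (qy x y * h2 (q x y))))
  as [f1 [f2 Hf]].
- exact Ch.
- apply cont2_mult; assumption.
- apply cont2_plus; repeat (assumption || apply cont2_mult).
- apply cont2_mult; assumption.
- apply cont2_plus; repeat (assumption || apply cont2_mult).
- intros x y Hy; exact (is_derive_comp h (fun x => q x y) x _ _ (Dh x y) (Dqx x y Hy)).
- intros x y Hy; apply (is_derive_Rmult (fun x => qx x y) (fun x => h1 (q x y)) x); [exact (Dqxx x y Hy) |].
  exact (is_derive_comp h1 (fun x => q x y) x _ _ (Dh1 x y) (Dqx x y Hy)).
- intros x y Hy; exact (is_derive_comp h (fun y => q x y) y _ _ (Dh x y) (Dqy x y Hy)).
- intros x y Hy; apply (is_derive_Rmult (fun y => qy x y) (fun y => h1 (q x y)) y); [exact (Dqyy x y Hy) |].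
  exact (is_derive_comp h1 (fun y => q x y) y _ _ (Dh1 x y) (Dqy x y Hy)).
- intros x y Hy; destruct (Hh _ (Q0 x y)) as [_ [_ [_ P]]].
  assert (N : 0 <= n1 x y) by (unfold n1; nra).
  replace (_ + _) with (4 * n1 x y * (h1 (q x y) + q x y * h2 (q x y))).
  + apply Rmult_le_pos; [lra | exact P].
  + unfold qxx, qyy, qx, qy, n1, r2, q; ring.
- exists f1, f2; intros x; specialize (Hf x).
  assert (EE : forall (v : R -> R) z, RInt (fun t => v t * h (q z t)) a b
          = RInt (fun t => v t * h (Cmod (G (z, t)) ^ 2)) a b).
  { intros v z; apply RInt_ext; intros t _; rewrite Eq; reflexivity. }
  destruct Hf as [Hf1 [Hf2 Hf3]]; split; [| split; [exact Hf2 |]].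
  + eapply is_derive_ext; [| exact Hf1]; intros z; apply EE.
  + rewrite <- EE, !Eq; exact Hf3.
Qed.

End SubMean.

(** The logistic shape is what makes [w''] bounded by a multiple of [w] itself. *)
Lemma weight_exists (a b k : R) : 0 < k -> a < b -> exists w w1 w2 : R -> R,
  weight w w1 w2 a b k (exp (- (k * (b - a) / 4))) /\
  (exp (- (k * (b - a) / 4)) <= 1 / 12 -> (b - a) / 8 <= RInt w a b).
Proof.
intros Hk Hab.
(* [E] is at most 2 on the middle half of the interval and of size exp(k (b - a) / 4) at its ends,
   so 1 / (1 + E) is a plateau with logistic flanks; subtracting its end value makes it vanish
   there. Since E' = k [E1], [E1]' = k E and |[E1]| <= E, all derivatives are controlled by the
   function. *)
set (E := fun t => exp (k * (t - (a + 3 * b) / 4)) + exp (k * ((3 * a + b) / 4 - t))).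
set (E1 := fun t => exp (k * (t - (a + 3 * b) / 4)) - exp (k * ((3 * a + b) / 4 - t))).
assert (EP : forall t, 0 < E t) by (intros; apply Rplus_lt_0_compat; apply exp_pos).
assert (E1P : forall t, - E t <= E1 t <= E t).
{ intros t; unfold E, E1; pose proof (exp_pos (k * (t - (a + 3 * b) / 4)));
  pose proof (exp_pos (k * ((3 * a + b) / 4 - t))); lra. }
assert (DE : forall t, is_derive E t (k * E1 t)).
{ intros t; unfold E, E1; auto_derive; [trivial | unfold Rminus; ring]. }
assert (DE1 : forall t, is_derive E1 t (k * E t)).
{ intros t; unfold E, E1; auto_derive; [trivial | unfold Rminus; ring]. }
set (w0 := fun t => / (1 + E t)).
assert (Sym : E b = E a).
{ unfold E; rewrite Rplus_comm; f_equal; f_equal; field. }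
set (eta := w0 a).
set (w := fun t => w0 t - eta).
set (w1 := fun t => - (k * E1 t) / (1 + E t) ^ 2).
set (w2 := fun t => - (k * k * E t) / (1 + E t) ^ 2 + 2 * (k * E1 t) ^ 2 / (1 + E t) ^ 3).
assert (Ea : exp (k * (b - a) / 4) <= E a).
{ unfold E; pose proof (exp_pos (k * (a - (a + 3 * b) / 4))).
  replace (k * ((3 * a + b) / 4 - a)) with (k * (b - a) / 4) by field; lra. }
assert (Heta : eta <= exp (- (k * (b - a) / 4))).
{ unfold eta, w0; rewrite exp_Ropp; apply Rinv_le_contravar; [apply exp_pos | lra]. }
assert (W0 : forall t, 0 < w0 t < 1).
{ intros t; specialize (EP t); unfold w0; split; [apply Rinv_0_lt_compat; lra |].
  rewrite <- Rinv_1; apply Rinv_lt_contravar; lra. }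
assert (D1 : forall t, is_derive w t (w1 t)).
{ intros t; unfold w, w0, w1; specialize (EP t); evar_last.
  - apply (is_derive_minus (V := R_NormedModule)); [| apply is_derive_const].
    apply is_derive_inv; [| lra].
    apply (is_derive_plus (V := R_NormedModule)); [apply is_derive_const | apply DE].
  - unfold minus, plus, opp, zero; simpl; field; lra. }
assert (D2 : forall t, is_derive w1 t (w2 t)).
{ intros t; unfold w1, w2; specialize (EP t); evar_last.
  - apply is_derive_div.
    + apply (is_derive_opp (V := R_NormedModule)), is_derive_scal, DE1.
    + apply is_derive_pow, (is_derive_plus (V := R_NormedModule));
        [apply is_derive_const | apply DE].
    + apply pow_nonzero; lra.
  - unfold plus, opp, zero; simpl; field; lra. }
assert (CE : forall t, continuous E t).
{ intros t; apply (ex_derive_continuous (V := R_NormedModule) E); eexists; apply DE. }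
assert (Hwpos : forall t, a <= t <= b -> 0 <= w t).
{ intros t Ht; unfold w, eta, w0; apply (Rplus_le_reg_r (/ (1 + E a))); ring_simplify.
  apply Rinv_le_contravar; [specialize (EP t); lra |].
  apply Rplus_le_compat_l.
  (* Nonnegativity of [w] on the interval means E t <= E a. With [p] and [r] the two exponentials at
     t, this is (m - p) (m - r) >= 0, because the product p r does not depend on t. *)
  set (m := exp (k * (b - a) / 4)).
  set (p := exp (k * (t - (a + 3 * b) / 4))); set (r := exp (k * ((3 * a + b) / 4 - t))).
  assert (Hp : p <= m) by (apply exp_le; nra).
  assert (Hr : r <= m) by (apply exp_le; nra).
  assert (Hm : 0 < m) by apply exp_pos.
  assert (Epr : p * r = exp (k * (a - (a + 3 * b) / 4)) * m).
  { unfold p, r, m; rewrite <- !exp_plus; f_equal; field. }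
  replace (E a) with (exp (k * (a - (a + 3 * b) / 4)) + m).
  2:{ unfold E, m; f_equal; f_equal; field. }
  apply (Rmult_le_reg_l m); [exact Hm |]; fold p r; unfold E; fold p r; nra. }
exists w, w1, w2; split.
- split; auto.
  + intros t; specialize (EP t).
    apply (ex_derive_continuous (V := R_NormedModule) w2); unfold w2.
    clearbody E E1; auto_derive.
    assert (ex_derive E t) by (eexists; apply DE).
    assert (ex_derive E1 t) by (eexists; apply DE1).
    repeat split; trivial; repeat apply Rmult_integral_contrapositive_currified; lra.
  + unfold w, eta; ring.
  + unfold w, eta, w0; rewrite Sym; ring.
  + intros t Ht; split.
    * apply Hwpos, Ht.
    * pose proof (W0 t); pose proof (W0 a); unfold w, eta; lra.
  + intros t; specialize (EP t); specialize (E1P t); pose proof (W0 t) as W0t.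
    apply (Rle_trans _ (k * w0 t)); [| apply Rmult_le_compat_l; unfold w; lra].
    replace (w1 t) with (- (k * (E1 t * w0 t * w0 t))) by (unfold w1, w0; field; lra).
    rewrite Rabs_Ropp, Rabs_mult, (Rabs_pos_eq k) by lra.
    apply Rmult_le_compat_l; [lra |].
    rewrite Rabs_mult, (Rabs_pos_eq (w0 t)) by lra.
    apply (Rle_trans _ (1 * w0 t)); [| lra]; apply Rmult_le_compat_r; [lra |].
    assert (E t * w0 t <= 1).
    { unfold w0; apply (Rmult_le_reg_r (1 + E t)); [lra |].
      replace (E t * / (1 + E t) * (1 + E t)) with (E t) by (field; lra); lra. }
    apply Rabs_le; nra.
  + intros t; specialize (EP t); specialize (E1P t); pose proof (W0 t) as W0t.
    apply (Rle_trans _ (3 * k ^ 2 * w0 t)); [| apply Rmult_le_compat_l; unfold w; nra].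
    replace (w2 t) with (k ^ 2 * w0 t * (2 * (E1 t * w0 t) ^ 2 - E t * w0 t))
      by (unfold w2, w0; field; lra).
    assert (B : 0 <= E t * w0 t <= 1).
    { split; [nra |].
      unfold w0; apply (Rmult_le_reg_r (1 + E t)); [lra |].
      replace (E t * / (1 + E t) * (1 + E t)) with (E t) by (field; lra); lra. }
    assert (B1 : 0 <= (E1 t * w0 t) ^ 2 <= 1).
    { split; [apply pow2_ge_0 |].
      assert (- 1 <= E1 t * w0 t <= 1) by nra; nra. }
    assert (0 < k ^ 2 * w0 t) by (apply Rmult_lt_0_compat; [apply pow_lt |]; lra).
    rewrite Rabs_mult, (Rabs_pos_eq (k ^ 2 * w0 t)) by lra.
    replace (3 * k ^ 2 * w0 t) with (k ^ 2 * w0 t * 3) by ring.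
    apply Rmult_le_compat_l; [lra |]; apply Rabs_le; lra.
- intros Hs.
  assert (I : forall u v, ex_RInt w u v).
  { intros u v; apply (ex_RInt_continuous (V := R_CompleteNormedModule)); intros t _.
    apply (ex_derive_continuous (V := R_NormedModule) w); eexists; apply D1. }
  assert (N : forall t, a <= t <= b -> 0 <= w t).
  { exact Hwpos. }
  rewrite <- (RInt_Chasles (V := R_CompleteNormedModule) w a ((3 * a + b) / 4) b) by auto.
  rewrite <- (RInt_Chasles (V := R_CompleteNormedModule) w ((3 * a + b) / 4) ((a + 3 * b) / 4) b) by auto.
  assert (0 <= RInt w a ((3 * a + b) / 4)) by (apply RInt_ge_0; auto; [lra | intros; apply N; lra]).
  assert (0 <= RInt w ((a + 3 * b) / 4) b) by (apply RInt_ge_0; auto; [lra | intros; apply N; lra]).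
  (* On the middle half 1 / (1 + E) >= 1/3, and the subtracted end value is at most 1/12, which
     leaves 1/4. *)
  assert ((b - a) / 2 * (1 / 4) <= RInt w ((3 * a + b) / 4) ((a + 3 * b) / 4)).
  { replace ((b - a) / 2 * (1 / 4))
      with (RInt (fun _ => 1 / 4) ((3 * a + b) / 4) ((a + 3 * b) / 4)).
    2:{ rewrite RInt_const; unfold scal; simpl; unfold mult; simpl; field. }
    apply RInt_le; auto; [lra | apply ex_RInt_const |].
    intros t Ht; unfold w, w0.
    assert (E t <= 2).
    { unfold E.
      apply (Rle_trans _ (exp 0 + exp 0)); [apply Rplus_le_compat; apply exp_le; nra | rewrite exp_0; lra]. }
    assert (/ 3 <= / (1 + E t)) by (apply Rinv_le_contravar; specialize (EP t); lra).
    lra. }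
  unfold plus; simpl; lra.
Qed.

Section WeightedMeans.

Variables (w w1 w2 : R -> R) (a b k e : R).
Hypothesis Hab : 0 < a < b.
Hypothesis Hk : 0 < k.
Hypothesis He : 0 < e.
Hypothesis Hw : weight w w1 w2 a b k e.

Lemma weight_slice (f : R -> R -> R) x : cont2 f ->
  ex_RInt (f x) a b /\ ex_RInt (fun t => w t * f x t) a b /\ ex_RInt (fun t => w2 t * f x t) a b.
Proof.
destruct (weight_cont2 _ _ _ _ _ _ _ Hw) as [W0 [W1 W2]]; intros Hf; split; [|split].
- apply ex_RInt_slice; [lra | exact Hf].
- apply (ex_RInt_slice (fun x t => w t * f x t)); [lra | auto with cont2].
- apply (ex_RInt_slice (fun x t => w2 t * f x t)); [lra | auto with cont2].
Qed.

Lemma weight_ex_RInt : ex_RInt w a b.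
Proof.
destruct (weight_cont2 _ _ _ _ _ _ _ Hw) as [W0 _].
apply (ex_RInt_slice (fun x t => w t) 0); [lra | exact W0].
Qed.

Lemma weight_int_le : RInt w a b <= b - a.
Proof.
replace (b - a) with (RInt (fun _ => 1) a b).
2:{ rewrite RInt_const; unfold scal; simpl; unfold mult; simpl; ring. }
apply RInt_le; [lra | apply weight_ex_RInt | apply ex_RInt_const |].
intros t Ht; apply (weight_range _ _ _ _ _ _ _ Hw); lra.
Qed.

Lemma weighted_abs_le (u : R -> R) c : ex_RInt (fun t => w t * u t) a b ->
  (forall t, a <= t <= b -> Rabs (u t) <= c) -> Rabs (RInt (fun t => w t * u t) a b) <= (b - a) * c.
Proof.
intros I B; apply abs_RInt_le_const; [lra | exact I |].
intros t Ht; specialize (B t Ht); pose proof (weight_range _ _ _ _ _ _ _ Hw t Ht).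
rewrite Rabs_mult, Rabs_pos_eq by lra; pose proof (Rabs_pos (u t)); nra.
Qed.

Lemma hol_cont2 (G : C -> C) (h h1 : R -> R) : smooth 2 G ->
  (forall q, 0 <= q -> is_derive h q (h1 q)) -> cont2 (fun x y => h (Cmod (G (x, y)) ^ 2)).
Proof.
intros HG Hh; apply smooth_cont in HG; destruct HG as [C1 C2].
replace (fun x y => h (Cmod (G (x, y)) ^ 2)) with
  (fun x y => h (Re (G (x, y)) * Re (G (x, y)) + Im (G (x, y)) * Im (G (x, y)))).
- apply cont2_comp; auto with cont2; intros x y _; eapply continuity_pt_of_derive, Hh; nra.
- apply functional_extensionality; intros x; apply functional_extensionality; intros y.
  f_equal; unfold Cmod, Re, Im; rewrite pow2_sqrt; [ring | nra].
Qed.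

(** The profile for log |G| kept finite at the zeros: here h' + q h'' = eps / (2 (q + eps)^2) >
    0. *)
Lemma log_profile eps q : 0 < eps -> 0 <= q ->
  is_derive (fun q => ln (q + eps) / 2) q (/ (2 * (q + eps))) /\
  is_derive (fun q => / (2 * (q + eps))) q (- / (2 * (q + eps) ^ 2)) /\
  continuity_pt (fun q => - / (2 * (q + eps) ^ 2)) q /\
  0 <= / (2 * (q + eps)) + q * (- / (2 * (q + eps) ^ 2)).
Proof.
intros H1 H2; split; [|split; [|split]].
- auto_derive; [lra | field; lra].
- auto_derive; [lra | field; lra].
- eapply continuity_pt_of_derive; auto_derive; [|reflexivity].
  assert (0 < (q + eps) * (q + eps)) by nra; simpl; lra.
- replace (/ (2 * (q + eps)) + q * (- / (2 * (q + eps) ^ 2))) with (eps / (2 * (q + eps) ^ 2))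
    by (field; lra).
  apply Rlt_le, Rdiv_lt_0_compat; [lra |]; assert (0 < (q + eps) ^ 2) by (apply pow_lt; lra); lra.
Qed.

(* Jensen's inequality: since [G] is close to 1 far to the right, [log |G|] has almost nonnegative
   mean on every line.  The parameter [eps] keeps the logarithm finite at the zeros. *)
Lemma jensen_mean (G : C -> C) (x0 S eps B rho : R) : smooth 2 G -> 0 < eps -> 0 <= x0 < S ->
  (forall x t, x0 <= x <= 2 * S -> a <= t <= b -> Rabs (ln (Cmod (G (x, t)) ^ 2 + eps) / 2) <= B) ->
  (forall x t, x = S \/ x = 2 * S -> a <= t <= b ->
     Rabs (ln (Cmod (G (x, t)) ^ 2 + eps) / 2) <= rho) ->
  - (3 * rho * (b - a) + 8 * S ^ 2 * (B * (2 * k * e + 3 * k ^ 2 * (1 + e) * (b - a))))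
  <= RInt (fun t => w t * (ln (Cmod (G (x0, t)) ^ 2 + eps) / 2)) a b.
Proof.
intros HG Heps Hx HB Hrho.
assert (HC := hol_cont2 G _ _ HG (fun q Hq => proj1 (log_profile eps q Heps Hq))).
destruct (submean_hol w w1 w2 a b k e Hab Hw G _ _ _ HG (fun q => log_profile eps q Heps))
  as [f1 [f2 Hf]].
set (E := B * (2 * k * e + 3 * k ^ 2 * (1 + e) * (b - a))).
set (u := fun x t => ln (Cmod (G (x, t)) ^ 2 + eps) / 2) in *.
assert (B0 : 0 <= B).
{ apply (Rle_trans _ (Rabs (u x0 a))); [apply Rabs_pos | apply HB; lra]. }
assert (Hke : 0 < k * e) by (apply Rmult_lt_0_compat; assumption).
assert (Hk2 : 0 < k ^ 2) by (apply pow_lt; assumption).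
assert (HE : 0 <= E).
{ apply Rmult_le_pos; [exact B0 |].
  assert (0 < k ^ 2 * (1 + e) * (b - a)) by (repeat apply Rmult_lt_0_compat; lra); lra. }
(* Convexity is used to extrapolate: means at S and 2S, both small by [Hrho], bound the mean at the
   left point x0 from below. *)
assert (C := convex_approx (fun x => RInt (fun t => w t * u x t) a b) f1 f2 E x0 S (2 * S)
  ltac:(lra) HE (fun x _ => proj1 (Hf x)) (fun x _ => proj1 (proj2 (Hf x)))).
assert (L : (forall x, x0 <= x <= 2 * S -> - E <= f2 x)).
{ intros x Hxx; destruct (Hf x) as [_ [_ Hf2]].
  change (ln (Cmod (G (x, b)) ^ 2 + eps) / 2) with (u x b) in Hf2.
  change (ln (Cmod (G (x, a)) ^ 2 + eps) / 2) with (u x a) in Hf2.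
  eapply Rle_trans; [| exact Hf2].
  assert (Q1 : Rabs (w1 b * u x b) <= k * e * B).
  { pose proof (weight_b1 _ _ _ _ _ _ _ Hw b) as W.
    rewrite (weight_right _ _ _ _ _ _ _ Hw), Rplus_0_l in W.
    rewrite Rabs_mult; apply Rmult_le_compat; try apply Rabs_pos; [exact W | apply HB; lra]. }
  assert (Q2 : Rabs (w1 a * u x a) <= k * e * B).
  { pose proof (weight_b1 _ _ _ _ _ _ _ Hw a) as W.
    rewrite (weight_left _ _ _ _ _ _ _ Hw), Rplus_0_l in W.
    rewrite Rabs_mult; apply Rmult_le_compat; try apply Rabs_pos; [exact W | apply HB; lra]. }
  assert (Q3 : Rabs (RInt (fun t => w2 t * u x t) a b) <= (b - a) * (3 * k ^ 2 * (1 + e) * B)).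
  { apply abs_RInt_le_const; [lra | apply (weight_slice u), HC |].
    intros t Ht; rewrite Rabs_mult; apply Rmult_le_compat; try apply Rabs_pos; [|apply HB; lra].
    eapply Rle_trans; [apply (weight_b2 _ _ _ _ _ _ _ Hw) |].
    apply Rmult_le_compat_l; [lra |].
    pose proof (weight_range _ _ _ _ _ _ _ Hw t Ht); lra. }
  apply Rabs_le_between in Q1; apply Rabs_le_between in Q2; apply Rabs_le_between in Q3.
  change (fun t => w2 t * (ln (Cmod (G (x, t)) ^ 2 + eps) / 2)) with (fun t => w2 t * u x t).
  unfold E; nra. }
specialize (C L); cbv beta in C.
assert (R1 := weighted_abs_le (u S) rho (proj1 (proj2 (weight_slice u S HC)))
  (fun t Ht => Hrho S t (or_introl eq_refl) Ht)).
assert (R2 := weighted_abs_le (u (2 * S)) rho (proj1 (proj2 (weight_slice u (2 * S) HC)))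
  (fun t Ht => Hrho (2 * S) t (or_intror eq_refl) Ht)).
apply Rabs_le_between in R1; apply Rabs_le_between in R2.
fold (u x0); change (fun t => w t * (ln (Cmod (G (x0, t)) ^ 2 + eps) / 2)) with (fun t => w t * u x0 t).
set (F := (fun x => RInt (fun t => w t * u x t) a b) : R -> R) in *.
change (RInt (fun t => w t * u x0 t) a b) with (F x0) in *.
change (RInt (fun t => w t * u S t) a b) with (F S) in *.
change (RInt (fun t => w t * u (2 * S) t) a b) with (F (2 * S)) in *.
apply (Rmult_le_reg_l S); [lra |].
assert (P0 : 0 <= (b - a) * rho).
{ lra. }
assert (C1 : (2 * S - x0) * F S >= - (2 * S * ((b - a) * rho))) by nra.
assert (C2 : (S - x0) * F (2 * S) <= S * ((b - a) * rho)) by nra.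
assert (C3 : E * (2 * S - x0) ^ 3 <= E * (8 * S ^ 3)).
{ apply Rmult_le_compat_l; [exact HE |].
  replace (8 * S ^ 3) with ((2 * S) ^ 3) by ring; apply pow_incr; lra. }
replace (2 * S - S) with S in C by ring.
fold E; replace (S * - (3 * rho * (b - a) + 8 * S ^ 2 * E))
  with (- (2 * S * ((b - a) * rho)) - S * ((b - a) * rho) - E * (8 * S ^ 3)) by ring.
lra.
Qed.

(** The convexity defect of the mean is 3 k^2 times the mean itself plus a term with [e]. Evaluated
    at the maximum of the mean over [1/4, 1/2] it enters with the factor 1/16, so 3 k^2 <= 8 makes
    it at most half of that maximum and it is absorbed; hence the factor 2. *)
Lemma growth_mean (G : C -> C) (B x : R) : smooth 2 G -> 3 * k ^ 2 <= 8 -> 1 / 4 <= x <= 1 / 2 ->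
  (forall x t, 1 / 4 <= x <= 1 / 2 -> a <= t <= b -> Cmod (G (x, t)) ^ 2 <= B) ->
  RInt (fun t => w t * Cmod (G (x, t)) ^ 2) a b <=
  2 * (RInt (fun t => w t * Cmod (G (1 / 4, t)) ^ 2) a b
       + RInt (fun t => w t * Cmod (G (1 / 2, t)) ^ 2) a b) + (k + (b - a)) * e * B.
Proof.
intros HG Hk8 Hx HB.
assert (Hid : forall q, 0 <= q -> is_derive (fun q : R => q) q ((fun _ => 1) q) /\
  is_derive (fun _ => 1) q ((fun _ => 0) q) /\ continuity_pt (fun _ => 0) q /\ 0 <= 1 + q * 0).
{ intros q _; split; [| split; [| split]].
  - apply (is_derive_id (K := R_AbsRing)).
  - apply (is_derive_const (V := R_NormedModule)).
  - apply continuity_pt_const; intros ? ?; reflexivity.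
  - lra. }
assert (HC := hol_cont2 G _ _ HG (fun q Hq => proj1 (Hid q Hq))).
destruct (submean_hol w w1 w2 a b k e Hab Hw G _ _ _ HG Hid) as [f1 [f2 Hf]].
set (u := fun x t => Cmod (G (x, t)) ^ 2) in *.
set (F := (fun x => RInt (fun t => w t * u x t) a b) : R -> R).
change (F x <= 2 * (F (1 / 4) + F (1 / 2)) + (k + (b - a)) * e * B).
assert (U0 : forall x t, 0 <= u x t) by (intros; apply pow2_ge_0).
assert (F0 : forall x, 0 <= F x).
{ intros z; destruct (weight_slice u z HC) as [I1 [I2 I3]].
  apply RInt_ge_0; [lra | exact I2 |].
  intros t Ht; apply Rmult_le_pos; [apply (weight_range _ _ _ _ _ _ _ Hw); lra | apply U0]. }
assert (B0 : 0 <= B).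
{ apply (Rle_trans _ (u (1/4) a)); [apply U0 | apply HB; lra]. }
destruct (continuity_ab_maj F (1 / 4) (1 / 2)) as [M [HM HMI]]; [lra | |].
{ intros c _; apply (continuity_pt_of_derive _ _ (f1 c)), (Hf c). }
assert (Hke : 0 < k * e) by (apply Rmult_lt_0_compat; assumption).
assert (Hk2 : 0 < k ^ 2) by (apply pow_lt; assumption).
set (E := 2 * k * e * B + 3 * k ^ 2 * (F M + e * ((b - a) * B))).
assert (eB : 0 <= e * ((b - a) * B)) by (repeat apply Rmult_le_pos; lra).
assert (HE : 0 <= E).
{ unfold E; apply Rplus_le_le_0_compat; repeat apply Rmult_le_pos; try lra.
  specialize (F0 M); lra. }
assert (L : (forall x, 1 / 4 <= x <= 1 / 2 -> - E <= f2 x)).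
{ intros z Hz; destruct (Hf z) as [_ [_ Hf2]].
  change (w1 b * u z b - w1 a * u z a - RInt (fun t => w2 t * u z t) a b <= f2 z) in Hf2.
  eapply Rle_trans; [| exact Hf2].
  assert (Q1 : Rabs (w1 b * u z b) <= k * e * B).
  { pose proof (weight_b1 _ _ _ _ _ _ _ Hw b) as W.
    rewrite (weight_right _ _ _ _ _ _ _ Hw), Rplus_0_l in W.
    rewrite Rabs_mult; apply Rmult_le_compat; try apply Rabs_pos; [exact W |].
    rewrite Rabs_pos_eq by apply U0; apply HB; lra. }
  assert (Q2 : Rabs (w1 a * u z a) <= k * e * B).
  { pose proof (weight_b1 _ _ _ _ _ _ _ Hw a) as W.
    rewrite (weight_left _ _ _ _ _ _ _ Hw), Rplus_0_l in W.
    rewrite Rabs_mult; apply Rmult_le_compat; try apply Rabs_pos; [exact W |].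
    rewrite Rabs_pos_eq by apply U0; apply HB; lra. }
  assert (Q3 : RInt (fun t => w2 t * u z t) a b <= 3 * k ^ 2 * (F z + e * ((b - a) * B))).
  { destruct (weight_slice u z HC) as [I1 [I2 I3]].
    apply (Rle_trans _ (RInt (fun t => 3 * k ^ 2 * (w t * u z t + e * B)) a b)).
    - assert (I4 : ex_RInt (fun t => w t * u z t + e * B) a b).
      { apply (ex_RInt_plus (V := R_NormedModule)); [exact I2 | apply ex_RInt_const]. }
      apply RInt_le; [lra | exact I3 | exact (ex_RInt_scal (V := R_NormedModule) _ _ _ (3 * k ^ 2) I4) |].
      intros t Ht.
      pose proof (weight_b2 _ _ _ _ _ _ _ Hw t) as W.
      apply (Rle_trans _ (3 * k ^ 2 * (w t + e) * u z t)).
      + apply Rmult_le_compat_r; [apply U0 |]; apply Rabs_le_between in W; lra.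
      + rewrite Rmult_assoc; apply Rmult_le_compat_l; [lra |].
        rewrite Rmult_plus_distr_r; apply Rplus_le_compat_l, Rmult_le_compat_l; [lra |].
        apply HB; lra.
    - apply Req_le.
      rewrite (RInt_scal (V := R_CompleteNormedModule) (fun t => w t * u z t + e * B)).
      + rewrite (RInt_plus (V := R_CompleteNormedModule)); [| exact I2 | apply ex_RInt_const].
        rewrite RInt_const; unfold scal, plus; simpl; unfold mult; simpl; unfold F; ring.
      + apply (ex_RInt_plus (V := R_NormedModule)); [exact I2 | apply ex_RInt_const]. }
  apply Rabs_le_between in Q1; apply Rabs_le_between in Q2.
  assert (3 * k ^ 2 * (F z + e * ((b - a) * B)) <= 3 * k ^ 2 * (F M + e * ((b - a) * B))).
  { apply Rmult_le_compat_l; [lra |]; specialize (HM z Hz); lra. }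
  unfold E; lra. }
assert (MB : F M <= F (1 / 4) + F (1 / 2) + E / 16).
{ pose proof (F0 (1 / 4)); pose proof (F0 (1 / 2)).
  destruct (Req_dec M (1 / 4)) as [-> | N1]; [lra |].
  destruct (Req_dec M (1 / 2)) as [-> | N2]; [lra |].
  pose proof (convex_approx F f1 f2 E (1 / 4) M (1 / 2) ltac:(lra) HE
    (fun x _ => proj1 (Hf x)) (fun x _ => proj1 (proj2 (Hf x))) L) as C.
  assert ((1 / 2 - M) * F (1 / 4) <= 1 / 4 * F (1 / 4)) by nra.
  assert ((M - 1 / 4) * F (1 / 2) <= 1 / 4 * F (1 / 2)) by nra.
  lra. }
assert (E <= 2 * k * e * B + 8 * (F M + e * ((b - a) * B))).
{ unfold E; apply Rplus_le_compat_l, Rmult_le_compat_r; [specialize (F0 M); lra | exact Hk8]. }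
assert (0 <= k * e * B) by (apply Rmult_le_pos; lra).
specialize (HM x Hx); nra.
Qed.

End WeightedMeans.

(** * The theta function *)

(** Dominated convergence for sums whose length grows too. The limits inherit the bound [B], and the
    tail of [B] controls what lies beyond a fixed K uniformly in m. *)
Lemma tannery (a : nat -> nat -> R) (N : nat -> nat) (b B : nat -> R) :
  (forall K, exists m0, forall m, (m0 <= m)%nat -> (K <= N m)%nat) ->
  (forall l, is_lim_seq (fun m => a m l) (b l)) ->
  (exists m0, forall m l, (m0 <= m)%nat -> (l < N m)%nat -> Rabs (a m l) <= B l) ->
  ex_series B -> ex_series b /\ is_lim_seq (fun m => Rsum (a m) (N m)) (Series b).
Proof.
intros HN Ha [m0 HB] EB.
assert (Hb : forall l, Rabs (b l) <= B l).
{ intros l; destruct (HN (S l)) as [m1 H1].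
  apply (is_lim_seq_le_loc (fun m => Rabs (a m l)) (fun _ => B l) (Rabs (b l)) (B l)).
  - exists (max m0 m1); intros m Hm; apply HB; [lia |]; specialize (H1 m ltac:(lia)); lia.
  - apply (is_lim_seq_abs _ (b l)), Ha.
  - apply is_lim_seq_const. }
assert (EA : ex_series (fun l => Rabs (b l))).
{ apply (ex_series_le (K := R_AbsRing) (V := R_CompleteNormedModule) _ B); [| exact EB].
  intros l; unfold norm; simpl; unfold abs; simpl; rewrite Rabs_Rabsolu; apply Hb. }
assert (Eb : ex_series b) by (apply ex_series_Rabs, EA).
split; [exact Eb |].
assert (B0 : forall l, 0 <= B l) by (intros l; eapply Rle_trans; [apply Rabs_pos | apply Hb]).
assert (SB : is_lim_seq (Rsum B) (Series B)) by (apply is_series_Rsum, Series_correct, EB).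
assert (Sb : is_lim_seq (Rsum b) (Series b)) by (apply is_series_Rsum, Series_correct, Eb).
assert (Tail : forall (f : nat -> R) K n, (forall l, (l < n)%nat -> Rabs (f l) <= B l) -> (K <= n)%nat ->
  Rabs (Rsum f n - Rsum f K) <= Series B - Rsum B K).
{ intros f K n Hf HK.
  apply (Rle_trans _ (Rsum B n - Rsum B K)).
  2:{ pose proof (Rsum_le_Series B n B0 EB); lra. }
  induction HK as [|n HK IH].
  - rewrite !Rminus_diag, Rabs_R0; lra.
  - simpl; replace (Rsum f n + f n - Rsum f K) with ((Rsum f n - Rsum f K) + f n) by ring.
    eapply Rle_trans; [apply Rabs_triang |].
    specialize (IH ltac:(intros; apply Hf; lia)); specialize (Hf n ltac:(lia)); lra. }
apply is_lim_seq_spec; intros eps.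
apply is_lim_seq_spec in SB; apply is_lim_seq_spec in Sb.
assert (He4 : 0 < eps / 4) by (destruct eps; simpl; lra).
destruct (SB (mkposreal _ He4)) as [K1 HK1]; destruct (Sb (mkposreal _ He4)) as [K2 HK2].
simpl in HK1, HK2.
set (K := max K1 K2).
assert (LK : is_lim_seq (fun m => Rsum (a m) K) (Rsum b K)).
{ generalize K; intros n; induction n as [|n IH]; simpl; [apply is_lim_seq_const |].
  apply is_lim_seq_plus'; [exact IH | apply Ha]. }
apply is_lim_seq_spec in LK; destruct (LK (mkposreal _ He4)) as [m1 H1]; simpl in H1.
destruct (HN K) as [m2 H2].
exists (max m0 (max m1 m2)); intros m Hm.
specialize (H1 m ltac:(lia)); specialize (H2 m ltac:(lia)).
specialize (HK1 K ltac:(lia)); specialize (HK2 K ltac:(lia)).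
assert (T := Tail (a m) K (N m) (fun l Hl => HB m l ltac:(lia) Hl) H2).
replace (Rsum (a m) (N m) - Series b) with
  ((Rsum (a m) (N m) - Rsum (a m) K) + (Rsum (a m) K - Rsum b K) + (Rsum b K - Series b)) by ring.
eapply Rle_lt_trans; [apply Rabs_triang |].
eapply Rle_lt_trans; [apply Rplus_le_compat_r, Rabs_triang |].
apply Rabs_def2 in HK1; destruct eps; simpl in *; lra.
Qed.

Lemma exp_INR_mult n y : exp (INR n * y) = exp y ^ n.
Proof.
induction n as [|n IH]; [simpl; rewrite Rmult_0_l; apply exp_0 |].
rewrite S_INR, Rmult_plus_distr_r, Rmult_1_l, exp_plus, IH; simpl; ring.
Qed.

Lemma exp_le_inv_1_minus y : 0 <= y < 1 -> exp (- (y / (1 - y))) <= 1 - y.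
Proof.
intros Hy; rewrite exp_Ropp.
replace (1 - y) with (/ (1 + y / (1 - y))) at 2 by (field; lra).
assert (0 <= y / (1 - y)) by (apply Rmult_le_pos; [lra | apply Rlt_le, Rinv_0_lt_compat; lra]).
apply Rinv_le_contravar; [lra | apply exp_ineq1_le].
Qed.

Lemma one_minus_le_exp y : 1 - y <= exp (- y).
Proof. pose proof (exp_ineq1_le (- y)); lra. Qed.

(* [cwalk m * rwalk m k = binom(2m, m+k) / 4^m]: the return probabilities of a simple random walk. *)
Fixpoint cwalk (m : nat) : R :=
  match m with O => 1 | S n => cwalk n * ((2 * INR n + 1) / (2 * INR n + 2)) end.

Fixpoint rwalk (m k : nat) : R :=
  match k with O => 1 | S j => rwalk m j * ((INR m - INR j) / (INR m + INR j + 1)) end.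

Lemma rwalk_shift m k : rwalk (S m) (S k) =
  rwalk m k * ((INR m + 1) ^ 2 / ((INR m + INR k + 1) * (INR m + INR k + 2))).
Proof.
pose proof (pos_INR m) as Hm.
induction k as [|k IH]; [cbn [rwalk]; rewrite S_INR; simpl; field; lra |].
change (rwalk (S m) (S (S k))) with
  (rwalk (S m) (S k) * ((INR (S m) - INR (S k)) / (INR (S m) + INR (S k) + 1))).
change (rwalk m (S k)) with (rwalk m k * ((INR m - INR k) / (INR m + INR k + 1))).
rewrite IH, !S_INR; pose proof (pos_INR k); field; repeat split; lra.
Qed.

Lemma rwalk_zero m k : (m < k)%nat -> rwalk m k = 0.
Proof.
intros H; induction H as [|k H IH]; cbn [rwalk]; [rewrite Rminus_diag | rewrite IH]; unfold Rdiv; ring.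
Qed.

Lemma rwalk_range m k : 0 <= rwalk m k.
Proof.
destruct (Nat.lt_ge_cases m k) as [H | H]; [rewrite rwalk_zero by exact H; lra |].
induction k as [|k IH]; cbn [rwalk]; [lra |].
specialize (IH ltac:(lia)).
assert (INR k <= INR m) by (apply le_INR; lia).
pose proof (pos_INR k).
apply Rmult_le_pos; [exact IH | apply Rmult_le_pos; [lra | apply Rlt_le, Rinv_0_lt_compat; lra]].
Qed.

(** Pascal's rule applied twice to binom(2m, m + k) / 4^m. *)
Lemma walk_step m k : 4 * (cwalk (S m) * rwalk (S m) (S k)) =
  cwalk m * rwalk m k + 2 * (cwalk m * rwalk m (S k)) + cwalk m * rwalk m (S (S k)).
Proof.
rewrite rwalk_shift; cbn [cwalk rwalk]; rewrite S_INR.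
pose proof (pos_INR m); pose proof (pos_INR k); field; repeat split; lra.
Qed.

Lemma walk_step_0 m : 4 * cwalk (S m) = 2 * cwalk m + 2 * (cwalk m * rwalk m 1).
Proof. cbn [cwalk rwalk]; simpl (INR 0); pose proof (pos_INR m); field; lra. Qed.

(** As 4 cos^2 u = 2 + 2 cos 2u, multiplication averages neighbouring Fourier coefficients with
    weights 1, 2, 1, exactly as in [walk_step]. The last line holds the terms created by cutting the
    sum at K. *)
Lemma cos_sq_mult (a : nat -> R) u K :
  4 * (cos u * cos u) * (a 0%nat + 2 * Rsum (fun k => a (S k) * cos (2 * INR (S k) * u)) K) =
  (2 * a 0%nat + 2 * a 1%nat)
  + 2 * Rsum (fun k => (a k + 2 * a (S k) + a (S (S k))) * cos (2 * INR (S k) * u)) K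
  + 2 * (a K * cos (2 * INR (S K) * u) - a (S K) * cos (2 * INR K * u)).
Proof.
assert (C2 : 4 * (cos u * cos u) = 2 + 2 * cos (2 * u)) by (rewrite cos_2a_cos; ring).
rewrite C2; induction K as [|K IH].
- cbn [Rsum]; simpl (INR 1); simpl (INR 0).
  replace (2 * 1 * u) with (2 * u) by ring; rewrite Rmult_0_r, Rmult_0_l, cos_0; ring.
- cbn [Rsum].
  assert (E : 2 * cos (2 * u) * cos (2 * INR (S K) * u)
     = cos (2 * INR (S (S K)) * u) + cos (2 * INR K * u)).
  { replace (2 * INR (S (S K)) * u) with (2 * INR (S K) * u + 2 * u) by (rewrite (S_INR (S K)); ring).
    replace (2 * INR K * u) with (2 * INR (S K) * u - 2 * u) by (rewrite (S_INR K); ring).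
    rewrite cos_plus, cos_minus; ring. }
  set (s1 := Rsum _ K) in *; set (s2 := Rsum _ K) in *.
  set (x := cos (2 * INR (S K) * u)) in *.
  set (y := cos (2 * INR (S (S K)) * u)) in *; set (z := cos (2 * INR K * u)) in *.
  replace ((2 + 2 * cos (2 * u)) * (a 0%nat + 2 * (s1 + a (S K) * x))) with
    ((2 + 2 * cos (2 * u)) * (a 0%nat + 2 * s1) + 4 * a (S K) * x
     + 2 * a (S K) * (2 * cos (2 * u) * x)) by ring.
  rewrite IH, E; ring.
Qed.

(** The coefficients vanish beyond m, so the length K is free; this lets sums for different m share
    one length and makes the truncation terms of [cos_sq_mult] disappear. *)
Lemma cos_power_expansion m K u : (m <= K)%nat ->
  cos u ^ (2 * m) = cwalk m + 2 * Rsum (fun k => cwalk m * rwalk m (S k) * cos (2 * INR (S k) * u)) K.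
Proof.
revert K; induction m as [|m IH]; intros K HK.
- rewrite (Rsum_ext _ (fun _ => 0)).
  + rewrite Rsum_const; simpl; ring.
  + intros k _; rewrite rwalk_zero by lia; ring.
- replace (2 * S m)%nat with (S (S (2 * m))) by lia.
  change (cos u ^ S (S (2 * m))) with (cos u * (cos u * cos u ^ (2 * m))).
  rewrite (IH K) by lia.
  apply (Rmult_eq_reg_l 4); [| lra].
  assert (E := cos_sq_mult (fun k => cwalk m * rwalk m k) u K); cbv beta in E.
  rewrite (rwalk_zero m K), (rwalk_zero m (S K)) in E by lia.
  change (rwalk m 0) with 1 in E; rewrite Rmult_1_r in E.
  rewrite <- Rmult_assoc, <- Rmult_assoc, (Rmult_assoc 4), E, <- walk_step_0.
  rewrite (Rsum_ext (fun k => (cwalk m * rwalk m k + _ + _) * _)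
    (fun k => 4 * (cwalk (S m) * rwalk (S m) (S k) * cos (2 * INR (S k) * u)))).
  + rewrite Rsum_scal; ring.
  + intros k _; rewrite <- walk_step; ring.
Qed.

Lemma dirichlet_kernel q x :
  sin x * (1 + 2 * Rsum (fun l => cos (2 * INR (S l) * x)) q) = sin ((2 * INR q + 1) * x).
Proof.
induction q as [|q IH]; [simpl; rewrite Rmult_0_r, Rplus_0_l, Rmult_1_l; ring |].
cbn [Rsum].
replace ((2 * INR (S q) + 1) * x) with (2 * INR (S q) * x + x) by ring.
replace ((2 * INR q + 1) * x) with (2 * INR (S q) * x - x) in IH by (rewrite S_INR; ring).
rewrite sin_plus; rewrite sin_minus in IH; lra.
Qed.

Lemma sin_int n : sin (INR n * PI) = 0.
Proof.
induction n as [|n IH]; [simpl; rewrite Rmult_0_l; apply sin_0 |].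
rewrite S_INR, Rmult_plus_distr_r, Rmult_1_l, neg_sin, IH; ring.
Qed.

Lemma cos_2int n : cos (2 * INR n * PI) = 1.
Proof.
replace (2 * INR n * PI) with (2 * (INR n * PI)) by ring.
rewrite cos_2a_sin, sin_int; ring.
Qed.

(** Characters of the cyclic group of order 2q + 1, with l and -l paired. By the Dirichlet kernel
    the sum times sin(j pi / L) is sin(j pi) = 0, and sin(j pi / L) vanishes only when L divides
    j. *)
Lemma cos_orthogonality q j :
  1 + 2 * Rsum (fun l => cos (2 * INR j * (PI * INR (S l) / INR (2 * q + 1)))) q =
  if Nat.eqb (j mod (2 * q + 1)) 0 then INR (2 * q + 1) else 0.
Proof.
set (L := (2 * q + 1)%nat).
assert (EL : INR L = 2 * INR q + 1) by (unfold L; rewrite plus_INR, mult_INR; simpl; ring).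
pose proof (pos_INR q) as Hq.
assert (HL : L <> 0%nat) by (unfold L; lia).
rewrite (Rsum_ext _ (fun l => cos (2 * INR (S l) * (INR j * PI / INR L)))).
2:{ intros l _; f_equal; field; lra. }
destruct (Nat.eqb_spec (j mod L) 0) as [H | H].
- rewrite (Rsum_ext _ (fun _ => 1)).
  + rewrite Rsum_const, EL; ring.
  + intros l _; apply Nat.Div0.mod_divides in H; destruct H as [v ->].
    rewrite <- (cos_2int (S l * v)); f_equal; rewrite !mult_INR; field; lra.
- apply (Rmult_eq_reg_l (sin (INR j * PI / INR L))).
  + rewrite dirichlet_kernel, <- EL, Rmult_0_r, <- (sin_int j); f_equal; field; lra.
  + rewrite (Nat.div_mod_eq j L), plus_INR, mult_INR.
    set (v := (j / L)%nat); set (r := (j mod L)%nat) in *.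
    assert (Hr : (r < L)%nat) by (apply Nat.mod_upper_bound, HL).
    apply lt_INR in Hr; assert (Hr0 : 0 < INR r) by (apply lt_0_INR; lia).
    replace ((INR L * INR v + INR r) * PI / INR L) with (INR v * PI + INR r / INR L * PI)
      by (field; lra).
    assert (HrL : 0 < INR r / INR L < 1).
    { split; [apply Rdiv_lt_0_compat; lra |].
      apply (Rmult_lt_reg_r (INR L)); [lra |]; unfold Rdiv; rewrite Rmult_assoc, Rinv_l; lra. }
    pose proof PI_RGT_0.
    assert (S0 : 0 < sin (INR r / INR L * PI)) by (apply sin_gt_0; nra).
    rewrite sin_plus, sin_int, Rmult_0_l, Rplus_0_l.
    apply Rmult_integral_contrapositive_currified; [| lra].
    intros C0; pose proof (sin2_cos2 (INR v * PI)) as P.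
    rewrite sin_int, C0 in P; unfold Rsqr in P; lra.
Qed.

(* Fourier inversion on the cyclic group of order [2q+1]; theta's functional equation is its
   limit for [q ~ sqrt m]. *)
Lemma finite_theta q m :
  1 + 2 * Rsum (fun l => cos (PI * INR (S l) / INR (2 * q + 1)) ^ (2 * m)) q =
  INR (2 * q + 1) * cwalk m * (1 + 2 * Rsum (fun v => rwalk m ((2 * q + 1) * S v)) (S m)).
Proof.
set (L := (2 * q + 1)%nat).
(* Longer than m, as the expansion requires, and a multiple of L, so that exactly m + 1 multiples of
   L are counted. *)
set (K := (L * S m)%nat).
rewrite (Rsum_ext _ (fun l => cwalk m + 2 * Rsum (fun k => cwalk m * rwalk m (S k)
   * cos (2 * INR (S k) * (PI * INR (S l) / INR L))) K)).
2:{ intros l _; apply cos_power_expansion; unfold K, L; nia. }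
rewrite Rsum_plus, Rsum_const, Rsum_scal, Rsum_exchange.
assert (EL : INR L = 2 * INR q + 1) by (unfold L; rewrite plus_INR, mult_INR; simpl; ring).
assert (O : cwalk m * INR L + 2 * Rsum (fun k => cwalk m * rwalk m (S k) *
   (if Nat.eqb (S k mod L) 0 then INR L else 0)) K =
   INR L * cwalk m * (1 + 2 * Rsum (fun v => rwalk m (L * S v)) (S m))).
{ unfold K; rewrite (Rsum_ext _ (fun k => INR L * cwalk m * (indic (S k mod L =? 0)%nat * rwalk m (S k)))).
  2:{ intros k _; destruct (S k mod L =? 0)%nat; simpl indic; ring. }
  rewrite Rsum_scal, Rsum_multiples, (Nat.mul_comm L), Nat.div_mul by (unfold L; lia); ring. }
rewrite <- O.
rewrite (Rsum_ext (fun k => cwalk m * rwalk m (S k) * (if Nat.eqb (S k mod L) 0 then INR L else 0))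
  (fun k => cwalk m * rwalk m (S k) +
     2 * Rsum (fun l => cwalk m * rwalk m (S k) * cos (2 * INR (S k) * (PI * INR (S l) / INR L))) q)).
2:{ intros k _; pose proof (cos_orthogonality q (S k)) as Q; fold L in Q; rewrite <- Q.
  rewrite Rsum_scal; ring. }
(* The expansion at u = 0 turns the isolated 1, which is the term of the trivial group element, into
   the same coefficients. *)
assert (Z : 1 = cwalk m + 2 * Rsum (fun k => cwalk m * rwalk m (S k)) K).
{ rewrite (Rsum_ext _ (fun k => cwalk m * rwalk m (S k) * cos (2 * INR (S k) * 0))).
  - rewrite <- cos_power_expansion by (unfold K, L; nia); rewrite cos_0, pow1; reflexivity.
  - intros; rewrite Rmult_0_r, cos_0; ring. }
rewrite Rsum_plus, (Rsum_scal 2), EL.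
set (s := Rsum (fun k => cwalk m * rwalk m (S k)) K) in *.
lra.
Qed.

(** The factors are 1 - (2j+1)/(m+j+1) <= exp(- (2j+1)/(m+k)), and the odd numbers 2j+1 for j < k
    sum to k^2. *)
Lemma rwalk_upper m k : (k <= m)%nat -> rwalk m k <= exp (- (INR k ^ 2 / (INR m + INR k))).
Proof.
intros Hk; destruct (Nat.eq_dec k 0) as [-> | N].
{ simpl (INR 0); rewrite pow_i by lia; unfold Rdiv; rewrite Rmult_0_l, Ropp_0, exp_0; simpl; lra. }
assert (Hk0 : 0 < INR k) by (apply lt_0_INR; lia).
apply le_INR in Hk.
assert (G : forall j, (j <= k)%nat -> rwalk m j <= exp (- (INR j ^ 2 / (INR m + INR k)))).
{ induction j as [|j IH]; intros Hj.
  - simpl (INR 0); rewrite pow_i by lia; unfold Rdiv; rewrite Rmult_0_l, Ropp_0, exp_0; simpl; lra.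
  - cbn [rwalk]; specialize (IH ltac:(lia)); apply le_INR in Hj; rewrite S_INR in Hj.
    pose proof (pos_INR j); rewrite S_INR.
    replace (- ((INR j + 1) ^ 2 / (INR m + INR k))) with
      (- (INR j ^ 2 / (INR m + INR k)) + - ((2 * INR j + 1) / (INR m + INR k))) by (field; lra).
    rewrite exp_plus; apply Rmult_le_compat; [apply rwalk_range | | exact IH |].
    + apply Rmult_le_pos; [lra | apply Rlt_le, Rinv_0_lt_compat; lra].
    + apply (Rle_trans _ (exp (- ((2 * INR j + 1) / (INR m + INR j + 1))))).
      * eapply Rle_trans; [| apply one_minus_le_exp]; apply Req_le; field; lra.
      * apply exp_le, Ropp_le_contravar, Rmult_le_compat_l; [lra |].
        apply Rinv_le_contravar; lra. }
apply G; lia.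
Qed.

(** The same product with 1 - y >= exp(- y / (1 - y)), where y = (2j+1)/(m+j+1) gives y / (1 - y) =
    (2j+1)/(m-j). *)
Lemma rwalk_lower m k : (k < m)%nat -> exp (- (INR k ^ 2 / (INR m - INR k))) <= rwalk m k.
Proof.
intros Hk; apply lt_INR in Hk.
assert (G : forall j, (j <= k)%nat -> exp (- (INR j ^ 2 / (INR m - INR k))) <= rwalk m j).
{ induction j as [|j IH]; intros Hj.
  - simpl (INR 0); rewrite pow_i by lia; unfold Rdiv; rewrite Rmult_0_l, Ropp_0, exp_0; simpl; lra.
  - cbn [rwalk]; specialize (IH ltac:(lia)); apply le_INR in Hj; rewrite S_INR in Hj.
    pose proof (pos_INR j); rewrite S_INR.
    replace (- ((INR j + 1) ^ 2 / (INR m - INR k))) with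
      (- (INR j ^ 2 / (INR m - INR k)) + - ((2 * INR j + 1) / (INR m - INR k))) by (field; lra).
    rewrite exp_plus; apply Rmult_le_compat; try (apply Rlt_le, exp_pos); [exact IH |].
    apply (Rle_trans _ (exp (- ((2 * INR j + 1) / (INR m - INR j))))).
    + apply exp_le, Ropp_le_contravar, Rmult_le_compat_l; [lra |].
      apply Rinv_le_contravar; lra.
    + replace ((2 * INR j + 1) / (INR m - INR j)) with
        (((2 * INR j + 1) / (INR m + INR j + 1)) / (1 - (2 * INR j + 1) / (INR m + INR j + 1)))
        by (field; lra).
      eapply Rle_trans; [apply exp_le_inv_1_minus |].
      * split; [apply Rmult_le_pos; [lra | apply Rlt_le, Rinv_0_lt_compat; lra] |].
        apply (Rmult_lt_reg_r (INR m + INR j + 1)); [lra |].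
        unfold Rdiv; rewrite Rmult_assoc, Rinv_l; lra.
      * apply Req_le; field; lra. }
apply G; lia.
Qed.

Lemma sin_lower u : 0 <= u <= 4 -> u - u ^ 3 / 6 <= sin u.
Proof.
intros Hu; eapply Rle_trans; [| apply (pre_sin_bound u 0); lra].
unfold sin_approx, sin_term; simpl; lra.
Qed.

(** [1 + 2 * omega x] is Jacobi's theta function at x^2. *)
Definition omega (x : R) : R := Series (fun n => exp (- (PI * INR (S n) ^ 2 * x ^ 2))).

Lemma INR_S_sq_ge n : INR (S n) <= INR (S n) ^ 2.
Proof. pose proof (INR_S_ge_1 n); nra. Qed.

Lemma ex_series_exp_sq c : 0 < c -> ex_series (fun n => exp (- (c * INR (S n)))).
Proof.
intros Hc; apply (ex_series_ext (fun n => exp (- c) * exp (- c) ^ n)).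
- intros n; rewrite <- exp_INR_mult, <- exp_plus; f_equal; rewrite S_INR; ring.
- apply (ex_series_scal (V := R_NormedModule)), ex_series_geom.
  rewrite Rabs_pos_eq by (apply Rlt_le, exp_pos); rewrite <- exp_0; apply exp_increasing; lra.
Qed.

Lemma nat_floor_spec y : 0 <= y -> INR (nat_floor y) <= y < INR (nat_floor y) + 1.
Proof.
intros Hy; unfold nat_floor.
destruct (base_Int_part y) as [H1 H2].
assert (H3 : (0 <= Int_part y)%Z).
{ assert (IZR (-1) < IZR (Int_part y)) by (simpl; lra).
  apply lt_IZR in H; lia. }
rewrite INR_IZR_INZ, Z2Nat.id by exact H3; lra.
Qed.

Lemma is_lim_seq_sqrt_p (u : nat -> R) :
  is_lim_seq u p_infty -> is_lim_seq (fun n => sqrt (u n)) p_infty.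
Proof. intros H; exact (filterlim_comp _ _ _ u sqrt _ _ _ H filterlim_sqrt_p). Qed.

Section ThetaLimit.

Variable x : R.
Hypothesis Hx : 0 < x.

(** With this choice L = 2q + 1 satisfies L^2 / m -> pi x^2. The Gaussian limits of [rwalk m (L v)]
    and of cos(pi l / L)^(2m) are then exp(- pi v^2 x^2) and exp(- pi l^2 / x^2), the terms of
    [omega x] and [omega (/ x)]. *)
Let q (m : nat) : nat := nat_floor (sqrt (PI * INR m) * x / 2).
Let L (m : nat) : R := INR (2 * q m + 1).

Lemma L_bounds m : sqrt (PI * INR m) * x - 1 <= L m <= sqrt (PI * INR m) * x + 1.
Proof.
assert (H : 0 <= sqrt (PI * INR m) * x / 2).
{ pose proof (sqrt_pos (PI * INR m)); nra. }
apply nat_floor_spec in H; unfold L, q; rewrite plus_INR, mult_INR; simpl; lra.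
Qed.

Lemma L_ge_1 m : 1 <= L m.
Proof. unfold L; rewrite plus_INR; simpl (INR 1); pose proof (pos_INR (2 * q m)); lra. Qed.

Lemma inv_sqrt_lim : is_lim_seq (fun m => / sqrt (INR m)) 0.
Proof.
replace (Finite 0) with (Rbar_inv p_infty) by reflexivity.
apply is_lim_seq_inv; [| discriminate].
apply is_lim_seq_sqrt_p, is_lim_seq_INR.
Qed.

Lemma L_ratio_lim : is_lim_seq (fun m => L m / sqrt (INR m)) (sqrt PI * x).
Proof.
pose proof PI_RGT_0.
apply (is_lim_seq_le_le_loc (fun m => sqrt PI * x - / sqrt (INR m)) _
  (fun m => sqrt PI * x + / sqrt (INR m))).
- exists 1%nat; intros m Hm.
  assert (Hs : 0 < sqrt (INR m)) by (apply sqrt_lt_R0, lt_0_INR; lia).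
  pose proof (L_bounds m) as B; rewrite sqrt_mult in B by (try lra; apply pos_INR).
  split; apply (Rmult_le_reg_r (sqrt (INR m))); try exact Hs;
    unfold Rdiv; rewrite Rmult_assoc, Rinv_l, Rmult_1_r by lra;
    rewrite ?Rmult_minus_distr_r, ?Rmult_plus_distr_r, Rinv_l by lra; lra.
- replace (Finite (sqrt PI * x)) with (Finite (sqrt PI * x - 0)) by (f_equal; ring).
  apply is_lim_seq_minus'; [apply is_lim_seq_const | apply inv_sqrt_lim].
- replace (Finite (sqrt PI * x)) with (Finite (sqrt PI * x + 0)) by (f_equal; ring).
  apply is_lim_seq_plus'; [apply is_lim_seq_const | apply inv_sqrt_lim].
Qed.

Lemma L_sq_lim : is_lim_seq (fun m => L m ^ 2 / INR m) (PI * x ^ 2).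
Proof.
pose proof PI_RGT_0.
apply (is_lim_seq_ext_loc (fun m => (L m / sqrt (INR m)) * (L m / sqrt (INR m)))).
- exists 1%nat; intros m Hm; assert (0 < INR m) by (apply lt_0_INR; lia).
  assert (0 < sqrt (INR m)) by (apply sqrt_lt_R0; assumption).
  rewrite <- (sqrt_sqrt (INR m)) at 3 by lra; field; lra.
- replace (PI * x ^ 2) with ((sqrt PI * x) * (sqrt PI * x)).
  + apply is_lim_seq_mult'; apply L_ratio_lim.
  + rewrite <- (sqrt_sqrt PI) at 3 by lra; ring.
Qed.

Lemma L_over_m_lim : is_lim_seq (fun m => L m / INR m) 0.
Proof.
apply (is_lim_seq_ext_loc (fun m => (L m / sqrt (INR m)) * / sqrt (INR m))).
- exists 1%nat; intros m Hm; assert (0 < INR m) by (apply lt_0_INR; lia).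
  assert (0 < sqrt (INR m)) by (apply sqrt_lt_R0; assumption).
  rewrite <- (sqrt_sqrt (INR m)) at 3 by lra; field; lra.
- replace 0 with (sqrt PI * x * 0) by ring.
  apply is_lim_seq_mult'; [apply L_ratio_lim | apply inv_sqrt_lim].
Qed.

Lemma q_large K : exists m0, forall m, (m0 <= m)%nat -> (K <= q m)%nat.
Proof.
assert (H : is_lim_seq (fun m => sqrt (PI * INR m) * x / 2) p_infty).
{ replace p_infty with (Rbar_mult p_infty (x / 2)).
  2:{ simpl; case Rle_dec; [intros h; case Rle_lt_or_eq_dec; [reflexivity |] |]; intros; exfalso; lra. }
  apply (is_lim_seq_ext (fun m => sqrt (PI * INR m) * (x / 2))).
  - intros; field.
  - apply is_lim_seq_scal_r, is_lim_seq_sqrt_p.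
    replace p_infty with (Rbar_mult PI p_infty).
    + apply is_lim_seq_scal_l, is_lim_seq_INR.
    + pose proof PI_RGT_0; simpl; case Rle_dec; [intros h; case Rle_lt_or_eq_dec; [reflexivity |] |];
          intros; exfalso; lra. }
apply is_lim_seq_spec in H; destruct (H (INR K)) as [m0 Hm0].
exists m0; intros m Hm; specialize (Hm0 m Hm).
destruct (nat_floor_spec (sqrt (PI * INR m) * x / 2)) as [_ B]; [pose proof (pos_INR K); lra |].
fold (q m) in B; apply INR_le.
assert (INR K < INR (S (q m))) by (rewrite S_INR; lra).
apply INR_lt in H0; apply le_INR; lia.
Qed.

Lemma rwalk_lim v : is_lim_seq (fun m => rwalk m ((2 * q m + 1) * S v))
  (exp (- (PI * INR (S v) ^ 2 * x ^ 2))).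
Proof.
set (k := INR (S v)).
assert (Hk : 1 <= k) by apply INR_S_ge_1.
assert (L0 : is_lim_seq (fun m => L m / INR m * k) 0).
{ replace (Finite 0) with (Finite (0 * k)) by (f_equal; ring).
  apply is_lim_seq_mult'; [apply L_over_m_lim | apply is_lim_seq_const]. }
assert (L2 : is_lim_seq (fun m => L m ^ 2 / INR m * k ^ 2) (PI * k ^ 2 * x ^ 2)).
{ replace (PI * k ^ 2 * x ^ 2) with (PI * x ^ 2 * k ^ 2) by ring.
  apply is_lim_seq_mult'; [apply L_sq_lim | apply is_lim_seq_const]. }
assert (Cexp : forall z, continuity_pt (fun t => exp (- t)) z).
{ intros z; eapply continuity_pt_of_derive; auto_derive; [trivial | reflexivity]. }
assert (Lim : forall e0, e0 = 1 \/ e0 = -1 ->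
  is_lim_seq (fun m => exp (- (L m ^ 2 / INR m * k ^ 2 / (1 + e0 * (L m / INR m * k)))))
    (exp (- (PI * k ^ 2 * x ^ 2)))).
{ intros e0 He0; apply (is_lim_seq_continuous (fun t => exp (- t))); [apply Cexp |].
  replace (PI * k ^ 2 * x ^ 2) with (PI * k ^ 2 * x ^ 2 / (1 + e0 * 0)) by field.
  apply is_lim_seq_div'; [exact L2 | | lra].
  apply is_lim_seq_plus'; [apply is_lim_seq_const |].
  apply is_lim_seq_mult'; [apply is_lim_seq_const | exact L0]. }
apply is_lim_seq_spec in L0; destruct (L0 (mkposreal (1/2) ltac:(lra))) as [m0 Hm0]; simpl in Hm0.
eapply is_lim_seq_le_le_loc; [| apply (Lim (-1)); auto | apply (Lim 1); auto].
exists (max 1 m0); intros m Hm; specialize (Hm0 m ltac:(lia)).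
assert (Pm : 0 < INR m) by (apply lt_0_INR; lia).
assert (Ek : INR ((2 * q m + 1) * S v) = L m * k) by (unfold L, k; rewrite mult_INR; reflexivity).
rewrite Rminus_0_r in Hm0; apply Rabs_def2 in Hm0.
assert (HL := L_ge_1 m).
assert (Hlt : L m * k < INR m).
{ apply (Rmult_lt_reg_r (/ INR m)); [apply Rinv_0_lt_compat, Pm |].
  rewrite Rinv_r by lra; unfold Rdiv in Hm0; lra. }
assert (Hn : ((2 * q m + 1) * S v < m)%nat) by (apply INR_lt; rewrite Ek; exact Hlt).
split.
- eapply Rle_trans; [| apply rwalk_lower, Hn]; rewrite Ek.
  apply Req_le; f_equal; field; repeat split; lra.
- eapply Rle_trans; [apply rwalk_upper; lia |]; rewrite Ek.
  apply Req_le; f_equal; field; repeat split; nra.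
Qed.

Lemma rwalk_sum_lim : ex_series (fun n => exp (- (PI * INR (S n) ^ 2 * x ^ 2))) /\
  is_lim_seq (fun m => Rsum (fun v => rwalk m ((2 * q m + 1) * S v)) (S m)) (omega x).
Proof.
pose proof PI_RGT_0.
(* For large m, L^2 / m >= 3c. As k + m <= 2m in the range where [rwalk] is not zero, the exponent
   k^2 / (m + k) with k = L v is at least c v^2 >= c v. *)
set (c := PI * x ^ 2 / 4).
assert (Hc : 0 < c) by (unfold c; pose proof (pow_lt x 2 Hx); nra).
apply (tannery (fun m v => rwalk m ((2 * q m + 1) * S v)) S _ (fun n => exp (- (c * INR (S n))))).
- intros K; exists K; intros; lia.
- apply rwalk_lim.
- pose proof L_sq_lim as HL; apply is_lim_seq_spec in HL.
  destruct (HL (mkposreal c Hc)) as [m0 Hm0]; simpl in Hm0.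
  exists (max 1 m0); intros m v Hm _; specialize (Hm0 m ltac:(lia)); apply Rabs_def2 in Hm0.
  rewrite Rabs_pos_eq by apply rwalk_range.
  destruct (Nat.le_gt_cases ((2 * q m + 1) * S v) m) as [H1 | H1].
  + eapply Rle_trans; [apply rwalk_upper, H1 |].
    apply exp_le, Ropp_le_contravar.
    assert (Ek : INR ((2 * q m + 1) * S v) = L m * INR (S v)) by (unfold L; rewrite mult_INR; reflexivity).
    apply le_INR in H1; rewrite Ek in *.
    assert (Pm : 0 < INR m) by (apply lt_0_INR; lia).
    pose proof (INR_S_sq_ge v); pose proof (L_ge_1 m); pose proof (INR_S_ge_1 v).
    apply (Rle_trans _ ((L m * INR (S v)) ^ 2 / (2 * INR m))).
    * replace ((L m * INR (S v)) ^ 2 / (2 * INR m)) with (L m ^ 2 / INR m / 2 * INR (S v) ^ 2)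
        by (field; lra).
      assert (c <= L m ^ 2 / INR m / 2) by (unfold c in *; lra).
      apply Rmult_le_compat; lra.
    * apply Rmult_le_compat_l; [apply pow2_ge_0 |].
      apply Rinv_le_contravar; [nra | lra].
  + rewrite rwalk_zero by exact H1; apply Rlt_le, exp_pos.
- apply ex_series_exp_sq, Hc.
Qed.

Let u (m l : nat) : R := PI * INR (S l) / L m.

Lemma u_range m l : (l < q m)%nat -> 0 < u m l < PI / 2.
Proof.
pose proof PI_RGT_0; pose proof (L_ge_1 m); pose proof (INR_S_ge_1 l).
intros Hl; assert (H2 : INR (S l) <= INR (q m)) by (apply le_INR; lia).
assert (EL : L m = 2 * INR (q m) + 1) by (unfold L; rewrite plus_INR, mult_INR; simpl; ring).
unfold u; split; [apply Rdiv_lt_0_compat; nra |].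
apply (Rmult_lt_reg_r (L m)); [lra |].
unfold Rdiv; rewrite Rmult_assoc, Rinv_l by lra; nra.
Qed.

Lemma sin_u_lower m l : (l < q m)%nat -> u m l / 3 <= sin (u m l).
Proof.
intros Hl; pose proof (u_range m l Hl); pose proof PI_4.
assert (H1 := sin_lower (u m l) ltac:(lra)).
assert (u m l * u m l <= 4) by nra; simpl in H1; nra.
Qed.

Lemma cos_pow_upper m l : cos (u m l) ^ (2 * m) <= exp (- (INR m * sin (u m l) ^ 2)).
Proof.
rewrite pow_mult.
replace (cos (u m l) ^ 2) with (1 - sin (u m l) ^ 2)
  by (pose proof (sin2_cos2 (u m l)); unfold Rsqr in *; simpl; lra).
replace (exp (- (INR m * sin (u m l) ^ 2))) with (exp (- sin (u m l) ^ 2) ^ m).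
- apply pow_incr; split; [| apply one_minus_le_exp].
  pose proof (sin2_cos2 (u m l)); unfold Rsqr in *; simpl; nra.
- rewrite <- exp_INR_mult; f_equal; ring.
Qed.

Lemma cos_pow_lower m l : sin (u m l) ^ 2 < 1 ->
  exp (- (INR m * sin (u m l) ^ 2 / (1 - sin (u m l) ^ 2))) <= cos (u m l) ^ (2 * m).
Proof.
intros H; rewrite pow_mult.
replace (cos (u m l) ^ 2) with (1 - sin (u m l) ^ 2)
  by (pose proof (sin2_cos2 (u m l)); unfold Rsqr in *; simpl; lra).
replace (exp (- (INR m * sin (u m l) ^ 2 / (1 - sin (u m l) ^ 2)))) with
  (exp (- (sin (u m l) ^ 2 / (1 - sin (u m l) ^ 2))) ^ m).
- apply pow_incr; split; [apply Rlt_le, exp_pos |].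
  apply exp_le_inv_1_minus; split; [apply pow2_ge_0 | exact H].
- rewrite <- exp_INR_mult; f_equal; field; lra.
Qed.

Lemma u_sq_lim l : is_lim_seq (fun m => INR m * u m l ^ 2) (PI * INR (S l) ^ 2 * (/ x) ^ 2).
Proof.
pose proof PI_RGT_0; pose proof (INR_S_ge_1 l).
apply (is_lim_seq_ext_loc (fun m => PI ^ 2 * INR (S l) ^ 2 / (L m ^ 2 / INR m))).
- exists 1%nat; intros m Hm; assert (0 < INR m) by (apply lt_0_INR; lia).
  pose proof (L_ge_1 m); unfold u; field; lra.
- replace (PI * INR (S l) ^ 2 * (/ x) ^ 2) with (PI ^ 2 * INR (S l) ^ 2 / (PI * x ^ 2)) by (field; lra).
  apply is_lim_seq_div'; [apply is_lim_seq_const | apply L_sq_lim |].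
  pose proof (pow_lt x 2 Hx); apply Rgt_not_eq; nra.
Qed.

Lemma u_lim l : is_lim_seq (fun m => u m l ^ 2) 0.
Proof.
apply (is_lim_seq_ext_loc (fun m => (INR m * u m l ^ 2) * / INR m)).
- exists 1%nat; intros m Hm; assert (0 < INR m) by (apply lt_0_INR; lia); field; lra.
- replace 0 with (PI * INR (S l) ^ 2 * (/ x) ^ 2 * 0) by ring.
  apply is_lim_seq_mult'; [apply u_sq_lim |].
  replace (Finite 0) with (Rbar_inv p_infty) by reflexivity.
  apply is_lim_seq_inv; [apply is_lim_seq_INR | discriminate].
Qed.

Lemma sin_sq_lim l : is_lim_seq (fun m => INR m * sin (u m l) ^ 2) (PI * INR (S l) ^ 2 * (/ x) ^ 2).
Proof.
destruct (q_large (S l)) as [m0 Hm0].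
apply (is_lim_seq_le_le_loc (fun m => INR m * u m l ^ 2 * ((1 - u m l ^ 2 / 6) * (1 - u m l ^ 2 / 6))) _
  (fun m => INR m * u m l ^ 2)); [| | apply u_sq_lim].
- exists m0; intros m Hm; specialize (Hm0 m Hm).
  pose proof (u_range m l ltac:(lia)) as U; pose proof PI_4; pose proof (pos_INR m).
  pose proof (sin_lower (u m l) ltac:(lra)) as S1.
  pose proof (sin_lt_x (u m l) ltac:(lra)) as S2.
  assert (u m l * u m l <= 4) by nra.
  assert (S0 : 0 <= u m l - u m l ^ 3 / 6) by (simpl; nra).
  replace (INR m * u m l ^ 2 * ((1 - u m l ^ 2 / 6) * (1 - u m l ^ 2 / 6))) with
    (INR m * (u m l - u m l ^ 3 / 6) ^ 2) by field.
  split; apply Rmult_le_compat_l; try lra; apply pow_incr; lra.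
- replace (PI * INR (S l) ^ 2 * (/ x) ^ 2) with
    (PI * INR (S l) ^ 2 * (/ x) ^ 2 * ((1 - 0 / 6) * (1 - 0 / 6))) by (unfold Rdiv; ring).
  apply is_lim_seq_mult'; [apply u_sq_lim |].
  assert (is_lim_seq (fun m => 1 - u m l ^ 2 / 6) (1 - 0 / 6)).
  { apply is_lim_seq_minus'; [apply is_lim_seq_const |].
    apply is_lim_seq_div'; [apply u_lim | apply is_lim_seq_const | lra]. }
  apply is_lim_seq_mult'; assumption.
Qed.

Lemma cos_pow_lim l : is_lim_seq (fun m => cos (u m l) ^ (2 * m))
  (exp (- (PI * INR (S l) ^ 2 * (/ x) ^ 2))).
Proof.
assert (Cexp : forall z, continuity_pt (fun t => exp (- t)) z).
{ intros z; eapply continuity_pt_of_derive; auto_derive; [trivial | reflexivity]. }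
set (lam := PI * INR (S l) ^ 2 * (/ x) ^ 2).
assert (S0 : is_lim_seq (fun m => sin (u m l) ^ 2) 0).
{ apply (is_lim_seq_ext_loc (fun m => (INR m * sin (u m l) ^ 2) * / INR m)).
  - exists 1%nat; intros m Hm; assert (0 < INR m) by (apply lt_0_INR; lia); field; lra.
  - replace 0 with (lam * 0) by ring.
    apply is_lim_seq_mult'; [apply sin_sq_lim |].
    replace (Finite 0) with (Rbar_inv p_infty) by reflexivity.
    apply is_lim_seq_inv; [apply is_lim_seq_INR | discriminate]. }
assert (Hs := S0); apply is_lim_seq_spec in Hs.
destruct (Hs (mkposreal 1 ltac:(lra))) as [m0 Hm0]; simpl in Hm0.
apply (is_lim_seq_le_le_loc
  (fun m => exp (- (INR m * sin (u m l) ^ 2 / (1 - sin (u m l) ^ 2)))) _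
  (fun m => exp (- (INR m * sin (u m l) ^ 2)))).
- exists m0; intros m Hm; specialize (Hm0 m Hm); rewrite Rminus_0_r in Hm0; apply Rabs_def2 in Hm0.
  split; [apply cos_pow_lower; simpl in *; lra | apply cos_pow_upper].
- apply (is_lim_seq_continuous (fun t => exp (- t))); [apply Cexp |].
  replace lam with (lam / (1 - 0)) by (unfold Rdiv; rewrite Rminus_0_r, Rinv_1; ring).
  apply is_lim_seq_div'; [apply sin_sq_lim | | lra].
  apply is_lim_seq_minus'; [apply is_lim_seq_const | exact S0].
- apply (is_lim_seq_continuous (fun t => exp (- t))); [apply Cexp | apply sin_sq_lim].
Qed.

Lemma cos_sum_lim :
  is_lim_seq (fun m => Rsum (fun l => cos (u m l) ^ (2 * m)) (q m)) (omega (/ x)).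
Proof.
pose proof PI_RGT_0.
assert (Hx2 := pow_lt x 2 Hx).
(* The 9 comes from sin u >= u / 3, and 2 pi x^2 is an eventual upper bound for L^2 / m. *)
set (c := PI ^ 2 / (9 * (2 * PI * x ^ 2))).
assert (Hc : 0 < c) by (apply Rdiv_lt_0_compat; [apply pow_lt | ]; nra).
apply (tannery (fun m l => cos (u m l) ^ (2 * m)) q _ (fun n => exp (- (c * INR (S n))))).
- apply q_large.
- apply cos_pow_lim.
- pose proof L_sq_lim as HL; apply is_lim_seq_spec in HL.
  assert (Hpx : 0 < PI * x ^ 2) by nra.
  destruct (HL (mkposreal _ Hpx)) as [m0 Hm0]; simpl in Hm0.
  exists (max 1 m0); intros m l Hm Hl; specialize (Hm0 m ltac:(lia)); apply Rabs_def2 in Hm0.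
  rewrite Rabs_pos_eq by (rewrite pow_mult; apply pow_le, pow2_ge_0).
  eapply Rle_trans; [apply cos_pow_upper |].
  apply exp_le, Ropp_le_contravar.
  assert (Pm : 0 < INR m) by (apply lt_0_INR; lia).
  pose proof (L_ge_1 m); pose proof (INR_S_ge_1 l); pose proof (u_range m l Hl).
  apply (Rle_trans _ (INR m * (u m l / 3) ^ 2)).
  2:{ apply Rmult_le_compat_l; [lra |].
      apply pow_incr; pose proof (sin_u_lower m l Hl); lra. }
  replace (INR m * (u m l / 3) ^ 2) with (PI ^ 2 / (9 * (L m ^ 2 / INR m)) * INR (S l) ^ 2)
    by (unfold u; field; lra).
  assert (HQ : 0 < L m ^ 2 / INR m) by (apply Rdiv_lt_0_compat; [apply pow_lt; lra | lra]).
  apply Rmult_le_compat; try lra; [| apply INR_S_sq_ge].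
  unfold c; apply Rmult_le_compat_l; [apply pow2_ge_0 |].
  apply Rinv_le_contravar; lra.
- apply ex_series_exp_sq, Hc.
Qed.

Lemma finite_theta_lim :
  is_lim_seq (fun m => L m * cwalk m * (1 + 2 * Rsum (fun v => rwalk m ((2 * q m + 1) * S v)) (S m)))
    (1 + 2 * omega (/ x)).
Proof.
apply (is_lim_seq_ext (fun m => 1 + 2 * Rsum (fun l => cos (u m l) ^ (2 * m)) (q m))).
- intros m; apply finite_theta.
- apply is_lim_seq_plus'; [apply is_lim_seq_const |].
  apply is_lim_seq_mult'; [apply is_lim_seq_const | apply cos_sum_lim].
Qed.

Lemma walk_sum_lim :
  is_lim_seq (fun m => 1 + 2 * Rsum (fun v => rwalk m ((2 * q m + 1) * S v)) (S m))
    (1 + 2 * omega x).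
Proof.
apply is_lim_seq_plus'; [apply is_lim_seq_const |].
apply is_lim_seq_mult'; [apply is_lim_seq_const | apply rwalk_sum_lim].
Qed.

End ThetaLimit.

Lemma omega_ex_series x : 0 < x -> ex_series (fun n => exp (- (PI * INR (S n) ^ 2 * x ^ 2))).
Proof. intros Hx; apply (rwalk_sum_lim x Hx). Qed.

Lemma omega_nonneg x : 0 < x -> 0 <= omega x.
Proof.
intros Hx; eapply Rle_trans; [| apply (Rsum_le_Series _ 0)]; [simpl; lra | |].
- intros; apply Rlt_le, exp_pos.
- apply omega_ex_series, Hx.
Qed.

(* Comparing with [x = 1] avoids computing the limit of [sqrt m * cwalk m]. *)
Lemma theta_functional_equation x : 0 < x -> 1 + 2 * omega (/ x) = x * (1 + 2 * omega x).
Proof.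
intros Hx.
pose proof (finite_theta_lim x Hx) as A; pose proof (walk_sum_lim x Hx) as B.
pose proof (finite_theta_lim 1 Rlt_0_1) as A1; pose proof (walk_sum_lim 1 Rlt_0_1) as B1.
pose proof (L_ratio_lim x Hx) as R; pose proof (L_ratio_lim 1 Rlt_0_1) as R1.
cbv zeta in *.
set (L := fun m => INR (2 * nat_floor (sqrt (PI * INR m) * x / 2) + 1)) in *.
set (L1 := fun m => INR (2 * nat_floor (sqrt (PI * INR m) * 1 / 2) + 1)) in *.
set (W := fun m => 1 + 2 * Rsum (fun v => rwalk m ((2 * nat_floor (sqrt (PI * INR m) * x / 2) + 1) * S v)) (S m)) in *.
set (W1 := fun m => 1 + 2 * Rsum (fun v => rwalk m ((2 * nat_floor (sqrt (PI * INR m) * 1 / 2) + 1) * S v)) (S m)) in *.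
(* One product of L, L1, cwalk, W, W1 and 1 / sqrt m, grouped in two ways. The factor [cwalk m] is
   attached once to (L, W) and once to (L1, W1), so its asymptotics cancel. *)
assert (E1 : is_lim_seq (fun m => (L m * cwalk m * W m) * (L1 m / sqrt (INR m)) * W1 m)
  ((1 + 2 * omega (/ x)) * (sqrt PI * 1) * (1 + 2 * omega 1))).
{ apply is_lim_seq_mult'; [apply is_lim_seq_mult' |]; assumption. }
assert (E2 : is_lim_seq (fun m => (L1 m * cwalk m * W1 m) * (L m / sqrt (INR m)) * W m)
  ((1 + 2 * omega (/ 1)) * (sqrt PI * x) * (1 + 2 * omega x))).
{ apply is_lim_seq_mult'; [apply is_lim_seq_mult' |]; assumption. }
assert (E3 : is_lim_seq (fun m => (L m * cwalk m * W m) * (L1 m / sqrt (INR m)) * W1 m)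
  ((1 + 2 * omega (/ 1)) * (sqrt PI * x) * (1 + 2 * omega x))).
{ eapply is_lim_seq_ext; [| exact E2]; intros m; unfold Rdiv; ring. }
apply is_lim_seq_unique in E1; apply is_lim_seq_unique in E3; rewrite E1 in E3.
injection E3; rewrite Rinv_1; intros E.
pose proof (omega_nonneg 1 Rlt_0_1).
assert (0 < sqrt PI) by apply sqrt_lt_R0, PI_RGT_0.
apply (Rmult_eq_reg_l (sqrt PI * (1 + 2 * omega 1))); [lra |].
apply Rmult_integral_contrapositive_currified; lra.
Qed.

(** * Complex-valued integrals over the real line *)

Definition CI (f : R -> C) (a b : R) : C :=
  (RInt (fun t => Re (f t)) a b, RInt (fun t => Im (f t)) a b).

Definition Cc (f : R -> C) : Prop :=
  (forall t, continuous (fun t => Re (f t)) t) /\ (forall t, continuous (fun t => Im (f t)) t).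

Lemma ex_RInt_cont (f : R -> R) a b : (forall t, continuous f t) -> ex_RInt f a b.
Proof. intros H; apply (ex_RInt_continuous (V := R_CompleteNormedModule)); auto. Qed.

Lemma Cc_dC f df : (forall t, dC f t (df t)) -> Cc f.
Proof.
intros H; split; intros t; destruct (H t);
  apply (ex_derive_continuous (V := R_NormedModule)); eexists; eassumption.
Qed.

Lemma Cc_plus f g : Cc f -> Cc g -> Cc (fun t => f t + g t)%C.
Proof.
intros [F1 F2] [G1 G2]; split; intros t; simpl;
  apply (continuous_plus (V := R_NormedModule)); auto.
Qed.

Lemma continuous_Rmult (f g : R -> R) t :
  continuous f t -> continuous g t -> continuous (fun t => f t * g t) t.
Proof. apply (continuous_mult (K := R_AbsRing)). Qed.

Lemma Cc_mult f g : Cc f -> Cc g -> Cc (fun t => f t * g t)%C.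
Proof.
intros [F1 F2] [G1 G2]; split; intros t; simpl.
- exact (continuous_minus (V := R_NormedModule) _ _ _
    (continuous_Rmult _ _ t (F1 t) (G1 t)) (continuous_Rmult _ _ t (F2 t) (G2 t))).
- exact (continuous_plus (V := R_NormedModule) _ _ _
    (continuous_Rmult _ _ t (F1 t) (G2 t)) (continuous_Rmult _ _ t (F2 t) (G1 t))).
Qed.

Lemma Cc_const z : Cc (fun _ => z).
Proof. split; intros t; apply continuous_const. Qed.

Lemma Cc_scal z f : Cc f -> Cc (fun t => z * f t)%C.
Proof. intros H; apply Cc_mult; [apply Cc_const | exact H]. Qed.

Lemma Cc_ext f g : (forall t, f t = g t) -> Cc f -> Cc g.
Proof. intros H; replace g with f; [auto | apply functional_extensionality, H]. Qed.

Lemma CI_ext f g a b : (forall t, f t = g t) -> CI f a b = CI g a b.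
Proof. intros H; replace g with f; [auto | apply functional_extensionality, H]. Qed.

Lemma CI_plus f g a b : Cc f -> Cc g -> CI (fun t => f t + g t)%C a b = (CI f a b + CI g a b)%C.
Proof.
intros [F1 F2] [G1 G2]; apply injective_projections; simpl;
  apply (RInt_plus (V := R_CompleteNormedModule)); apply ex_RInt_cont; auto.
Qed.

Lemma CI_scal z f a b : Cc f -> CI (fun t => z * f t)%C a b = (z * CI f a b)%C.
Proof.
intros [F1 F2].
assert (S : forall c h, (forall t, continuous h t) -> ex_RInt (fun t => c * h t) a b).
{ intros c h Hh; apply (ex_RInt_scal (V := R_NormedModule)), ex_RInt_cont, Hh. }
assert (S2 : forall c h, (forall t, continuous h t) -> RInt (fun t => c * h t) a b = c * RInt h a b).
{ intros c h Hh; apply (RInt_scal (V := R_CompleteNormedModule)), ex_RInt_cont, Hh. }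
pose proof (S2 (fst z) _ F1) as Q1; pose proof (S2 (snd z) _ F2) as Q2.
pose proof (S2 (fst z) _ F2) as Q3; pose proof (S2 (snd z) _ F1) as Q4.
apply injective_projections; simpl.
- transitivity (RInt (fun t => fst z * Re (f t)) a b - RInt (fun t => snd z * Im (f t)) a b).
  + apply (RInt_minus (V := R_CompleteNormedModule)); apply S; assumption.
  + f_equal; assumption.
- transitivity (RInt (fun t => fst z * Im (f t)) a b + RInt (fun t => snd z * Re (f t)) a b).
  + apply (RInt_plus (V := R_CompleteNormedModule)); apply S; assumption.
  + f_equal; assumption.
Qed.

Lemma CI_Chasles f a b c : Cc f -> (CI f a b + CI f b c)%C = CI f a c.
Proof.
intros [F1 F2]; apply injective_projections; simpl;
  apply (RInt_Chasles (V := R_CompleteNormedModule)); apply ex_RInt_cont; auto.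
Qed.

(** If w is the integral, |w|^2 is the integral of Re (conj(w) f), which is at most |w| times the
    integral of g. This avoids the loss of a constant from treating real and imaginary parts
    apart. *)
Lemma CI_bound f g a b : a <= b -> Cc f -> (forall t, continuous g t) ->
  (forall t, a <= t <= b -> Cmod (f t) <= g t) -> Cmod (CI f a b) <= RInt g a b.
Proof.
intros Hab [F1 F2] Hg B.
set (w := CI f a b).
assert (I : forall c h, (forall t, continuous h t) -> ex_RInt (fun t => c * h t) a b).
{ intros c h Hh; apply (ex_RInt_scal (V := R_NormedModule)), ex_RInt_cont, Hh. }
assert (S2 : forall c h, (forall t, continuous h t) -> RInt (fun t => c * h t) a b = c * RInt h a b).
{ intros c h Hh; apply (RInt_scal (V := R_CompleteNormedModule)), ex_RInt_cont, Hh. }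
assert (E : Cmod w ^ 2 = RInt (fun t => Re w * Re (f t) + Im w * Im (f t)) a b).
{ rewrite (RInt_plus (V := R_CompleteNormedModule) (fun t => Re w * Re (f t)) (fun t => Im w * Im (f t)))
    by (apply I; assumption).
  rewrite (S2 (Re w)), (S2 (Im w)) by assumption.
  unfold Cmod; rewrite pow2_sqrt by nra; unfold w, CI, Re, Im, plus; simpl; ring. }
assert (L : Cmod w ^ 2 <= Cmod w * RInt g a b).
{ rewrite E, <- (S2 (Cmod w) g Hg).
  apply RInt_le; [exact Hab | | apply I, Hg |].
  - apply (ex_RInt_plus (V := R_NormedModule)); apply I; assumption.
  - intros t Ht; apply (Rle_trans _ (Cmod w * Cmod (f t))).
    + rewrite <- (Cmod_conj w), <- Cmod_mult.
      eapply Rle_trans; [| apply (Rle_trans _ _ _ (Rle_abs _) (re_le_Cmod _))].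
      unfold Cconj, Cmult, Re, Im; simpl; lra.
    + apply Rmult_le_compat_l; [apply Cmod_ge_0 | apply B; lra]. }
pose proof (Cmod_ge_0 w).
destruct (Req_dec (Cmod w) 0) as [Z | N].
- rewrite Z; apply RInt_ge_0; [exact Hab | apply ex_RInt_cont, Hg |].
  intros t Ht; eapply Rle_trans; [apply Cmod_ge_0 | apply B; lra].
- simpl in L; apply (Rmult_le_reg_l (Cmod w)); lra.
Qed.

Lemma CI_FTC F f a b : (forall t, dC F t (f t)) -> Cc f -> CI f a b = (F b - F a)%C.
Proof.
intros D [F1 F2]; apply injective_projections; simpl; apply is_RInt_unique.
- apply (is_RInt_derive (fun t => Re (F t)) (fun t => Re (f t))); intros; [apply D | apply F1].
- apply (is_RInt_derive (fun t => Im (F t)) (fun t => Im (f t))); intros; [apply D | apply F2].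
Qed.

Lemma RInt_shift (f : R -> R) h a b : (forall t, continuous f t) ->
  RInt (fun v => f (v + h)) a b = RInt f (a + h) (b + h).
Proof.
intros H; rewrite <- (Rmult_1_l a) at 2; rewrite <- (Rmult_1_l b) at 2.
rewrite <- (RInt_comp_lin (V := R_CompleteNormedModule) f 1 h) by (apply ex_RInt_cont, H).
apply RInt_ext; intros t _; unfold scal; simpl; unfold mult; simpl; rewrite !Rmult_1_l; reflexivity.
Qed.

Lemma CI_shift f h a b : Cc f -> CI (fun v => f (v + h)) a b = CI f (a + h) (b + h).
Proof.
intros [F1 F2]; apply injective_projections; simpl;
  [apply (RInt_shift (fun t => Re (f t))) | apply (RInt_shift (fun t => Im (f t)))]; assumption.
Qed.

Lemma RInt_reflect (f : R -> R) a : (forall t, continuous f t) ->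
  RInt (fun v => f (- v)) (- a) a = RInt f (- a) a.
Proof.
intros H.
assert (H2 : forall t, continuous (fun v => f (- v)) t).
{ intros t; apply (continuous_comp Ropp f); [| apply H].
  apply (ex_derive_continuous (V := R_NormedModule) Ropp); auto_derive; trivial. }
pose proof (ex_RInt_cont _ a (- a) H2) as I.
rewrite <- (opp_RInt_swap (V := R_CompleteNormedModule)) by exact I.
rewrite <- (RInt_opp (V := R_CompleteNormedModule)) by exact I.
pose proof (RInt_comp (V := R_CompleteNormedModule) f Ropp (fun _ => -1) a (- a)) as E.
rewrite Ropp_involutive in E; rewrite <- E.
- apply RInt_ext; intros t _; unfold opp, scal; simpl; unfold mult; simpl; ring.
- intros x _; apply H.
- intros x _; split; [auto_derive; [trivial | ring] | apply continuous_const].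
Qed.

Lemma CI_reflect f a : Cc f -> CI (fun v => f (- v)) (- a) a = CI f (- a) a.
Proof.
intros [F1 F2]; apply injective_projections; simpl;
  [apply (RInt_reflect (fun t => Re (f t))) | apply (RInt_reflect (fun t => Im (f t)))]; assumption.
Qed.

(** Both endpoints move independently, so that a translate of the integrand visibly has the same
    integral. *)
Definition conv (k : R -> C) (l : C) : Prop :=
  forall eps, 0 < eps -> exists Y, forall A B, A <= - Y -> Y <= B -> Cmod (CI k A B - l) < eps.

Lemma conv_ext k k' l : (forall t, k t = k' t) -> conv k l -> conv k' l.
Proof. intros H; replace k' with k; [auto | apply functional_extensionality, H]. Qed.

Lemma conv_plus k k' l l' : Cc k -> Cc k' -> conv k l -> conv k' l' ->
  conv (fun t => k t + k' t)%C (l + l')%C.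
Proof.
intros C1 C2 H1 H2 eps He.
destruct (H1 (eps / 2)) as [Y1 Q1]; [lra |]; destruct (H2 (eps / 2)) as [Y2 Q2]; [lra |].
exists (Rmax Y1 Y2); intros A B HA HB.
pose proof (Rmax_l Y1 Y2); pose proof (Rmax_r Y1 Y2).
rewrite CI_plus by assumption.
specialize (Q1 A B ltac:(lra) ltac:(lra)); specialize (Q2 A B ltac:(lra) ltac:(lra)).
replace (_ - _)%C with ((CI k A B - l) + (CI k' A B - l'))%C by ring.
eapply Rle_lt_trans; [apply Cmod_triangle | lra].
Qed.

Lemma conv_scal z k l : Cc k -> conv k l -> conv (fun t => z * k t)%C (z * l)%C.
Proof.
intros C1 H eps He; pose proof (Cmod_ge_0 z) as Hz.
destruct (H (eps / (Cmod z + 1))) as [Y Q]; [apply Rdiv_lt_0_compat; lra |].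
exists Y; intros A B HA HB; specialize (Q A B HA HB).
rewrite CI_scal by assumption.
replace (_ - _)%C with (z * (CI k A B - l))%C by ring; rewrite Cmod_mult.
apply (Rmult_lt_compat_r (Cmod z + 1)) in Q; [| lra].
unfold Rdiv in Q; rewrite Rmult_assoc, Rinv_l, Rmult_1_r in Q by lra.
pose proof (Cmod_ge_0 (CI k A B - l)); nra.
Qed.

Lemma conv_shift k l h : Cc k -> conv k l -> conv (fun t => k (t + h)) l.
Proof.
intros C1 H eps He; destruct (H eps He) as [Y Q].
exists (Y + Rabs h); intros A B HA HB.
pose proof (Rle_abs h); pose proof (Rle_abs (- h)) as H1; rewrite Rabs_Ropp in H1.
rewrite CI_shift by assumption; apply Q; lra.
Qed.

Lemma conv_bound k l m : conv k l ->
  (exists Y0, forall Y, Y0 <= Y -> Cmod (CI k (- Y) Y) <= m) -> Cmod l <= m.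
Proof.
intros H [Y0 B]; apply le_epsilon; intros eps He.
destruct (H eps He) as [Y Q].
set (Z := Rmax Y Y0); pose proof (Rmax_l Y Y0); pose proof (Rmax_r Y Y0).
specialize (Q (- Z) Z ltac:(unfold Z; lra) ltac:(unfold Z; lra)); specialize (B Z ltac:(unfold Z; lra)).
replace l with (CI k (- Z) Z - (CI k (- Z) Z - l))%C by ring.
eapply Rle_trans; [apply Cmod_triangle |]; rewrite Cmod_opp; lra.
Qed.

Lemma conv_unique k l l' : conv k l -> conv k l' -> l = l'.
Proof.
intros H1 H2; apply (proj2 (Ceq_minus l l')), Cmod_eq_0.
apply Rle_antisym; [| apply Cmod_ge_0].
apply le_epsilon; intros eps He.
destruct (H1 (eps / 2)) as [Y1 Q1]; [lra |]; destruct (H2 (eps / 2)) as [Y2 Q2]; [lra |].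
set (Z := Rmax Y1 Y2); pose proof (Rmax_l Y1 Y2); pose proof (Rmax_r Y1 Y2).
specialize (Q1 (- Z) Z ltac:(unfold Z; lra) ltac:(unfold Z; lra)).
specialize (Q2 (- Z) Z ltac:(unfold Z; lra) ltac:(unfold Z; lra)).
replace (l - l')%C with ((CI k (- Z) Z - l') - (CI k (- Z) Z - l))%C by ring.
eapply Rle_trans; [apply Cmod_triangle |]; rewrite Cmod_opp; lra.
Qed.

Lemma conv_Re_nonneg k l : conv k l -> (forall t, continuous (fun t => Re (k t)) t) ->
  (forall t, 0 <= Re (k t)) -> 0 <= Re l.
Proof.
intros H C1 P; apply Ropp_le_cancel; rewrite Ropp_0; apply le_epsilon; intros eps He.
destruct (H eps He) as [Y Q].
set (Z := Rmax Y 0); pose proof (Rmax_l Y 0); pose proof (Rmax_r Y 0).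
specialize (Q (- Z) Z ltac:(unfold Z; lra) ltac:(unfold Z; lra)).
assert (0 <= RInt (fun t => Re (k t)) (- Z) Z).
{ apply RInt_ge_0; [unfold Z; lra | apply ex_RInt_cont, C1 | auto]. }
pose proof (Rle_trans _ _ _ (Rle_abs _) (re_le_Cmod (CI k (- Z) Z - l))) as R0.
unfold Re in R0; simpl in R0; unfold Re in *; lra.
Qed.

Lemma conv_derivative F f : (forall t, dC F t (f t)) -> Cc f ->
  (forall eps, 0 < eps -> exists Y, forall t, (t <= - Y \/ Y <= t) -> Cmod (F t) < eps) -> conv f 0.
Proof.
intros D C1 H eps He; destruct (H (eps / 2)) as [Y Q]; [lra |].
exists Y; intros A B HA HB; rewrite (CI_FTC F f) by assumption.
pose proof (Q A ltac:(lra)); pose proof (Q B ltac:(lra)).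
replace (F B - F A - 0)%C with (F B - F A)%C by ring.
eapply Rle_lt_trans; [apply Cmod_triangle |]; rewrite Cmod_opp; lra.
Qed.

Lemma exp_decay_small C0 c eps : 0 < c -> 0 < eps -> exists Y, 0 <= Y /\
  forall y, Y <= y -> C0 * exp (- (c * y)) < eps.
Proof.
intros Hc He; exists ((Rabs C0 + 1) / (c * eps)).
pose proof (Rabs_pos C0); pose proof (Rle_abs C0).
assert (H2 : 0 < (Rabs C0 + 1) / (c * eps)) by (apply Rdiv_lt_0_compat; nra).
split; [lra |]; intros y Hy.
rewrite exp_Ropp.
assert (H3 : c * y < exp (c * y)).
{ pose proof (exp_ineq1 (c * y)); assert (c * y <> 0) by nra; lra. }
apply (Rmult_lt_reg_r (exp (c * y))); [apply exp_pos |].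
rewrite Rmult_assoc, Rinv_l, Rmult_1_r by (apply Rgt_not_eq, exp_pos).
assert (H4 : (Rabs C0 + 1) / (c * eps) * (c * eps) <= y * (c * eps)).
{ apply Rmult_le_compat_r; nra. }
unfold Rdiv in H4; rewrite Rmult_assoc, Rinv_l, Rmult_1_r in H4 by nra.
nra.
Qed.

Section Decay.

Variables (k : R -> C) (C0 c : R).
Hypothesis Hk : Cc k.
Hypothesis Hc : 0 < c.
Hypothesis HC0 : 0 <= C0.
Hypothesis Hdec : forall v, Cmod (k v) <= C0 * exp (- (c * Rabs v)).

Lemma decay_tail Y A B : 0 <= Y -> A <= - Y -> Y <= B ->
  Cmod (CI k A B - CI k (- Y) Y) <= 2 * C0 / c * exp (- (c * Y)).
Proof.
intros HY HA HB.
rewrite <- (CI_Chasles k A (- Y) B), <- (CI_Chasles k (- Y) Y B) by exact Hk.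
replace (_ - _)%C with (CI k A (- Y) + CI k Y B)%C by ring.
eapply Rle_trans; [apply Cmod_triangle |].
assert (T1 : Cmod (CI k Y B) <= C0 / c * exp (- (c * Y))).
{ apply (Rle_trans _ (RInt (fun v => C0 * exp (- (c * v))) Y B)).
  - apply CI_bound; [lra | exact Hk | |].
    + intros t; apply (ex_derive_continuous (V := R_NormedModule)); auto_derive; trivial.
    + intros t Ht; specialize (Hdec t); rewrite Rabs_pos_eq in Hdec by lra; exact Hdec.
  - rewrite (RInt_FTC (fun v => - (C0 / c) * exp (- (c * v)))).
    + pose proof (exp_pos (- (c * B))).
      assert (0 <= C0 / c) by (apply Rmult_le_pos; [lra | apply Rlt_le, Rinv_0_lt_compat, Hc]); nra.
    + lra.
    + intros t _; auto_derive; [trivial | field; lra].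
    + intros t _; apply (ex_derive_continuous (V := R_NormedModule)); auto_derive; trivial. }
assert (T2 : Cmod (CI k A (- Y)) <= C0 / c * exp (- (c * Y))).
{ apply (Rle_trans _ (RInt (fun v => C0 * exp (c * v)) A (- Y))).
  - apply CI_bound; [lra | exact Hk | |].
    + intros t; apply (ex_derive_continuous (V := R_NormedModule)); auto_derive; trivial.
    + intros t Ht; specialize (Hdec t); rewrite Rabs_left1 in Hdec by lra.
      eapply Rle_trans; [exact Hdec |]; apply Req_le; f_equal; f_equal; ring.
  - rewrite (RInt_FTC (fun v => (C0 / c) * exp (c * v))).
    + pose proof (exp_pos (c * A)).
      replace (c * - Y) with (- (c * Y)) by ring.
      assert (0 <= C0 / c) by (apply Rmult_le_pos; [lra | apply Rlt_le, Rinv_0_lt_compat, Hc]); nra.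
    + lra.
    + intros t _; auto_derive; [trivial | field; lra].
    + intros t _; apply (ex_derive_continuous (V := R_NormedModule)); auto_derive; trivial. }
lra.
Qed.

Lemma conv_exists : exists l, conv k l.
Proof.
assert (Cau : forall (p : C -> R), (forall z w, Rabs (p z - p w) <= Cmod (z - w)) ->
  ex_finite_lim_seq (fun n => p (CI k (- INR n) (INR n)))).
{ intros p Hp; apply ex_lim_seq_cauchy_corr; intros eps.
  assert (He : 0 < eps / 2) by (destruct eps; simpl; lra).
  destruct (exp_decay_small (2 * C0 / c) c (eps / 2) Hc He) as [Y [HY Q]].
  destruct (INR_unbounded Y) as [N HN].
  exists N; intros n m Hn Hm; apply le_INR in Hn; apply le_INR in Hm.
  eapply Rle_lt_trans; [apply Hp |].
  replace (_ - _)%C with ((CI k (- INR n) (INR n) - CI k (- INR N) (INR N))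
    - (CI k (- INR m) (INR m) - CI k (- INR N) (INR N)))%C by ring.
  eapply Rle_lt_trans; [apply Cmod_triangle |]; rewrite Cmod_opp.
  specialize (Q (INR N) ltac:(lra)).
  pose proof (decay_tail (INR N) (- INR n) (INR n) (pos_INR N) ltac:(lra) ltac:(lra)).
  pose proof (decay_tail (INR N) (- INR m) (INR m) (pos_INR N) ltac:(lra) ltac:(lra)); lra. }
destruct (Cau Re) as [l1 L1]; [intros z w; apply (re_le_Cmod (z - w)) |].
destruct (Cau Im) as [l2 L2]; [intros z w; apply (im_le_Cmod (z - w)) |].
exists (l1, l2); intros eps He.
destruct (exp_decay_small (2 * C0 / c) c (eps / 4) Hc ltac:(lra)) as [Y [HY Q]].
apply is_lim_seq_spec in L1; apply is_lim_seq_spec in L2.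
assert (He4 : 0 < eps / 4) by lra.
destruct (L1 (mkposreal _ He4)) as [N1 H1]; destruct (L2 (mkposreal _ He4)) as [N2 H2].
simpl in H1, H2.
destruct (INR_unbounded Y) as [N3 H3].
set (N := max N1 (max N2 N3)).
specialize (H1 N ltac:(lia)); specialize (H2 N ltac:(lia)).
assert (HN : INR N3 <= INR N) by (apply le_INR; lia).
exists (INR N); intros A B HA HB.
pose proof (decay_tail (INR N) A B (pos_INR N) HA HB) as T; specialize (Q (INR N) ltac:(lra)).
replace (CI k A B - (l1, l2))%C with
  ((CI k A B - CI k (- INR N) (INR N)) + (CI k (- INR N) (INR N) - (l1, l2)))%C by ring.
eapply Rle_lt_trans; [apply Cmod_triangle |].
pose proof (Cmod_le_sum (CI k (- INR N) (INR N) - (l1, l2))) as S.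
change (Re (CI k (- INR N) (INR N) - (l1, l2))) with
  (RInt (fun t => Re (k t)) (- INR N) (INR N) - l1) in S.
change (Im (CI k (- INR N) (INR N) - (l1, l2))) with
  (RInt (fun t => Im (k t)) (- INR N) (INR N) - l2) in S.
lra.
Qed.

End Decay.

(** * The Mellin transform of the Gaussian *)

(** The substitution u = e^v in the integral of exp(- pi u^2) u^(x-1) du. On the whole line
    dilations of u become translations and u -> 1/u becomes v -> -v. *)
Definition kr (x v : R) : R := exp (- (PI * exp (2 * v)) + x * v).

Definition ker (s : C) (v : R) : C := (RtoC (exp (- (PI * exp (2 * v)))) * Cexp (s * v))%C.

(* [gam s = (1/2) pi^(-s/2) Gamma(s/2)] *)
Definition gam (s : C) : C :=
  (real (Lim_seq (fun n => Re (CI (ker s) (- INR n) (INR n)))),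
   real (Lim_seq (fun n => Im (CI (ker s) (- INR n) (INR n))))).

Lemma Cmod_ker s v : Cmod (ker s v) = kr (Re s) v.
Proof.
unfold ker, kr; rewrite Cmod_mult, Cmod_R, Cmod_Cexp, Rabs_pos_eq by (apply Rlt_le, exp_pos).
rewrite exp_plus; f_equal; f_equal; unfold Re; simpl; ring.
Qed.

Lemma Cexp_R x : Cexp (RtoC x) = RtoC (exp x).
Proof. apply injective_projections; unfold Cexp; simpl; rewrite ?cos_0, ?sin_0; ring. Qed.

Lemma ker_real x v : ker (RtoC x) v = RtoC (kr x v).
Proof.
unfold ker, kr; rewrite exp_plus, <- RtoC_mult, Cexp_R, <- RtoC_mult; reflexivity.
Qed.

Lemma dC_ker s v : dC (ker s) v (s * ker s v - 2 * PI * ker (s + 2) v)%C.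
Proof.
eapply dC_eq.
- apply dC_mult.
  + apply dC_RtoC; auto_derive; [trivial | reflexivity].
  + apply dC_Cexp, dC_mult; [apply dC_const | apply dC_id].
- unfold ker; cbv beta.
  replace ((s + 2) * v)%C with (s * v + RtoC (2 * v))%C by (rewrite RtoC_mult; ring).
  rewrite Cexp_plus, Cexp_R.
  rewrite !RtoC_mult, RtoC_opp, !RtoC_mult; ring.
Qed.

Lemma Cc_ker s : Cc (ker s).
Proof. eapply Cc_dC; intros; apply dC_ker. Qed.

Lemma kr_cont x t : continuous (kr x) t.
Proof. apply (ex_derive_continuous (V := R_NormedModule)); unfold kr; auto_derive; trivial. Qed.

Lemma kr_pos x v : 0 < kr x v.
Proof. apply exp_pos. Qed.

Lemma kr_decay x v : 0 < x -> kr x v <= exp ((x + 1) ^ 2 / 4) * exp (- (Rmin x 1 * Rabs v)).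
Proof.
intros Hx; unfold kr; rewrite <- exp_plus; apply exp_le.
pose proof PI2_1; pose proof (Rmin_l x 1); pose proof (Rmin_r x 1); pose proof (exp_pos (2 * v)).
pose proof (pow2_ge_0 (x + 1)).
destruct (Rle_lt_dec 0 v) as [Hv | Hv].
- rewrite Rabs_pos_eq by exact Hv.
  assert (E : v ^ 2 <= exp (2 * v)).
  { replace (2 * v) with (v + v) by ring; rewrite exp_plus.
    pose proof (exp_ineq1_le v); simpl; nra. }
  pose proof (pow2_ge_0 (2 * v - (x + 1))); nra.
- rewrite Rabs_left by exact Hv; nra.
Qed.

Lemma ker_decay s v : 0 < Re s ->
  Cmod (ker s v) <= exp ((Re s + 1) ^ 2 / 4) * exp (- (Rmin (Re s) 1 * Rabs v)).
Proof. intros H; rewrite Cmod_ker; apply kr_decay, H. Qed.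

Lemma conv_ker s : 0 < Re s -> conv (ker s) (gam s).
Proof.
intros Hs.
destruct (conv_exists (ker s) _ (Rmin (Re s) 1) (Cc_ker s) ltac:(apply Rmin_pos; lra)
  (Rlt_le _ _ (exp_pos _)) (fun v => ker_decay s v Hs)) as [l Hl].
assert (G : forall (p : C -> R), (forall z w, Rabs (p z - p w) <= Cmod (z - w)) ->
  is_lim_seq (fun n => p (CI (ker s) (- INR n) (INR n))) (p l)).
{ intros p Hp; apply is_lim_seq_spec; intros eps.
  destruct (Hl eps (cond_pos eps)) as [Y Q]; destruct (INR_unbounded Y) as [N HN].
  exists N; intros n Hn; apply le_INR in Hn.
  eapply Rle_lt_trans; [apply Hp | apply Q; lra]. }
pose proof (G Re (fun z w => re_le_Cmod (z - w))) as L1.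
pose proof (G Im (fun z w => im_le_Cmod (z - w))) as L2.
apply is_lim_seq_unique in L1; apply is_lim_seq_unique in L2.
replace (gam s) with l; [exact Hl |].
unfold gam; rewrite L1, L2; apply injective_projections; reflexivity.
Qed.

Lemma conv_axpy z k l k' l' : Cc k -> Cc k' -> conv k l -> conv k' l' ->
  Cc (fun v => k v + z * k' v)%C /\ conv (fun v => k v + z * k' v)%C (l + z * l')%C.
Proof.
intros C1 C2 H1 H2; split.
- exact (Cc_plus k _ C1 (Cc_scal z k' C2)).
- exact (conv_plus k _ l _ C1 (Cc_scal z k' C2) H1 (conv_scal z k' l' C2 H2)).
Qed.

(** The derivative of [ker s] is s [ker s] - 2 pi [ker (s + 2)], and its integral vanishes because
    [ker s] decays at both ends. *)
Lemma gam_rec s : 0 < Re s -> (s * gam s = 2 * PI * gam (s + 2))%C.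
Proof.
intros Hs.
assert (Hs2 : 0 < Re (s + 2)%C) by (unfold Re in *; simpl; lra).
destruct (conv_axpy (- (2 * PI))%C _ _ _ _ (Cc_scal s _ (Cc_ker s)) (Cc_ker (s + 2)%C)
  (conv_scal s _ _ (Cc_ker s) (conv_ker s Hs)) (conv_ker (s + 2)%C Hs2)) as [C1 H1].
assert (H2 : conv (fun v => s * ker s v + (- (2 * PI)) * ker (s + 2) v)%C 0).
{ apply (conv_derivative (ker s)).
  - intros t; eapply dC_eq; [apply dC_ker | ring].
  - exact C1.
  - intros eps He.
    destruct (exp_decay_small (exp ((Re s + 1) ^ 2 / 4)) (Rmin (Re s) 1) eps) as [Y [HY Q]];
      [apply Rmin_pos; lra | exact He |].
    exists Y; intros t Ht; eapply Rle_lt_trans; [apply ker_decay, Hs | apply Q].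
    destruct Ht; [rewrite Rabs_left1 | rewrite Rabs_pos_eq]; lra. }
pose proof (conv_unique _ _ _ H1 H2) as E.
apply (proj2 (Ceq_minus _ _)); rewrite <- E; ring.
Qed.

Definition gr (x : R) : R := Re (gam (RtoC x)).

Lemma conv_kr x : 0 < x -> conv (fun v => RtoC (kr x v)) (gam (RtoC x)).
Proof.
intros Hx; eapply conv_ext; [intros t; apply ker_real |]; apply conv_ker; exact Hx.
Qed.

Lemma kr_int_le x A B : 0 < x -> A <= B -> RInt (kr x) A B <= gr x.
Proof.
intros Hx HAB; apply le_epsilon; intros eps He.
destruct (conv_kr x Hx eps He) as [Y Q].
set (Z := Rmax Y (Rmax (- A) B)).
pose proof (Rmax_l Y (Rmax (- A) B)); pose proof (Rmax_r Y (Rmax (- A) B)).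
pose proof (Rmax_l (- A) B); pose proof (Rmax_r (- A) B).
specialize (Q (- Z) Z ltac:(unfold Z; lra) ltac:(unfold Z; lra)).
assert (I : forall a b, ex_RInt (kr x) a b) by (intros; apply ex_RInt_cont, kr_cont).
assert (P : forall a b, a <= b -> 0 <= RInt (kr x) a b).
{ intros a b Hab; apply RInt_ge_0; auto; intros; apply Rlt_le, kr_pos. }
assert (RInt (kr x) A B <= RInt (kr x) (- Z) Z).
{ rewrite <- (RInt_Chasles (V := R_CompleteNormedModule) (kr x) (- Z) A Z) by auto.
  rewrite <- (RInt_Chasles (V := R_CompleteNormedModule) (kr x) A B Z) by auto.
  pose proof (P (- Z) A ltac:(unfold Z; lra)); pose proof (P B Z ltac:(unfold Z; lra)).
  unfold plus; simpl; lra. }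
pose proof (Rle_trans _ _ _ (Rle_abs _) (re_le_Cmod (CI (fun v => RtoC (kr x v)) (- Z) Z - gam (RtoC x)))) as R0.
change (Re (CI (fun v => RtoC (kr x v)) (- Z) Z - gam (RtoC x)))
  with (RInt (kr x) (- Z) Z - gr x) in R0.
lra.
Qed.

Lemma gr_pos x : 0 < x -> 0 < gr x.
Proof.
intros Hx; eapply Rlt_le_trans; [| apply (kr_int_le x 0 1 Hx); lra].
apply RInt_gt_0; [lra | intros; apply kr_pos | intros; apply kr_cont].
Qed.

Lemma Cmod_gam_le s : 0 < Re s -> Cmod (gam s) <= gr (Re s).
Proof.
intros Hs; apply (conv_bound (ker s)); [apply conv_ker, Hs |].
exists 0; intros Y HY; eapply Rle_trans; [| apply (kr_int_le _ (- Y) Y Hs); lra].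
apply CI_bound; [lra | apply Cc_ker | apply kr_cont | intros; rewrite Cmod_ker; lra].
Qed.

Lemma gr_rec x : 0 < x -> x * gr x = 2 * PI * gr (x + 2).
Proof.
intros Hx; pose proof (gam_rec (RtoC x) Hx) as E.
apply (f_equal Re) in E; rewrite <- RtoC_plus in E.
unfold gr; unfold Re in *; simpl in *; lra.
Qed.

Lemma gam_conj s : 0 < Re s -> gam (Cconj s) = Cconj (gam s).
Proof.
intros Hs; apply (conv_unique (ker (Cconj s))); [apply conv_ker; exact Hs |].
assert (E : forall v, ker (Cconj s) v = Cconj (ker s v)).
{ intros v; unfold ker, Cexp, Cconj; apply injective_projections; simpl.
  - replace (fst s * 0 + - snd s * v) with (- (fst s * 0 + snd s * v)) by ring.
    replace (fst s * v - - snd s * 0) with (fst s * v - snd s * 0) by ring.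
    rewrite cos_neg; ring.
  - replace (fst s * 0 + - snd s * v) with (- (fst s * 0 + snd s * v)) by ring.
    replace (fst s * v - - snd s * 0) with (fst s * v - snd s * 0) by ring.
    rewrite sin_neg; ring. }
intros eps He; destruct (conv_ker s Hs eps He) as [Y Q]; exists Y; intros A B HA HB.
rewrite (CI_ext _ _ _ _ E).
assert (E2 : CI (fun v => Cconj (ker s v)) A B = Cconj (CI (ker s) A B)).
{ apply injective_projections; [reflexivity |]; simpl.
  apply (RInt_opp (V := R_CompleteNormedModule)), ex_RInt_cont, Cc_ker. }
replace (CI (fun v => Cconj (ker s v)) A B - Cconj (gam s))%C
  with (Cconj (CI (ker s) A B - gam s)).
- rewrite Cmod_conj; apply Q; assumption.
- rewrite E2; apply injective_projections; unfold Cconj; simpl; ring.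
Qed.

Lemma cos_lower y : 1 - y ^ 2 / 2 <= cos y.
Proof.
assert (S : forall z, sin z ^ 2 <= z ^ 2).
{ assert (P : forall z, 0 <= z -> sin z ^ 2 <= z ^ 2).
  { intros z Hz; destruct (Rle_lt_dec z 1) as [H1 | H1].
    - destruct (Req_dec z 0) as [-> | N]; [rewrite sin_0; lra |].
      pose proof (sin_lt_x z ltac:(lra)); pose proof PI2_1.
      pose proof (sin_ge_0 z Hz ltac:(lra)); apply pow_incr; lra.
    - pose proof (SIN_bound z); simpl; nra. }
  intros z; destruct (Rle_lt_dec 0 z) as [Hz | Hz]; [apply P, Hz |].
  specialize (P (- z) ltac:(lra)); rewrite sin_neg in P.
  replace ((- sin z) ^ 2) with (sin z ^ 2) in P by ring.
  replace ((- z) ^ 2) with (z ^ 2) in P by ring; exact P. }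
replace y with (2 * (y / 2)) at 2 by field.
rewrite cos_2a_sin; specialize (S (y / 2)); simpl in *; nra.
Qed.

Lemma sq_le_exp y : 4 * y ^ 2 <= exp (2 * y) - 2 + exp (- (2 * y)).
Proof.
assert (P : forall z, 0 <= z -> 2 * z <= exp z - exp (- z)).
{ intros z Hz; destruct (Req_dec z 0) as [-> | N]; [rewrite Ropp_0, exp_0; lra |].
  destruct (MVT_gen (fun z => exp z - exp (- z) - 2 * z) 0 z
    (fun z => exp z + exp (- z) - 2)) as [c [_ E]].
  - intros t _; auto_derive; [trivial | ring].
  - intros t _; eapply continuity_pt_of_derive; auto_derive; [trivial | reflexivity].
  - rewrite Ropp_0, exp_0, Rmult_0_r in E.
    assert (1 = exp c * exp (- c)) by (rewrite <- exp_plus, Rplus_opp_r, exp_0; reflexivity).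
    pose proof (exp_pos c); pose proof (exp_pos (- c)).
    assert (0 <= (exp c - 1) ^ 2 * exp (- c)) by (apply Rmult_le_pos; [apply pow2_ge_0 | lra]).
    assert (0 <= exp c + exp (- c) - 2) by (simpl in *; nra).
    assert (0 <= (exp c + exp (- c) - 2) * (z - 0)) by (apply Rmult_le_pos; lra); lra. }
replace (exp (2 * y) - 2 + exp (- (2 * y))) with ((exp y - exp (- y)) ^ 2).
2:{ replace (2 * y) with (y + y) by ring; rewrite Ropp_plus_distr, !exp_plus.
    assert (exp y * exp (- y) = 1) by (rewrite <- exp_plus, Rplus_opp_r, exp_0; reflexivity).
    simpl; nra. }
destruct (Rle_lt_dec 0 y) as [Hy | Hy].
- specialize (P y Hy); simpl; nra.
- specialize (P (- y) ltac:(lra)); rewrite Ropp_involutive in P; simpl; nra.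
Qed.

Lemma kr_shift x h v : kr (x + h) v = kr x v * exp (h * v).
Proof. unfold kr; rewrite <- exp_plus; f_equal; ring. Qed.

Lemma Cc_kr x : Cc (fun v => RtoC (kr x v)).
Proof. eapply Cc_ext; [intros v; apply ker_real | apply Cc_ker]. Qed.

(* With [A^2 = (x-2)/(2 pi)] the density [kr x] concentrates near [v = ln A]. *)
Lemma gam_lower x t : 2 < x -> gr x * (1 - t ^ 2 / (4 * (x - 2))) <= Cmod (gam (x, t)).
Proof.
intros Hx; pose proof PI_RGT_0 as HPI.
set (A := (x - 2) / (2 * PI)).
assert (HA : 0 < A) by (apply Rdiv_lt_0_compat; lra).
set (lA := ln A / 2).
assert (EA : exp (2 * lA) = A) by (unfold lA; replace (2 * (ln A / 2)) with (ln A) by field; apply exp_ln, HA).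
set (w := Cexp (0, - (t * lA))).
assert (Hw : Cmod w = 1) by (unfold w; rewrite Cmod_Cexp; simpl; apply exp_0).
(* With y = v - ln A / 2, the real part of [p] is [kr x v] times cos(t y) - 1 - t^2/4 + (t^2/8)
   (e^(2y) + e^(-2y)). It is nonnegative by cos z >= 1 - z^2/2 and 4 y^2 <= e^(2y) - 2 + e^(-2y).
   The moments at x + 2 and x - 2 are reduced to [gr x] by the recurrence. *)
set (p := fun v => (w * ker (x, t) v + (- RtoC (1 + t ^ 2 / 4)) * RtoC (kr x v)
  + RtoC (t ^ 2 / 8 / A) * RtoC (kr (x + 2) v) + RtoC (t ^ 2 / 8 * A) * RtoC (kr (x - 2) v))%C).
assert (Cp : Cc p /\ conv p (w * gam (x, t) + (- RtoC (1 + t ^ 2 / 4)) * gam (RtoC x)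
  + RtoC (t ^ 2 / 8 / A) * gam (RtoC (x + 2)) + RtoC (t ^ 2 / 8 * A) * gam (RtoC (x - 2)))%C).
{ destruct (conv_axpy (- RtoC (1 + t ^ 2 / 4))%C _ _ _ _ (Cc_scal w _ (Cc_ker (x, t))) (Cc_kr x)
    (conv_scal w _ _ (Cc_ker (x, t)) (conv_ker (x, t) ltac:(simpl; lra)))
    (conv_kr x ltac:(lra))) as [A1 A2].
  destruct (conv_axpy (RtoC (t ^ 2 / 8 / A)) _ _ _ _ A1 (Cc_kr (x + 2)) A2
    (conv_kr (x + 2) ltac:(lra))) as [A3 A4].
  exact (conv_axpy (RtoC (t ^ 2 / 8 * A)) _ _ _ _ A3 (Cc_kr (x - 2)) A4
    (conv_kr (x - 2) ltac:(lra))). }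
destruct Cp as [Cp H].
apply conv_Re_nonneg in H; [| apply Cp |].
- assert (R1 : Re (w * gam (x, t))%C <= Cmod (gam (x, t))).
  { eapply Rle_trans; [apply Rle_abs |]; eapply Rle_trans; [apply re_le_Cmod |].
    rewrite Cmod_mult, Hw; lra. }
  assert (G1 := gr_rec x ltac:(lra)); assert (G2 := gr_rec (x - 2) ltac:(lra)).
  replace (x - 2 + 2) with x in G2 by ring.
  assert (E1 : gr (x + 2) / A = x / (x - 2) * gr x).
  { unfold A; replace (gr (x + 2)) with (x * gr x / (2 * PI)) by (rewrite G1; field; lra); field; lra. }
  assert (E2 : gr (x - 2) * A = gr x).
  { unfold A; replace (gr (x - 2)) with (2 * PI * gr x / (x - 2)) by (rewrite <- G2; field; lra); field; lra. }
  assert (H' : 0 <= Re (w * gam (x, t))%C - (1 + t ^ 2 / 4) * gr x + t ^ 2 / 8 / A * gr (x + 2)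
     + t ^ 2 / 8 * A * gr (x - 2)).
  { unfold gr, Re in *; simpl in *; lra. }
  replace (t ^ 2 / 8 / A * gr (x + 2)) with (t ^ 2 / 8 * (gr (x + 2) / A)) in H' by (field; lra).
  replace (t ^ 2 / 8 * A * gr (x - 2)) with (t ^ 2 / 8 * (gr (x - 2) * A)) in H' by ring.
  rewrite E1, E2 in H'.
  replace (gr x * (1 - t ^ 2 / (4 * (x - 2)))) with
    ((1 + t ^ 2 / 4) * gr x - t ^ 2 / 8 * (x / (x - 2) * gr x) - t ^ 2 / 8 * gr x) by (field; lra).
  lra.
- intros v.
  replace (Re (p v)) with (kr x v * (cos (t * (v - lA)) - (1 + t ^ 2 / 4)
    + t ^ 2 / 8 * (exp (2 * (v - lA)) + exp (- (2 * (v - lA)))))).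
  + apply Rmult_le_pos; [apply Rlt_le, kr_pos |].
    pose proof (cos_lower (t * (v - lA))); pose proof (sq_le_exp (v - lA)).
    pose proof (pow2_ge_0 t).
    replace ((t * (v - lA)) ^ 2) with (t ^ 2 * (v - lA) ^ 2) in * by ring.
    nra.
  + unfold p; rewrite (kr_shift x 2), (kr_shift x (- (2)) v : kr (x - 2) v = _).
    replace (exp (2 * (v - lA))) with (exp (2 * v) / A).
    2:{ rewrite <- EA; unfold Rdiv; rewrite <- exp_Ropp, <- exp_plus; f_equal; ring. }
    replace (exp (- (2 * (v - lA)))) with (exp (- (2) * v) * A).
    2:{ rewrite <- EA, <- exp_plus; f_equal; ring. }
    assert (Ew : Re (w * ker (x, t) v)%C = kr x v * cos (t * (v - lA))).
    { unfold w, ker, kr; rewrite exp_plus, Cmult_assoc, (Cmult_comm (Cexp _)), <- Cmult_assoc, <- Cexp_plus.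
      unfold Cexp, Re; simpl.
      replace (0 + (x * v - t * 0)) with (x * v) by ring.
      replace (- (t * lA) + (x * 0 + t * v)) with (t * (v - lA)) by ring; ring. }
    unfold Re in *; simpl in *; rewrite Ew; field; lra.
Qed.

(** A Stirling-type lower bound for a ratio of gamma values. The inequality e^(dy) - (1 + d/2) +
    (d/2) e^(-2y) >= 0 with y = v - ln(A) / 2 is integrated against [kr x]; the recurrence makes the
    moment at x - 2 equal to [gr x / A]. *)
Lemma gr_ratio x d : 2 < x -> 0 <= d ->
  exp (d / 2 * ln ((x - 2) / (2 * PI))) * gr x <= gr (x + d).
Proof.
intros Hx Hd; pose proof PI_RGT_0 as HPI.
set (A := (x - 2) / (2 * PI)).
assert (HA : 0 < A) by (apply Rdiv_lt_0_compat; lra).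
set (Ad := exp (d / 2 * ln A)).
set (p := fun v => (RtoC (kr (x + d) v) + (- RtoC (Ad * (1 + d / 2))) * RtoC (kr x v)
  + RtoC (Ad * (d / 2) * A) * RtoC (kr (x - 2) v))%C).
assert (Cp : Cc p /\ conv p (gam (RtoC (x + d)) + (- RtoC (Ad * (1 + d / 2))) * gam (RtoC x)
  + RtoC (Ad * (d / 2) * A) * gam (RtoC (x - 2)))%C).
{ destruct (conv_axpy (- RtoC (Ad * (1 + d / 2)))%C _ _ _ _ (Cc_kr (x + d)) (Cc_kr x)
    (conv_kr (x + d) ltac:(lra)) (conv_kr x ltac:(lra))) as [A1 A2].
  exact (conv_axpy (RtoC (Ad * (d / 2) * A)) _ _ _ _ A1 (Cc_kr (x - 2)) A2
    (conv_kr (x - 2) ltac:(lra))). }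
destruct Cp as [Cp H].
apply conv_Re_nonneg in H; [| apply Cp |].
- assert (G2 := gr_rec (x - 2) ltac:(lra)); replace (x - 2 + 2) with x in G2 by ring.
  assert (E2 : A * gr (x - 2) = gr x).
  { unfold A; replace (gr (x - 2)) with (2 * PI * gr x / (x - 2)) by (rewrite <- G2; field; lra); field; lra. }
  assert (H' : 0 <= gr (x + d) - Ad * (1 + d / 2) * gr x + Ad * (d / 2) * A * gr (x - 2)).
  { unfold gr, Re in *; simpl in *; lra. }
  replace (Ad * (d / 2) * A * gr (x - 2)) with (Ad * (d / 2) * (A * gr (x - 2))) in H' by ring.
  rewrite E2 in H'; lra.
- intros v; unfold p.
  assert (K1 := kr_shift x d v); assert (K2 : kr (x - 2) v = kr x v * exp (- (2) * v)) by apply kr_shift.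
  unfold Re; simpl; rewrite K1, K2.
  pose proof (kr_pos x v).
  assert (E1 : exp (d * v) = Ad * exp (d * (v - ln A / 2))).
  { unfold Ad; rewrite <- exp_plus; f_equal; field. }
  assert (E2 : A * exp (- (2) * v) = exp (- (2 * (v - ln A / 2)))).
  { rewrite <- (exp_ln A HA) at 1; rewrite <- exp_plus; f_equal; field. }
  pose proof (exp_ineq1_le (d * (v - ln A / 2))); pose proof (exp_ineq1_le (- (2 * (v - ln A / 2)))).
  pose proof (exp_pos (d / 2 * ln A) : 0 < Ad).
  replace (_ + _) with (kr x v * (Ad * (exp (d * (v - ln A / 2)) - (1 + d / 2)
    + d / 2 * (A * exp (- (2) * v))))) by (rewrite E1; ring).
  apply Rmult_le_pos; [lra | apply Rmult_le_pos; [lra |]].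
  rewrite E2; nra.
Qed.

(** * The functional equation *)

(* The Euler-Maclaurin approximation to [zeta]; unlike [zeta] it is an explicit elementary function. *)
Definition Zp (N : nat) (s : C) : C :=
  (Csum (fun n => cpow (INR (S n)) (- s)) N - cpow (INR (S N)) (1 - s) / (1 - s))%C.

Lemma one_minus_neq_0 (s : C) : s <> 1 -> (1 - s)%C <> 0.
Proof.
intros Hs E; apply Hs, (proj2 (Ceq_minus s 1)).
replace (s - 1)%C with (- (1 - s))%C by ring; rewrite E; ring.
Qed.

Lemma Zp_partial N (s : C) : s <> 1 ->
  Zp N s = (/ (s - 1) + Csum (fun n => zeta_term s (INR (S n))) N)%C.
Proof.
intros Hs; pose proof (one_minus_neq_0 s Hs) as H1.
assert (H2 : (s - 1)%C <> 0) by (intros E; apply Hs, (proj2 (Ceq_minus s 1)), E).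
induction N as [|N IH].
- unfold Zp; simpl (Csum _ 0); change (INR 1) with 1; rewrite cpow_1_l; field; auto.
- cbn [Csum]; rewrite Cplus_assoc, <- IH; unfold Zp; cbn [Csum].
  unfold zeta_term; rewrite (S_INR (S N)); field; exact H1.
Qed.

(** The term is at most |s| x^(-sigma-1), which the mean value theorem on [x - 1, x] turns into a
    difference, so that the bounds telescope in [Zp_diff]. *)
Lemma zeta_term_le (s : C) x : 2 <= x -> 0 < Re s -> s <> 1 ->
  Cmod (zeta_term s x) <=
  Cmod s / Re s * (exp (- Re s * ln (x - 1)) - exp (- Re s * ln x)).
Proof.
intros Hx H0 H1.
assert (B : Cmod (zeta_term s x) <= Cmod s * exp (- (Re s + 1) * ln x)).
{ rewrite zeta_term_F.
  apply (dC_MVT2 (fun u => (u * cpow x (- s) - cpow u (1 - s) / (1 - s))%C)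
    (fun u => cpow u (- s)) (fun u => (- s * cpow u (- s - 1))%C)).
  - intros u Hu; apply (dC_F x ltac:(lra)); [exact H1 | lra].
  - intros u Hu; apply dC_cpow; lra.
  - intros u Hu; rewrite Cmod_mult, Cmod_opp, Cmod_cpow.
    apply Rmult_le_compat_l; [apply Cmod_ge_0 |]; apply exp_le.
    assert (ln x <= ln u) by (apply ln_le_mono; lra).
    unfold Re in *; simpl; nra. }
eapply Rle_trans; [exact B |].
unfold Rdiv; rewrite Rmult_assoc; apply Rmult_le_compat_l; [apply Cmod_ge_0 |].
destruct (MVT_gen (fun u => - exp (- Re s * ln u)) (x - 1) x
  (fun u => Re s * exp (- (Re s + 1) * ln u))) as [c [Hc E]].
- intros u; rewrite Rmin_left, Rmax_right by lra; intros Hu; auto_derive; [lra |].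
  replace (- (Re s + 1) * ln u) with (- Re s * ln u + - ln u) by ring.
  rewrite exp_plus, exp_Ropp, exp_ln by lra; field; lra.
- intros u; rewrite Rmin_left, Rmax_right by lra; intros Hu.
  eapply continuity_pt_of_derive; auto_derive; [lra | reflexivity].
- rewrite Rmin_left, Rmax_right in Hc by lra.
  assert (exp (- (Re s + 1) * ln x) <= exp (- (Re s + 1) * ln c)).
  { apply exp_le; assert (ln c <= ln x) by (apply ln_le_mono; lra); nra. }
  apply (Rmult_le_reg_l (Re s)); [exact H0 |].
  rewrite <- Rmult_assoc, Rinv_r, Rmult_1_l by lra; nra.
Qed.

Lemma Zp_diff (s : C) N M : 0 < Re s -> s <> 1 -> (1 <= N)%nat ->
  Cmod (Zp (N + M) s - Zp N s) <=
  Cmod s / Re s * (exp (- Re s * ln (INR N)) - exp (- Re s * ln (INR (N + M)))).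
Proof.
intros H0 H1 HN; induction M as [|M IH].
- rewrite Nat.add_0_r, Rminus_diag, Rmult_0_r; replace (_ - _)%C with (RtoC 0) by ring.
  rewrite Cmod_0; lra.
- rewrite Nat.add_succ_r.
  assert (E : Zp (S (N + M)) s = (Zp (N + M) s + zeta_term s (INR (S (N + M))))%C).
  { rewrite !Zp_partial by exact H1; cbn [Csum]; ring. }
  rewrite E.
  replace (_ - _)%C with ((Zp (N + M) s - Zp N s) + zeta_term s (INR (S (N + M))))%C by ring.
  eapply Rle_trans; [apply Cmod_triangle |].
  assert (H2 : 2 <= INR (S (N + M))).
  { rewrite S_INR; assert (1 <= INR (N + M)) by (apply (le_INR 1); lia); lra. }
  pose proof (zeta_term_le s _ H2 H0 H1) as Z.
  replace (INR (S (N + M)) - 1) with (INR (N + M)) in Z by (rewrite S_INR; ring).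
  lra.
Qed.

Lemma Zp_cvg (s : C) : 0 < Re s -> s <> 1 -> forall eps, 0 < eps ->
  exists N0, forall N, (N0 <= N)%nat -> Cmod (zeta s - Zp N s) < eps.
Proof.
intros H0 H1 eps He.
destruct (proj1 (is_Cseries_parts _ _) (zeta_series s H0 H1)) as [S1 S2].
apply is_series_Rsum in S1; apply is_series_Rsum in S2.
apply is_lim_seq_spec in S1; apply is_lim_seq_spec in S2.
assert (He4 : 0 < eps / 2) by lra.
destruct (S1 (mkposreal _ He4)) as [N1 A1]; destruct (S2 (mkposreal _ He4)) as [N2 A2].
simpl in A1, A2.
exists (max N1 N2); intros N HN; specialize (A1 N ltac:(lia)); specialize (A2 N ltac:(lia)).
rewrite Zp_partial by exact H1; unfold zeta.
set (S := CSeries (fun n => zeta_term s (INR (S n)))).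
set (P := Csum (fun n => zeta_term s (INR (Datatypes.S n))) N).
replace (_ - _)%C with (- (P - S))%C by ring; rewrite Cmod_opp.
eapply Rle_lt_trans; [apply Cmod_le_sum |].
assert (EI : forall f n, Im (Csum f n) = Rsum (fun k => Im (f k)) n).
{ intros f n; induction n as [|n IH]; simpl; [reflexivity |]; rewrite <- IH; reflexivity. }
replace (Re (P - S)) with (Rsum (fun n => Re (zeta_term s (INR (Datatypes.S n)))) N - Re S)
  by (rewrite <- Re_Csum; reflexivity).
replace (Im (P - S)) with (Rsum (fun n => Im (zeta_term s (INR (Datatypes.S n)))) N - Im S)
  by (rewrite <- EI; reflexivity).
unfold S; simpl; lra.
Qed.

Lemma Zp_tail (s : C) N : 0 < Re s -> s <> 1 -> (1 <= N)%nat ->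
  Cmod (zeta s - Zp N s) <= Cmod s / Re s * exp (- Re s * ln (INR N)).
Proof.
intros H0 H1 HN; apply le_epsilon; intros eps He.
destruct (Zp_cvg s H0 H1 eps He) as [N0 Q].
specialize (Q (N + N0)%nat ltac:(lia)).
pose proof (Zp_diff s N N0 H0 H1 HN) as D.
replace (zeta s - Zp N s)%C with ((zeta s - Zp (N + N0) s) + (Zp (N + N0) s - Zp N s))%C by ring.
eapply Rle_trans; [apply Cmod_triangle |].
assert (0 <= Cmod s / Re s * exp (- Re s * ln (INR (N + N0)))).
{ apply Rmult_le_pos; [apply Rmult_le_pos; [apply Cmod_ge_0 | apply Rlt_le, Rinv_0_lt_compat, H0] |
    apply Rlt_le, exp_pos]. }
lra.
Qed.

(** * The truncated theta series and its Mellin transform *)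

Definition gauss (u : R) : R := exp (- (PI * u ^ 2)).
Definition Psi (y : R) : R := RInt gauss 0 y.

Lemma gauss_cont t : continuous gauss t.
Proof. apply (ex_derive_continuous (V := R_NormedModule)); unfold gauss; auto_derive; trivial. Qed.

Lemma gauss_pos u : 0 < gauss u.
Proof. apply exp_pos. Qed.

Lemma gauss_decr u v : 0 <= u <= v -> gauss v <= gauss u.
Proof. intros H; pose proof PI_RGT_0; assert (u ^ 2 <= v ^ 2) by (apply pow_incr; lra); apply exp_le; nra. Qed.

Lemma gauss_le_1 u : gauss u <= 1.
Proof. rewrite <- exp_0; apply exp_le; pose proof PI_RGT_0; pose proof (pow2_ge_0 u); nra. Qed.

Lemma Psi_derive y : is_derive Psi y (gauss y).
Proof.
apply (is_derive_RInt gauss Psi 0); [| apply gauss_cont].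
exists (mkposreal 1 Rlt_0_1); intros z _.
apply (RInt_correct (V := R_CompleteNormedModule)), ex_RInt_cont, gauss_cont.
Qed.

Lemma Psi_0 : Psi 0 = 0.
Proof. apply (RInt_point (V := R_CompleteNormedModule)). Qed.

Lemma Psi_step a b : 0 <= a < b -> gauss b * (b - a) <= Psi b - Psi a <= gauss a * (b - a).
Proof.
intros H; destruct (MVT_gen Psi a b gauss) as [c [Hc E]].
- intros; apply Psi_derive.
- intros x _; eapply continuity_pt_of_derive, Psi_derive.
- rewrite Rmin_left, Rmax_right in Hc by lra; rewrite E.
  pose proof (gauss_decr c b ltac:(lra)); pose proof (gauss_decr a c ltac:(lra)); nra.
Qed.

Lemma Psi_mono a b : 0 <= a <= b -> Psi a <= Psi b.
Proof.
intros H; destruct (Req_dec a b) as [-> | N]; [lra |].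
pose proof (Psi_step a b ltac:(lra)); pose proof (gauss_pos b); nra.
Qed.

Lemma Psi_range y : 0 <= y -> 0 <= Psi y <= y.
Proof.
intros Hy; pose proof (Psi_mono 0 y ltac:(lra)); rewrite Psi_0 in *; split; [lra |].
destruct (Req_dec 0 y) as [<- | N]; [rewrite Psi_0; lra |].
pose proof (Psi_step 0 y ltac:(lra)) as P; rewrite Psi_0 in P; pose proof (gauss_le_1 0); nra.
Qed.

(** The counterpart of [Zp N] on the theta side: subtracting the integral removes the 1/x
    singularity of the series, just as the subtracted power in [Zp N] replaces the divergent tail of
    the Dirichlet series. *)
Definition SN (N : nat) (x : R) : R :=
  Rsum (fun n => gauss (INR (S n) * x)) N - Psi (INR (S N) * x) / x.

Lemma SN_step N x : 0 < x -> 0 <= SN (S N) x - SN N x <= gauss (INR (S N) * x) - gauss (INR (S (S N)) * x).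
Proof.
intros Hx; unfold SN; cbn [Rsum].
pose proof (INR_S_ge_1 N).
pose proof (Psi_step (INR (S N) * x) (INR (S (S N)) * x)) as P; rewrite (S_INR (S N)) in *.
specialize (P ltac:(nra)).
replace ((INR (S N) + 1) * x - INR (S N) * x) with x in P by ring.
set (p := Psi ((INR (S N) + 1) * x)) in *; set (r := Psi (INR (S N) * x)) in *.
assert (E : p / x - r / x = (p - r) / x) by (field; lra).
assert (gauss ((INR (S N) + 1) * x) <= (p - r) / x <= gauss (INR (S N) * x)).
{ split; apply (Rmult_le_reg_r x); try exact Hx;
    replace ((p - r) / x * x) with (p - r) by (field; lra); lra. }
lra.
Qed.

Lemma SN_incr N M x : 0 < x -> 0 <= SN (N + M) x - SN N x <= gauss (INR (S N) * x) - gauss (INR (S (N + M)) * x).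
Proof.
intros Hx; induction M as [|M IH]; [rewrite Nat.add_0_r; lra |].
rewrite Nat.add_succ_r; pose proof (SN_step (N + M) x Hx); lra.
Qed.

Lemma omega_gauss x : 0 < x -> is_lim_seq (Rsum (fun n => gauss (INR (S n) * x))) (omega x).
Proof.
intros Hx; apply is_series_Rsum.
eapply is_series_ext; [| apply Series_correct, (omega_ex_series x Hx)].
intros n; unfold gauss; f_equal; ring.
Qed.

Lemma Rsum_gauss_le x N : 0 < x -> Rsum (fun n => gauss (INR (S n) * x)) N <= omega x.
Proof.
intros Hx; apply (is_lim_seq_incr_compare _ _ (omega_gauss x Hx)).
intros n; cbn [Rsum]; pose proof (gauss_pos (INR (S n) * x)); lra.
Qed.

(** [Psi] is increasing, and bounded because the integral is compared with the convergent series
    [omega 1]. The value of the limit P is found afterwards. *)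
Lemma Psi_limit_aux : exists P, (forall y, 0 <= y -> Psi y <= P) /\
  forall x, 0 < x -> is_lim_seq (fun M => Psi (INR (S M) * x)) P.
Proof.
assert (B : forall n, Psi (INR n) <= omega 1 + Psi 1).
{ intros n; eapply Rle_trans; [apply (Psi_mono _ (INR (S n)))|].
  - rewrite S_INR; pose proof (pos_INR n); lra.
  - pose proof (SN_incr 0 n 1 Rlt_0_1) as I; unfold SN in I; rewrite Nat.add_0_l in I.
    simpl (Rsum _ 0) in I; rewrite !Rmult_1_r, !Rdiv_1_r in I; simpl (INR 1) in I.
    pose proof (Rsum_gauss_le 1 n Rlt_0_1); lra. }
destruct (ex_finite_lim_seq_incr (fun n => Psi (INR n)) (omega 1 + Psi 1)) as [P HP].
- intros n; apply Psi_mono; rewrite S_INR; pose proof (pos_INR n); lra.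
- exact B.
- assert (U : forall y, 0 <= y -> Psi y <= P).
  { intros y Hy; destruct (INR_unbounded y) as [n Hn].
    apply (Rle_trans _ (Psi (INR n))); [apply Psi_mono; lra |].
    apply (is_lim_seq_incr_compare _ _ HP); intros m; apply Psi_mono.
    rewrite S_INR; pose proof (pos_INR m); lra. }
  exists P; split; [exact U |].
  intros x Hx; apply is_lim_seq_spec; intros eps.
  apply is_lim_seq_spec in HP; destruct (HP eps) as [n Hn]; specialize (Hn n (le_n n)).
  destruct (INR_unbounded (INR n / x)) as [M0 HM0].
  exists M0; intros M HM.
  apply le_INR in HM.
  assert (INR n <= INR (S M) * x).
  { rewrite S_INR; apply (Rmult_gt_compat_r x) in HM0; [| lra].
    unfold Rdiv in HM0; rewrite Rmult_assoc, Rinv_l, Rmult_1_r in HM0 by lra; nra. }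
  pose proof (Psi_mono (INR n) (INR (S M) * x) ltac:(pose proof (pos_INR n); lra)).
  pose proof (U (INR (S M) * x) ltac:(pose proof (pos_INR n); lra)).
  apply Rabs_def2 in Hn; apply Rabs_def1; lra.
Qed.

(** The Gaussian integral is evaluated by the theta relation: comparing sum and integral gives x
    omega(x) -> P as x -> 0, whereas x (1 + 2 omega(x)) = 1 + 2 omega(1/x) -> 1. Quantitatively |1 -
    2P| <= x (2P + 8) for every x in (0, 1]. *)
Lemma Psi_limit : (forall y, 0 <= y -> Psi y <= 1 / 2) /\
  forall x N, 0 < x -> 0 <= omega x - 1 / 2 / x - SN N x <= gauss (INR (S N) * x).
Proof.
destruct Psi_limit_aux as [P [U L]].
assert (A : forall x N, 0 < x -> 0 <= omega x - P / x - SN N x <= gauss (INR (S N) * x)).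
{ intros x N Hx.
  assert (Lim : is_lim_seq (fun M => SN (N + M) x) (omega x - P / x)).
  { apply (is_lim_seq_ext (fun M => SN (M + N) x)); [intros; f_equal; lia |].
    apply (is_lim_seq_incr_n (fun M => SN M x)); unfold SN.
    apply is_lim_seq_minus'; [apply omega_gauss, Hx |].
    apply is_lim_seq_div'; [apply L, Hx | apply is_lim_seq_const | lra]. }
  split.
  - assert (SN N x <= omega x - P / x); [| lra].
    apply (is_lim_seq_le (fun _ => SN N x) (fun M => SN (N + M) x) (SN N x) (omega x - P / x));
      [| apply is_lim_seq_const | exact Lim].
    intros M; pose proof (SN_incr N M x Hx); lra.
  - assert (omega x - P / x <= SN N x + gauss (INR (S N) * x)); [| lra].
    apply (is_lim_seq_le (fun M => SN (N + M) x) (fun _ => SN N x + gauss (INR (S N) * x))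
      (omega x - P / x) (SN N x + gauss (INR (S N) * x)));
      [| exact Lim | apply is_lim_seq_const].
    intros M; pose proof (SN_incr N M x Hx); pose proof (gauss_pos (INR (S (N + M)) * x)); lra. }
assert (P0 : 0 <= P) by (apply (Rle_trans _ (Psi 0)); [rewrite Psi_0; lra | apply U; lra]).
assert (P2 : P = 1 / 2).
{ assert (Q : forall x, 0 < x <= 1 -> Rabs (1 - 2 * P) <= x * (2 * P + 8)).
  { intros x Hx.
    pose proof (theta_functional_equation x ltac:(lra)) as T.
    pose proof (A x 0%nat ltac:(lra)) as A1.
    assert (Hix : 1 <= / x) by (rewrite <- Rinv_1; apply Rinv_le_contravar; lra).
    pose proof (A (/ x) 0%nat ltac:(lra)) as A2.
    unfold SN in A1, A2; simpl (Rsum _ 0) in A1, A2; simpl (INR 1) in A1, A2.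
    rewrite !Rmult_1_l in A1, A2.
    pose proof (gauss_le_1 x); pose proof (Psi_range x ltac:(lra)); pose proof (Psi_range (/ x) ltac:(lra)).
    assert (G : gauss (/ x) <= x).
    { unfold gauss; rewrite exp_Ropp; rewrite <- (Rinv_inv x) at 2.
      apply Rinv_le_contravar; [lra |].
      pose proof (exp_ineq1_le (PI * (/ x) ^ 2)); pose proof PI2_1; simpl in *; nra. }
    pose proof (omega_nonneg (/ x) ltac:(lra)) as W0.
    unfold Rdiv in A2; rewrite Rinv_inv in A2.
    assert (W : omega (/ x) <= (P + 1) * x) by nra.
    assert (B1 : x * (omega x - P / x - (0 - Psi x / x)) <= x * gauss x) by (apply Rmult_le_compat_l; lra).
    assert (B2 : 0 <= x * (omega x - P / x - (0 - Psi x / x))) by (apply Rmult_le_pos; lra).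
    replace (x * (omega x - P / x - (0 - Psi x / x))) with (x * omega x - P + Psi x) in B1, B2 by (field; lra).
    apply Rabs_le; nra. }
  destruct (Req_dec (1 - 2 * P) 0) as [Z | N]; [lra |].
  exfalso; apply Rabs_pos_lt in N.
  assert (R8 : 0 < 2 * P + 8) by lra.
  set (x := Rmin 1 (Rabs (1 - 2 * P) / (2 * (2 * P + 8)))).
  assert (Hx : 0 < x) by (apply Rmin_pos; [lra | apply Rdiv_lt_0_compat; lra]).
  specialize (Q x (conj Hx (Rmin_l _ _))).
  assert (x * (2 * P + 8) <= Rabs (1 - 2 * P) / (2 * (2 * P + 8)) * (2 * P + 8))
    by (apply Rmult_le_compat_r; [lra | apply Rmin_r]).
  replace (Rabs (1 - 2 * P) / (2 * (2 * P + 8)) * (2 * P + 8)) with (Rabs (1 - 2 * P) / 2) in H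
    by (field; lra).
  lra. }
rewrite P2 in U, A; split; assumption.
Qed.

Lemma gauss_ker (s : C) n v :
  (RtoC (gauss (INR (S n) * exp v)) * Cexp (s * v))%C =
  (cpow (INR (S n)) (- s) * ker s (v + ln (INR (S n))))%C.
Proof.
assert (H : 0 < INR (S n)) by (apply lt_0_INR; lia).
unfold ker, cpow, gauss.
replace (exp (2 * (v + ln (INR (S n))))) with ((INR (S n) * exp v) ^ 2).
2:{ replace (2 * (v + ln (INR (S n)))) with (v + v + (ln (INR (S n)) + ln (INR (S n)))) by ring.
    rewrite !exp_plus, !exp_ln by exact H; ring. }
rewrite Cmult_assoc, (Cmult_comm (Cexp _) (RtoC _)), <- Cmult_assoc, <- Cexp_plus.
f_equal; f_equal; rewrite RtoC_plus; ring.
Qed.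

Lemma Cc_ker_shift s h : Cc (fun v => ker s (v + h)).
Proof.
apply (Cc_dC _ (fun v => (s * ker s (v + h) - 2 * PI * ker (s + 2) (v + h))%C)).
intros t; destruct (dC_ker s (t + h)) as [D1 D2].
split.
- evar_last.
  + apply (is_derive_comp (fun x => Re (ker s x)) (fun x => x + h)); [exact D1 |].
    auto_derive; [trivial | reflexivity].
  + unfold scal; simpl; unfold mult; simpl; rewrite Rmult_1_l; reflexivity.
- evar_last.
  + apply (is_derive_comp (fun x => Im (ker s x)) (fun x => x + h)); [exact D2 |].
    auto_derive; [trivial | reflexivity].
  + unfold scal; simpl; unfold mult; simpl; rewrite Rmult_1_l; reflexivity.
Qed.

Lemma conv_zero : conv (fun _ => RtoC 0) 0.
Proof.
intros eps He; exists 0; intros A B _ _.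
assert (CI (fun _ => RtoC 0) A B = 0) as ->.
{ apply injective_projections; simpl; rewrite RInt_const; unfold scal; simpl; unfold mult; simpl; ring. }
replace (0 - 0)%C with (RtoC 0) by ring; rewrite Cmod_0; exact He.
Qed.

Definition kN (N : nat) (s : C) (v : R) : C := (RtoC (SN N (exp v)) * Cexp (s * v))%C.

Lemma conv_gauss_sum s N : 0 < Re s ->
  Cc (fun v => RtoC (Rsum (fun n => gauss (INR (S n) * exp v)) N) * Cexp (s * v))%C /\
  conv (fun v => RtoC (Rsum (fun n => gauss (INR (S n) * exp v)) N) * Cexp (s * v))%C
    (gam s * Csum (fun n => cpow (INR (S n)) (- s)) N)%C.
Proof.
intros Hs; induction N as [|N [I1 I2]].
- assert (E : forall v : R, RtoC 0 = (RtoC (Rsum (fun n => gauss (INR (S n) * exp v)) 0) * Cexp (s * v))%C)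
    by (intros; simpl; ring).
  split; [eapply Cc_ext; [exact E | apply Cc_const] |].
  simpl (Csum _ 0); rewrite Cmult_0_r; eapply conv_ext; [exact E | apply conv_zero].
- destruct (conv_axpy (cpow (INR (S N)) (- s)) _ _ _ _ I1 (Cc_ker_shift s (ln (INR (S N)))) I2
    (conv_shift _ _ (ln (INR (S N))) (Cc_ker s) (conv_ker s Hs))) as [J1 J2].
  assert (E : forall v : R, (RtoC (Rsum (fun n => gauss (INR (S n) * exp v)) N) * Cexp (s * v)
     + cpow (INR (S N)) (- s) * ker s (v + ln (INR (S N))))%C
     = (RtoC (Rsum (fun n => gauss (INR (S n) * exp v)) (S N)) * Cexp (s * v))%C).
  { intros v; rewrite <- gauss_ker; cbn [Rsum]; rewrite RtoC_plus; ring. }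
  split; [eapply Cc_ext; [exact E | exact J1] |].
  replace (gam s * Csum (fun n => cpow (INR (S n)) (- s)) (S N))%C with
    (gam s * Csum (fun n => cpow (INR (S n)) (- s)) N + cpow (INR (S N)) (- s) * gam s)%C
    by (cbn [Csum]; ring).
  eapply conv_ext; [exact E | exact J2].
Qed.

(** Integration by parts: the derivative of the integrand [b] is a translate of [ker s] plus (s - 1)
    [b], and it integrates to 0. The strip is where [b] decays at both ends, by Psi y <= y on the
    left and Psi <= 1/2 on the right. *)
Lemma conv_Psi s N : 0 < Re s < 1 ->
  Cc (fun v => RtoC (Psi (INR (S N) * exp v)) * Cexp ((s - 1) * v))%C /\
  conv (fun v => RtoC (Psi (INR (S N) * exp v)) * Cexp ((s - 1) * v))%C
    (gam s * (cpow (INR (S N)) (1 - s) / (1 - s)))%C.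
Proof.
intros Hs; set (M := INR (S N)).
assert (HM : 1 <= M) by apply INR_S_ge_1.
assert (Hs1 : (1 - s)%C <> 0).
{ intros E; apply (f_equal Re) in E; unfold Re in *; simpl in *; lra. }
set (b := fun v => (RtoC (Psi (M * exp v)) * Cexp ((s - 1) * v))%C).
set (db := fun v : R => (M * cpow M (- s) * ker s (v + ln M) + (s - 1) * b v)%C).
assert (D : forall t, dC b t (db t)).
{ intros t; unfold b, db; eapply dC_eq.
  - apply dC_mult.
    + apply dC_RtoC.
      apply (is_derive_comp Psi (fun v => M * exp v)); [apply Psi_derive |].
      auto_derive; [trivial | reflexivity].
    + apply dC_Cexp, dC_mult; [apply dC_const | apply dC_id].
  - cbv beta; fold (b t).
    rewrite <- Cmult_assoc; unfold M; rewrite <- gauss_ker; fold M.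
    replace (s * t)%C with ((s - 1) * t + RtoC t)%C by ring.
    rewrite Cexp_plus, Cexp_R; unfold scal; simpl; unfold mult; simpl.
    unfold b; rewrite !RtoC_mult; ring. }
assert (Cb : Cc b) by (eapply Cc_dC, D).
assert (Ck := Cc_ker_shift s (ln M)).
assert (Cdb : Cc db).
{ exact (Cc_plus _ _ (Cc_scal (M * cpow M (- s))%C _ Ck) (Cc_scal (s - 1)%C _ Cb)). }
assert (V : conv db 0).
{ apply (conv_derivative b); [exact D | exact Cdb |]; intros eps He.
  set (c := Rmin (Re s) (1 - Re s)).
  assert (Hc : 0 < c) by (apply Rmin_pos; lra).
  destruct (exp_decay_small M c eps Hc He) as [Y [HY Q]].
  exists Y; intros t Ht; unfold b.
  rewrite Cmod_mult, Cmod_R, Cmod_Cexp.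
  pose proof (exp_pos t) as Et.
  destruct (Psi_range (M * exp t)) as [P0 P1]; [nra |].
  destruct Psi_limit as [PL _]; specialize (PL (M * exp t) ltac:(nra)).
  rewrite Rabs_pos_eq by exact P0.
  replace (Re ((s - 1) * t)%C) with (Re s * t - t) by (unfold Re; simpl; ring).
  pose proof (Rmin_l (Re s) (1 - Re s)); pose proof (Rmin_r (Re s) (1 - Re s)); fold c in H, H0.
  pose proof (exp_pos (Re s * t - t)).
  destruct Ht as [Ht | Ht].
  - apply (Rle_lt_trans _ (M * exp (- (c * - t)))); [| apply Q; lra].
    apply (Rle_trans _ (M * exp t * exp (Re s * t - t))); [apply Rmult_le_compat_r; lra |].
    rewrite Rmult_assoc, <- exp_plus; apply Rmult_le_compat_l; [lra |]; apply exp_le; nra.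
  - apply (Rle_lt_trans _ (M * exp (- (c * t)))); [| apply Q; lra].
    apply Rmult_le_compat; try lra; apply exp_le; nra. }
destruct (conv_axpy (- (M * cpow M (- s)))%C _ _ _ _ Cdb Ck V
  (conv_shift _ _ (ln M) (Cc_ker s) (conv_ker s (proj1 Hs)))) as [J1 J2].
split; [exact Cb |].
assert (E : forall v, (/ (s - 1) * (db v + - (M * cpow M (- s)) * ker s (v + ln M)))%C = b v).
{ intros v; unfold db; field; intros E; apply Hs1; replace (1 - s)%C with (- (s - 1))%C by ring.
  rewrite E; ring. }
replace (gam s * (cpow M (1 - s) / (1 - s)))%C with
  (/ (s - 1) * (0 + - (M * cpow M (- s)) * gam s))%C.
- exact (conv_ext _ _ _ E (conv_scal _ _ _ J1 J2)).
- unfold Cminus at 2; rewrite (cpow_plus M 1), cpow_1_r by lra; field; split; [exact Hs1 |].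
  intros E'; apply Hs1; replace (1 - s)%C with (- (s - 1))%C by ring; rewrite E'; ring.
Qed.

(** Because the integral part is subtracted before the transform is taken, this formula holds inside
    the critical strip itself and no analytic continuation of a Mellin transform is required. *)
Lemma conv_kN s N : 0 < Re s < 1 -> Cc (kN N s) /\ conv (kN N s) (gam s * Zp N s)%C.
Proof.
intros Hs; destruct (conv_gauss_sum s N (proj1 Hs)) as [A1 A2]; destruct (conv_Psi s N Hs) as [B1 B2].
destruct (conv_axpy (- (1))%C _ _ _ _ A1 B1 A2 B2) as [J1 J2].
assert (E : forall v : R, (RtoC (Rsum (fun n => gauss (INR (S n) * exp v)) N) * Cexp (s * v)
   + - (1) * (RtoC (Psi (INR (S N) * exp v)) * Cexp ((s - 1) * v)))%C = kN N s v).
{ intros v; unfold kN, SN.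
  replace (s * v)%C with ((s - 1) * v + RtoC v)%C by ring.
  rewrite Cexp_plus, Cexp_R; unfold Cminus at 1, Rminus, Rdiv.
  rewrite <- exp_Ropp, RtoC_plus, RtoC_opp, RtoC_mult.
  assert (RtoC (exp (- v)) * RtoC (exp v) = 1)%C.
  { rewrite <- RtoC_mult, <- exp_plus, Rplus_opp_l, exp_0; reflexivity. }
  set (X := RtoC (Psi _)); set (Y := Cexp ((s - 1) * v)).
  replace (X * Y)%C with (X * Y * (RtoC (exp (- v)) * RtoC (exp v)))%C by (rewrite H; ring).
  unfold Y, Cminus; ring. }
split; [eapply Cc_ext; [exact E | exact J1] |].
replace (gam s * Zp N s)%C with
 (gam s * Csum (fun n => cpow (INR (S n)) (- s)) N + - (1) * (gam s * (cpow (INR (S N)) (1 - s) / (1 - s))))%C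
 by (unfold Zp; ring).
eapply conv_ext; [exact E | exact J2].
Qed.

(* [e^(v/2) (omega (e^v) - e^(-v)/2)] is even; [SN N] inherits this up to a Gaussian error. *)
Lemma SN_reflect N v :
  Rabs (SN N (exp (- v)) - exp v * SN N (exp v)) <=
  gauss (INR (S N) * exp (- v)) + exp v * gauss (INR (S N) * exp v).
Proof.
destruct Psi_limit as [_ A].
pose proof (exp_pos v) as Pv; pose proof (exp_pos (- v)) as Pm.
pose proof (A (exp v) N Pv) as A1; pose proof (A (exp (- v)) N Pm) as A2.
pose proof (theta_functional_equation (exp v) Pv) as T.
assert (Ei : / exp v = exp (- v)) by (rewrite exp_Ropp; reflexivity).
assert (Ei2 : / exp (- v) = exp v) by (rewrite exp_Ropp, Rinv_inv; reflexivity).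
unfold Rdiv in A1, A2; rewrite Ei in *; rewrite Ei2 in *.
assert (Eo : omega (exp (- v)) - 1 * / 2 * exp v = exp v * (omega (exp v) - 1 * / 2 * exp (- v))).
{ assert (exp v * exp (- v) = 1) by (rewrite <- exp_plus, Rplus_opp_r, exp_0; reflexivity). nra. }
assert (0 <= exp v * (omega (exp v) - 1 * / 2 * exp (- v) - SN N (exp v)) <= exp v * gauss (INR (S N) * exp v))
  by (split; [apply Rmult_le_pos | apply Rmult_le_compat_l]; lra).
pose proof (gauss_pos (INR (S N) * exp (- v))).
apply Rabs_le; lra.
Qed.

Lemma gauss_kr x n v :
  gauss (INR (S n) * exp v) * exp (x * v) = exp (- x * ln (INR (S n))) * kr x (v + ln (INR (S n))).
Proof.
assert (H : 0 < INR (S n)) by (apply lt_0_INR; lia).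
unfold gauss, kr; rewrite <- !exp_plus; f_equal.
replace (2 * (v + ln (INR (S n)))) with (v + v + (ln (INR (S n)) + ln (INR (S n)))) by ring.
rewrite !exp_plus, !exp_ln by exact H; ring.
Qed.

Lemma kr_shift_cont x h t : continuous (fun v => kr x (v + h)) t.
Proof. apply (ex_derive_continuous (V := R_NormedModule)); unfold kr; auto_derive; trivial. Qed.

(** Reflecting v in the integral for s yields the integral for 1 - s up to the Gaussian error of
    [SN_reflect]. The two error terms are translates of [kr] times powers of N + 1, so they vanish
    as N grows. *)
Lemma kN_symmetry s N : 0 < Re s < 1 ->
  Cmod (gam s * Zp N s - gam (1 - s) * Zp N (1 - s)) <=
  exp (- Re s * ln (INR (S N))) * gr (Re s) + exp (- (1 - Re s) * ln (INR (S N))) * gr (1 - Re s).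
Proof.
intros Hs; set (l := ln (INR (S N))).
assert (Hs' : 0 < Re (1 - s)%C < 1) by (unfold Re in *; simpl; lra).
destruct (conv_kN s N Hs) as [A1 A2]; destruct (conv_kN (1 - s)%C N Hs') as [B1 B2].
destruct (conv_axpy (- (1))%C _ _ _ _ A1 B1 A2 B2) as [J1 J2].
replace (_ - _)%C with (gam s * Zp N s + - (1) * (gam (1 - s) * Zp N (1 - s)))%C by ring.
apply (conv_bound _ _ _ J2); exists 0; intros Y HY.
rewrite (CI_plus (kN N s) (fun v => - (1) * kN N (1 - s) v)%C) by (auto using Cc_scal).
rewrite <- (CI_reflect (kN N s)) by exact A1.
assert (Cr : Cc (fun v => kN N s (- v))).
{ destruct A1 as [a1 a2]; split; intros t.
  - apply (continuous_comp Ropp (fun v => Re (kN N s v))); [| apply a1].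
    apply (ex_derive_continuous (V := R_NormedModule) Ropp); auto_derive; trivial.
  - apply (continuous_comp Ropp (fun v => Im (kN N s v))); [| apply a2].
    apply (ex_derive_continuous (V := R_NormedModule) Ropp); auto_derive; trivial. }
rewrite <- CI_plus by (auto using Cc_scal).
set (g := fun v => exp (- Re s * l) * kr (Re s) (- v + l) + exp (- (1 - Re s) * l) * kr (1 - Re s) (v + l)).
assert (C1 : forall t, continuous (fun v => exp (- Re s * l) * kr (Re s) (- v + l)) t).
{ intros t; apply (ex_derive_continuous (V := R_NormedModule)); unfold kr; auto_derive; trivial. }
assert (C2 : forall t, continuous (fun v => exp (- (1 - Re s) * l) * kr (1 - Re s) (v + l)) t).
{ intros t; apply (ex_derive_continuous (V := R_NormedModule)); unfold kr; auto_derive; trivial. }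
apply (Rle_trans _ (RInt g (- Y) Y)).
- apply CI_bound; [lra | | |].
  + exact (Cc_plus _ _ Cr (Cc_scal (- (1))%C _ B1)).
  + intros t; exact (continuous_plus (V := R_NormedModule) _ _ _ (C1 t) (C2 t)).
  + intros v _; unfold kN, g.
    replace (RtoC (SN N (exp (- v))) * Cexp (s * RtoC (- v)) + - (1) * (RtoC (SN N (exp v)) * Cexp ((1 - s) * v)))%C
      with (RtoC (SN N (exp (- v)) - exp v * SN N (exp v)) * Cexp (- s * v))%C.
    2:{ replace (s * RtoC (- v))%C with (- s * v)%C by (rewrite RtoC_opp; ring).
        replace ((1 - s) * v)%C with (- s * v + RtoC v)%C by ring.
        rewrite Cexp_plus, Cexp_R, RtoC_minus, RtoC_mult; ring. }
    rewrite Cmod_mult, Cmod_R, Cmod_Cexp.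
    replace (Re (- s * v)%C) with (- Re s * v) by (unfold Re; simpl; ring).
    unfold l; rewrite <- !gauss_kr.
    eapply Rle_trans; [apply Rmult_le_compat_r; [apply Rlt_le, exp_pos | apply SN_reflect] |].
    apply Req_le; rewrite Rmult_plus_distr_r.
    replace (Re s * - v) with (- Re s * v) by ring; f_equal.
    replace ((1 - Re s) * v) with (v + - Re s * v) by ring; rewrite exp_plus; ring.
- unfold g.
  assert (S2 : forall c h, (forall t, continuous h t) -> RInt (fun t => c * h t) (- Y) Y = c * RInt h (- Y) Y).
  { intros c h Hh; apply (RInt_scal (V := R_CompleteNormedModule)), ex_RInt_cont, Hh. }
  assert (C3 : forall t, continuous (fun v => kr (Re s) (- v + l)) t).
  { intros t; apply (ex_derive_continuous (V := R_NormedModule)); unfold kr; auto_derive; trivial. }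
  assert (E : RInt (fun v => exp (- Re s * l) * kr (Re s) (- v + l)
       + exp (- (1 - Re s) * l) * kr (1 - Re s) (v + l)) (- Y) Y =
     exp (- Re s * l) * RInt (fun v => kr (Re s) (- v + l)) (- Y) Y +
     exp (- (1 - Re s) * l) * RInt (fun v => kr (1 - Re s) (v + l)) (- Y) Y).
  { rewrite <- !S2 by (apply C3 || apply kr_shift_cont).
    apply (RInt_plus (V := R_CompleteNormedModule)); apply ex_RInt_cont; assumption. }
  rewrite E.
  rewrite (RInt_reflect (fun v => kr (Re s) (v + l))) by (intros; apply kr_shift_cont).
  rewrite !RInt_shift by (intros; apply kr_cont).
  apply Rplus_le_compat; apply Rmult_le_compat_l; try (apply Rlt_le, exp_pos);
    apply kr_int_le; lra.
Qed.

Lemma exp_ln_small x eps : 0 < x -> 0 < eps -> exists N0, forall N, (N0 <= N)%nat ->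
  exp (- x * ln (INR (S N))) < eps.
Proof.
intros Hx He; pose proof (is_lim_exp_ln x Hx) as L; apply is_lim_seq_spec in L.
destruct (L (mkposreal eps He)) as [N0 H]; exists N0; intros N HN; specialize (H N HN); simpl in H.
rewrite Rminus_0_r, Rabs_pos_eq in H by (apply Rlt_le, exp_pos); exact H.
Qed.

Lemma functional_equation s : 0 < Re s < 1 -> (gam s * zeta s = gam (1 - s) * zeta (1 - s))%C.
Proof.
intros Hs; set (s' := (1 - s)%C).
assert (Hs' : 0 < Re s' < 1) by (unfold s', Re in *; simpl; lra).
assert (N1 : s <> 1) by (intros ->; simpl in Hs; lra).
assert (N2 : s' <> 1) by (intros E; rewrite E in Hs'; simpl in Hs'; lra).
apply (proj2 (Ceq_minus _ _)), Cmod_eq_0, Rle_antisym; [| apply Cmod_ge_0].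
apply le_epsilon; intros eps He.
set (K := Cmod (gam s) + Cmod (gam s') + gr (Re s) + gr (1 - Re s) + 1).
pose proof (Cmod_ge_0 (gam s)) as P1; pose proof (Cmod_ge_0 (gam s')) as P2.
pose proof (gr_pos (Re s) ltac:(lra)) as P3; pose proof (gr_pos (1 - Re s) ltac:(lra)) as P4.
assert (He2 : 0 < eps / K) by (apply Rdiv_lt_0_compat; unfold K; lra).
destruct (Zp_cvg s (proj1 Hs) N1 _ He2) as [n1 Q1].
destruct (Zp_cvg s' (proj1 Hs') N2 _ He2) as [n2 Q2].
destruct (exp_ln_small (Re s) _ (proj1 Hs) He2) as [n3 Q3].
destruct (exp_ln_small (1 - Re s) _ ltac:(lra) He2) as [n4 Q4].
set (N := max (max n1 n2) (max n3 n4)).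
specialize (Q1 N ltac:(lia)); specialize (Q2 N ltac:(lia)).
specialize (Q3 N ltac:(lia)); specialize (Q4 N ltac:(lia)).
pose proof (kN_symmetry s N Hs) as S; fold s' in S.
replace (gam s * zeta s - gam s' * zeta s')%C with
  (gam s * (zeta s - Zp N s) + (- (gam s' * (zeta s' - Zp N s'))
   + (gam s * Zp N s - gam s' * Zp N s')))%C by ring.
eapply Rle_trans; [apply Cmod_triangle |].
eapply Rle_trans; [apply Rplus_le_compat_l, Cmod_triangle |].
rewrite Cmod_opp, !Cmod_mult.
set (d := eps / K) in *.
assert (EK : d * K = eps) by (unfold d, K; field; lra).
pose proof (Cmod_ge_0 (zeta s - Zp N s)); pose proof (Cmod_ge_0 (zeta s' - Zp N s')).
assert (Cmod (gam s) * Cmod (zeta s - Zp N s) <= Cmod (gam s) * d) by (apply Rmult_le_compat_l; lra).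
assert (Cmod (gam s') * Cmod (zeta s' - Zp N s') <= Cmod (gam s') * d) by (apply Rmult_le_compat_l; lra).
assert (exp (- Re s * ln (INR (Datatypes.S N))) * gr (Re s) <= d * gr (Re s)) by (apply Rmult_le_compat_r; lra).
assert (exp (- (1 - Re s) * ln (INR (Datatypes.S N))) * gr (1 - Re s) <= d * gr (1 - Re s))
  by (apply Rmult_le_compat_r; lra).
unfold K in EK; lra.
Qed.

Fixpoint shift_prod (x t : R) (k : nat) : R :=
  match k with O => 1 | S j => shift_prod x t j * Cmod (x + 2 * INR j, t) end.

Lemma shift_prod_pos x t k : 0 < x -> 0 < shift_prod x t k.
Proof.
intros Hx; induction k as [|k IH]; simpl; [lra |].
apply Rmult_lt_0_compat; [exact IH | apply Cmod_gt_0].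
intros E; apply (f_equal fst) in E; simpl in E; pose proof (pos_INR k); lra.
Qed.

Lemma gam_iter x t k : 0 < x ->
  Cmod (gam (x, t)) * shift_prod x t k = (2 * PI) ^ k * Cmod (gam (x + 2 * INR k, t)).
Proof.
intros Hx; induction k as [|k IH].
- simpl; rewrite Rmult_0_r, Rplus_0_r; ring.
- cbn [shift_prod]; rewrite <- Rmult_assoc, IH.
  pose proof PI_RGT_0; pose proof (pos_INR k).
  assert (G := gam_rec (x + 2 * INR k, t) ltac:(simpl; lra)).
  apply (f_equal Cmod) in G; rewrite !Cmod_mult, !Cmod_R, (Rabs_pos_eq PI), (Rabs_pos_eq 2) in G by lra.
  replace (((x + 2 * INR k)%R, t) + 2)%C with (x + 2 * INR (S k), t) in G.
  2:{ rewrite S_INR; apply injective_projections; simpl; ring. }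
  simpl pow; rewrite Rmult_assoc, (Rmult_comm (Cmod (gam (x + 2 * INR k, t)))), G; ring.
Qed.

Section Ratio.

Variables (d t : R).
Hypothesis Hd : 0 < d <= 1 / 4.
Hypothesis Ht : 1 <= t.

Let a : R := 1 / 2 + d.
Let b : R := 1 / 2 - d.

(** Since a + b = 1 and a - b = 2d, the squared moduli of a + 2j + it and b + 2j + it differ by 2d
    (4j + 1); then sqrt(1 + 2y) <= e^y for each factor. *)
Lemma shift_prod_ratio k : shift_prod a t k <=
  shift_prod b t k * exp (d * Rsum (fun j => (4 * INR j + 1) / ((b + 2 * INR j) ^ 2 + t ^ 2)) k).
Proof.
induction k as [|k IH]; cbn [shift_prod Rsum]; [rewrite Rmult_0_r, exp_0; lra |].
rewrite Rmult_plus_distr_l, exp_plus.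
set (e := (4 * INR k + 1) / ((b + 2 * INR k) ^ 2 + t ^ 2)).
set (h := (b + 2 * INR k) ^ 2 + t ^ 2).
assert (Hh : 0 < h) by (unfold h; pose proof (pow2_ge_0 (b + 2 * INR k)); pose proof (pow_lt t 2); nra).
assert (Q : Cmod (a + 2 * INR k, t) <= Cmod (b + 2 * INR k, t) * exp (d * e)).
{ assert (Hr : exp (d * e) = sqrt (exp (2 * (d * e)))).
  { replace (2 * (d * e)) with (d * e + d * e) by ring; rewrite exp_plus, sqrt_square; [reflexivity |].
    apply Rlt_le, exp_pos. }
  rewrite Hr; unfold Cmod; simpl fst; simpl snd; fold h.
  rewrite <- sqrt_mult by (try lra; apply Rlt_le, exp_pos).
  apply sqrt_le_1_alt.
  replace ((a + 2 * INR k) ^ 2 + t ^ 2) with (h * (1 + 2 * (d * e))).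
  - apply Rmult_le_compat_l; [lra | apply exp_ineq1_le].
  - unfold e; fold h; replace (h * (1 + 2 * (d * ((4 * INR k + 1) / h)))) with (h + 2 * d * (4 * INR k + 1)) by (field; lra).
    unfold h, a, b; field. }
pose proof (shift_prod_pos a t k ltac:(unfold a; lra)).
apply (Rle_trans _ (shift_prod b t k * exp (d * Rsum (fun j => (4 * INR j + 1) / ((b + 2 * INR j) ^ 2 + t ^ 2)) k)
  * (Cmod (b + 2 * INR k, t) * exp (d * e)))); [| apply Req_le; ring].
apply Rmult_le_compat; [lra | apply Cmod_ge_0 | exact IH | exact Q].
Qed.

(** With h = 4 j^2 + t^2 the numerator splits as (8j - 4)/2 + 3: the first part is at most half the
    increment of log h, the second telescopes against 1/j - 1/(j + 1). The term j = 0 contributes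
    the 1. *)
Lemma ratio_sum_bound n : Rsum (fun j => (4 * INR j + 1) / ((b + 2 * INR j) ^ 2 + t ^ 2)) (S n) <=
  1 + (ln (4 * INR n ^ 2 + t ^ 2) - ln (t ^ 2)) / 2 + 3 / 2 * (1 - / INR (S n)).
Proof.
assert (Ht2 : 1 <= t ^ 2) by nra.
assert (Hb : 0 < b) by (unfold b; lra).
induction n as [|n IH].
- cbn [Rsum]; change (INR 0) with 0; change (INR 1) with 1.
  replace (4 * 0 ^ 2 + t ^ 2) with (t ^ 2) by ring.
  replace ((4 * 0 + 1) / ((b + 2 * 0) ^ 2 + t ^ 2)) with (/ (b ^ 2 + t ^ 2)).
  2:{ replace (b + 2 * 0) with b by ring; unfold Rdiv; rewrite Rmult_0_r, Rplus_0_l, Rmult_1_l; reflexivity. }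
  assert (/ (b ^ 2 + t ^ 2) <= / 1).
  { apply Rinv_le_contravar; [lra | pose proof (pow2_ge_0 b); lra]. }
  rewrite Rinv_1 in *; lra.
- change (Rsum ?f (S (S n))) with (Rsum f (S n) + f (S n)).
  cbv beta; set (y := INR (S n)) in *.
  assert (Hy : 1 <= y) by apply INR_S_ge_1.
  set (h := 4 * y ^ 2 + t ^ 2); set (h' := 4 * INR n ^ 2 + t ^ 2) in *.
  assert (En : INR n = y - 1) by (unfold y; rewrite S_INR; ring).
  assert (Hh : 0 < h) by (unfold h; nra).
  assert (Hh' : 0 < h') by (unfold h'; pose proof (pow2_ge_0 (INR n)); nra).
  assert (T1 : (4 * y + 1) / ((b + 2 * y) ^ 2 + t ^ 2) <= (4 * y + 1) / h).
  { apply Rmult_le_compat_l; [lra |]; apply Rinv_le_contravar; [exact Hh | unfold h; nra]. }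
  assert (T2 : (8 * y - 4) / h <= ln h - ln h').
  { pose proof (exp_ineq1_le (ln (h' / h))) as X.
    rewrite exp_ln in X by (apply Rdiv_lt_0_compat; assumption).
    rewrite ln_div in X by assumption.
    replace ((8 * y - 4) / h) with (1 - h' / h); [lra |].
    unfold h' in *; rewrite En; unfold h; field; fold h; lra. }
  assert (T3 : 3 / h <= 3 / 2 * (/ y - / (y + 1))).
  { replace (3 / 2 * (/ y - / (y + 1))) with (3 / (2 * y * (y + 1))) by (field; lra).
    apply Rmult_le_compat_l; [lra |]; apply Rinv_le_contravar; unfold h; nra. }
  replace (INR (S (S n))) with (y + 1) by (unfold y; rewrite (S_INR (S n)); reflexivity).
  replace ((4 * y + 1) / h) with ((8 * y - 4) / h / 2 + 3 / h) in T1 by (field; lra).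
  lra.
Qed.

(** The recurrence moves both points to real parts beyond t^2, where |gam(x + it)| is nearly [gr x]
    and [gr_ratio] applies. The large power of y that it yields cancels against the product of
    shifts, leaving t^d; the 5/2 is 1 + 3/2 from [ratio_sum_bound]. *)
Lemma gam_ratio_step n : t ^ 2 < INR (S n) ->
  (1 - t ^ 2 / INR (S n)) * exp (d * (ln t - ln (2 * PI) - 5 / 2 - t ^ 2 / INR (S n))) * Cmod (gam (b, t))
  <= Cmod (gam (a, t)).
Proof.
set (y := INR (S n)); intros Hn.
assert (Hy : 1 <= y) by apply INR_S_ge_1.
assert (Ht2 : 1 <= t ^ 2) by nra.
pose proof PI_RGT_0 as HPI.
set (k := S (S n)).
assert (Ek : INR k = y + 1) by (unfold k; rewrite S_INR; reflexivity).
assert (Ha : 0 < a) by (unfold a; lra).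
assert (Hb : 0 < b) by (unfold b; lra).
pose proof (gam_iter a t k Ha) as Ia; pose proof (gam_iter b t k Hb) as Ib.
rewrite Ek in Ia, Ib.
pose proof (gam_lower (a + 2 * (y + 1)) t ltac:(lra)) as La.
pose proof (Cmod_gam_le (b + 2 * (y + 1), t) ltac:(simpl; lra)) as Lb.
simpl Re in Lb.
pose proof (gr_ratio (b + 2 * (y + 1)) (2 * d) ltac:(lra) ltac:(lra)) as G.
replace (b + 2 * (y + 1) + 2 * d) with (a + 2 * (y + 1)) in G by (unfold a, b; field).
replace (2 * d / 2) with d in G by field.
pose proof (shift_prod_ratio k) as Q.
pose proof (ratio_sum_bound (S n)) as R; fold k y in R.
set (S := Rsum (fun j => (4 * INR j + 1) / ((b + 2 * INR j) ^ 2 + t ^ 2)) k) in *.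
set (E := exp (d * (ln t - ln (2 * PI) - 5 / 2 - t ^ 2 / y))).
pose proof (shift_prod_pos a t k Ha) as Pa; pose proof (shift_prod_pos b t k Hb) as Pb.
pose proof (gr_pos (b + 2 * (y + 1)) ltac:(lra)) as Gb.
pose proof (gr_pos (a + 2 * (y + 1)) ltac:(lra)) as Ga.
assert (Ip : 0 < t ^ 2 / y < 1).
{ split; [apply Rdiv_lt_0_compat; lra |].
  apply (Rmult_lt_reg_r y); [lra |]; unfold Rdiv; rewrite Rmult_assoc, Rinv_l; lra. }
assert (F1 : 1 - t ^ 2 / y <= 1 - t ^ 2 / (4 * (a + 2 * (y + 1) - 2))).
{ assert (t ^ 2 / (4 * (a + 2 * (y + 1) - 2)) <= t ^ 2 / y); [| lra].
  apply Rmult_le_compat_l; [lra |]; apply Rinv_le_contravar; lra. }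
assert (F2 : E * exp (d * S) <= exp (d * ln ((b + 2 * (y + 1) - 2) / (2 * PI)))).
{ unfold E; rewrite <- exp_plus, <- Rmult_plus_distr_l; apply exp_le, Rmult_le_compat_l; [lra |].
  assert (L1 : ln (2 * y) - ln (2 * PI) <= ln ((b + 2 * (y + 1) - 2) / (2 * PI))).
  { rewrite ln_div by lra; apply Rplus_le_compat_r.
    apply (ln_le_mono (2 * y)); lra. }
  assert (L2 : ln (t ^ 2) = 2 * ln t).
  { simpl; rewrite Rmult_1_r, ln_mult by lra; ring. }
  assert (L3 : ln (4 * y ^ 2 + t ^ 2) <= 2 * ln (2 * y) + t ^ 2 / y).
  { replace (4 * y ^ 2 + t ^ 2) with ((2 * y) * (2 * y) * (1 + t ^ 2 / (4 * y ^ 2))) by (field; lra).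
    assert (Hq : 0 < t ^ 2 / (4 * y ^ 2)) by (apply Rdiv_lt_0_compat; nra).
    rewrite !ln_mult by nra.
    assert (X : ln (1 + t ^ 2 / (4 * y ^ 2)) <= t ^ 2 / (4 * y ^ 2)).
    { rewrite <- (ln_exp (t ^ 2 / (4 * y ^ 2))) at 2.
      apply (ln_le_mono (1 + t ^ 2 / (4 * y ^ 2))); [lra | apply exp_ineq1_le]. }
    assert (t ^ 2 / (4 * y ^ 2) <= t ^ 2 / y).
    { apply Rmult_le_compat_l; [lra |]; apply Rinv_le_contravar; nra. }
    lra. }
  assert (0 < / INR (Datatypes.S k)) by (apply Rinv_0_lt_compat; pose proof (INR_S_ge_1 k); lra).
  assert (0 < / INR k) by (apply Rinv_0_lt_compat; lra).
  lra. }
pose proof (exp_pos (d * S)) as PS; pose proof (exp_pos (d * (ln t - ln (2 * PI) - 5 / 2 - t ^ 2 / y)) : 0 < E) as PE.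
set (c := 1 - t ^ 2 / y) in *.
assert (Hc : 0 < c) by (unfold c; lra).
set (X := Cmod (gam (a, t))) in *; set (W := Cmod (gam (b, t))) in *.
set (pp := (2 * PI) ^ k) in *.
assert (Hpp : 0 < pp) by (apply pow_lt; lra).
assert (HW : 0 <= W) by apply Cmod_ge_0.
apply (Rmult_le_reg_r (shift_prod a t k)); [exact Pa |].
rewrite Ia.
apply (Rle_trans _ (c * E * W * (shift_prod b t k * exp (d * S)))).
{ apply Rmult_le_compat_l; [repeat apply Rmult_le_pos; lra | exact Q]. }
replace (c * E * W * (shift_prod b t k * exp (d * S))) with (c * (E * exp (d * S)) * (W * shift_prod b t k)) by ring.
rewrite Ib.
apply (Rle_trans _ (c * (E * exp (d * S)) * (pp * gr (b + 2 * (y + 1))))).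
{ apply Rmult_le_compat_l; [repeat apply Rmult_le_pos; lra |]; apply Rmult_le_compat_l; lra. }
apply (Rle_trans _ (pp * (c * gr (a + 2 * (y + 1))))).
- replace (c * (E * exp (d * S)) * (pp * gr (b + 2 * (y + 1)))) with
    (pp * (c * (E * exp (d * S) * gr (b + 2 * (y + 1))))) by ring.
  apply Rmult_le_compat_l; [lra |]; apply Rmult_le_compat_l; [lra |].
  eapply Rle_trans; [| exact G]; apply Rmult_le_compat_r; [lra | exact F2].
- apply Rmult_le_compat_l; [lra |]; eapply Rle_trans; [| exact La].
  rewrite Rmult_comm; apply Rmult_le_compat_l; lra.
Qed.

Lemma gam_ratio : exp (d * (ln t - ln (2 * PI) - 5 / 2)) * Cmod (gam (b, t)) <= Cmod (gam (a, t)).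
Proof.
set (D := ln t - ln (2 * PI) - 5 / 2).
assert (L0 : is_lim_seq (fun n => t ^ 2 / INR (S n)) 0).
{ replace (Finite 0) with (Rbar_mult (t ^ 2) 0) by (simpl; f_equal; ring).
  apply (is_lim_seq_scal_l (fun n => / INR (S n))).
  replace (Finite 0) with (Rbar_inv p_infty) by reflexivity.
  apply is_lim_seq_inv; [| discriminate].
  apply (is_lim_seq_incr_1 INR), is_lim_seq_INR. }
assert (L : is_lim_seq (fun n => (1 - t ^ 2 / INR (S n)) * exp (d * (D - t ^ 2 / INR (S n))) * Cmod (gam (b, t)))
  ((1 - 0) * exp (d * (D - 0)) * Cmod (gam (b, t)))).
{ apply is_lim_seq_mult'; [apply is_lim_seq_mult' | apply is_lim_seq_const].
  - apply is_lim_seq_minus'; [apply is_lim_seq_const | exact L0].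
  - apply (is_lim_seq_continuous (fun y => exp (d * (D - y)))); [| exact L0].
    eapply continuity_pt_of_derive; auto_derive; [trivial | reflexivity]. }
rewrite !Rminus_0_r, Rmult_1_l in L.
destruct (INR_unbounded (t ^ 2)) as [N HN].
refine (is_lim_seq_le_loc _ (fun _ => Cmod (gam (a, t))) (Finite _) (Finite (Cmod (gam (a, t)))) _ L
  (is_lim_seq_const _)).
exists N; intros n Hn; apply gam_ratio_step.
apply le_INR in Hn; rewrite S_INR; lra.
Qed.

Lemma gam_neq_0 : 0 < Cmod (gam (b, t)).
Proof.
assert (Hb : 0 < b) by (unfold b; lra).
destruct (INR_unbounded (t ^ 2 + 2)) as [k Hk].
pose proof (gam_iter b t k Hb) as I.
pose proof (shift_prod_pos b t k Hb) as P.
assert (Ht2 : 0 <= t ^ 2) by apply pow2_ge_0.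
pose proof (gam_lower (b + 2 * INR k) t ltac:(lra)) as L.
pose proof (gr_pos (b + 2 * INR k) ltac:(lra)) as G.
assert (X : t ^ 2 / (4 * (b + 2 * INR k - 2)) < 1).
{ apply (Rmult_lt_reg_r (4 * (b + 2 * INR k - 2))); [lra |].
  unfold Rdiv; rewrite Rmult_assoc, Rinv_l; lra. }
assert (0 < gr (b + 2 * INR k) * (1 - t ^ 2 / (4 * (b + 2 * INR k - 2)))) by (apply Rmult_lt_0_compat; lra).
assert (0 < (2 * PI) ^ k) by (apply pow_lt; pose proof PI_RGT_0; lra).
apply (Rmult_lt_reg_r (shift_prod b t k)); [exact P |].
rewrite Rmult_0_l, I; apply Rmult_lt_0_compat; lra.
Qed.

End Ratio.

Lemma cpow_conj x s : cpow x (Cconj s) = Cconj (cpow x s).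
Proof.
unfold cpow, Cexp, Cconj; apply injective_projections; simpl.
- replace (fst s * 0 + - snd s * ln x) with (- (fst s * 0 + snd s * ln x)) by ring.
  replace (fst s * ln x - - snd s * 0) with (fst s * ln x - snd s * 0) by ring.
  rewrite cos_neg; reflexivity.
- replace (fst s * 0 + - snd s * ln x) with (- (fst s * 0 + snd s * ln x)) by ring.
  replace (fst s * ln x - - snd s * 0) with (fst s * ln x - snd s * 0) by ring.
  rewrite sin_neg; ring.
Qed.

Lemma Cconj_inv (z : C) : z <> 0 -> Cconj (/ z) = (/ Cconj z)%C.
Proof.
intros Hz; assert (Hd : fst z ^ 2 + snd z ^ 2 <> 0).
{ intros E; apply Hz, Cmod_eq_0; unfold Cmod; rewrite E; apply sqrt_0. }
unfold Cconj, Cinv; apply injective_projections; simpl in *; field; simpl; nra.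
Qed.

Lemma Zp_conj N (s : C) : s <> 1 -> Zp N (Cconj s) = Cconj (Zp N s).
Proof.
intros Hs; pose proof (one_minus_neq_0 s Hs) as H1.
assert (Ep : forall z w, Cconj (z + w) = (Cconj z + Cconj w)%C) by (intros; apply injective_projections; simpl; ring).
assert (Em : forall z w, Cconj (z * w) = (Cconj z * Cconj w)%C) by (intros; apply injective_projections; simpl; ring).
assert (Eo : forall z, Cconj (- z) = (- Cconj z)%C) by (intros; apply injective_projections; simpl; ring).
assert (E1 : (1 - Cconj s)%C = Cconj (1 - s)) by (apply injective_projections; simpl; ring).
assert (Es : forall f n, Cconj (Csum f n) = Csum (fun k => Cconj (f k)) n).
{ intros f n; induction n as [|n IH]; [apply injective_projections; simpl; ring |].
  cbn [Csum]; rewrite Ep, IH; reflexivity. }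
assert (Eb : forall z w, Cconj (z - w) = (Cconj z - Cconj w)%C) by (intros; apply injective_projections; simpl; ring).
unfold Zp; rewrite Eb; unfold Cdiv; rewrite Em, Cconj_inv, Es, E1, cpow_conj by exact H1.
f_equal; apply Csum_ext; intros k _; rewrite <- cpow_conj, Eo; reflexivity.
Qed.

Lemma zeta_conj (s : C) : 0 < Re s -> s <> 1 -> zeta (Cconj s) = Cconj (zeta s).
Proof.
intros H0 H1.
assert (H1' : Cconj s <> 1).
{ intros E; apply H1; apply injective_projections; apply (f_equal fst) in E as E1;
    apply (f_equal snd) in E; simpl in *; lra. }
apply (proj2 (Ceq_minus _ _)), Cmod_eq_0, Rle_antisym; [| apply Cmod_ge_0].
apply le_epsilon; intros eps He.
destruct (Zp_cvg s H0 H1 (eps / 2) ltac:(lra)) as [n1 Q1].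
destruct (Zp_cvg (Cconj s) H0 H1' (eps / 2) ltac:(lra)) as [n2 Q2].
set (N := max n1 n2); specialize (Q1 N ltac:(lia)); specialize (Q2 N ltac:(lia)).
rewrite Zp_conj in Q2 by exact H1.
replace (zeta (Cconj s) - Cconj (zeta s))%C with
  ((zeta (Cconj s) - Cconj (Zp N s)) + - Cconj (zeta s - Zp N s))%C
  by (apply injective_projections; simpl; ring).
eapply Rle_trans; [apply Cmod_triangle |]; rewrite Cmod_opp, Cmod_conj; lra.
Qed.

(** For s = 1/2 - d + it the point 1 - s is the conjugate of 1/2 + d + it, so the functional
    equation and conjugation compare the two lines at the same height. *)
Lemma zeta_ratio d t : 0 < d <= 1 / 4 -> 1 <= t ->
  Cmod (zeta (1 / 2 + d, t)) <= exp (- (d * (ln t - ln (2 * PI) - 5 / 2))) * Cmod (zeta (1 / 2 - d, t)).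
Proof.
intros Hd Ht.
pose proof (functional_equation (1 / 2 - d, t) ltac:(simpl; lra)) as F.
replace (1 - ((1 / 2 - d)%R, t))%C with (Cconj (1 / 2 + d, t)) in F
  by (apply injective_projections; simpl; field).
rewrite gam_conj, zeta_conj in F; [| simpl; lra | intros E; apply (f_equal snd) in E; simpl in E; lra | simpl; lra].
apply (f_equal Cmod) in F; rewrite !Cmod_mult, !Cmod_conj in F.
pose proof (gam_ratio d t Hd Ht) as G; pose proof (gam_neq_0 d t Hd) as P.
set (D := d * (ln t - ln (2 * PI) - 5 / 2)) in *.
rewrite exp_Ropp; pose proof (exp_pos D).
apply (Rmult_le_reg_l (exp D * Cmod (gam (1 / 2 - d, t)))); [apply Rmult_lt_0_compat; lra |].
replace (exp D * Cmod (gam (1 / 2 - d, t)) * (/ exp D * Cmod (zeta (1 / 2 - d, t))))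
  with (Cmod (gam (1 / 2 - d, t)) * Cmod (zeta (1 / 2 - d, t))) by (field; lra).
rewrite F; apply Rmult_le_compat_r; [apply Cmod_ge_0 | exact G].
Qed.

(** * Size of [zeta] and of the mollifier *)

Definition Mp (a : nat -> C) (n : nat) (s : C) : C :=
  Csum (fun i => a (S i) * cpow (INR (S i)) (- s))%C n.

Lemma dirichlet_poly_Mp a x s : dirichlet_poly a x s = Mp a (nat_floor x) s.
Proof.
unfold dirichlet_poly, Mp; induction (nat_floor x) as [|n IH].
- rewrite sum_n_m_zero by lia; reflexivity.
- rewrite sum_n_Sm by lia; cbn [Csum]; rewrite IH, cpow_opp; reflexivity.
Qed.

Lemma smooth_Mp k a n : smooth k (Mp a n).
Proof.
apply (smooth_Csum k (fun i s => a (S i) * cpow (INR (S i)) (- s))%C).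
intros i; apply smooth_mult; [apply smooth_const | apply smooth_cpow_opp].
Qed.

Lemma smooth_Zp k N : smooth k (Zp N).
Proof.
apply smooth_minus; [apply (smooth_Csum k (fun i s => cpow (INR (S i)) (- s))); intros; apply smooth_cpow_opp |].
apply (smooth_mult k (fun s => cpow (INR (S N)) (1 - s)) (fun s => / (1 - s))%C);
  [| apply smooth_inv_1_minus].
eapply (smooth_ext k (fun s => Cexp (- ln (INR (S N)) * s + ln (INR (S N))))%C); [| apply smooth_Cexp].
intros s; unfold cpow; f_equal; ring.
Qed.

Lemma Rinv_range y : 1 <= y -> 0 < / y <= 1.
Proof.
intros Hy; split; [apply Rinv_0_lt_compat; lra |].
apply (Rle_trans _ (/ 1)); [apply Rinv_le_contravar; lra | rewrite Rinv_1; lra].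
Qed.

Lemma pair_neq_1 (x t : R) : 0 < t -> ((x, t) : C) <> 1.
Proof. intros Ht E; apply (f_equal snd) in E; simpl in E; lra. Qed.

Lemma Cmod_1_minus_ge (x t : R) : 0 <= t -> t <= Cmod (1 - (x, t)).
Proof.
intros Ht; eapply Rle_trans; [| apply im_le_Cmod]; unfold Im; simpl.
rewrite Rabs_left1 by lra; lra.
Qed.

Lemma Cmod_pair_le (x t : R) : 0 <= x -> 0 <= t -> Cmod (x, t) <= x + t.
Proof.
intros Hx Ht; eapply Rle_trans; [apply Cmod_le_sum |]; simpl; rewrite !Rabs_pos_eq by lra; lra.
Qed.

Lemma Cmod_cpow_pair x t n : Cmod (cpow (INR (S n)) (- (x, t))) = exp (- x * ln (INR (S n))).
Proof. rewrite Cmod_cpow; f_equal; unfold Re; simpl; ring. Qed.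

Lemma ln_INR_S n : 0 <= ln (INR (S n)).
Proof. apply ln_nonneg, INR_S_ge_1. Qed.

Lemma zeta_bound x t : 1 / 4 <= x -> 1 <= t -> Cmod (zeta (x, t)) <= 3 + 4 * (x + t).
Proof.
intros Hx Ht.
pose proof (Zp_tail (x, t) 1 ltac:(simpl; lra) (pair_neq_1 x t ltac:(lra)) (le_n 1)) as Z.
change (INR 1) with 1 in Z; rewrite ln_1, Rmult_0_r, exp_0, Rmult_1_r in Z.
assert (Z1 : Cmod (Zp 1 (x, t)) <= 3).
{ unfold Zp; cbn [Csum]; change (INR 1) with 1; rewrite cpow_1_l.
  replace (0 + 1 - cpow (INR 2) (1 - (x, t)) / (1 - (x, t)))%C with
    (1 + - (cpow (INR 2) (1 - (x, t)) * / (1 - (x, t))))%C by (unfold Cdiv; ring).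
  eapply Rle_trans; [apply Cmod_triangle |]; rewrite Cmod_1, Cmod_opp, Cmod_mult.
  pose proof (Cmod_1_minus_ge x t ltac:(lra)).
  rewrite Cmod_inv by (apply Cmod_gt_0; lra).
  assert (Cmod (cpow (INR 2) (1 - (x, t))) <= 2).
  { rewrite Cmod_cpow; change (INR 2) with (1 + 1).
    apply (Rle_trans _ (exp (ln 2))); [apply exp_le | rewrite exp_ln; lra].
    pose proof (ln_nonneg 2 ltac:(lra)).
    replace (Re (1 - (x, t))%C) with (1 - x) by (unfold Re; simpl; ring).
    replace (1 + 1) with 2 by ring; nra. }
  destruct (Rinv_range (Cmod (1 - (x, t))) ltac:(lra)).
  pose proof (Cmod_ge_0 (cpow (INR 2) (1 - (x, t)))); nra. }
simpl Re in Z.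
assert (Cmod (x, t) / x <= 4 * (x + t)).
{ pose proof (Cmod_pair_le x t ltac:(lra) ltac:(lra)).
  assert (/ x <= 4) by (replace 4 with (/ (1 / 4)) by field; apply Rinv_le_contravar; lra).
  pose proof (Cmod_ge_0 (x, t)); assert (0 < / x) by (apply Rinv_0_lt_compat; lra).
  unfold Rdiv; nra. }
replace (zeta (x, t)) with ((zeta (x, t) - Zp 1 (x, t)) + Zp 1 (x, t))%C by ring.
eapply Rle_trans; [apply Cmod_triangle | lra].
Qed.

Lemma Zp_approx x t N : 1 / 4 <= x -> 0 < t -> (1 <= N)%nat ->
  Cmod (zeta (x, t) - Zp N (x, t)) <= 4 * (x + t) * exp (- (ln (INR N) / 4)).
Proof.
intros Hx Ht HN.
pose proof (Zp_tail (x, t) N ltac:(simpl; lra) (pair_neq_1 x t Ht) HN) as Z; simpl Re in Z.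
eapply Rle_trans; [exact Z |].
pose proof (Cmod_pair_le x t ltac:(lra) ltac:(lra)) as P; pose proof (Cmod_ge_0 (x, t)).
assert (0 <= / x <= 4).
{ split; [apply Rlt_le, Rinv_0_lt_compat; lra |].
  replace 4 with (/ (1 / 4)) by field; apply Rinv_le_contravar; lra. }
apply Rmult_le_compat; [unfold Rdiv; nra | apply Rlt_le, exp_pos | unfold Rdiv; nra |].
apply exp_le; destruct N as [|N]; [lia |]; pose proof (ln_INR_S N); nra.
Qed.

Lemma Mp_bound (a : nat -> C) n K x t : 0 <= x ->
  (forall i, (i < n)%nat -> Cmod (a (S i)) <= K * INR (S i)) -> 0 <= K ->
  Cmod (Mp a n (x, t)) <= K * INR n ^ 2.
Proof.
intros Hx Ha HK; unfold Mp; eapply Rle_trans; [apply Csum_mod |].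
apply (Rle_trans _ (Rsum (fun _ => K * INR n) n)).
- apply Rsum_le; intros i Hi; rewrite Cmod_mult, Cmod_cpow_pair.
  assert (exp (- x * ln (INR (S i))) <= 1).
  { rewrite <- exp_0; apply exp_le; pose proof (ln_INR_S i); nra. }
  pose proof (exp_pos (- x * ln (INR (S i)))).
  specialize (Ha i Hi); pose proof (Cmod_ge_0 (a (S i))).
  assert (INR (S i) <= INR n) by (apply le_INR; lia).
  assert (K * INR (S i) <= K * INR n) by (apply Rmult_le_compat_l; lra).
  nra.
- rewrite Rsum_const; apply Req_le; ring.
Qed.

Lemma Rsum_inv_sq n : Rsum (fun i => / INR (S (S i)) ^ 2) n <= 1 - / INR (S n).
Proof.
induction n as [|n IH]; [simpl; rewrite Rinv_1; lra |].
cbn [Rsum]; pose proof (INR_S_ge_1 n); set (y := INR (S n)) in *.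
rewrite (S_INR (S n)); fold y.
assert (/ (y + 1) ^ 2 <= / y - / (y + 1)); [| lra].
replace (/ y - / (y + 1)) with (/ (y * (y + 1))) by (field; lra).
apply Rinv_le_contravar; nra.
Qed.

(** For y >= 2 one has ln y >= 1/2, so y^(1 - S0) = y^(-2) y^(3 - S0) splits into a summable factor
    and one that is small uniformly in y. *)
Lemma exp_ln_decay S0 n : 3 <= S0 ->
  INR (S (S n)) * exp (- S0 * ln (INR (S (S n)))) <= exp (- ((S0 - 3) / 2)) * / INR (S (S n)) ^ 2.
Proof.
intros HS; set (y := INR (S (S n))).
assert (Hy : 2 <= y) by (unfold y; rewrite (S_INR (S n)); pose proof (INR_S_ge_1 n); lra).
assert (L2 : 1 / 2 <= ln y).
{ eapply Rle_trans; [| apply (ln_le_mono 2); lra].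
  pose proof ln_lt_2; lra. }
replace (/ y ^ 2) with (exp (- (2) * ln y)).
2:{ replace (- (2) * ln y) with (- (ln y + ln y)) by ring.
    rewrite exp_Ropp, exp_plus, exp_ln by lra; f_equal; ring. }
rewrite <- (exp_ln y) at 1 by lra; rewrite <- !exp_plus; apply exp_le; nra.
Qed.

Lemma Dirichlet_right (b : nat -> C) n K S0 t : 3 <= S0 -> 0 <= K ->
  (forall i, (i < n)%nat -> Cmod (b i) <= K * INR (S (S i))) ->
  Cmod (Csum (fun i => b i * cpow (INR (S (S i))) (- (S0, t)))%C n) <= K * exp (- ((S0 - 3) / 2)).
Proof.
intros HS HK Hb; eapply Rle_trans; [apply Csum_mod |].
apply (Rle_trans _ (Rsum (fun i => K * exp (- ((S0 - 3) / 2)) * / INR (S (S i)) ^ 2) n)).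
- apply Rsum_le; intros i Hi; rewrite Cmod_mult, Cmod_cpow_pair.
  apply (Rle_trans _ (K * INR (S (S i)) * exp (- S0 * ln (INR (S (S i)))))).
  + apply Rmult_le_compat_r; [apply Rlt_le, exp_pos | auto].
  + rewrite !Rmult_assoc; apply Rmult_le_compat_l; [exact HK | apply exp_ln_decay, HS].
- rewrite Rsum_scal.
  assert (Rsum (fun i => / INR (S (S i)) ^ 2) n <= 1).
  { eapply Rle_trans; [apply Rsum_inv_sq |].
    assert (0 < / INR (S n)) by (apply Rinv_0_lt_compat; pose proof (INR_S_ge_1 n); lra); lra. }
  rewrite <- (Rmult_1_r (K * _)) at 2; apply Rmult_le_compat_l; [| assumption].
  apply Rmult_le_pos; [exact HK | apply Rlt_le, exp_pos].
Qed.

Lemma Mp_right (a : nat -> C) n K S0 t : 3 <= S0 -> 0 <= K -> (1 <= n)%nat -> a 1%nat = 1 ->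
  (forall i, (i < n)%nat -> Cmod (a (S i)) <= K * INR (S i)) ->
  Cmod (Mp a n (S0, t) - 1) <= K * exp (- ((S0 - 3) / 2)).
Proof.
intros HS HK Hn H1 Ha; destruct n as [|n]; [lia |].
unfold Mp; rewrite Csum_S_l, H1; change (INR 1) with 1; rewrite cpow_1_l.
replace (_ - _)%C with (Csum (fun i => a (S (S i)) * cpow (INR (S (S i))) (- (S0, t)))%C n) by ring.
apply (Dirichlet_right (fun i => a (S (S i)))); auto.
intros i Hi; apply Ha; lia.
Qed.

Lemma Zp_right N S0 t : 3 <= S0 -> 1 <= t -> (1 <= N)%nat ->
  Cmod (Zp N (S0, t) - 1) <= 2 * exp (- ((S0 - 3) / 2)).
Proof.
intros HS Ht HN; destruct N as [|N]; [lia |].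
unfold Zp; rewrite Csum_S_l; change (INR 1) with 1; rewrite cpow_1_l.
replace (_ - _)%C with (Csum (fun i => 1 * cpow (INR (S (S i))) (- (S0, t)))%C N
  + - (cpow (INR (S (S N))) (1 - (S0, t)) * / (1 - (S0, t))))%C.
2:{ rewrite (Csum_ext (fun i => 1 * _)%C (fun i => cpow (INR (S (S i))) (- (S0, t))))
      by (intros; ring); unfold Cdiv; ring. }
eapply Rle_trans; [apply Cmod_triangle |]; rewrite Cmod_opp, Cmod_mult.
assert (A1 : Cmod (Csum (fun i => 1 * cpow (INR (S (S i))) (- (S0, t)))%C N) <= 1 * exp (- ((S0 - 3) / 2))).
{ apply (Dirichlet_right (fun _ => 1)); [exact HS | lra |].
  intros i _; rewrite Cmod_1; pose proof (INR_S_ge_1 (S i)); lra. }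
pose proof (Cmod_1_minus_ge S0 t ltac:(lra)).
rewrite Cmod_inv by (apply Cmod_gt_0; lra).
destruct (Rinv_range (Cmod (1 - (S0, t))) ltac:(lra)).
assert (A2 : Cmod (cpow (INR (S (S N))) (1 - (S0, t))) <= exp (- ((S0 - 3) / 2))).
{ rewrite Cmod_cpow; pose proof (exp_ln_decay S0 N HS) as D.
  pose proof (INR_S_ge_1 (S N)); set (y := INR (S (S N))) in *.
  replace (Re (1 - (S0, t))%C * ln y) with (ln y + - S0 * ln y) by (unfold Re; simpl; ring).
  rewrite exp_plus, exp_ln by lra; eapply Rle_trans; [exact D |].
  destruct (Rinv_range (y ^ 2) ltac:(nra)); pose proof (exp_pos (- ((S0 - 3) / 2))); nra. }
pose proof (Cmod_ge_0 (cpow (INR (S (S N))) (1 - (S0, t)))); nra.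
Qed.

(** Provides the boundary data far to the right when Jensen's inequality is applied to G = M (2 - Z
    M). *)
Lemma mollified_right (z m : C) nu : nu <= 1 -> Cmod (z - 1) <= nu -> Cmod (m - 1) <= nu ->
  Cmod (m * (2 - z * m) - 1) <= 7 * nu.
Proof.
intros H1 Hz Hm; set (y := (z - 1)%C) in *; set (x := (m - 1)%C) in *.
replace (m * (2 - z * m) - 1)%C with (x + - ((1 + x) * (x + (y + x * y))))%C
  by (unfold x, y; ring).
eapply Rle_trans; [apply Cmod_triangle |]; rewrite Cmod_opp, Cmod_mult.
assert (A : Cmod (1 + x) <= 2).
{ eapply Rle_trans; [apply Cmod_triangle |]; rewrite Cmod_1; lra. }
pose proof (Cmod_ge_0 x); pose proof (Cmod_ge_0 y).
assert (B : Cmod (x + (y + x * y)) <= 3 * nu).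
{ eapply Rle_trans; [apply Cmod_triangle |].
  eapply Rle_trans; [apply Rplus_le_compat_l, Cmod_triangle |]; rewrite Cmod_mult; nra. }
pose proof (Cmod_ge_0 (1 + x)); pose proof (Cmod_ge_0 (x + (y + x * y))); nra.
Qed.

Lemma ln_le_sub_1 x : 0 < x -> ln x <= x - 1.
Proof. intros Hx; pose proof (exp_ineq1_le (ln x)); rewrite exp_ln in *; lra. Qed.

Lemma log_close (G : C) tau eps : Cmod (G - 1) <= tau -> tau <= 1 / 4 -> 0 < eps <= tau ->
  Rabs (ln (Cmod G ^ 2 + eps) / 2) <= 2 * tau.
Proof.
intros HG Ht He.
assert (U : Cmod G <= 1 + tau).
{ replace G with (1 + (G - 1))%C by ring; eapply Rle_trans; [apply Cmod_triangle |].
  rewrite Cmod_1; lra. }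
assert (L : 1 - tau <= Cmod G).
{ pose proof (Cmod_triangle G (- (G - 1))) as T; rewrite Cmod_opp in T.
  replace (G + - (G - 1))%C with (RtoC 1) in T by ring; rewrite Cmod_1 in T; lra. }
assert (Q1 : (1 - tau) ^ 2 <= Cmod G ^ 2) by (apply pow_incr; lra).
assert (Q2 : Cmod G ^ 2 <= (1 + tau) ^ 2) by (apply pow_incr; lra).
set (q := Cmod G ^ 2 + eps) in *.
assert (Hq : 0 < q) by (unfold q; nra).
pose proof (ln_le_sub_1 q Hq) as B1.
assert (B2 : 1 - / q <= ln q).
{ pose proof (ln_le_sub_1 (/ q) (Rinv_0_lt_compat _ Hq)) as B; rewrite ln_Rinv in B by exact Hq; lra. }
assert (/ q <= 1 + 4 * tau).
{ apply (Rmult_le_reg_l q); [exact Hq |]; rewrite Rinv_r by lra.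
  assert ((1 - tau) ^ 2 * (1 + 4 * tau) >= 1) by (simpl; nra).
  unfold q; nra. }
apply Rabs_le; unfold q in *; simpl in *; nra.
Qed.

Lemma log_range q Q B eps : 0 <= q <= Q -> 0 < eps <= 1 -> 1 <= Q ->
  ln (2 * Q) <= 2 * B -> - ln eps <= 2 * B -> Rabs (ln (q + eps) / 2) <= B.
Proof.
intros Hq He HQ H1 H2.
assert (ln (q + eps) <= ln (2 * Q)) by (apply ln_le; lra).
assert (ln eps <= ln (q + eps)) by (apply ln_le; lra).
apply Rabs_le; lra.
Qed.

(** Here [zp] and [zm] are the values at 1/2 + d and 1/2 - d. With g = m (2 - zm m) one has zm g = 1
    - f^2 for f = 1 - zm m, so |zp g| is at most rho (1 + |f|^2) up to errors, and log(1 + |f|^2) <=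
    |f|^2. The terms [e1] and [eps] pay for replacing [zeta] by [Zp] and for regularising the
    logarithm. *)
Lemma log_pointwise (zp zm m : C) rho e1 eps T : 1 / 2 <= rho -> 1 <= T -> 0 < eps ->
  Cmod zp <= rho * Cmod zm + e1 ->
  e1 * Cmod (m * (2 - zm * m)) <= 2 / T ->
  eps * (Cmod zp ^ 2 + Cmod (m * (2 - zm * m)) ^ 2 + eps) <= (1 / T) ^ 2 ->
  ln (Cmod zp ^ 2 + eps) / 2 + ln (Cmod (m * (2 - zm * m)) ^ 2 + eps) / 2 <=
  ln rho + Cmod (1 - zm * m) ^ 2 + 6 / T.
Proof.
intros Hr HT He H1 H2 H3; set (g := (m * (2 - zm * m))%C) in *.
pose proof (Cmod_ge_0 zp) as P1; pose proof (Cmod_ge_0 g) as P2; pose proof (Cmod_ge_0 zm) as P3.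
set (f := Cmod (1 - zm * m)).
assert (Pf : 0 <= f) by apply Cmod_ge_0.
assert (HiT : 0 < / T) by (apply Rinv_0_lt_compat; lra).
assert (A : Cmod zm * Cmod g <= 1 + f ^ 2).
{ rewrite <- Cmod_mult; replace (zm * g)%C with (1 + - ((1 - zm * m) * (1 - zm * m)))%C
    by (unfold g; ring).
  eapply Rle_trans; [apply Cmod_triangle |]; rewrite Cmod_1, Cmod_opp, Cmod_mult; fold f.
  apply Req_le; ring. }
assert (B : Cmod zp * Cmod g <= rho * (1 + f ^ 2) + 2 / T).
{ apply (Rle_trans _ ((rho * Cmod zm + e1) * Cmod g)); [apply Rmult_le_compat_r; assumption |].
  assert (rho * (Cmod zm * Cmod g) <= rho * (1 + f ^ 2)) by (apply Rmult_le_compat_l; lra).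
  lra. }
set (Y := rho * (1 + f ^ 2)) in *.
assert (HY : 1 / 2 <= Y) by (unfold Y; pose proof (pow2_ge_0 f); nra).
assert (Q : (Cmod zp ^ 2 + eps) * (Cmod g ^ 2 + eps) <= (Y + 3 / T) ^ 2).
{ assert ((Cmod zp * Cmod g) ^ 2 <= (Y + 2 / T) ^ 2).
  { apply pow_incr; split; [apply Rmult_le_pos; assumption | exact B]. }
  replace ((Cmod zp ^ 2 + eps) * (Cmod g ^ 2 + eps)) with
    ((Cmod zp * Cmod g) ^ 2 + eps * (Cmod zp ^ 2 + Cmod g ^ 2 + eps)) by ring.
  unfold Rdiv in *; simpl in *; nra. }
assert (Z1 : 0 < Cmod zp ^ 2 + eps) by (pose proof (pow2_ge_0 (Cmod zp)); lra).
assert (Z2 : 0 < Cmod g ^ 2 + eps) by (pose proof (pow2_ge_0 (Cmod g)); lra).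
assert (Z3 : 0 < 3 / T) by (unfold Rdiv; lra).
assert (E : ln ((Cmod zp ^ 2 + eps) * (Cmod g ^ 2 + eps)) <= ln ((Y + 3 / T) ^ 2)).
{ apply ln_le; [nra | exact Q]. }
rewrite ln_mult in E by assumption.
replace ((Y + 3 / T) ^ 2) with ((Y + 3 / T) * (Y + 3 / T)) in E by ring.
rewrite ln_mult in E by lra.
replace (Y + 3 / T) with (rho * ((1 + f ^ 2) * (1 + 3 / T / Y))) in E.
2:{ unfold Y; pose proof (pow2_ge_0 f); field; repeat split; lra. }
pose proof (pow2_ge_0 f).
assert (Z4 : 0 < 3 / T / Y <= 6 / T).
{ split; [apply Rdiv_lt_0_compat; lra |].
  replace (6 / T) with (3 / T * / (1 / 2)) by (field; lra).
  apply Rmult_le_compat_l; [lra | apply Rinv_le_contravar; lra]. }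
assert (Hp1 : 0 < 1 + f ^ 2) by lra.
assert (Hp2 : 0 < 1 + 3 / T / Y) by lra.
rewrite !ln_mult in E by (try assumption; try lra; apply Rmult_lt_0_compat; assumption).
pose proof (ln_le_sub_1 (1 + f ^ 2) ltac:(lra)).
pose proof (ln_le_sub_1 (1 + 3 / T / Y) ltac:(lra)).
lra.
Qed.

(** * Long mollifiers *)

Lemma zeta_line_cont (x t : R) : 0 < x -> 0 < t ->
  continuous (fun t => Re (zeta (x, t))) t /\ continuous (fun t => Im (zeta (x, t))) t.
Proof.
intros Hx Ht.
pose proof (ex_derive_continuous _ _ (zeta_derivable (x, t) Hx (pair_neq_1 x t Ht))) as Cz.
assert (H : forall eps : posreal, exists del : posreal, forall u, Rabs (u - t) < del ->
  Cmod (zeta (x, u) - zeta (x, t)) < eps).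
{ intros eps.
  destruct (proj1 (filterlim_locally_ball_norm _ _) Cz eps) as [del Hdel].
  exists del; intros u Hu; apply Hdel.
  change (Cmod ((x, u) - (x, t)) < del).
  replace ((x, u) - (x, t))%C with (Ci * RtoC (u - t))%C
    by (apply injective_projections; simpl; ring).
  rewrite Cmod_mult, Cmod_R.
  assert (Cmod Ci = 1) as ->; [| lra].
  unfold Cmod, Ci; simpl; rewrite Rmult_0_l, !Rmult_1_l, Rplus_0_l; apply sqrt_1. }
split; apply filterlim_locally; intros eps; destruct (H eps) as [del Hd]; exists del; intros u Hu.
- eapply Rle_lt_trans; [apply (re_le_Cmod (zeta (x, u) - zeta (x, t))) | apply Hd, Hu].
- eapply Rle_lt_trans; [apply (im_le_Cmod (zeta (x, u) - zeta (x, t))) | apply Hd, Hu].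
Qed.

Lemma Cmod_le_l (z w : C) : Cmod z <= Cmod w + Cmod (z - w).
Proof. replace z with (w + (z - w))%C at 1 by ring; apply Cmod_triangle. Qed.

Lemma Cmod_le_r (z w : C) : Cmod w <= Cmod z + Cmod (z - w).
Proof. replace (z - w)%C with (- (w - z))%C by ring; rewrite Cmod_opp; apply Cmod_le_l. Qed.

Lemma Cmod_sq (z : C) : Cmod z ^ 2 = Re z * Re z + Im z * Im z.
Proof. unfold Cmod, Re, Im; rewrite pow2_sqrt; [ring | nra]. Qed.

Lemma mollified_cont (M : C -> C) x t : smooth 0 M -> 0 < x -> 0 < t ->
  continuous (fun t => Cmod (1 - zeta (x, t) * M (x, t))%C ^ 2) t.
Proof.
intros [[M1 M2] _] Hx Ht.
destruct (zeta_line_cont x t Hx Ht) as [Z1 Z2].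
pose proof (cont2_slice _ x t M1 Ht) as N1; pose proof (cont2_slice _ x t M2 Ht) as N2.
apply (continuous_ext (fun t =>
  (1 - (Re (zeta (x, t)) * Re (M (x, t)) - Im (zeta (x, t)) * Im (M (x, t)))) *
  (1 - (Re (zeta (x, t)) * Re (M (x, t)) - Im (zeta (x, t)) * Im (M (x, t)))) +
  (Re (zeta (x, t)) * Im (M (x, t)) + Im (zeta (x, t)) * Re (M (x, t))) *
  (Re (zeta (x, t)) * Im (M (x, t)) + Im (zeta (x, t)) * Re (M (x, t))))).
- intros u; rewrite Cmod_sq; unfold Re, Im; simpl; ring.
- pose proof (continuous_minus (V := R_NormedModule) _ _ _
    (continuous_Rmult _ _ t Z1 N1) (continuous_Rmult _ _ t Z2 N2)) as A.
  pose proof (continuous_minus (V := R_NormedModule) (fun _ => 1) _ _ (continuous_const 1 t) A) as A1.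
  pose proof (continuous_plus (V := R_NormedModule) _ _ _
    (continuous_Rmult _ _ t Z1 N2) (continuous_Rmult _ _ t Z2 N1)) as B.
  exact (continuous_plus (V := R_NormedModule) _ _ _
    (continuous_Rmult _ _ t A1 A1) (continuous_Rmult _ _ t B B)).
Qed.

(** The passage from [zeta] to [Zp N], by (x + y)^2 <= 2 x^2 + 2 y^2. Here [zeta] itself stands
    under an integral, and its continuity on the line supplies integrability. *)
Lemma moment_Zp a n N T err : 1 <= T ->
  (forall t, T <= t <= 2 * T ->
     Cmod (zeta (1 / 2, t) - Zp N (1 / 2, t)) * Cmod (Mp a n (1 / 2, t)) <= err) ->
  RInt (fun t => Cmod (1 - Zp N (1 / 2, t) * Mp a n (1 / 2, t)) ^ 2) T (2 * T) <=
  T * (2 * mollified_moment (Mp a n) T + 2 * err ^ 2).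
Proof.
intros HT Herr.
assert (I1 : ex_RInt (fun t => Cmod (1 - zeta (1 / 2, t) * Mp a n (1 / 2, t)) ^ 2) T (2 * T)).
{ apply (ex_RInt_continuous (V := R_CompleteNormedModule)); intros t.
  rewrite Rmin_left by lra; intros Ht; apply mollified_cont; [apply smooth_Mp | lra | lra]. }
assert (SF : smooth 2 (fun s => 1 - Zp N s * Mp a n s)%C).
{ apply smooth_minus; [apply smooth_const | apply smooth_mult; [apply smooth_Zp | apply smooth_Mp]]. }
assert (I2 : ex_RInt (fun t => Cmod (1 - Zp N (1 / 2, t) * Mp a n (1 / 2, t)) ^ 2) T (2 * T)).
{ apply (ex_RInt_slice (fun x t => Cmod (1 - Zp N (x, t) * Mp a n (x, t)) ^ 2) (1 / 2)); [lra |].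
  exact (hol_cont2 (fun s => 1 - Zp N s * Mp a n s)%C (fun q => q) (fun _ => 1) SF
    (fun q _ => is_derive_id (K := R_AbsRing) q)). }
assert (E : mollified_moment (Mp a n) T =
  / T * RInt (fun t => Cmod (1 - zeta (1 / 2, t) * Mp a n (1 / 2, t)) ^ 2) T (2 * T)).
{ unfold mollified_moment; f_equal; apply RInt_ext; intros t _; cbv zeta.
  replace (RtoC (1 / 2) + Ci * RtoC t)%C with ((1 / 2)%R, t); [reflexivity |].
  apply injective_projections; simpl; ring. }
set (A := RInt (fun t => Cmod (1 - zeta (1 / 2, t) * Mp a n (1 / 2, t)) ^ 2) T (2 * T)) in *.
rewrite E; replace (T * (2 * (/ T * A) + 2 * err ^ 2)) with (2 * A + T * (2 * err ^ 2)) by (field; lra).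
apply (Rle_trans _ (RInt (fun t => 2 * Cmod (1 - zeta (1 / 2, t) * Mp a n (1 / 2, t)) ^ 2 + 2 * err ^ 2) T (2 * T))).
- apply RInt_le; [lra | exact I2 | |].
  + apply (ex_RInt_plus (V := R_NormedModule)); [| apply ex_RInt_const].
    exact (ex_RInt_scal (V := R_NormedModule) _ _ _ 2 I1).
  + intros t Ht; specialize (Herr t ltac:(lra)).
    set (f := (1 - zeta ((1 / 2)%R, t) * Mp a n ((1 / 2)%R, t))%C).
    replace (1 - Zp N ((1 / 2)%R, t) * Mp a n ((1 / 2)%R, t))%C with
      (f + (zeta ((1 / 2)%R, t) - Zp N ((1 / 2)%R, t)) * Mp a n ((1 / 2)%R, t))%C by (unfold f; ring).
    pose proof (Cmod_triangle f ((zeta ((1 / 2)%R, t) - Zp N ((1 / 2)%R, t)) * Mp a n ((1 / 2)%R, t))) as Tr.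
    rewrite Cmod_mult in Tr.
    set (g := (f + (zeta ((1 / 2)%R, t) - Zp N ((1 / 2)%R, t)) * Mp a n ((1 / 2)%R, t))%C) in *.
    pose proof (Cmod_ge_0 g); pose proof (Cmod_ge_0 f).
    assert (G : Cmod g <= Cmod f + err) by lra.
    assert (Cmod g ^ 2 <= (Cmod f + err) ^ 2) by (apply pow_incr; lra).
    pose proof (pow2_ge_0 (Cmod f - err)); simpl in *; nra.
- rewrite (RInt_Rplus _ _ _ _ (ex_RInt_Rscal 2 _ _ _ I1) (ex_RInt_const _ _ _)).
  rewrite RInt_Rscal, RInt_Rconst by exact I1; fold A; apply Req_le; ring.
Qed.

Lemma pow_le_exp n C : exists L0, 1 <= L0 /\ forall L, L0 <= L -> C * L ^ n <= exp L.
Proof.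
set (m := INR (S n)).
assert (Hm : 1 <= m) by apply INR_S_ge_1.
exists (Rmax 1 (C * m ^ S n)); split; [apply Rmax_l |].
intros L HL; pose proof (Rmax_l 1 (C * m ^ S n)); pose proof (Rmax_r 1 (C * m ^ S n)).
assert (B : (L / m) ^ S n <= exp L).
{ replace (exp L) with (exp (L / m) ^ S n).
  - apply pow_incr; split.
    + apply Rmult_le_pos; [lra | apply Rlt_le, Rinv_0_lt_compat; lra].
    + pose proof (exp_ineq1_le (L / m)); lra.
  - rewrite <- exp_INR_mult; f_equal; fold m; field; lra. }
assert (Pm : 0 < m ^ S n) by (apply pow_lt; lra).
assert (PL : 0 < L ^ n) by (apply pow_lt; lra).
unfold Rdiv in B; rewrite Rpow_mult_distr, pow_inv in B.
eapply Rle_trans; [| exact B].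
apply (Rmult_le_reg_r (m ^ S n)); [exact Pm |].
rewrite (Rmult_assoc (L ^ S n)), Rinv_l, Rmult_1_r by lra.
change (L ^ S n) with (L * L ^ n); nra.
Qed.

Section PartB.

Variables (theta K S0 : R) (a : nat -> C) (n N : nat) (L : R).
(** L is log T. T^D dominates |Z|, |M|, |1 - Z M| and |G| in the region used. Rr = 1 / (4D + 2) is
    the r of the overview and makes the tilting factor of [upper_mean] cost only e^2; eps =
    T^(-2D-4) stays below T^(-2) even after multiplication by 3 T^(2D). *)
Let T : R := exp L.
Let D : R := 6 + 4 * theta.
Let Rr : R := / (4 * D + 2).
Let d : R := Rr / L.
Let eps : R := exp (- (2 * D + 4) * L).

Hypothesis Htheta : 0 < theta.
Hypothesis HnT : INR n <= exp (theta * L).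
Hypothesis Ha : forall i, (i < n)%nat -> Cmod (a (S i)) <= K * INR (S i).
Hypothesis HK : 0 <= K <= T.
Hypothesis HN : (1 <= N)%nat.
Hypothesis HNT : 4 * (D + 3) * L <= ln (INR N).
Hypothesis HT : 100 <= T.
Hypothesis HS : 3 <= S0.
Hypothesis HST : 2 * S0 <= T.
Hypothesis HL : 8 * D + 8 <= L.
Hypothesis HLT : L ^ 2 <= T.
Hypothesis HLC : 2 * (ln (2 * PI) + 5 / 2) <= L.

Let Z (s : C) := Zp N s.
Let M (s : C) := Mp a n s.

Lemma B_D : 5 < D /\ 48 < L /\ 0 < Rr <= / 22 /\ 0 < d <= / 22.
Proof.
assert (D5 : 5 < D) by (unfold D; lra).
assert (R1 : 0 < Rr <= / 22).
{ unfold Rr; split; [apply Rinv_0_lt_compat; lra | apply Rinv_le_contravar; lra]. }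
repeat split; try lra.
- unfold d; apply Rdiv_lt_0_compat; lra.
- unfold d, Rdiv; destruct (Rinv_range L ltac:(lra)); nra.
Qed.

Lemma T_pow p : 1 <= p -> T <= exp (p * L).
Proof. intros Hp; destruct B_D as [? [? _]]; apply exp_le; nra. Qed.

Lemma M_size x t : 0 <= x -> Cmod (M (x, t)) <= exp ((1 + 2 * theta) * L).
Proof.
intros Hx; eapply Rle_trans; [apply (Mp_bound a n K x t Hx Ha); lra |].
replace (exp ((1 + 2 * theta) * L)) with (T * exp (theta * L) ^ 2).
- apply Rmult_le_compat; [lra | apply pow2_ge_0 | lra |].
  apply pow_incr; split; [apply pos_INR | exact HnT].
- unfold T; simpl; rewrite Rmult_1_r, <- !exp_plus; f_equal; ring.
Qed.

Lemma Z_error x t : 1 / 4 <= x <= 3 / 4 -> T <= t <= 2 * T ->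
  Cmod (zeta (x, t) - Z (x, t)) <= exp (- (D + 1) * L).
Proof.
intros Hx Ht; eapply Rle_trans; [apply Zp_approx; [lra | lra | exact HN] |].
apply (Rle_trans _ (T * T * exp (- (D + 3) * L))).
- apply Rmult_le_compat; [lra | apply Rlt_le, exp_pos | nra | apply exp_le; lra].
- unfold T; rewrite <- !exp_plus; apply exp_le; lra.
Qed.

Lemma Z_size x t : 1 / 4 <= x <= 2 * S0 -> T <= t <= 2 * T -> Cmod (Z (x, t)) <= exp (2 * L).
Proof.
intros Hx Ht.
replace (Z (x, t)) with (zeta (x, t) + - (zeta (x, t) - Z (x, t)))%C by ring.
eapply Rle_trans; [apply Cmod_triangle |]; rewrite Cmod_opp.
pose proof (zeta_bound x t ltac:(lra) ltac:(lra)).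
pose proof (Zp_approx x t N ltac:(lra) ltac:(lra) HN) as A.
assert (exp (- (ln (INR N) / 4)) <= 1).
{ rewrite <- exp_0; apply exp_le; destruct B_D as [? [? _]]; nra. }
assert (exp (2 * L) = T * T) by (unfold T; rewrite <- exp_plus; f_equal; ring).
pose proof (exp_pos (- (ln (INR N) / 4))); unfold Z; nra.
Qed.

Lemma exp_sum_le p q r : 1 <= r - p -> 1 <= r - q -> exp (p * L) + exp (q * L) <= exp (r * L).
Proof.
intros Hp Hq; destruct B_D as [? [? _]].
assert (P : forall y, 1 <= r - y -> exp (y * L) <= exp (r * L) / 2).
{ intros y Hy; replace (r * L) with (y * L + (r - y) * L) by ring; rewrite exp_plus.
  pose proof (exp_pos (y * L)); pose proof (T_pow (r - y) Hy); nra. }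
pose proof (P p Hp); pose proof (P q Hq); lra.
Qed.

Lemma F_size x t : 1 / 4 <= x <= 2 * S0 -> T <= t <= 2 * T ->
  Cmod (1 - Z (x, t) * M (x, t)) <= exp ((4 + 2 * theta) * L).
Proof.
intros Hx Ht; eapply Rle_trans; [apply Cmod_triangle |].
rewrite Cmod_1, Cmod_opp, Cmod_mult.
pose proof (Z_size x t Hx Ht); pose proof (M_size x t ltac:(lra)).
assert (Cmod (Z (x, t)) * Cmod (M (x, t)) <= exp ((3 + 2 * theta) * L)).
{ replace ((3 + 2 * theta) * L) with (2 * L + (1 + 2 * theta) * L) by ring; rewrite exp_plus.
  apply Rmult_le_compat; try apply Cmod_ge_0; assumption. }
pose proof (exp_sum_le 0 (3 + 2 * theta) (4 + 2 * theta) ltac:(lra) ltac:(lra)) as E.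
rewrite Rmult_0_l, exp_0 in E; lra.
Qed.

Lemma G_size x t : 1 / 4 <= x <= 2 * S0 -> T <= t <= 2 * T ->
  Cmod (M (x, t) * (2 - Z (x, t) * M (x, t))) <= exp (D * L).
Proof.
intros Hx Ht; rewrite Cmod_mult.
pose proof (M_size x t ltac:(lra)) as HM; pose proof (F_size x t Hx Ht) as HF.
replace (2 - Z (x, t) * M (x, t))%C with (1 + (1 - Z (x, t) * M (x, t)))%C by ring.
assert (Cmod (1 + (1 - Z (x, t) * M (x, t))) <= exp ((4 + 2 * theta) * L) + 1).
{ eapply Rle_trans; [apply Cmod_triangle |]; rewrite Cmod_1; lra. }
pose proof (exp_sum_le 0 (4 + 2 * theta) (5 + 2 * theta) ltac:(lra) ltac:(lra)) as E.
rewrite Rmult_0_l, exp_0 in E.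
replace (D * L) with ((1 + 2 * theta) * L + (5 + 2 * theta) * L) by (unfold D; ring).
rewrite exp_plus; apply Rmult_le_compat; try apply Cmod_ge_0; lra.
Qed.


(* Both factors of [Z(1/2+d) G(1/2-d)] are close to 1 far to the right, so by Jensen the mean of
   [log |Z(1/2+d) G(1/2-d)|] is essentially nonnegative. By the functional equation it is at most
   the mean of [log |1 - F^2| - d log T], so [|F|^2] must have mean at least about [d log T]. *)
Section WithWeight.

Variables (w w1 w2 : R -> R).
(** On [T, 2T] the defect of [weight_exists] is exp(- k T / 4) = [e], smaller than any power of T,
    while k^2 T, which governs the integral of the second derivative, is only L^4 / T. *)
Let k : R := L ^ 2 / T.
Let e : R := exp (- (L ^ 2 / 4)).
Hypothesis Hw : weight w w1 w2 T (2 * T) k e.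
Hypothesis HwI : T / 8 <= RInt w T (2 * T).

Lemma e_small : 0 < e <= / T.
Proof.
destruct B_D as [? [? _]]; split; [apply exp_pos |].
unfold e, T; rewrite <- exp_Ropp; apply exp_le; simpl; nra.
Qed.

Lemma k_range : 0 < k <= 1.
Proof.
destruct B_D as [? [? _]]; unfold k; split; [apply Rdiv_lt_0_compat; [apply pow_lt |]; lra |].
apply (Rmult_le_reg_r T); [lra |]; unfold Rdiv; rewrite Rmult_assoc, Rinv_l; lra.
Qed.

Lemma eps_range : 0 < eps <= / T.
Proof.
destruct B_D as [? [? _]]; split; [apply exp_pos |].
unfold eps, T; rewrite <- exp_Ropp; apply exp_le; nra.
Qed.

(** The regularised logarithm is at most (D + 2) L in absolute value and the error terms of the
    weight total at most 8 L^4 / T, whence L^5 / T; closeness [tau] to 1 gives logarithms of size at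
    most 2 [tau]. *)
Lemma jensen_T (G : C -> C) x0 tau : smooth 2 G -> 1 / 4 <= x0 <= 3 / 4 ->
  / T <= tau <= 1 / 4 ->
  (forall x t, 1 / 4 <= x <= 2 * S0 -> T <= t <= 2 * T -> Cmod (G (x, t)) <= exp (D * L)) ->
  (forall x t, S0 <= x -> T <= t <= 2 * T -> Cmod (G (x, t) - 1) <= tau) ->
  - (6 * tau * T + 64 * S0 ^ 2 * (D + 2) * L ^ 5 / T) <=
  RInt (fun t => w t * (ln (Cmod (G (x0, t)) ^ 2 + eps) / 2)) T (2 * T).
Proof.
intros HG Hx Htau HB H1.
destruct B_D as [HD [HL48 _]]; pose proof e_small as He; pose proof k_range as Hk; pose proof eps_range as Hep.
assert (HiT : / T <= 1) by (destruct (Rinv_range T ltac:(lra)); lra).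
pose proof (jensen_mean w w1 w2 T (2 * T) k e ltac:(lra) ltac:(lra) ltac:(lra) Hw G x0 S0 eps
  ((D + 2) * L) (2 * tau) HG ltac:(lra) ltac:(lra)) as J.
eapply Rle_trans; [| apply J].
- replace (2 * T - T) with T by ring.
  apply Ropp_le_contravar.
  assert (A : 2 * k * e + 3 * k ^ 2 * (1 + e) * T <= 8 * L ^ 4 / T).
  { assert (A1 : k * e <= L ^ 4 / T).
    { apply (Rle_trans _ (k * 1)); [apply Rmult_le_compat_l; lra |].
      rewrite Rmult_1_r; unfold k, Rdiv; apply Rmult_le_compat_r; [lra |].
      replace (L ^ 4) with (L ^ 2 * L ^ 2) by ring; assert (1 <= L ^ 2) by nra; nra. }
    assert (A2 : k ^ 2 * T = L ^ 4 / T) by (unfold k; field; lra).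
    assert (A3 : 0 < L ^ 4 / T) by (rewrite <- A2; apply Rmult_lt_0_compat; [apply pow_lt |]; lra).
    replace (3 * k ^ 2 * (1 + e) * T) with (3 * (1 + e) * (k ^ 2 * T)) by ring.
    rewrite A2; replace (8 * L ^ 4 / T) with (8 * (L ^ 4 / T)) by (unfold Rdiv; ring).
    nra. }
  replace (64 * S0 ^ 2 * (D + 2) * L ^ 5 / T) with
    (8 * S0 ^ 2 * ((D + 2) * L * (8 * L ^ 4 / T))) by (field; lra).
  assert (0 <= 8 * S0 ^ 2) by (pose proof (pow2_ge_0 S0); lra).
  assert (8 * S0 ^ 2 * ((D + 2) * L * (2 * k * e + 3 * k ^ 2 * (1 + e) * T)) <=
          8 * S0 ^ 2 * ((D + 2) * L * (8 * L ^ 4 / T))).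
  { apply Rmult_le_compat_l; [assumption |]; apply Rmult_le_compat_l; [nra | exact A]. }
  lra.
- intros x t Hxx Ht; apply (log_range _ (exp (2 * D * L))).
  + split; [apply pow2_ge_0 |].
    replace (2 * D * L) with (INR 2 * (D * L)) by (simpl; ring); rewrite exp_INR_mult.
    apply pow_incr; split; [apply Cmod_ge_0 | apply HB; lra].
  + lra.
  + rewrite <- exp_0 at 1; apply exp_le; nra.
  + rewrite ln_mult, ln_exp by (try lra; apply exp_pos).
    assert (ln 2 <= 1) by (pose proof (ln_le_sub_1 2 ltac:(lra)); lra); nra.
  + unfold eps; rewrite ln_exp; nra.
- intros x t Hxx Ht; apply log_close; [apply H1; [destruct Hxx; lra | lra] | lra | lra].
Qed.

Lemma lower_mean tau : / T <= tau <= 1 / 4 ->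
  (forall x t, S0 <= x -> T <= t <= 2 * T -> Cmod (Z (x, t) - 1) <= tau) ->
  (forall x t, S0 <= x -> T <= t <= 2 * T -> Cmod (M (x, t) * (2 - Z (x, t) * M (x, t)) - 1) <= tau) ->
  Rr / 16 * T - 6 - 2 * (6 * tau * T + 64 * S0 ^ 2 * (D + 2) * L ^ 5 / T) <=
  RInt (fun t => w t * Cmod (1 - Z (1 / 2 - d, t) * M (1 / 2 - d, t)) ^ 2) T (2 * T).
Proof.
intros Htau H1 H2.
destruct B_D as [HD [HL48 [HR Hd]]]; pose proof e_small as He; pose proof k_range as Hk; pose proof eps_range as Hep.
assert (HTT : 0 < T < 2 * T) by lra.
assert (SZ : smooth 2 Z) by apply smooth_Zp.
assert (SM : smooth 2 M) by apply smooth_Mp.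
set (G := fun s => (M s * (2 - Z s * M s))%C).
assert (SG : smooth 2 G).
{ apply smooth_mult; [exact SM | apply smooth_minus; [apply smooth_const | apply smooth_mult; assumption]]. }
set (F := fun s => (1 - Z s * M s)%C).
assert (SF : smooth 2 F).
{ apply smooth_minus; [apply smooth_const | apply smooth_mult; assumption]. }
assert (ZB : forall x t, 1 / 4 <= x <= 2 * S0 -> T <= t <= 2 * T -> Cmod (Z (x, t)) <= exp (D * L)).
{ intros x t Hx Ht; eapply Rle_trans; [apply Z_size; assumption | apply exp_le; nra]. }
pose proof (jensen_T Z (1 / 2 + d) tau SZ ltac:(lra) Htau ZB H1) as J1.
pose proof (jensen_T G (1 / 2 - d) tau SG ltac:(lra) Htau G_size H2) as J2.
set (Er := 6 * tau * T + 64 * S0 ^ 2 * (D + 2) * L ^ 5 / T) in *.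
assert (Slog : forall H x, smooth 2 H ->
  ex_RInt (fun t => w t * (ln (Cmod (H (x, t)) ^ 2 + eps) / 2)) T (2 * T)).
{ intros H x SH.
  pose proof (hol_cont2 H _ _ SH (fun q Hq => proj1 (log_profile eps q ltac:(lra) Hq))) as C2.
  exact (proj1 (proj2 (weight_slice w w1 w2 T (2 * T) k e HTT Hw _ x C2))). }
assert (SqI : ex_RInt (fun t => w t * Cmod (F (1 / 2 - d, t)) ^ 2) T (2 * T)).
{ pose proof (hol_cont2 F (fun q => q) (fun _ => 1) SF (fun q _ => is_derive_id (K := R_AbsRing) q)) as C2.
  exact (proj1 (proj2 (weight_slice w w1 w2 T (2 * T) k e HTT Hw _ (1 / 2 - d) C2))). }
pose proof (weight_ex_RInt w w1 w2 T (2 * T) k e HTT Hw) as WI.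
pose proof (weight_int_le w w1 w2 T (2 * T) k e HTT Hw) as WL.
assert (P : forall t, T <= t <= 2 * T ->
  ln (Cmod (Z (1 / 2 + d, t)) ^ 2 + eps) / 2 + ln (Cmod (G (1 / 2 - d, t)) ^ 2 + eps) / 2 <=
  - (Rr / 2) + Cmod (F (1 / 2 - d, t)) ^ 2 + 6 / T).
{ intros t Ht.
  replace (- (Rr / 2)) with (ln (exp (- (Rr / 2)))) by apply ln_exp.
  apply (log_pointwise (Z (1 / 2 + d, t)) (Z (1 / 2 - d, t)) (M (1 / 2 - d, t)) _ (2 * exp (- (D + 1) * L))).
  - pose proof (exp_ineq1_le (- (Rr / 2))); lra.
  - lra.
  - lra.
  - pose proof (Z_error (1 / 2 + d) t ltac:(lra) Ht) as Z1.
    pose proof (Z_error (1 / 2 - d) t ltac:(lra) Ht) as Z2.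
    pose proof (zeta_ratio d t ltac:(lra) ltac:(lra)) as Q.
    set (rho := exp (- (Rr / 2))).
    assert (Hrho : rho <= 1) by (unfold rho; rewrite <- exp_0; apply exp_le; lra).
    (* [HLC] makes the constants at most L / 2, so the exponent d (ln t - ...) is at least d L / 2 =
       Rr / 2. *)
    assert (Q2 : exp (- (d * (ln t - ln (2 * PI) - 5 / 2))) <= rho).
    { apply exp_le, Ropp_le_contravar.
      assert (L <= ln t).
      { apply (Rle_trans _ (ln T)); [unfold T; rewrite ln_exp; lra | apply ln_le; lra]. }
      replace (Rr / 2) with (d * (L / 2)) by (unfold d; field; lra).
      apply Rmult_le_compat_l; lra. }
    assert (Q3 : Cmod (zeta (1 / 2 + d, t)) <= rho * Cmod (zeta (1 / 2 - d, t))).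
    { eapply Rle_trans; [exact Q | apply Rmult_le_compat_r; [apply Cmod_ge_0 | exact Q2]]. }
    assert (T1 : Cmod (Z (1 / 2 + d, t)) <= Cmod (zeta (1 / 2 + d, t)) + exp (- (D + 1) * L)).
    { pose proof (Cmod_le_r (zeta (1 / 2 + d, t)) (Z (1 / 2 + d, t))); lra. }
    assert (T2 : Cmod (zeta (1 / 2 - d, t)) <= Cmod (Z (1 / 2 - d, t)) + exp (- (D + 1) * L)).
    { pose proof (Cmod_le_l (zeta (1 / 2 - d, t)) (Z (1 / 2 - d, t))); lra. }
    assert (rho * Cmod (zeta (1 / 2 - d, t)) <= rho * (Cmod (Z (1 / 2 - d, t)) + exp (- (D + 1) * L))).
    { apply Rmult_le_compat_l; [apply Rlt_le, exp_pos | exact T2]. }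
    pose proof (exp_pos (- (D + 1) * L)); nra.
  - pose proof (G_size (1 / 2 - d) t ltac:(lra) Ht) as GS.
    rewrite Rmult_assoc; unfold Rdiv; apply Rmult_le_compat_l; [lra |].
    apply (Rle_trans _ (exp (- (D + 1) * L) * exp (D * L))).
    + apply Rmult_le_compat_l; [apply Rlt_le, exp_pos | exact GS].
    + rewrite <- exp_plus; unfold T; rewrite <- exp_Ropp; apply exp_le; lra.
  - pose proof (G_size (1 / 2 - d) t ltac:(lra) Ht) as GS.
    pose proof (Z_size (1 / 2 + d) t ltac:(lra) Ht) as ZS.
    assert (ZS2 : Cmod (Z (1 / 2 + d, t)) <= exp (D * L)) by (eapply Rle_trans; [exact ZS | apply exp_le; nra]).
    set (q := exp (D * L)) in *.
    assert (Hq : 1 <= q) by (unfold q; rewrite <- exp_0; apply exp_le; nra).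
    assert (Z3 : Cmod (Z (1 / 2 + d, t)) ^ 2 <= q ^ 2) by (apply pow_incr; split; [apply Cmod_ge_0 | exact ZS2]).
    assert (G3 : Cmod (M (1 / 2 - d, t) * (2 - Z (1 / 2 - d, t) * M (1 / 2 - d, t))) ^ 2 <= q ^ 2)
      by (apply pow_incr; split; [apply Cmod_ge_0 | exact GS]).
    assert (Eeps : eps = / q ^ 2 * (/ T) ^ 4).
    { unfold eps, q, T; simpl; rewrite !Rmult_1_r, <- exp_plus, <- !exp_Ropp, <- !exp_plus; f_equal; ring. }
    destruct (Rinv_range T ltac:(lra)).
    assert (Hq2 : 1 <= q ^ 2) by nra.
    apply (Rle_trans _ (eps * (3 * q ^ 2))).
    + apply Rmult_le_compat_l; [lra |]; lra.
    + rewrite Eeps; replace (/ q ^ 2 * (/ T) ^ 4 * (3 * q ^ 2)) with (3 * (/ T) ^ 2 * (/ T) ^ 2) by (field; lra).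
      unfold Rdiv; rewrite Rmult_1_l.
      assert (0 <= (/ T) ^ 2) by apply pow2_ge_0.
      assert (3 * (/ T) ^ 2 <= 1).
      { assert (/ T <= / 100) by (apply Rinv_le_contravar; lra); simpl; nra. }
      nra. }
assert (Int : RInt (fun t => w t * (ln (Cmod (Z (1 / 2 + d, t)) ^ 2 + eps) / 2)) T (2 * T) +
  RInt (fun t => w t * (ln (Cmod (G (1 / 2 - d, t)) ^ 2 + eps) / 2)) T (2 * T) <=
  (- (Rr / 2) + 6 / T) * RInt w T (2 * T) + RInt (fun t => w t * Cmod (F (1 / 2 - d, t)) ^ 2) T (2 * T)).
{ pose proof (Slog Z (1 / 2 + d) SZ) as I1; pose proof (Slog G (1 / 2 - d) SG) as I2.
  pose proof (ex_RInt_Rscal (- (Rr / 2) + 6 / T) w _ _ WI) as I3.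
  rewrite <- (RInt_Rscal (- (Rr / 2) + 6 / T) w _ _ WI).
  eapply Rle_trans; [apply Req_le; symmetry; exact (RInt_Rplus _ _ _ _ I1 I2) |].
  eapply Rle_trans; [| apply Req_le; exact (RInt_Rplus _ _ _ _ I3 SqI)].
  apply RInt_le; [lra | exact (ex_RInt_Rplus _ _ _ _ I1 I2) | exact (ex_RInt_Rplus _ _ _ _ I3 SqI) |].
  intros t Ht; specialize (P t ltac:(lra)).
  pose proof (weight_range _ _ _ _ _ _ _ Hw t ltac:(lra)); nra. }
assert (W6 : 6 / T * RInt w T (2 * T) <= 6).
{ replace 6 with (6 / T * T) at 2 by (field; lra); apply Rmult_le_compat_l; [| lra].
  apply Rlt_le, Rdiv_lt_0_compat; lra. }
change (RInt (fun t => w t * Cmod (F (1 / 2 - d, t)) ^ 2) T (2 * T))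
  with (RInt (fun t => w t * Cmod (1 - Z (1 / 2 - d, t) * M (1 / 2 - d, t)) ^ 2) T (2 * T)) in Int.
assert (Rr / 2 * (T / 8) <= Rr / 2 * RInt w T (2 * T)) by (apply Rmult_le_compat_l; lra).
lra.
Qed.

Lemma upper_mean :
  RInt (fun t => w t * Cmod (1 - Z (1 / 2 - d, t) * M (1 / 2 - d, t)) ^ 2) T (2 * T) <=
  9 * (2 * RInt (fun t => w t * Cmod (1 - Z (1 / 2, t) * M (1 / 2, t)) ^ 2) T (2 * T) + 3).
Proof.
destruct B_D as [HD [HL48 [HR Hd]]]; pose proof e_small as He; pose proof k_range as Hk.
assert (HTT : 0 < T < 2 * T) by lra.
set (F := fun s => (1 - Z s * M s)%C).
assert (SF : smooth 2 F).
{ apply smooth_minus; [apply smooth_const | apply smooth_mult; [apply smooth_Zp | apply smooth_Mp]]. }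
set (lam := (4 * D + 2) * L).
set (G := fun s => (F s * Cexp (RtoC lam * s + 0))%C).
assert (SG : smooth 2 G) by (apply smooth_mult; [exact SF | apply smooth_Cexp]).
assert (EG : forall x t, Cmod (G (x, t)) ^ 2 = exp (2 * lam * x) * Cmod (F (x, t)) ^ 2).
{ intros x t; unfold G; rewrite Cmod_mult, Cmod_Cexp.
  replace (Re (RtoC lam * (x, t) + 0)%C) with (lam * x) by (unfold Re; simpl; ring).
  replace (2 * lam * x) with (lam * x + lam * x) by ring; rewrite exp_plus; ring. }
assert (SqF : forall x, ex_RInt (fun t => w t * Cmod (F (x, t)) ^ 2) T (2 * T)).
{ pose proof (hol_cont2 F (fun q => q) (fun _ => 1) SF (fun q _ => is_derive_id (K := R_AbsRing) q)) as C2.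
  intros x; exact (proj1 (proj2 (weight_slice w w1 w2 T (2 * T) k e HTT Hw _ x C2))). }
assert (IG : forall x, RInt (fun t => w t * Cmod (G (x, t)) ^ 2) T (2 * T) =
  exp (2 * lam * x) * RInt (fun t => w t * Cmod (F (x, t)) ^ 2) T (2 * T)).
{ intros x; rewrite <- (RInt_Rscal _ _ _ _ (SqF x)); apply RInt_ext; intros t _.
  rewrite EG, <- !Rmult_assoc, (Rmult_comm (w t)); reflexivity. }
assert (FB : forall x t, 1 / 4 <= x <= 1 / 2 -> T <= t <= 2 * T -> Cmod (F (x, t)) ^ 2 <= exp (2 * D * L)).
{ intros x t Hx Ht; replace (2 * D * L) with (INR 2 * (D * L)) by (simpl; ring); rewrite exp_INR_mult.
  apply pow_incr; split; [apply Cmod_ge_0 |].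
  eapply Rle_trans; [apply F_size; lra | apply exp_le; unfold D; nra]. }
assert (Hlam : 0 < lam) by (unfold lam; nra).
pose proof (growth_mean w w1 w2 T (2 * T) k e HTT ltac:(lra) ltac:(lra) Hw G (exp (2 * D * L) * exp lam)
  (1 / 2 - d) SG ltac:(nra) ltac:(lra)) as Gr.
assert (GB : forall x t, 1 / 4 <= x <= 1 / 2 -> T <= t <= 2 * T -> Cmod (G (x, t)) ^ 2 <= exp (2 * D * L) * exp lam).
{ intros x t Hx Ht; rewrite EG, Rmult_comm.
  apply Rmult_le_compat; [apply pow2_ge_0 | apply Rlt_le, exp_pos | apply FB; assumption | apply exp_le; nra]. }
specialize (Gr GB); rewrite !IG in Gr.
set (psi := (fun x => RInt (fun t => w t * Cmod (F (x, t)) ^ 2) T (2 * T)) : R -> R).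
change (RInt (fun t => w t * Cmod (F (1 / 2 - d, t)) ^ 2) T (2 * T)) with (psi (1 / 2 - d)) in Gr.
change (RInt (fun t => w t * Cmod (F (1 / 4, t)) ^ 2) T (2 * T)) with (psi (1 / 4)) in Gr.
change (RInt (fun t => w t * Cmod (F (1 / 2, t)) ^ 2) T (2 * T)) with (psi (1 / 2)) in Gr.
change (psi (1 / 2 - d) <= 9 * (2 * psi (1 / 2) + 3)).
assert (Q4 : psi (1 / 4) <= T * exp (2 * D * L)).
{ pose proof (weighted_abs_le w w1 w2 T (2 * T) k e HTT Hw (fun t => Cmod (F (1 / 4, t)) ^ 2)
    (exp (2 * D * L)) (SqF (1 / 4))) as B.
  replace (2 * T - T) with T in B by ring.
  eapply Rle_trans; [apply Rle_abs | apply B].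
  intros t Ht; rewrite Rabs_pos_eq by apply pow2_ge_0; apply FB; lra. }
assert (P0 : 0 <= psi (1 / 2)).
{ apply RInt_ge_0; [lra | apply SqF |]; intros t Ht; apply Rmult_le_pos; [|apply pow2_ge_0].
  apply (weight_range _ _ _ _ _ _ _ Hw); lra. }
assert (E0 : exp (2 * lam * (1 / 4)) = exp (lam - (2 * D * L + L))).
{ f_equal; unfold lam; field. }
assert (E1 : exp (2 * lam * (1 / 2)) = exp lam) by (f_equal; field).
assert (E2 : exp (2 * lam * (1 / 2 - d)) = exp lam * exp (- (2))).
{ rewrite <- exp_plus; f_equal; unfold lam, d, Rr; field; lra. }
rewrite E0, E1, E2 in Gr.
assert (B1 : exp (lam - (2 * D * L + L)) * psi (1 / 4) <= exp lam).
{ apply (Rle_trans _ (exp (lam - (2 * D * L + L)) * (T * exp (2 * D * L)))).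
  - apply Rmult_le_compat_l; [apply Rlt_le, exp_pos | exact Q4].
  - unfold T; rewrite <- !exp_plus; apply Req_le; f_equal; ring. }
assert (B2 : (k + (2 * T - T)) * e * (exp (2 * D * L) * exp lam) <= exp lam).
{ replace ((k + (2 * T - T)) * e * (exp (2 * D * L) * exp lam)) with
    ((k + T) * (e * exp (2 * D * L)) * exp lam) by ring.
  rewrite <- (Rmult_1_l (exp lam)) at 2; apply Rmult_le_compat_r; [apply Rlt_le, exp_pos |].
  assert (X : e * exp (2 * D * L) <= / T * / T).
  { unfold e, T; rewrite <- !exp_Ropp, <- !exp_plus; apply exp_le; simpl; nra. }
  apply (Rle_trans _ ((2 * T) * (/ T * / T))).
  - apply Rmult_le_compat; [lra | | lra | exact X].
    apply Rmult_le_pos; [lra | apply Rlt_le, exp_pos].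
  - replace (2 * T * (/ T * / T)) with (2 * / T) by (field; lra).
    assert (/ T <= / 100) by (apply Rinv_le_contravar; lra); lra. }
assert (E9 : 1 <= 9 * exp (- (2))).
{ replace (- (2)) with (- (1) + - (1)) by ring; rewrite exp_plus, exp_Ropp.
  pose proof exp_le_3; pose proof (exp_pos 1).
  assert (/ 3 <= / exp 1) by (apply Rinv_le_contravar; lra); nra. }
pose proof (exp_pos lam) as PE.
assert (Gr2 : exp lam * (exp (- (2)) * psi (1 / 2 - d)) <= exp lam * (2 * psi (1 / 2) + 3)) by lra.
apply Rmult_le_reg_l in Gr2; [| exact PE].
assert (0 <= psi (1 / 2 - d)).
{ apply RInt_ge_0; [lra | apply SqF |]; intros t Ht; apply Rmult_le_pos; [|apply pow2_ge_0].
  apply (weight_range _ _ _ _ _ _ _ Hw); lra. }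
nra.
Qed.

End WithWeight.

Lemma moment_lower tau : / T <= tau <= 1 / 4 ->
  (forall x t, S0 <= x -> T <= t <= 2 * T -> Cmod (Z (x, t) - 1) <= tau) ->
  (forall x t, S0 <= x -> T <= t <= 2 * T -> Cmod (M (x, t) * (2 - Z (x, t) * M (x, t)) - 1) <= tau) ->
  Rr / 16 * T - 6 - 2 * (6 * tau * T + 64 * S0 ^ 2 * (D + 2) * L ^ 5 / T) <=
  9 * (2 * (T * (2 * mollified_moment M T + 2 * (/ T) ^ 2)) + 3).
Proof.
intros Htau H1 H2.
destruct B_D as [HD [HL48 _]].
assert (HTT : 0 < T < 2 * T) by lra.
destruct (weight_exists T (2 * T) (L ^ 2 / T)) as [w [w1 [w2 [Hw HwI]]]].
{ apply Rdiv_lt_0_compat; [apply pow_lt |]; lra. }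
{ lra. }
replace (L ^ 2 / T * (2 * T - T) / 4) with (L ^ 2 / 4) in Hw, HwI by (field; lra).
replace ((2 * T - T) / 8) with (T / 8) in HwI by (field; lra).
assert (He12 : exp (- (L ^ 2 / 4)) <= 1 / 12).
{ rewrite exp_Ropp; replace (1 / 12) with (/ 12) by field; apply Rinv_le_contravar; [lra |].
  pose proof (exp_ineq1_le (L ^ 2 / 4)); assert (48 <= L ^ 2) by nra; lra. }
specialize (HwI He12).
pose proof (lower_mean w w1 w2 Hw HwI tau Htau H1 H2) as Lo.
pose proof (upper_mean w w1 w2 Hw) as Up.
assert (Mo : RInt (fun t => w t * Cmod (1 - Z (1 / 2, t) * M (1 / 2, t)) ^ 2) T (2 * T) <=
  T * (2 * mollified_moment M T + 2 * (/ T) ^ 2)).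
{ eapply Rle_trans; [| apply (moment_Zp a n N T (/ T)); [lra |]].
  - assert (SF : smooth 2 (fun s => 1 - Z s * M s)%C).
    { apply smooth_minus; [apply smooth_const | apply smooth_mult; [apply smooth_Zp | apply smooth_Mp]]. }
    pose proof (hol_cont2 _ (fun q => q) (fun _ => 1) SF (fun q _ => is_derive_id (K := R_AbsRing) q)) as C2.
    destruct (weight_slice w w1 w2 T (2 * T) _ _ HTT Hw _ (1 / 2) C2) as [I1 [I2 _]].
    apply RInt_le; [lra | exact I2 | exact I1 |].
    intros t Ht; pose proof (weight_range _ _ _ _ _ _ _ Hw t ltac:(lra)) as Wt.
    eapply Rle_trans; [apply Rmult_le_compat_r; [apply pow2_ge_0 | apply Wt] |].
    rewrite Rmult_1_l; apply Rle_refl.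
  - intros t Ht; pose proof (Z_error (1 / 2) t ltac:(lra) Ht) as ZE.
    pose proof (M_size (1 / 2) t ltac:(lra)) as MS.
    apply (Rle_trans _ (exp (- (D + 1) * L) * exp ((1 + 2 * theta) * L))).
    + apply Rmult_le_compat; try apply Cmod_ge_0; assumption.
    + unfold T; rewrite <- exp_plus, <- exp_Ropp; apply exp_le; unfold D; nra. }
lra.
Qed.


End PartB.

Lemma large_theta_bound : exists c : R, 0 < c /\
  forall theta : R, 0 < theta -> forall K : R -> R,
  exists T0 : R, forall T : R, T0 <= T -> forall a : nat -> C,
    a 1%nat = 1 ->
    (forall eps : R, 0 < eps -> forall n : nat, (1 <= n)%nat -> INR n <= Rpower T theta ->
       Cmod (a n) <= K eps * Rpower (INR n) eps) ->
    c / (1 + theta) <= mollified_moment (dirichlet_poly a (Rpower T theta)) T.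
Proof.
(* The final bound is Rr / 1152 = 1 / (1152 (26 + 16 theta)), and 1152 * 26 = 29952. *)
exists (/ 30000); split; [lra |]; intros theta Hth K.
set (K0 := Rabs (K 1)); pose proof (Rabs_pos (K 1) : 0 <= K0) as HK0.
(* The choice of [tau] makes the Jensen loss 12 [tau] T equal to Rr T / 64, a quarter of the main
   term Rr T / 16. *)
set (D := 6 + 4 * theta); set (Rr := / (4 * D + 2)); set (tau := Rr / 768).
assert (HD : 6 < D) by (unfold D; lra).
assert (HR : 0 < Rr <= / 22).
{ unfold Rr; split; [apply Rinv_0_lt_compat; lra | apply Rinv_le_contravar; lra]. }
assert (Htau : 0 < tau <= 1 / 4) by (unfold tau; lra).
(* By e^y >= 1 + y this makes (K0 + 2) e^(-(x-3)/2) <= tau / 7 for x >= S0, enough for both Z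
   (constant 2) and M (constant K0); the 7 is the loss in [mollified_right]. *)
set (S0 := 3 + 2 * (7 * (K0 + 2) / tau)).
assert (Hy : 0 < 7 * (K0 + 2) / tau) by (apply Rdiv_lt_0_compat; lra).
assert (HS : 3 <= S0) by (unfold S0; lra).
destruct (pow_le_exp 2 1) as [L1 [HL1 Q1]].
destruct (pow_le_exp 5 (128 * S0 ^ 2 * (D + 2))) as [L2 [HL2 Q2]].
set (L0 := L1 + L2 + K0 + 100 + 2 * S0 + (8 * D + 8) + 2 * Rabs (ln (2 * PI) + 5 / 2) + 4480 / Rr + / tau).
assert (P1 : 0 < 4480 / Rr) by (apply Rdiv_lt_0_compat; lra).
assert (P2 : 0 < / tau) by (apply Rinv_0_lt_compat; lra).
pose proof (Rabs_pos (ln (2 * PI) + 5 / 2)) as P3; pose proof (Rle_abs (ln (2 * PI) + 5 / 2)) as P4.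
exists (exp L0); intros T HT a Ha1 Ha.
assert (HT0 : 0 < T) by (pose proof (exp_pos L0); lra).
set (L := ln T).
assert (EL : exp L = T) by (apply exp_ln, HT0).
assert (HL : L0 <= L) by (unfold L; rewrite <- (ln_exp L0); apply ln_le; [apply exp_pos | exact HT]).
assert (HTL : L <= exp L) by (pose proof (exp_ineq1_le L); lra).
set (X := Rpower T theta).
assert (EX : X = exp (theta * L)) by reflexivity.
assert (HX : 1 <= X) by (rewrite EX, <- exp_0; apply exp_le; unfold L0 in HL; nra).
set (n := nat_floor X).
destruct (nat_floor_spec X ltac:(lra)) as [N1 N2]; fold n in N1, N2.
assert (Hn : (1 <= n)%nat).
{ destruct n; [simpl in N2; lra | lia]. }
assert (HaK : forall i, (i < n)%nat -> Cmod (a (S i)) <= K0 * INR (S i)).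
{ intros i Hi; pose proof (INR_S_ge_1 i).
  assert (INR (S i) <= X) by (eapply Rle_trans; [apply le_INR; exact Hi | exact N1]).
  eapply Rle_trans; [apply (Ha 1 Rlt_0_1 (S i)); [lia | assumption] |].
  rewrite Rpower_1 by lra; apply Rmult_le_compat_r; [lra | apply Rle_abs]. }
destruct (INR_unbounded (exp (4 * (D + 3) * L))) as [N HN].
assert (HN1 : (1 <= N)%nat).
{ destruct N; [simpl in HN; pose proof (exp_pos (4 * (D + 3) * L)); lra | lia]. }
assert (HNT : 4 * (D + 3) * L <= ln (INR N)).
{ rewrite <- (ln_exp (4 * (D + 3) * L)); apply ln_le; [apply exp_pos | lra]. }
unfold L0 in HL.
assert (HLL : L ^ 2 <= exp L) by (specialize (Q1 L ltac:(lra)); lra).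
specialize (Q2 L ltac:(lra)).
assert (Sm : forall x, S0 <= x -> 7 * ((K0 + 2) * exp (- ((x - 3) / 2))) <= tau).
{ intros x Hx.
  assert (exp (- ((x - 3) / 2)) <= / (7 * (K0 + 2) / tau)).
  { rewrite exp_Ropp; apply Rinv_le_contravar; [exact Hy |].
    pose proof (exp_ineq1_le ((x - 3) / 2)); unfold S0 in Hx; lra. }
  replace tau with (7 * ((K0 + 2) * / (7 * (K0 + 2) / tau))) by (field; lra).
  apply Rmult_le_compat_l; [lra |]; apply Rmult_le_compat_l; lra. }
assert (Hi : forall t, T <= t <= 2 * T -> 1 <= t) by (intros; lra).
assert (ZR : forall x t, S0 <= x -> T <= t <= 2 * T -> Cmod (Zp N (x, t) - 1) <= tau / 7).
{ intros x t Hx Ht; eapply Rle_trans; [apply Zp_right; [lra | apply Hi, Ht | exact HN1] |].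
  specialize (Sm x Hx); pose proof (exp_pos (- ((x - 3) / 2))); nra. }
assert (MR : forall x t, S0 <= x -> Cmod (Mp a n (x, t) - 1) <= tau / 7).
{ intros x t Hx; eapply Rle_trans; [apply (Mp_right a n K0); [lra | exact HK0 | exact Hn | exact Ha1 | exact HaK] |].
  specialize (Sm x Hx); pose proof (exp_pos (- ((x - 3) / 2))); nra. }
assert (HiT : / T <= tau).
{ replace tau with (/ / tau) by (apply Rinv_inv); apply Rinv_le_contravar; lra. }
pose proof (moment_lower theta K0 S0 a n N L Hth ltac:(rewrite <- EX; exact N1) HaK
  ltac:(lra) HN1 HNT ltac:(lra) HS ltac:(lra) ltac:(fold D; lra) HLL ltac:(lra) tau) as ML.
rewrite EL in ML; fold D Rr in ML.
assert (T7' : tau / 7 <= tau) by lra.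
specialize (ML ltac:(lra) (fun x t Hx Ht => Rle_trans _ _ _ (ZR x t Hx Ht) T7')).
assert (G1 : forall x t, S0 <= x -> T <= t <= 2 * T ->
  Cmod (Mp a n (x, t) * (2 - Zp N (x, t) * Mp a n (x, t)) - 1) <= tau).
{ intros x t Hx Ht; replace tau with (7 * (tau / 7)) by field.
  apply mollified_right; [lra | apply ZR | apply MR]; assumption. }
specialize (ML G1).
replace (dirichlet_poly a X) with (Mp a n)
  by (apply functional_extensionality; intros s; symmetry; apply dirichlet_poly_Mp).
set (I := mollified_moment (Mp a n) T) in *.
assert (T5 : 64 * S0 ^ 2 * (D + 2) * L ^ 5 / T <= / 2).
{ apply (Rmult_le_reg_r T); [lra |].
  replace (64 * S0 ^ 2 * (D + 2) * L ^ 5 / T * T) with (128 * S0 ^ 2 * (D + 2) * L ^ 5 / 2) by (field; lra).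
  lra. }
assert (T6 : T * (2 * I + 2 * (/ T) ^ 2) <= 2 * T * I + 1).
{ replace (T * (2 * I + 2 * (/ T) ^ 2)) with (2 * T * I + 2 * / T) by (field; lra).
  assert (/ T <= / 100) by (apply Rinv_le_contravar; lra); lra. }
assert (T7 : 70 <= Rr / 64 * T).
{ apply (Rle_trans _ (Rr / 64 * (4480 / Rr))); [apply Req_le; field; lra |].
  apply Rmult_le_compat_l; lra. }
assert (T8 : 12 * tau * T = Rr / 64 * T) by (unfold tau; field).
(* Of Rr T / 16, one Rr T / 64 goes to the Jensen error and another, at least 70, covers the
   additive constants. *)
assert (T9 : Rr / 32 * T <= 36 * T * I) by lra.
assert (T10 : Rr / 1152 <= I).
{ apply (Rmult_le_reg_l (36 * T)); [lra |]; lra. }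
eapply Rle_trans; [| exact T10].
apply (Rle_trans _ (/ (30000 * (1 + theta)))); [apply Req_le; field; lra |].
unfold Rr, D; replace (/ (4 * (6 + 4 * theta) + 2) / 1152) with (/ (1152 * (26 + 16 * theta))) by (field; lra).
apply Rinv_le_contravar; lra.
Qed.

(** * Short mollifiers: weighted mean values *)

Section Mean.

Variables (w w1 w2 : R -> R) (a b k e : R).
Hypothesis Hab : 0 < a < b.
Hypothesis Hk : 0 < k.
Hypothesis Hw : weight w w1 w2 a b k e.

(** A calculus of approximate averages with absolute errors that add up, so that a multiple
    Dirichlet sum can be treated term by term; integrability is carried along. *)
Definition mean (f : R -> R) (v B : R) : Prop :=
  ex_RInt (fun t => w t * f t) a b /\ Rabs (RInt (fun t => w t * f t) a b - v * RInt w a b) <= B.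

(** An upper bound for the integral of |w1|, from [weight_b1] and w <= 1. *)
Let Q : R := k * (1 + e) * (b - a).

Lemma mean_ext f g v B : (forall t, f t = g t) -> mean f v B -> mean g v B.
Proof. intros H; replace g with f; [auto | apply functional_extensionality, H]. Qed.

Lemma mean_le f v B B' : mean f v B -> B <= B' -> mean f v B'.
Proof. intros [I H] HB; split; [exact I | lra]. Qed.

Lemma mean_plus f g v v' B B' : mean f v B -> mean g v' B' ->
  mean (fun t => f t + g t) (v + v') (B + B').
Proof.
intros [I H] [I' H'].
assert (E : forall t, w t * (f t + g t) = w t * f t + w t * g t) by (intros; ring).
split.
- eapply ex_RInt_ext; [intros t _; symmetry; apply E | apply ex_RInt_Rplus; assumption].
- rewrite (RInt_ext _ (fun t => w t * f t + w t * g t)) by (intros; apply E).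
  rewrite (RInt_Rplus _ _ _ _ I I').
  replace (_ - _) with ((RInt (fun t => w t * f t) a b - v * RInt w a b) +
    (RInt (fun t => w t * g t) a b - v' * RInt w a b)) by ring.
  eapply Rle_trans; [apply Rabs_triang | lra].
Qed.

Lemma mean_0 : mean (fun _ => 0) 0 0.
Proof.
split.
- apply (ex_RInt_ext (fun _ => 0)); [intros; symmetry; apply Rmult_0_r | apply ex_RInt_const].
- rewrite (RInt_ext _ (fun _ => 0)) by (intros; apply Rmult_0_r).
  rewrite RInt_Rconst, Rmult_0_r, Rmult_0_l, Rminus_0_r, Rabs_R0; apply Rle_refl.
Qed.

Lemma mean_Rsum (f : nat -> R -> R) v B n : (forall i, (i < n)%nat -> mean (f i) (v i) (B i)) ->
  mean (fun t => Rsum (fun i => f i t) n) (Rsum v n) (Rsum B n).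
Proof.
induction n as [|n IH]; intros H; [apply mean_0 |].
cbn [Rsum]; apply mean_plus; [apply IH; intros; apply H; lia | apply H; lia].
Qed.

Lemma mean_opp f v B : mean f v B -> mean (fun t => - f t) (- v) B.
Proof.
intros [I H].
assert (E : forall t, w t * - f t = -1 * (w t * f t)) by (intros; ring).
split.
- eapply ex_RInt_ext; [intros t _; symmetry; apply E | apply ex_RInt_Rscal; assumption].
- rewrite (RInt_ext _ (fun t => -1 * (w t * f t))) by (intros; apply E).
  rewrite RInt_Rscal by exact I.
  replace (_ - _) with (- (RInt (fun t => w t * f t) a b - v * RInt w a b)) by ring.
  rewrite Rabs_Ropp; exact H.
Qed.

Lemma mean_const c : mean (fun _ => c) c 0.
Proof.
pose proof (weight_ex_RInt w w1 w2 a b k e Hab Hw) as I.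
assert (E : forall t, w t * c = c * w t) by (intros; ring).
split.
- eapply ex_RInt_ext; [intros t _; symmetry; apply E | apply ex_RInt_Rscal; assumption].
- rewrite (RInt_ext _ (fun t => c * w t)) by (intros; apply E).
  rewrite RInt_Rscal by exact I; rewrite Rminus_diag, Rabs_R0; apply Rle_refl.
Qed.

Lemma mean_bounded (f : R -> R -> R) x B : cont2 f ->
  (forall t, a <= t <= b -> Rabs (f x t) <= B) -> mean (f x) 0 ((b - a) * B).
Proof.
intros Cf HB.
pose proof (proj1 (proj2 (weight_slice w w1 w2 a b k e Hab Hw f x Cf))) as I.
split; [exact I |]; rewrite Rmult_0_l, Rminus_0_r.
apply (weighted_abs_le w w1 w2 a b k e Hab Hw); assumption.
Qed.

Lemma weight_by_parts (F f : R -> R) B :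
  (forall t, a <= t <= b -> is_derive F t (f t)) ->
  (forall t, a <= t <= b -> continuous F t) -> (forall t, a <= t <= b -> continuous f t) ->
  (forall t, a <= t <= b -> Rabs (F t) <= B) ->
  ex_RInt (fun t => w t * f t) a b /\ Rabs (RInt (fun t => w t * f t) a b) <= Q * B.
Proof.
intros D CF Cf HB; destruct Hw as [W1 W2 _ Wa Wb Wr B1 _].
assert (Cw : forall t, continuous w t)
  by (intros t; apply (ex_derive_continuous w); eexists; apply W1).
assert (Cw1 : forall t, continuous w1 t)
  by (intros t; apply (ex_derive_continuous w1); eexists; apply W2).
assert (I1 : ex_RInt (fun t => w t * f t) a b).
{ apply (ex_RInt_continuous (V := R_CompleteNormedModule)); intros t.
  rewrite Rmin_left, Rmax_right by lra; intros Ht; apply continuous_Rmult; auto. }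
assert (I2 : ex_RInt (fun t => w1 t * F t) a b).
{ apply (ex_RInt_continuous (V := R_CompleteNormedModule)); intros t.
  rewrite Rmin_left, Rmax_right by lra; intros Ht; apply continuous_Rmult; auto. }
split; [exact I1 |].
assert (E : RInt (fun t => w1 t * F t + w t * f t) a b = w b * F b - w a * F a).
{ apply (RInt_FTC (fun t => w t * F t)); [lra | |].
  - intros t Ht; apply is_derive_Rmult; auto.
  - intros t Ht; apply (continuous_plus (V := R_NormedModule)); apply continuous_Rmult; auto. }
rewrite (RInt_Rplus _ _ _ _ I2 I1), Wa, Wb in E.
replace (RInt (fun t => w t * f t) a b) with (- RInt (fun t => w1 t * F t) a b) by lra.
rewrite Rabs_Ropp.
replace (Q * B) with ((b - a) * (k * (1 + e) * B)) by (unfold Q; ring).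
apply abs_RInt_le_const; [lra | exact I2 |].
intros t Ht; rewrite Rabs_mult; apply Rmult_le_compat; auto using Rabs_pos.
eapply Rle_trans; [apply B1 |]; apply Rmult_le_compat_l; [lra |].
specialize (Wr t Ht); lra.
Qed.

(** One integration by parts against [w]: the antiderivative of the oscillation gains 1 / |la| and
    leaves no boundary term. *)
Lemma mean_osc (c : C) (al la : R) (f : R -> C) : la <> 0 ->
  (forall t, f t = (c * Cexp (al, (la * t)%R))%C) ->
  mean (fun t => Re (f t)) 0 (Q * (Cmod c * exp al / Rabs la)).
Proof.
intros Hla Hf.
set (F := fun t => exp al * (Re c * sin (la * t) + Im c * cos (la * t)) / la).
assert (D : forall t, is_derive F t (Re (f t))).
{ intros t; rewrite Hf; unfold F, Cexp, Re, Im; simpl; auto_derive; [trivial |]; simpl; field; exact Hla. }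
assert (CF : forall t, continuous F t)
  by (intros t; apply (ex_derive_continuous F); eexists; apply D).
assert (Cf : forall t, continuous (fun t => Re (f t)) t).
{ intros t; apply (continuous_ext (fun t => exp al * (Re c * cos (la * t) - Im c * sin (la * t)))).
  - intros u; rewrite Hf; unfold Cexp, Re, Im; simpl; ring.
  - apply (ex_derive_continuous (fun t => exp al * (Re c * cos (la * t) - Im c * sin (la * t)))).
    auto_derive; trivial. }
destruct (weight_by_parts F (fun t => Re (f t)) (Cmod c * exp al / Rabs la)) as [I B]; auto.
- intros t _.
  replace (F t) with (Im (c * Cexp (al, (la * t)%R)) / la)
    by (unfold F, Cexp, Re, Im; simpl; field; exact Hla).
  rewrite Rabs_div by exact Hla; apply Rmult_le_compat_r.
  + apply Rlt_le, Rinv_0_lt_compat, Rabs_pos_lt, Hla.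
  + eapply Rle_trans; [apply im_le_Cmod |]; rewrite Cmod_mult, Cmod_Cexp; apply Rle_refl.
- split; [exact I |]; rewrite Rmult_0_l, Rminus_0_r; exact B.
Qed.

(* By the Cauchy-Riemann equations the [x]-derivative of the mean of [Re G] is an integral of
   [w1 * Im G], so the mean hardly depends on the abscissa. *)
Lemma mean_shift (G : C -> C) x0 x1 B v B' : x0 < x1 -> smooth 1 G ->
  (forall x t, x0 <= x <= x1 -> a <= t <= b -> Cmod (G (x, t)) <= B) ->
  mean (fun t => Re (G (x1, t))) v B' -> mean (fun t => Re (G (x0, t))) v (B' + Q * B * (x1 - x0)).
Proof.
intros Hx SG HB [_ Hm].
destruct SG as [[C1 C2] [G1 [H [[C3 C4] _]]]].
destruct (weight_cont2 w w1 w2 a b k e Hw) as [W0 [W1 _]].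
assert (I : forall x, ex_RInt (fun t => w t * Re (G (x, t))) a b).
{ intros x; exact (ex_RInt_slice (fun x t => w t * Re (G (x, t))) x a b ltac:(lra) (cont2_mult _ _ W0 C1)). }
split; [apply I |].
set (p := fun x => RInt (fun t => w t * Re (G (x, t))) a b : R).
set (p' := fun x => RInt (fun t => w t * Re (G1 (x, t))) a b : R).
assert (D : forall x, is_derive p x (p' x)).
{ intros x; apply (is_derive_RInt_p (fun x t => w t * Re (G (x, t))) (fun x t => w t * Re (G1 (x, t)))).
  - lra.
  - exact (cont2_mult _ _ W0 C1).
  - exact (cont2_mult _ _ W0 C3).
  - intros z t Ht; apply (is_derive_scal (fun x => Re (G (x, t)))); exact (proj1 (proj1 (H z t Ht))). }
assert (P : forall x, x0 <= x <= x1 -> Rabs (p' x) <= Q * B).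
{ intros x Hxx; refine (proj2 (weight_by_parts (fun t => Im (G (x, t))) (fun t => Re (G1 (x, t))) B _ _ _ _)).
  - intros t Ht; destruct (H x t ltac:(lra)) as [_ [_ D2]].
    evar_last; [exact D2 | unfold Im, Re; simpl; ring].
  - intros t Ht; apply (cont2_slice (fun x t => Im (G (x, t)))); [exact C2 | lra].
  - intros t Ht; apply (cont2_slice (fun x t => Re (G1 (x, t)))); [exact C3 | lra].
  - intros t Ht; eapply Rle_trans; [apply im_le_Cmod | apply HB; assumption]. }
destruct (MVT_gen p x0 x1 p') as [c [Hc E]].
- intros; apply D.
- intros x _; apply (continuity_pt_of_derive _ _ _ (D x)).
- rewrite Rmin_left, Rmax_right in Hc by lra; specialize (P c Hc).
  change (Rabs (p x0 - v * RInt w a b) <= B' + Q * B * (x1 - x0)).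
  change (Rabs (p x1 - v * RInt w a b) <= B') in Hm.
  replace (p x0 - v * RInt w a b) with ((p x1 - v * RInt w a b) + - (p' c * (x1 - x0))) by lra.
  eapply Rle_trans; [apply Rabs_triang |]; rewrite Rabs_Ropp, Rabs_mult, (Rabs_pos_eq (x1 - x0)) by lra.
  nra.
Qed.

End Mean.

(** * Short mollifiers: rough numbers *)

(** Trial division by 2, ..., d; the disjunct [d' =? 0] exempts the divisor 1. *)
Fixpoint rough (d k : nat) : bool :=
  match d with
  | O => true
  | S d' => rough d' k && ((d' =? 0)%nat || negb (k mod d =? 0)%nat)
  end.

Definition is_prime (d : nat) : bool :=
  match d with O => false | S d' => (1 <=? d')%nat && rough d' d end.

Lemma rough_spec d k :
  rough d k = true <-> forall e, (2 <= e <= d)%nat -> ~ Nat.divide e k.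
Proof.
induction d as [|d IH]; [simpl; split; [intros; lia | reflexivity] |].
cbn [rough]; rewrite Bool.andb_true_iff, IH, Bool.orb_true_iff, Bool.negb_true_iff,
  Nat.eqb_eq, Nat.eqb_neq, Nat.Lcm0.mod_divide; split.
- intros [H1 H2] e He; destruct (Nat.eq_dec e (S d)) as [-> | N]; [| apply H1; lia].
  destruct H2 as [H2 | H2]; [lia | exact H2].
- intros H; split; [intros e He; apply H; lia |].
  destruct d; [left; reflexivity | right; apply H; lia].
Qed.

Lemma is_prime_spec p : is_prime p = true <->
  (2 <= p)%nat /\ forall e, (2 <= e < p)%nat -> ~ Nat.divide e p.
Proof.
destruct p as [|d]; [simpl; split; [discriminate | lia] |].
unfold is_prime; rewrite Bool.andb_true_iff, Nat.leb_le, rough_spec.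
split; intros [H1 H2]; (split; [lia |]); intros e He; apply H2; lia.
Qed.

Lemma prime_coprime p q : is_prime p = true -> (1 <= q < p)%nat -> Nat.gcd p q = 1%nat.
Proof.
intros Hp Hq; apply is_prime_spec in Hp as [H2 H].
pose proof (Nat.gcd_divide_l p q) as G1; pose proof (Nat.gcd_divide_r p q) as G2.
pose proof (Nat.divide_pos_le (Nat.gcd p q) q ltac:(lia) G2).
destruct (Nat.eq_dec (Nat.gcd p q) 0) as [E | N0]; [apply Nat.gcd_eq_0 in E; lia |].
destruct (Nat.eq_dec (Nat.gcd p q) 1) as [E | N1]; [exact E |].
exfalso; apply (H (Nat.gcd p q)); [lia | exact G1].
Qed.

Lemma gcd_mul_1 p x y : Nat.gcd p x = 1%nat -> Nat.gcd p y = 1%nat -> Nat.gcd p (x * y) = 1%nat.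
Proof.
intros Hx Hy; apply Nat.divide_1_r; rewrite <- Hy.
assert (G : Nat.gcd (Nat.gcd p (x * y)) x = 1%nat).
{ apply Nat.divide_1_r; rewrite <- Hx; apply Nat.gcd_greatest; [| apply Nat.gcd_divide_r].
  eapply Nat.divide_trans; [apply Nat.gcd_divide_l | apply Nat.gcd_divide_l]. }
apply Nat.gcd_greatest; [apply Nat.gcd_divide_l |].
apply (Nat.gauss _ x); [apply Nat.gcd_divide_r | exact G].
Qed.

(** A prime is coprime to every smaller positive number, so by Gauss's lemma the new factor creates
    no divisor up to d. *)
Lemma rough_mul_prime d k : is_prime (S d) = true -> rough d (S d * k) = rough d k.
Proof.
intros Hp; apply Bool.eq_iff_eq_true; rewrite !rough_spec.
split; intros H e He D; apply (H e He).
- apply Nat.divide_mul_r, D.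
- apply (Nat.gauss _ (S d)); [exact D |].
  rewrite Nat.gcd_comm; apply prime_coprime; [exact Hp | lia].
Qed.

Lemma rough_not_prime d k : is_prime (S d) = false -> rough (S d) k = rough d k.
Proof.
intros Hp; apply Bool.eq_iff_eq_true; rewrite !rough_spec.
split; intros H e He D; [apply (H e); [lia | exact D] |].
destruct (Nat.eq_dec e (S d)) as [-> | N]; [| apply (H e); [lia | exact D]].
apply Bool.not_true_iff_false in Hp; apply Hp; apply is_prime_spec; split; [lia |].
intros f Hf D2; apply (H f); [lia | eapply Nat.divide_trans; eassumption].
Qed.

Fixpoint euler (g : nat -> R) (n : nat) : R :=
  match n with
  | O => 1
  | S d => euler g d * (if is_prime n then 1 - g n else 1)
  end.

Section Sieve.

Variable g : nat -> R.
Hypothesis g_pos : forall k, 0 <= g (S k) <= 1.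
Hypothesis g_mul : forall d k, g (S d * S k)%nat = g (S d) * g (S k).

Definition rough_sum (d n : nat) : R := Rsum (fun i => indic (rough d (S i)) * g (S i)) n.

Lemma euler_range n : 0 <= euler g n.
Proof.
induction n as [|n IH]; cbn [euler]; [lra |].
destruct (is_prime (S n)); specialize (g_pos n); [apply Rmult_le_pos; lra | lra].
Qed.

(** One step of Legendre's sieve: the removed integers are the multiples of the prime that were
    rough so far, and complete multiplicativity factors out [g] of the prime. *)
Lemma rough_sum_prime d n : is_prime (S d) = true ->
  rough_sum (S d) n = rough_sum d n - g (S d) * rough_sum d (n / S d).
Proof.
intros Hp.
assert (Hd : (1 <= d)%nat) by (apply is_prime_spec in Hp; lia).
pose proof (Rsum_multiples (fun k => indic (rough d k) * g k) (S d) n ltac:(lia)) as M.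
assert (E : Rsum (fun i => indic (rough d (S d * S i)) * g (S d * S i)%nat) (n / S d) =
  g (S d) * rough_sum d (n / S d)).
{ unfold rough_sum; rewrite <- Rsum_scal; apply Rsum_ext; intros i _.
  rewrite rough_mul_prime, g_mul by exact Hp; ring. }
rewrite <- E, <- M.
assert (P : rough_sum d n = rough_sum (S d) n +
  Rsum (fun i => indic (S i mod S d =? 0)%nat * (indic (rough d (S i)) * g (S i))) n); [| lra].
unfold rough_sum; rewrite <- Rsum_plus; apply Rsum_ext; intros i _.
cbn [rough]; destruct d as [|d]; [lia |].
change (S d =? 0)%nat with false; rewrite Bool.orb_false_l.
destruct (rough (S d) (S i)), (S i mod S (S d) =? 0)%nat; simpl; ring.
Qed.

Lemma rough_sum_not_prime d n : is_prime (S d) = false -> rough_sum (S d) n = rough_sum d n.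
Proof.
intros Hp; apply Rsum_ext; intros i _; rewrite rough_not_prime by exact Hp; reflexivity.
Qed.

Lemma rough_term_pos d i : 0 <= indic (rough d (S i)) * g (S i).
Proof. pose proof (indic_range (rough d (S i))); specialize (g_pos i); nra. Qed.

Lemma rough_sum_mono d m n : (m <= n)%nat -> rough_sum d m <= rough_sum d n.
Proof.
induction 1 as [|n H IH]; [lra |].
unfold rough_sum in *; cbn [Rsum]; pose proof (rough_term_pos d n); lra.
Qed.

(** What a prime p removes is g(p) times a sum cut at n / p, hence at most g(p) times the whole sum.
    So each step keeps at least the factor 1 - g(p), and no error terms accumulate. *)
Lemma rough_sum_lower d n : euler g d * rough_sum 0 n <= rough_sum d n.
Proof.
induction d as [|d IH]; [simpl; lra |].
cbn [euler]; destruct (is_prime (S d)) eqn:Hp.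
- rewrite rough_sum_prime by exact Hp.
  assert (rough_sum d (n / S d) <= rough_sum d n)
    by (apply rough_sum_mono, Nat.Div0.div_le_upper_bound; nia).
  specialize (g_pos d); nra.
- rewrite rough_sum_not_prime by exact Hp; lra.
Qed.

Hypothesis g_sum : ex_series (fun i => g (S i)).

Definition rough_series (d : nat) : R := Series (fun i => indic (rough d (S i)) * g (S i)).

Lemma rough_series_ex d : ex_series (fun i => indic (rough d (S i)) * g (S i)).
Proof.
apply (ex_series_le (V := R_CompleteNormedModule) _ (fun i => g (S i))); [| exact g_sum].
intros i; change (Rabs (indic (rough d (S i)) * g (S i)) <= g (S i)).
rewrite Rabs_pos_eq by apply rough_term_pos.
pose proof (indic_range (rough d (S i))); specialize (g_pos i); nra.
Qed.

Lemma rough_series_le d c : (forall n, rough_sum d n <= c) -> rough_series d <= c.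
Proof.
intros H; destruct (rough_series_ex d) as [l Hl].
unfold rough_series; rewrite (is_series_unique _ _ Hl).
apply is_series_Rsum in Hl.
exact (is_lim_seq_le _ _ l c H Hl (is_lim_seq_const c)).
Qed.

Lemma rough_sum_le_series d n : rough_sum d n <= rough_series d.
Proof. apply Rsum_le_Series; [apply rough_term_pos | apply rough_series_ex]. Qed.

(** For the full series nothing is lost by the cut at n / p, so the inequality of [rough_sum_lower]
    can be reversed. This will bound the Euler product from below. *)
Lemma rough_series_upper d : rough_series d <= euler g d * rough_series 0.
Proof.
induction d as [|d IH]; [simpl; lra |].
cbn [euler]; destruct (is_prime (S d)) eqn:Hp.
- apply (Rle_trans _ (rough_series d * (1 - g (S d)))); [| specialize (g_pos d); nra].
  destruct (Req_dec (g (S d)) 0) as [Z | NZ].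
  { apply rough_series_le; intros n; rewrite rough_sum_prime, Z by exact Hp.
    pose proof (rough_sum_le_series d n); lra. }
  assert (Hg : 0 < g (S d)) by (specialize (g_pos d); lra).
  (* With p = d + 1 this reads g(p) S_d <= S_d - S_(d+1), in divided form so that it can be proved
     on partial sums. Cutting at n + p m retains all multiples p j with j <= m, so m and n go to
     infinity separately. *)
  assert (A : rough_series d <= (rough_series d - rough_series (S d)) / g (S d)).
  { apply rough_series_le; intros m.
    apply (Rmult_le_reg_l (g (S d))); [exact Hg |].
    replace (g (S d) * ((rough_series d - rough_series (S d)) / g (S d)))
      with (rough_series d - rough_series (S d)) by (field; lra).
    assert (rough_series (S d) <= rough_series d - g (S d) * rough_sum d m); [| lra].
    apply rough_series_le; intros n.
    apply (Rle_trans _ (rough_sum (S d) (n + S d * m))); [apply rough_sum_mono; lia |].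
    rewrite rough_sum_prime by exact Hp.
    pose proof (rough_sum_le_series d (n + S d * m)).
    assert (rough_sum d m <= rough_sum d ((n + S d * m) / S d)); [| nra].
    apply rough_sum_mono, Nat.div_le_lower_bound; lia. }
  apply (Rmult_le_compat_l (g (S d))) in A; [| lra].
  replace (g (S d) * ((rough_series d - rough_series (S d)) / g (S d)))
    with (rough_series d - rough_series (S d)) in A by (field; lra).
  lra.
- apply (Rle_trans _ (rough_series d)); [| lra].
  apply rough_series_le; intros n; rewrite rough_sum_not_prime by exact Hp.
  apply rough_sum_le_series.
Qed.

(** The integer 1 survives every sieving step, so the sieved series is at least g(1) = 1. *)
Lemma euler_lower d : g 1%nat = 1 -> 1 <= euler g d * rough_series 0.
Proof.
intros H1; eapply Rle_trans; [| apply rough_series_upper].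
eapply Rle_trans; [| apply (rough_sum_le_series d 1)].
unfold rough_sum; simpl; rewrite H1.
assert (rough d 1 = true) as ->; [| simpl; lra].
apply rough_spec; intros e He D; apply Nat.divide_1_r in D; lia.
Qed.

End Sieve.

(** The product of the distinct primes up to n that divide m. It divides m, so the logarithms of
    these primes sum to at most log m. *)
Fixpoint prime_part (n m : nat) : nat :=
  match n with
  | O => 1
  | S j => if (is_prime (S j) && (m mod S j =? 0)%nat)%bool then S j * prime_part j m else prime_part j m
  end.

Lemma prime_part_coprime p n m : is_prime p = true -> (n < p)%nat ->
  Nat.gcd p (prime_part n m) = 1%nat.
Proof.
intros Hp; induction n as [|j IH]; intros Hn; [rewrite Nat.gcd_comm; reflexivity |].
cbn [prime_part]; destruct (_ && _)%bool; [| apply IH; lia].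
apply gcd_mul_1; [apply prime_coprime; [exact Hp | lia] | apply IH; lia].
Qed.

Lemma prime_part_divide n m : Nat.divide (prime_part n m) m.
Proof.
induction n as [|j IH]; [apply Nat.divide_1_l |].
cbn [prime_part]; destruct (is_prime (S j)) eqn:Hp; [| exact IH].
destruct (m mod S j =? 0)%nat eqn:E; [| exact IH].
apply Nat.eqb_eq, Nat.Lcm0.mod_divide in E.
destruct IH as [c Hc]; change (Nat.divide (S j * prime_part j m) m).
assert (D : Nat.divide (S j) c).
{ apply (Nat.gauss _ (prime_part j m)); [rewrite Nat.mul_comm, <- Hc; exact E |].
  apply prime_part_coprime; [exact Hp | lia]. }
destruct D as [c' ->]; exists c'; rewrite Hc at 1; ring.
Qed.

Lemma prime_part_ln n m :
  Rsum (fun i => indic (S m mod S i =? 0)%nat * (indic (is_prime (S i)) * ln (INR (S i)))) n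
  <= ln (INR (S m)).
Proof.
assert (P : forall n, (1 <= prime_part n (S m))%nat /\ Rsum (fun i => indic (S m mod S i =? 0)%nat *
  (indic (is_prime (S i)) * ln (INR (S i)))) n = ln (INR (prime_part n (S m)))).
{ clear n; induction n as [|j [IH1 IH2]]; [split; [simpl; lia | simpl; rewrite ln_1; reflexivity] |].
  cbn [Rsum prime_part]; rewrite IH2.
  destruct (is_prime (S j)), (S m mod S j =? 0)%nat; cbn [andb indic]; try (split; [exact IH1 | ring]).
  split; [nia |].
  apply le_INR in IH1; pose proof (INR_S_ge_1 j); simpl (INR 1) in IH1.
  rewrite mult_INR, ln_mult by lra; ring. }
destruct (P n) as [P1 ->]; apply ln_le.
- apply le_INR in P1; simpl (INR 1) in P1; lra.
- apply le_INR, Nat.divide_pos_le; [lia | apply prime_part_divide].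
Qed.

(* Half of Chebyshev's estimate, from [log n! <= n log n]. *)
Lemma prime_log_sum n : (1 <= n)%nat ->
  Rsum (fun i => indic (is_prime (S i)) * (ln (INR (S i)) / INR (S i))) n <= 2 * ln (INR n).
Proof.
intros Hn; assert (Hn' : 1 <= INR n) by (apply le_INR in Hn; exact Hn).
assert (U : Rsum (fun m => Rsum (fun i => indic (S m mod S i =? 0)%nat *
    (indic (is_prime (S i)) * ln (INR (S i)))) n) n <= INR n * ln (INR n)).
{ rewrite <- Rsum_const; apply Rsum_le; intros m Hm.
  eapply Rle_trans; [apply prime_part_ln |]; apply ln_le; [pose proof (INR_S_ge_1 m); lra |].
  apply le_INR; lia. }
rewrite Rsum_exchange in U.
apply (Rmult_le_reg_l (INR n / 2)); [lra |].
apply (Rle_trans _ (INR n * ln (INR n))); [| lra].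
eapply Rle_trans; [| exact U].
rewrite <- Rsum_scal; apply Rsum_le; intros i Hi.
rewrite (Rsum_multiples (fun _ => indic (is_prime (S i)) * ln (INR (S i))) (S i) n) by lia.
rewrite Rsum_const.
pose proof (INR_S_ge_1 i) as Ip; pose proof (ln_INR_S i) as Lp; pose proof (indic_range (is_prime (S i))) as Rp.
(* The factor 2 of the bound comes from here: the quotient is at least 1, so taking its integer part
   at most halves it. *)
assert (F : INR n <= 2 * INR (S i) * INR (n / S i)).
{ pose proof (Nat.div_mod_eq n (S i)) as E; pose proof (Nat.mod_upper_bound n (S i) ltac:(lia)) as M.
  assert (1 <= n / S i)%nat by (apply Nat.div_le_lower_bound; lia).
  replace 2 with (INR 2) by reflexivity; rewrite <- !mult_INR; apply le_INR; nia. }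
replace (INR n / 2 * (indic (is_prime (S i)) * (ln (INR (S i)) / INR (S i)))) with
  (INR n / (2 * INR (S i)) * (indic (is_prime (S i)) * ln (INR (S i)))) by (field; lra).
apply Rmult_le_compat_r; [apply Rmult_le_pos; lra |].
apply (Rmult_le_reg_l (2 * INR (S i))); [lra |].
replace (2 * INR (S i) * (INR n / (2 * INR (S i)))) with (INR n) by (field; lra); exact F.
Qed.

(** The integral test, as an induction: the bound proved for the partial sums contains the exact
    integral of u^(-1-del). *)
Lemma zeta_1_delta del n : 0 < del ->
  Rsum (fun i => exp (- (1 + del) * ln (INR (S i)))) n <= 1 + / del.
Proof.
intros Hd.
assert (P : forall n, Rsum (fun i => exp (- (1 + del) * ln (INR (S i)))) (S n)
  <= 1 + (1 - exp (- del * ln (INR (S n)))) / del).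
{ clear n; induction n as [|n IH].
  - simpl; rewrite ln_1, !Rmult_0_r, exp_0; apply Req_le; field; lra.
  - change (Rsum (fun i => exp (- (1 + del) * ln (INR (S i)))) (S (S n))) with
      (Rsum (fun i => exp (- (1 + del) * ln (INR (S i)))) (S n) +
        exp (- (1 + del) * ln (INR (S (S n))))).
    pose proof (INR_S_ge_1 n) as Iy; rewrite (S_INR (S n)); set (y := INR (S n)) in *.
    assert (Lr : / (y + 1) <= ln (y + 1) - ln y).
    { pose proof (ln_le_sub_1 (y / (y + 1)) ltac:(apply Rdiv_lt_0_compat; lra)) as B.
      rewrite ln_div in B by lra.
      replace (y / (y + 1) - 1) with (- / (y + 1)) in B by (field; lra); lra. }
    assert (E1 : exp (- del * ln y) = exp (- del * ln (y + 1)) * exp (del * (ln (y + 1) - ln y)))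
      by (rewrite <- exp_plus; f_equal; ring).
    assert (E2 : exp (- (1 + del) * ln (y + 1)) = exp (- del * ln (y + 1)) * / (y + 1)).
    { replace (- (1 + del) * ln (y + 1)) with (- del * ln (y + 1) + - ln (y + 1)) by ring.
      rewrite exp_plus, exp_Ropp, exp_ln by lra; reflexivity. }
    pose proof (exp_ineq1_le (del * (ln (y + 1) - ln y))) as E3.
    pose proof (exp_pos (- del * ln (y + 1))) as E4.
    apply (Rmult_le_reg_l del); [exact Hd |].
    apply (Rmult_le_compat_l del) in IH; [| lra].
    replace (del * (1 + (1 - exp (- del * ln y)) / del)) with
      (del + (1 - exp (- del * ln y))) in IH by (field; lra).
    replace (del * (1 + (1 - exp (- del * ln (y + 1))) / del)) with
      (del + (1 - exp (- del * ln (y + 1)))) by (field; lra).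
    rewrite E2; rewrite E1 in IH.
    set (q := exp (- del * ln (y + 1))) in *.
    assert (del * (q * / (y + 1)) <= q * exp (del * (ln (y + 1) - ln y)) - q); [| nra].
    assert (del * / (y + 1) <= del * (ln (y + 1) - ln y)) by (apply Rmult_le_compat_l; lra).
    assert (q * (del * / (y + 1)) <= q * (exp (del * (ln (y + 1) - ln y)) - 1))
      by (apply Rmult_le_compat_l; lra).
    lra. }
pose proof (Rinv_0_lt_compat del Hd).
destruct n as [|n]; [simpl; lra |].
eapply Rle_trans; [apply P |].
pose proof (exp_pos (- del * ln (INR (S n)))); unfold Rdiv; nra.
Qed.

Lemma harmonic_lower n : ln (INR (S n)) <= Rsum (fun i => / INR (S i)) n.
Proof.
induction n as [|n IH]; [simpl; rewrite ln_1; lra |].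
cbn [Rsum]; pose proof (INR_S_ge_1 n) as Iy; rewrite (S_INR (S n)); set (y := INR (S n)) in *.
pose proof (ln_le_sub_1 ((y + 1) / y) ltac:(apply Rdiv_lt_0_compat; lra)) as B.
rewrite ln_div in B by lra.
replace ((y + 1) / y - 1) with (/ y) in B by (field; lra); lra.
Qed.

(** Passes from the exponent 1 + del to 1 prime by prime. Since 1/p - p^(-1-del) <= t = del log p /
    p and 1 - 1/p >= 1/2, one gets 1 - p^(-1-del) <= (1 - 1/p) (1 + 4t). *)
Lemma euler_compare del n : 0 < del ->
  euler (fun k => exp (- (1 + del) * ln (INR k))) n *
    exp (- (4 * del) * Rsum (fun i => indic (is_prime (S i)) * (ln (INR (S i)) / INR (S i))) n)
  <= euler (fun k => / INR k) n.
Proof.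
intros Hd; induction n as [|n IH]; [simpl; rewrite Rmult_0_r, exp_0; lra |].
cbn [Rsum euler]; rewrite Rmult_plus_distr_l, exp_plus.
set (E := euler (fun k => exp (- (1 + del) * ln (INR k))) n) in *.
set (S0 := exp (- (4 * del) * Rsum _ n)) in *; set (V := euler (fun k => / INR k) n) in *.
destruct (is_prime (S n)) eqn:Hp; [| simpl indic; rewrite Rmult_0_l, !Rmult_0_r, exp_0, !Rmult_1_r; exact IH].
simpl indic; rewrite Rmult_1_l.
assert (H2 : 2 <= INR (S n)).
{ apply is_prime_spec in Hp as [H2 _]; apply le_INR in H2; exact H2. }
set (p := INR (S n)) in *; set (v := ln p) in *.
assert (Hv : 0 <= v) by apply ln_INR_S.
assert (Hy : 0 < / p <= / 2) by (split; [apply Rinv_0_lt_compat | apply Rinv_le_contravar]; lra).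
set (y := / p) in *; set (t := del * v * y).
assert (Ht : 0 <= t) by (unfold t; apply Rmult_le_pos; [apply Rmult_le_pos; lra | lra]).
set (q := exp (- (1 + del) * v)).
assert (Eq : q = y * exp (- (del * v))).
{ unfold q, y; rewrite <- (exp_ln p), <- exp_Ropp by lra; fold v; rewrite <- exp_plus; f_equal; ring. }
assert (B1 : y - q <= t).
{ rewrite Eq; unfold t; pose proof (exp_ineq1_le (- (del * v))); nra. }
assert (B2 : q <= y).
{ rewrite Eq; assert (exp (- (del * v)) <= 1) by (rewrite <- exp_0; apply exp_le; assert (0 <= del * v) by (apply Rmult_le_pos; lra); lra); nra. }
replace (- (4 * del) * (v / p)) with (- (4 * t)) by (unfold t, y; field; lra).
assert (B3 : (1 - q) * exp (- (4 * t)) <= 1 - y).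
{ rewrite exp_Ropp; apply (Rmult_le_reg_r (exp (4 * t))); [apply exp_pos |].
  rewrite Rmult_assoc, Rinv_l, Rmult_1_r by (apply Rgt_not_eq, exp_pos).
  pose proof (exp_ineq1_le (4 * t)).
  apply (Rle_trans _ ((1 - y) * (1 + 4 * t))); [nra | apply Rmult_le_compat_l; lra]. }
replace (E * (1 - q) * (S0 * exp (- (4 * t)))) with ((E * S0) * ((1 - q) * exp (- (4 * t)))) by ring.
apply Rmult_le_compat; [| | exact IH | exact B3].
- apply Rmult_le_pos; [| apply Rlt_le, exp_pos].
  apply euler_range; intros k; pose proof (ln_INR_S k) as Lk.
  assert (0 <= (1 + del) * ln (INR (S k))) by (apply Rmult_le_pos; lra).
  split; [apply Rlt_le, exp_pos | rewrite <- exp_0 at 2; apply exp_le; lra].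
- apply Rmult_le_pos; [lra | apply Rlt_le, exp_pos].
Qed.

(** A Mertens-type lower bound with del = 1 / log n: the Euler product at exponent 1 + del is at
    least 1 / (1 + log n) because the full series is at most 1 + 1 / del. Changing the exponent to 1
    costs exp(- 4 del * 2 log n) = exp(-8). *)
Lemma rough_sum_ge n X : (3 <= n)%nat ->
  exp (- 8) / (2 * ln (INR n)) * ln (INR (S X)) <= rough_sum (fun k => / INR k) n X.
Proof.
intros Hn.
assert (Hl : 1 <= ln (INR n)).
{ rewrite <- (ln_exp 1); apply ln_le; [apply exp_pos |].
  apply (Rle_trans _ (INR 3)); [simpl; pose proof exp_le_3; lra | apply le_INR, Hn]. }
set (l := ln (INR n)) in *; set (del := / l).
assert (Hd : 0 < del) by (apply Rinv_0_lt_compat; lra).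
assert (Inv : forall k, 0 <= / INR (S k) <= 1).
{ intros k; destruct (Rinv_range (INR (S k)) (INR_S_ge_1 k)); lra. }
eapply Rle_trans; [| apply rough_sum_lower; [exact Inv |]].
2:{ intros d k; rewrite mult_INR, Rinv_mult; reflexivity. }
assert (H0 : ln (INR (S X)) <= rough_sum (fun k => / INR k) 0 X).
{ eapply Rle_trans; [apply harmonic_lower |]; apply Req_le, Rsum_ext; intros i _; simpl indic; ring. }
set (g := fun k => exp (- (1 + del) * ln (INR k))).
assert (G1 : forall k, 0 <= g (S k) <= 1).
{ intros k; pose proof (ln_INR_S k) as Lk; unfold g.
  assert (0 <= (1 + del) * ln (INR (S k))) by (apply Rmult_le_pos; lra).
  split; [apply Rlt_le, exp_pos | rewrite <- exp_0 at 2; apply exp_le; lra]. }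
assert (G2 : forall d k, g (S d * S k)%nat = g (S d) * g (S k)).
{ intros d k; unfold g; pose proof (INR_S_ge_1 d); pose proof (INR_S_ge_1 k).
  rewrite mult_INR, ln_mult, <- exp_plus by lra; f_equal; ring. }
pose proof (euler_lower g G1 G2 (ex_series_pow del Hd) n) as EL.
assert (g 1%nat = 1) by (unfold g; simpl; rewrite ln_1, Rmult_0_r; apply exp_0).
specialize (EL H).
assert (A0 : rough_series g 0 <= 1 + l).
{ apply rough_series_le; [exact G1 | exact (ex_series_pow del Hd) |]; intros m.
  replace l with (/ del) by (unfold del; apply Rinv_inv).
  eapply Rle_trans; [| apply (zeta_1_delta del m Hd)].
  apply Req_le, Rsum_ext; intros i _; unfold g; simpl indic; ring. }
pose proof (euler_range g G1 n) as EP.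
pose proof (euler_compare del n Hd) as EC; fold g in EC.
pose proof (prime_log_sum n ltac:(lia)) as PL; fold l in PL.
assert (X8 : exp (- 8) <= exp (- (4 * del) *
  Rsum (fun i => indic (is_prime (S i)) * (ln (INR (S i)) / INR (S i))) n)).
{ apply exp_le; assert (del * l = 1) by (unfold del; field; lra); nra. }
set (S1 := exp (- (4 * del) * Rsum _ n)) in *.
assert (ELow : / (2 * l) <= euler g n).
{ apply (Rmult_le_reg_r (2 * l)); [lra |]; rewrite Rinv_l by lra; nra. }
pose proof (exp_pos (- 8)).
apply Rmult_le_compat; [| apply ln_INR_S | | exact H0].
- apply Rmult_le_pos; [lra | apply Rlt_le, Rinv_0_lt_compat; lra].
- eapply Rle_trans; [| exact EC]; unfold Rdiv; rewrite Rmult_comm.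
  apply Rmult_le_compat; [apply Rlt_le, Rinv_0_lt_compat; lra | lra | exact ELow | exact X8].
Qed.

(** * Short mollifiers: the duality argument *)

Lemma Rsum_mult f g m n :
  Rsum f m * Rsum g n = Rsum (fun i => Rsum (fun j => f i * g j) n) m.
Proof.
induction m as [|m IH]; simpl; [ring |].
rewrite <- IH, Rsum_scal; ring.
Qed.

Lemma Cmod_Csum_sq f n :
  Cmod (Csum f n) ^ 2 = Rsum (fun i => Rsum (fun j => Re (f i * Cconj (f j))%C) n) n.
Proof.
rewrite Cmod_sq, Re_Csum, Im_Csum, !Rsum_mult, <- Rsum_plus.
apply Rsum_ext; intros i _; rewrite <- Rsum_plus.
apply Rsum_ext; intros j _; unfold Re, Im; simpl; ring.
Qed.

Lemma Csum_mult f g m n :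
  (Csum f m * Csum g n)%C = Csum (fun i => Csum (fun j => f i * g j)%C n) m.
Proof.
induction m as [|m IH]; simpl; [ring |].
rewrite <- IH, Csum_mult_l; ring.
Qed.

Lemma Rsum_delta v j n : (j < n)%nat -> Rsum (fun i => if (i =? j)%nat then v else 0) n = v.
Proof.
induction n as [|n IH]; intros H; [lia |]; cbn [Rsum].
destruct (Nat.eq_dec n j) as [-> | N].
- rewrite Nat.eqb_refl, (Rsum_ext _ (fun _ => 0)), Rsum_const; [ring |].
  intros i Hi; destruct (Nat.eqb_spec i j); [lia | reflexivity].
- rewrite IH by lia; destruct (Nat.eqb_spec n j); [lia | ring].
Qed.

Lemma cpow_pos_pair x y t : cpow x ((y, t) - 1) = Cexp ((y - 1) * ln x, ln x * t).
Proof. unfold cpow; f_equal; apply injective_projections; simpl; ring. Qed.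

Lemma cpow_neg_pair x y t : cpow x (- (y, t)) = Cexp (- y * ln x, - ln x * t).
Proof. unfold cpow; f_equal; apply injective_projections; simpl; ring. Qed.

Lemma Cexp_pair_mult x y x' y' : (Cexp (x, y) * Cexp (x', y') = Cexp ((x + x')%R, (y + y')%R))%C.
Proof. rewrite <- Cexp_plus; reflexivity. Qed.

Lemma Cconj_Cexp x y : Cconj (Cexp (x, y)) = Cexp (x, - y).
Proof. unfold Cconj, Cexp; simpl; rewrite cos_neg, sin_neg; f_equal; ring. Qed.

(** The frequency spacing depends on the size of [i] alone; [j] will also stand for products m l
    that run far beyond X. *)
Lemma ln_diff_lower i j X : (i < X)%nat -> i <> j ->
  / (2 * INR X) <= Rabs (ln (INR (S i)) - ln (INR (S j))).
Proof.
intros Hi Hij; pose proof (INR_S_ge_1 i) as Ii; pose proof (INR_S_ge_1 j) as Ij.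
assert (IX : INR (S i) <= INR X) by (apply le_INR; lia).
destruct (Nat.lt_ge_cases j i) as [H | H].
- assert (D : INR (S j) + 1 <= INR (S i)) by (rewrite <- S_INR; apply le_INR; lia).
  set (x := INR (S i)) in *; set (y := INR (S j)) in *.
  pose proof (ln_le_sub_1 (y / x) ltac:(apply Rdiv_lt_0_compat; lra)) as B.
  rewrite ln_div in B by lra.
  assert (y / x <= (x - 1) / x) by (apply Rmult_le_compat_r; [apply Rlt_le, Rinv_0_lt_compat |]; lra).
  replace ((x - 1) / x) with (1 - / x) in * by (field; lra).
  assert (/ (2 * INR X) <= / x) by (apply Rinv_le_contravar; lra).
  eapply Rle_trans; [| apply Rle_abs]; lra.
- assert (D : INR (S i) + 1 <= INR (S j)) by (rewrite <- S_INR; apply le_INR; lia).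
  set (x := INR (S i)) in *; set (y := INR (S j)) in *.
  pose proof (ln_le_sub_1 (x / y) ltac:(apply Rdiv_lt_0_compat; lra)) as B.
  rewrite ln_div in B by lra.
  assert (x / y <= x / (x + 1)) by (apply Rmult_le_compat_l; [lra | apply Rinv_le_contravar; lra]).
  replace (x / (x + 1)) with (1 - / (x + 1)) in * by (field; lra).
  assert (/ (2 * INR X) <= / (x + 1)) by (apply Rinv_le_contravar; lra).
  rewrite Rabs_left1 by (pose proof (Rinv_0_lt_compat (x + 1) ltac:(lra)); lra); lra.
Qed.

Section PartA.

Variables (T u L K e : R) (a : nat -> C) (n N X : nat) (h : nat -> R) (w w1 w2 : R -> R).
(** The unit of size is u = T^(1/100), and [L] will be log T. All quantities are measured in powers
    of u; the total error, of order u^89, has to stay below T = u^100. *)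
Let k : R := L ^ 2 / T.
Let Q : R := k * (1 + e) * (2 * T - T).

Hypothesis HTu : T = u ^ 100.
Hypothesis Hu : 100 <= u.
Hypothesis HL : 0 < L.
Hypothesis HLu : L ^ 2 <= u.
Hypothesis HK : 0 <= K <= u.
Hypothesis Hn : (1 <= n)%nat.
Hypothesis Hnu : INR n <= u.
Hypothesis Ha1 : a 1%nat = 1.
Hypothesis Ha : forall i, (i < n)%nat -> Cmod (a (S i)) <= K * INR (S i).
Hypothesis HX : INR X <= u ^ 5.
Hypothesis HXN : (1 <= X <= N)%nat.
Hypothesis HN : 12 * ln T <= ln (INR N).
Hypothesis Hh : forall i, h i = 0 \/ h i = 1.
Hypothesis Hh1 : h 1%nat = 0.
Hypothesis Hrough : forall i m, h i <> 0 -> (2 <= m <= n)%nat -> ~ Nat.divide m i.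
Hypothesis He : 0 < e <= 1 / 12.
Hypothesis Hw : weight w w1 w2 T (2 * T) k e.

Let Z (s : C) := Zp N s.
Let M (s : C) := Mp a n s.
Let H (s : C) := Csum (fun i => h (S i) * cpow (INR (S i)) (s - 1))%C X.
Let V : R := Rsum (fun i => h (S i) / INR (S i)) X.

Lemma u_pow i j : (i <= j)%nat -> 1 <= u ^ i <= u ^ j.
Proof. intros Hij; split; [apply pow_R1_Rle; lra | apply Rle_pow; [lra | exact Hij]]. Qed.

Lemma T_large : 100 <= T.
Proof.
rewrite HTu; apply (Rle_trans _ (u ^ 1)); [rewrite pow_1; exact Hu | apply u_pow; lia].
Qed.

Lemma k_pos : 0 < k.
Proof. pose proof T_large; apply Rdiv_lt_0_compat; [apply pow_lt |]; lra. Qed.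

Lemma Q_le : 0 <= Q <= 2 * u.
Proof.
pose proof T_large; assert (E : Q = L ^ 2 * (1 + e)) by (unfold Q, k; field; lra).
rewrite E; pose proof (pow2_ge_0 L); nra.
Qed.

Lemma h_range i : 0 <= h i <= 1.
Proof. destruct (Hh i) as [-> | ->]; lra. Qed.

Lemma smooth_cpow m x : smooth m (fun s => cpow x (s - 1)).
Proof.
eapply (smooth_ext m (fun s => Cexp (ln x * s + - ln x))%C); [| apply smooth_Cexp].
intros s; unfold cpow; f_equal; ring.
Qed.

Lemma smooth_H m : smooth m H.
Proof.
apply (smooth_Csum m (fun i s => h (S i) * cpow (INR (S i)) (s - 1))%C).
intros i; apply smooth_mult; [apply smooth_const | apply smooth_cpow].
Qed.

Let Ttwo : 0 < T < 2 * T.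
Proof. pose proof T_large; lra. Qed.

Lemma H_size x t : 0 <= x <= 2 -> Cmod (H (x, t)) <= u ^ 10.
Proof.
intros Hx; unfold H; eapply Rle_trans; [apply Csum_mod |].
apply (Rle_trans _ (Rsum (fun _ => INR X) X)).
- apply Rsum_le; intros i Hi; rewrite Cmod_mult, Cmod_R, cpow_pos_pair, Cmod_Cexp.
  pose proof (h_range (S i)) as R0; rewrite Rabs_pos_eq by lra.
  pose proof (INR_S_ge_1 i) as Ii; pose proof (ln_INR_S i) as Li; cbn [Re fst].
  assert (exp ((x - 1) * ln (INR (S i))) <= INR (S i)).
  { apply (Rle_trans _ (exp (ln (INR (S i))))); [apply exp_le; nra | rewrite exp_ln; lra]. }
  assert (INR (S i) <= INR X) by (apply le_INR; lia).
  pose proof (exp_pos ((x - 1) * ln (INR (S i)))); nra.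
- rewrite Rsum_const; replace (u ^ 10) with (u ^ 5 * u ^ 5) by ring.
  apply Rmult_le_compat; auto using pos_INR.
Qed.

Lemma M_small x t : 0 <= x -> Cmod (M (x, t)) <= u ^ 3.
Proof.
intros Hx; eapply Rle_trans; [apply (Mp_bound a n K x t Hx Ha); lra |].
replace (u ^ 3) with (u * u ^ 2) by ring.
apply Rmult_le_compat; [lra | apply pow2_ge_0 | lra |].
apply pow_incr; split; [apply pos_INR | exact Hnu].
Qed.

Lemma Zp_tail_right x t m : 1 / 2 <= x <= 2 -> T <= t <= 2 * T -> (1 <= m)%nat ->
  Cmod (zeta (x, t) - Zp m (x, t)) <= 5 * T * exp (- (ln (INR m) / 2)).
Proof.
intros Hx Ht Hm; pose proof T_large.
eapply Rle_trans; [apply Zp_tail; [simpl; lra | apply pair_neq_1; lra | exact Hm] |]; simpl Re.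
pose proof (Cmod_pair_le x t ltac:(lra) ltac:(lra)) as P; pose proof (Cmod_ge_0 (x, t)).
assert (Ix : 0 <= / x <= 2).
{ split; [apply Rlt_le, Rinv_0_lt_compat; lra |].
  replace 2 with (/ (1 / 2)) by field; apply Rinv_le_contravar; lra. }
assert (Cmod (x, t) / x <= 5 * T).
{ assert (E : Cmod (x, t) / x <= (x + t) / x) by (apply Rmult_le_compat_r; lra).
  replace ((x + t) / x) with (1 + t * / x) in E by (field; lra); nra. }
apply Rmult_le_compat; [unfold Rdiv; nra | apply Rlt_le, exp_pos | assumption |].
apply exp_le; destruct m as [|m]; [lia |]; pose proof (ln_INR_S m); nra.
Qed.

(** Balances two estimates for [zeta] at m near sqrt T = u^50: the sum has m bounded terms and the
    tail is at most 5 T / sqrt m. A bound of order T would be too weak, since moving the line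
    multiplies it by the sizes of M and H, u^13, and by Q, of order u. *)
Lemma Z_small x t : 1 / 2 <= x <= 2 -> T <= t <= 2 * T -> Cmod (Z (x, t)) <= 15 * u ^ 75.
Proof.
intros Hx Ht; pose proof T_large as TL.
destruct (nat_floor_spec (u ^ 50)) as [F1 F2]; [apply pow_le; lra |].
set (m := S (nat_floor (u ^ 50))).
rewrite <- S_INR in F2; fold m in F2.
assert (F3 : INR m <= u ^ 50 + 1) by (unfold m; rewrite S_INR; lra).
assert (Hm : (1 <= m)%nat) by (unfold m; lia).
pose proof (u_pow 50 75 ltac:(lia)) as U1.
assert (B1 : Cmod (Zp m (x, t)) <= 2 * INR m + 1).
{ unfold Zp, Cminus, Cdiv; eapply Rle_trans; [apply Cmod_triangle |]; rewrite Cmod_opp, Cmod_mult.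
  pose proof (Cmod_1_minus_ge x t ltac:(lra)) as G.
  rewrite Cmod_inv by (apply Cmod_gt_0; unfold Cminus in G; lra).
  assert (S1 : Cmod (Csum (fun i => cpow (INR (S i)) (- (x, t))) m) <= INR m).
  { eapply Rle_trans; [apply Csum_mod |].
    rewrite <- (Rmult_1_r (INR m)), <- Rsum_const; apply Rsum_le; intros i _.
    rewrite Cmod_cpow_pair, <- exp_0; apply exp_le; pose proof (ln_INR_S i); nra. }
  assert (S2 : Cmod (cpow (INR (S m)) (1 + - (x, t))) <= INR (S m)).
  { rewrite Cmod_cpow; pose proof (INR_S_ge_1 m); pose proof (ln_INR_S m).
    apply (Rle_trans _ (exp (ln (INR (S m))))); [apply exp_le; unfold Re; simpl fst; nra | rewrite exp_ln; lra]. }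
  assert (S3 : 0 < / Cmod (1 + - (x, t)) <= 1) by (apply Rinv_range; unfold Cminus in G; lra).
  rewrite (S_INR m) in S2 at 2; pose proof (Cmod_ge_0 (cpow (INR (S m)) (1 + - (x, t)))).
  set (c := Cmod (cpow _ _)) in *; set (iv := / Cmod _) in *; nra. }
pose proof (Zp_tail_right x t m Hx Ht Hm) as B2.
assert (B3 : 5 * T * exp (- (ln (INR m) / 2)) <= 5 * u ^ 75).
{ assert (E : exp (- (ln (INR m) / 2)) <= / u ^ 25).
  { replace (/ u ^ 25) with (exp (- (INR 25 * ln u))).
    - apply exp_le.
      assert (INR 50 * ln u <= ln (INR m)).
      { rewrite <- (ln_exp (INR 50 * ln u)), exp_INR_mult, exp_ln by lra.
        apply ln_le; [apply pow_lt |]; lra. }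
      replace (INR 50) with 50 in * by (simpl; lra); replace (INR 25) with 25 by (simpl; lra); lra.
    - rewrite exp_Ropp, exp_INR_mult, exp_ln by lra; reflexivity. }
  apply (Rle_trans _ (5 * T * / u ^ 25)); [apply Rmult_le_compat_l; lra |].
  apply Req_le; rewrite HTu; replace (u ^ 100) with (u ^ 75 * u ^ 25) by (rewrite <- pow_add; reflexivity).
  field; lra. }
pose proof (Zp_tail_right x t N Hx Ht ltac:(lia)) as B4.
assert (B5 : 5 * T * exp (- (ln (INR N) / 2)) <= 5).
{ assert (E : exp (- (ln (INR N) / 2)) <= / T).
  { rewrite <- (exp_ln T) at 1 by lra; rewrite <- exp_Ropp; apply exp_le.
    assert (0 <= ln T) by (apply ln_nonneg; lra); lra. }
  apply (Rle_trans _ (5 * T * / T)); [apply Rmult_le_compat_l; lra | apply Req_le; field; lra]. }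
pose proof (Cmod_le_l (zeta (x, t)) (Zp m (x, t))) as C1.
pose proof (Cmod_le_r (zeta (x, t)) (Zp N (x, t))) as C2.
unfold Z; lra.
Qed.

Lemma FH_size x t : 1 / 2 <= x <= 2 -> T <= t <= 2 * T ->
  Cmod ((1 - Z (x, t) * M (x, t)) * H (x, t)) <= 16 * u ^ 88.
Proof.
intros Hx Ht; rewrite Cmod_mult.
pose proof (Z_small x t Hx Ht) as B1; pose proof (M_small x t ltac:(lra)) as B2.
pose proof (H_size x t ltac:(lra)) as B3.
pose proof (u_pow 0 78 ltac:(lia)) as U; rewrite pow_O in U.
assert (B4 : Cmod (1 - Z (x, t) * M (x, t)) <= 16 * u ^ 78).
{ eapply Rle_trans; [apply Cmod_triangle |]; rewrite Cmod_1, Cmod_opp, Cmod_mult.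
  assert (Cmod (Z (x, t)) * Cmod (M (x, t)) <= 15 * u ^ 75 * u ^ 3)
    by (apply Rmult_le_compat; auto using Cmod_ge_0).
  replace (15 * u ^ 75 * u ^ 3) with (15 * u ^ 78) in * by ring; lra. }
replace (16 * u ^ 88) with (16 * u ^ 78 * u ^ 10) by ring.
apply Rmult_le_compat; auto using Cmod_ge_0.
Qed.

Let X_pos : 1 <= INR X.
Proof. destruct HXN as [X1 _]; apply le_INR in X1; exact X1. Qed.

Lemma osc_term (c : C) (al la B : R) (f : R -> C) : / (2 * INR X) <= Rabs la ->
  Cmod c * exp al <= B -> (forall t, f t = (c * Cexp (al, (la * t)%R))%C) ->
  mean w T (2 * T) (fun t => Re (f t)) 0 (4 * u * INR X * B).
Proof.
intros Hla HB Hf; pose proof X_pos as XP; pose proof Q_le as QL.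
assert (I1 : 0 < / (2 * INR X)) by (apply Rinv_0_lt_compat; lra).
assert (N0 : la <> 0) by (intros E; rewrite E, Rabs_R0 in Hla; lra).
eapply mean_le; [exact (mean_osc w w1 w2 T (2 * T) k e Ttwo k_pos Hw c al la f N0 Hf) |].
fold Q; assert (I2 : 0 <= / Rabs la <= 2 * INR X).
{ split; [apply Rlt_le, Rinv_0_lt_compat; lra |].
  rewrite <- (Rinv_inv (2 * INR X)); apply Rinv_le_contravar; assumption. }
assert (I3 : 0 <= Cmod c * exp al) by (apply Rmult_le_pos; [apply Cmod_ge_0 | apply Rlt_le, exp_pos]).
replace (4 * u * INR X * B) with (2 * u * (B * (2 * INR X))) by ring.
apply Rmult_le_compat; [lra | apply Rmult_le_pos; lra | lra |].
apply Rmult_le_compat; lra.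
Qed.

(** The coefficients are 0 or 1, hence equal to their squares, and the diagonal is exactly [V]. Each
    of the at most X^2 other pairs oscillates at a frequency of at least 1 / (2X). *)
Lemma mean_H2 : mean w T (2 * T) (fun t => Cmod (H (1 / 2, t)) ^ 2) V (4 * u ^ 16).
Proof.
pose proof X_pos as XP.
set (f := fun i j t => Re ((h (S i) * cpow (INR (S i)) (((1 / 2)%R, t) - 1)) *
  Cconj (h (S j) * cpow (INR (S j)) (((1 / 2)%R, t) - 1)))%C).
apply (mean_ext w T (2 * T) (fun t => Rsum (fun i => Rsum (fun j => f i j t) X) X)).
{ intros t; unfold H; rewrite Cmod_Csum_sq; reflexivity. }
apply (mean_le w T (2 * T) _ _ (Rsum (fun _ => Rsum (fun _ => 4 * u * INR X * 1) X) X)).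
2:{ rewrite !Rsum_const.
  replace (4 * u ^ 16) with (4 * u * (u ^ 5 * (u ^ 5 * u ^ 5))) by ring.
  replace (INR X * (INR X * (4 * u * INR X * 1))) with (4 * u * (INR X * (INR X * INR X))) by ring.
  apply Rmult_le_compat_l; [lra |]; repeat (apply Rmult_le_compat; try nra). }
replace V with (Rsum (fun i => Rsum (fun j => if (j =? i)%nat then h (S i) / INR (S i) else 0) X) X).
2:{ apply Rsum_ext; intros i Hi; apply Rsum_delta, Hi. }
apply (mean_Rsum w T (2 * T) (fun i t => Rsum (fun j => f i j t) X)); intros i Hi.
apply (mean_Rsum w T (2 * T) (f i)); intros j Hj.
pose proof (h_range (S i)) as Ri; pose proof (h_range (S j)) as Rj.
assert (E : forall t, f i j t = Re (RtoC (h (S i) * h (S j))%R *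
  Cexp ((- (1 / 2) * (ln (INR (S i)) + ln (INR (S j))))%R, ((ln (INR (S i)) - ln (INR (S j))) * t)%R))%C).
{ intros t; unfold f; f_equal; rewrite !cpow_pos_pair, Cmult_conj, Cconj_Cexp.
  replace (Cconj (h (S j))) with (RtoC (h (S j))) by (apply injective_projections; simpl; ring).
  rewrite RtoC_mult.
  match goal with |- (?p * ?q * (?r * ?s))%C = _ => transitivity ((p * r) * (q * s))%C; [ring |] end.
  rewrite Cexp_pair_mult; f_equal; f_equal; apply injective_projections; simpl; field. }
eapply mean_ext; [intros t; symmetry; apply E |].
destruct (Nat.eqb_spec j i) as [-> | Nij].
- apply (mean_le w T (2 * T) _ _ 0); [| nra].
  apply (mean_ext w T (2 * T) (fun _ => h (S i) / INR (S i)));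
    [| apply (mean_const w w1 w2 T (2 * T) k e Ttwo Hw)].
  intros t; rewrite Rminus_diag, Rmult_0_l; unfold Cexp, Re, Im, RtoC, Cmult; cbn [fst snd].
  replace (- (1 / 2) * (ln (INR (S i)) + ln (INR (S i)))) with (- ln (INR (S i))) by field.
  rewrite exp_Ropp, exp_ln, cos_0, sin_0 by (pose proof (INR_S_ge_1 i); lra).
  destruct (Hh (S i)) as [-> | ->]; unfold Rdiv; ring.
- eapply osc_term; [exact (ln_diff_lower i j X Hi (not_eq_sym Nij)) | | reflexivity].
  rewrite Cmod_R, Rabs_pos_eq by nra.
  assert (exp (- (1 / 2) * (ln (INR (S i)) + ln (INR (S j)))) <= 1).
  { apply (Rle_trans _ (exp 0)); [apply exp_le; pose proof (ln_INR_S i); pose proof (ln_INR_S j); lra | rewrite exp_0; lra]. }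
  pose proof (exp_pos (- (1 / 2) * (ln (INR (S i)) + ln (INR (S j))))); apply (Rle_trans _ (1 * 1)); [apply Rmult_le_compat; nra | lra].
Qed.

Lemma exp_neg2_ln y : 0 < y -> exp (- (2) * ln y) = / y ^ 2.
Proof.
intros Hy; replace (- (2) * ln y) with (- (INR 2 * ln y)) by (simpl; ring).
rewrite exp_Ropp, exp_INR_mult, exp_ln by exact Hy; reflexivity.
Qed.

(** The term k = 1 would not oscillate; it is excluded by h(1) = 0, which is why the sum defining H
    starts above 1. *)
Lemma mean_H1 : mean w T (2 * T) (fun t => Re (H (2, t))) 0 (4 * u ^ 16).
Proof.
pose proof X_pos as XP.
set (f := fun i t => (h (S i) * cpow (INR (S i)) ((2, t) - 1))%C).
apply (mean_ext w T (2 * T) (fun t => Rsum (fun i => Re (f i t)) X)).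
{ intros t; unfold H; rewrite Re_Csum; reflexivity. }
apply (mean_le w T (2 * T) _ _ (Rsum (fun _ => 4 * u * INR X * INR X) X)).
2:{ rewrite Rsum_const.
  replace (4 * u ^ 16) with (4 * u * (u ^ 5 * (u ^ 5 * u ^ 5))) by ring.
  replace (INR X * (4 * u * INR X * INR X)) with (4 * u * (INR X * (INR X * INR X))) by ring.
  apply Rmult_le_compat_l; [lra |]; repeat (apply Rmult_le_compat; try nra). }
replace 0 with (Rsum (fun _ => 0) X) by (rewrite Rsum_const; ring).
apply (mean_Rsum w T (2 * T) (fun i t => Re (f i t))); intros i Hi.
destruct i as [|i].
- apply (mean_le w T (2 * T) _ _ 0); [| pose proof (Rmult_le_pos (4 * u * INR X) (INR X)); nra].
  eapply mean_ext; [| apply mean_0]; intros t; unfold f; rewrite Hh1, Cmult_0_l; reflexivity.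
- pose proof (ln_diff_lower (S i) 0 X Hi ltac:(lia)) as LD.
  change (INR 1) with 1 in LD; rewrite ln_1, Rminus_0_r in LD.
  apply (osc_term (RtoC (h (S (S i)))) (ln (INR (S (S i)))) (ln (INR (S (S i)))) (INR X) (f (S i)) LD).
  + rewrite Cmod_R, exp_ln by (pose proof (INR_S_ge_1 (S i)); lra).
    pose proof (h_range (S (S i))) as R0; rewrite Rabs_pos_eq by lra.
    assert (INR (S (S i)) <= INR X) by (apply le_INR; lia).
    pose proof (INR_S_ge_1 (S i)); nra.
  + intros t; unfold f; rewrite cpow_pos_pair; do 3 f_equal; ring.
Qed.

(** All indices are shifted by one, so the term is stationary when i + 1 = (m + 1) (l + 1), and
    roughness of i + 1 then forces m = 0. The factor (l + 1)^(-2) is kept in the error because l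
    runs up to the huge N. *)
Lemma mean_triple i m l : (i < X)%nat -> (m < n)%nat ->
  mean w T (2 * T) (fun t => Re ((h (S i) * cpow (INR (S i)) ((2, t) - 1)) *
      (a (S m) * cpow (INR (S m)) (- (2, t)) * cpow (INR (S l)) (- (2, t))))%C)
    (if (m =? 0)%nat then (if (l =? i)%nat then h (S i) / INR (S i) else 0) else 0)
    (4 * u * INR X * (u * INR X * / INR (S l) ^ 2)).
Proof.
intros Hi Hm; pose proof X_pos as XP.
pose proof (INR_S_ge_1 i) as Ii; pose proof (INR_S_ge_1 m) as Jm; pose proof (INR_S_ge_1 l) as Il.
pose proof (h_range (S i)) as Ri.
assert (E0 : 0 <= 4 * u * INR X * (u * INR X * / INR (S l) ^ 2)).
{ assert (0 < / INR (S l) ^ 2) by (apply Rinv_0_lt_compat, pow_lt; lra).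
  repeat apply Rmult_le_pos; lra. }
set (al := ln (INR (S i)) + (- (2) * ln (INR (S m)) + - (2) * ln (INR (S l)))).
set (la := ln (INR (S i)) - ln (INR (S m * S l))).
assert (Ef : forall t, ((h (S i) * cpow (INR (S i)) ((2, t) - 1)) *
  (a (S m) * cpow (INR (S m)) (- (2, t)) * cpow (INR (S l)) (- (2, t))) =
  (h (S i) * a (S m)) * Cexp (al, (la * t)%R))%C).
{ intros t; rewrite cpow_pos_pair, !cpow_neg_pair.
  match goal with |- (?p * ?q * (?r * ?s * ?v))%C = _ => transitivity ((p * r) * (q * (s * v)))%C; [ring |] end.
  rewrite !Cexp_pair_mult; f_equal; f_equal; unfold al, la; rewrite mult_INR, ln_mult by lra.
  apply injective_projections; cbn [fst snd]; ring. }
assert (Ea : exp al = INR (S i) * (/ INR (S m) ^ 2 * / INR (S l) ^ 2)).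
{ unfold al; rewrite !exp_plus, !exp_neg2_ln, exp_ln by lra; reflexivity. }
destruct (Nat.eq_dec (S i) (S m * S l)) as [Eq | Nq].
- assert (Ela : la = 0) by (unfold la; rewrite <- Eq; apply Rminus_diag).
  destruct (Hh (S i)) as [H0 | H0].
  + replace (if (m =? 0)%nat then _ else 0) with 0
      by (rewrite H0; destruct (m =? 0)%nat, (l =? i)%nat; unfold Rdiv; ring).
    apply (mean_le w T (2 * T) _ _ 0); [| exact E0].
    eapply mean_ext; [| apply mean_0]; intros t; cbv beta; rewrite Ef, H0, !Cmult_0_l; reflexivity.
  + assert (m = 0%nat).
    { destruct m as [|m]; [reflexivity | exfalso].
      apply (Hrough (S i) (S (S m))); [lra | lia | exists (S l); lia]. }
    subst m; assert (l = i) by lia; subst l.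
    rewrite !Nat.eqb_refl; apply (mean_le w T (2 * T) _ _ 0); [| exact E0].
    apply (mean_ext w T (2 * T) (fun _ => h (S i) / INR (S i)));
      [| apply (mean_const w w1 w2 T (2 * T) k e Ttwo Hw)].
    intros t; rewrite Ef, Ela, Rmult_0_l, Ha1, H0; unfold Cexp, Re, Im, RtoC, Cmult; cbn [fst snd].
    rewrite Ea, cos_0, sin_0; change (INR 1) with 1; field; lra.
- replace (if (m =? 0)%nat then _ else 0) with 0.
  2:{ destruct (Nat.eqb_spec m 0) as [-> |]; [| reflexivity].
    destruct (Nat.eqb_spec l i) as [-> |]; [lia | reflexivity]. }
  apply (osc_term (h (S i) * a (S m))%C al la); [| | exact Ef].
  + exact (ln_diff_lower i (l + m * S l) X Hi ltac:(lia)).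
  + rewrite Cmod_mult, Cmod_R, Rabs_pos_eq, Ea by lra.
    assert (Hx : INR (S i) <= INR X) by (apply le_INR; lia).
    assert (Hs : 0 < / INR (S l) ^ 2) by (apply Rinv_0_lt_compat, pow_lt; lra).
    assert (Ha' : Cmod (a (S m)) * / INR (S m) ^ 2 <= u).
    { apply (Rmult_le_reg_r (INR (S m) ^ 2)); [apply pow_lt; lra |].
      rewrite Rmult_assoc, Rinv_l, Rmult_1_r by (apply pow_nonzero; lra).
      apply (Rle_trans _ (K * INR (S m))); [apply Ha, Hm |].
      apply Rmult_le_compat; [lra | lra | lra |]; rewrite <- (pow_1 (INR (S m))) at 1.
      apply Rle_pow; [exact Jm | lia]. }
    assert (Ha0 : 0 <= Cmod (a (S m)) * / INR (S m) ^ 2).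
    { apply Rmult_le_pos; [apply Cmod_ge_0 | apply Rlt_le, Rinv_0_lt_compat, pow_lt; lra]. }
    replace (h (S i) * Cmod (a (S m)) * (INR (S i) * (/ INR (S m) ^ 2 * / INR (S l) ^ 2))) with
      (h (S i) * ((Cmod (a (S m)) * / INR (S m) ^ 2) * INR (S i) * / INR (S l) ^ 2)) by ring.
    assert (P1 : Cmod (a (S m)) * / INR (S m) ^ 2 * INR (S i) <= u * INR X)
      by (apply Rmult_le_compat; lra).
    assert (P0 : 0 <= Cmod (a (S m)) * / INR (S m) ^ 2 * INR (S i)) by (apply Rmult_le_pos; lra).
    assert (P2 : Cmod (a (S m)) * / INR (S m) ^ 2 * INR (S i) * / INR (S l) ^ 2 <=
      u * INR X * / INR (S l) ^ 2) by (apply Rmult_le_compat_r; lra).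
    assert (P3 : 0 <= Cmod (a (S m)) * / INR (S m) ^ 2 * INR (S i) * / INR (S l) ^ 2)
      by (apply Rmult_le_pos; lra).
    nra.
Qed.

Let S1 (s : C) := Csum (fun l => cpow (INR (S l)) (- s)) N.

Lemma mean_HMS : mean w T (2 * T) (fun t => Re (H (2, t) * (M (2, t) * S1 (2, t)))%C) V (8 * u ^ 18).
Proof.
pose proof X_pos as XP.
set (f := fun i m l t => Re ((h (S i) * cpow (INR (S i)) ((2, t) - 1)) *
      (a (S m) * cpow (INR (S m)) (- (2, t)) * cpow (INR (S l)) (- (2, t))))%C).
apply (mean_ext w T (2 * T) (fun t => Rsum (fun i => Rsum (fun m => Rsum (fun l => f i m l t) N) n) X)).
{ intros t; unfold H, M, Mp, S1; rewrite Csum_mult.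
  rewrite (Csum_mult _ (fun i => Csum _ N)), Re_Csum; apply Rsum_ext; intros i _.
  rewrite Re_Csum; apply Rsum_ext; intros m _.
  rewrite <- Csum_mult_l, Re_Csum; reflexivity. }
set (v := fun i m l => if (m =? 0)%nat then (if (l =? i)%nat then h (S i) / INR (S i) else 0) else 0).
apply (mean_le w T (2 * T) _ _ (Rsum (fun _ => Rsum (fun _ =>
  Rsum (fun l => 4 * u * INR X * (u * INR X * / INR (S l) ^ 2)) N) n) X)).
2:{ rewrite !Rsum_const.
  assert (E : Rsum (fun l => 4 * u * INR X * (u * INR X * / INR (S l) ^ 2)) N <=
    8 * u ^ 2 * (INR X * INR X)).
  { rewrite (Rsum_ext _ (fun l => (4 * u ^ 2 * (INR X * INR X)) * / INR (S l) ^ 2)) by (intros; ring).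
    rewrite Rsum_scal; destruct N as [|N']; [lia |].
    rewrite Rsum_S_l; pose proof (Rsum_inv_sq N').
    pose proof (Rinv_0_lt_compat (INR (S N')) ltac:(pose proof (INR_S_ge_1 N'); lra)).
    assert (0 <= 4 * u ^ 2 * (INR X * INR X)).
    { repeat apply Rmult_le_pos; try lra; apply pow2_ge_0. }
    change (INR 1) with 1; rewrite pow1, Rinv_1; nra. }
  assert (E0 : 0 <= 8 * u ^ 2 * (INR X * INR X)).
  { repeat apply Rmult_le_pos; try lra; apply pow2_ge_0. }
  apply (Rle_trans _ (u ^ 5 * (u * (8 * u ^ 2 * (u ^ 5 * u ^ 5))))); [| apply Req_le; ring].
  pose proof (pos_INR n).
  assert (8 * u ^ 2 * (INR X * INR X) <= 8 * u ^ 2 * (u ^ 5 * u ^ 5)).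
  { apply Rmult_le_compat_l; [pose proof (pow2_ge_0 u); lra | apply Rmult_le_compat; lra]. }
  apply (Rle_trans _ (INR X * (INR n * (8 * u ^ 2 * (INR X * INR X))))).
  - apply Rmult_le_compat_l; [lra |]; apply Rmult_le_compat_l; lra.
  - apply Rmult_le_compat; [lra | apply Rmult_le_pos; lra | lra |].
    apply Rmult_le_compat; lra. }
replace V with (Rsum (fun i => Rsum (fun m => Rsum (v i m) N) n) X).
2:{ apply Rsum_ext; intros i Hi.
  rewrite (Rsum_ext _ (fun m => if (m =? 0)%nat then h (S i) / INR (S i) else 0)).
  - apply Rsum_delta; lia.
  - intros m _; unfold v; destruct (m =? 0)%nat; [apply Rsum_delta; lia | rewrite Rsum_const; ring]. }
apply (mean_Rsum w T (2 * T) (fun i t => Rsum (fun m => Rsum (fun l => f i m l t) N) n)); intros i Hi.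
apply (mean_Rsum w T (2 * T) (fun m t => Rsum (fun l => f i m l t) N)); intros m Hm.
apply (mean_Rsum w T (2 * T) (f i m)); intros l Hl.
apply mean_triple; assumption.
Qed.

Lemma mean_tail : mean w T (2 * T) (fun t => Re ((Z (2, t) - S1 (2, t)) * (M (2, t) * H (2, t)))%C) 0 1.
Proof.
pose proof T_large as TL; pose proof (u_pow 13 100 ltac:(lia)) as U; rewrite <- HTu in U.
assert (SG : smooth 0 (fun s => (Z s - S1 s) * (M s * H s))%C).
{ apply smooth_mult; [| apply smooth_mult; [apply smooth_Mp | apply smooth_H]].
  apply smooth_minus; [apply smooth_Zp |].
  apply (smooth_Csum 0 (fun l s => cpow (INR (S l)) (- s))); intros l; apply smooth_cpow_opp. }
apply (mean_le w T (2 * T) _ _ ((2 * T - T) * / T)); [| apply Req_le; field; lra].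
apply (mean_bounded w w1 w2 T (2 * T) k e Ttwo Hw
  (fun x t => Re ((Z (x, t) - S1 (x, t)) * (M (x, t) * H (x, t)))%C)); [exact (proj1 (proj1 SG)) |].
intros t Ht; eapply Rle_trans; [apply re_le_Cmod |]; rewrite !Cmod_mult.
pose proof (M_small 2 t ltac:(lra)) as B1; pose proof (H_size 2 t ltac:(lra)) as B2.
assert (B3 : Cmod (Z (2, t) - S1 (2, t)) <= / T ^ 2).
{ unfold Z, Zp, S1.
  replace (Csum _ N - cpow (INR (S N)) (1 - (2, t)) / (1 - (2, t)) - Csum _ N)%C with
    (- (cpow (INR (S N)) (1 - (2, t)) * / (1 - (2, t))))%C by (unfold Cdiv; ring).
  rewrite Cmod_opp, Cmod_mult; pose proof (Cmod_1_minus_ge 2 t ltac:(lra)) as G.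
  rewrite Cmod_inv by (apply Cmod_gt_0; lra).
  assert (S3 : 0 < / Cmod (1 - (2, t)) <= 1) by (apply Rinv_range; lra).
  assert (S4 : Cmod (cpow (INR (S N)) (1 - (2, t))) <= / T ^ 2).
  { rewrite Cmod_cpow, <- exp_neg2_ln by lra; apply exp_le; unfold Re; cbn [fst Cminus Cplus Copp RtoC].
    assert (0 <= ln T) by (apply ln_nonneg; lra).
    assert (ln (INR N) <= ln (INR (S N))).
    { apply ln_le; [| apply le_INR; lia].
      destruct HXN as [X1 X2]; assert (1 <= INR N) by (apply (le_INR 1); lia); lra. }
    lra. }
  pose proof (Cmod_ge_0 (cpow (INR (S N)) (1 - (2, t)))).
  apply (Rle_trans _ (Cmod (cpow (INR (S N)) (1 - (2, t))) * 1)); [apply Rmult_le_compat_l |]; lra. }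
replace (/ T) with (/ T ^ 2 * T) by (field; lra).
apply Rmult_le_compat; [apply Cmod_ge_0 | apply Rmult_le_pos; apply Cmod_ge_0 | exact B3 |].
apply (Rle_trans _ (u ^ 3 * u ^ 10)); [apply Rmult_le_compat; auto using Cmod_ge_0 |].
replace (u ^ 3 * u ^ 10) with (u ^ 13) by ring; lra.
Qed.

Lemma mean_FH : mean w T (2 * T)
  (fun t => Re ((1 - Z ((1 / 2)%R, t) * M ((1 / 2)%R, t)) * H ((1 / 2)%R, t))%C) (- V) (61 * u ^ 89).
Proof.
pose proof (u_pow 16 18 ltac:(lia)) as U1; pose proof (u_pow 18 89 ltac:(lia)) as U2.
assert (A : mean w T (2 * T) (fun t => Re ((1 - Z (2, t) * M (2, t)) * H (2, t))%C) (- V) (13 * u ^ 18)).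
{ pose proof (mean_plus w T (2 * T) _ _ _ _ _ _ mean_H1
    (mean_plus w T (2 * T) _ _ _ _ _ _ (mean_opp w T (2 * T) _ _ _ mean_HMS)
       (mean_opp w T (2 * T) _ _ _ mean_tail))) as P.
  replace (0 + (- V + - 0)) with (- V) in P by ring.
  apply (mean_le w T (2 * T)) with (B' := 13 * u ^ 18) in P; [| lra].
  eapply mean_ext; [| exact P]; intros t; cbv beta.
  replace ((1 - Z (2, t) * M (2, t)) * H (2, t))%C with (H (2, t) + (- (H (2, t) * (M (2, t) * S1 (2, t))) +
    - ((Z (2, t) - S1 (2, t)) * (M (2, t) * H (2, t)))))%C by ring.
  reflexivity. }
assert (SG : smooth 1 (fun s => (1 - Z s * M s) * H s)%C).
{ apply smooth_mult; [| apply smooth_H].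
  apply smooth_minus; [apply smooth_const | apply smooth_mult; [apply smooth_Zp | apply smooth_Mp]]. }
pose proof (mean_shift w w1 w2 T (2 * T) k e Ttwo k_pos Hw _ (1 / 2) 2 (16 * u ^ 88) (- V) (13 * u ^ 18)
  ltac:(lra) SG FH_size A) as P.
eapply mean_le; [exact P |]; fold Q; pose proof Q_le as QL.
assert (0 <= u ^ 88) by (apply pow_le; lra).
assert (Q * (16 * u ^ 88) <= 2 * u * (16 * u ^ 88)) by (apply Rmult_le_compat_r; lra).
replace (2 * u * (16 * u ^ 88)) with (32 * u ^ 89) in * by ring; lra.
Qed.

(* [|F|^2 >= - 2 Re (F H) - |H|^2], whose weighted mean is [V] up to a negligible error. *)
Lemma moment_rough : T / 8 <= RInt w T (2 * T) -> 1 <= V ->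
  V / 32 <= mollified_moment (Mp a n) T.
Proof.
intros HW HV; pose proof T_large as TL.
set (F := fun s => (1 - Z s * M s)%C).
assert (SF : smooth 2 F).
{ apply smooth_minus; [apply smooth_const | apply smooth_mult; [apply smooth_Zp | apply smooth_Mp]]. }
pose proof (hol_cont2 F (fun q => q) (fun _ => 1) SF (fun q _ => is_derive_id (K := R_AbsRing) q)) as CF.
destruct (weight_slice w w1 w2 T (2 * T) k e Ttwo Hw _ (1 / 2) CF) as [I1 [I2 _]]; cbv beta in I1, I2.
assert (Mo : RInt (fun t => w t * Cmod (F (1 / 2, t)) ^ 2) T (2 * T) <=
  T * (2 * mollified_moment (Mp a n) T + 2 * (/ T) ^ 2)).
{ eapply Rle_trans; [| apply (moment_Zp a n N T (/ T)); [lra |]].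
  - apply RInt_le; [lra | exact I2 | exact I1 |].
    intros t Ht; pose proof (weight_range _ _ _ _ _ _ _ Hw t ltac:(lra)) as Wt.
    eapply Rle_trans; [apply Rmult_le_compat_r; [apply pow2_ge_0 | apply Wt] |].
    rewrite Rmult_1_l; apply Rle_refl.
  - intros t Ht; pose proof (Zp_tail_right (1 / 2) t N ltac:(lra) Ht ltac:(lia)) as B1.
    pose proof (M_small (1 / 2) t ltac:(lra)) as B2.
    assert (B3 : exp (- (ln (INR N) / 2)) <= / T ^ 6).
    { replace (/ T ^ 6) with (exp (- (INR 6 * ln T)))
        by (rewrite exp_Ropp, exp_INR_mult, exp_ln by lra; reflexivity).
      apply exp_le; replace (INR 6) with 6 by (simpl; lra); lra. }
    pose proof (u_pow 3 100 ltac:(lia)) as U; rewrite <- HTu in U.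
    apply (Rle_trans _ (5 * T * / T ^ 6 * T)).
    + apply Rmult_le_compat; try apply Cmod_ge_0; [| unfold M in B2; lra].
      eapply Rle_trans; [exact B1 | apply Rmult_le_compat_l; lra].
    + replace (5 * T * / T ^ 6 * T) with (5 * / T * / T ^ 3 ) by (field; lra).
      assert (0 < / T) by (apply Rinv_0_lt_compat; lra).
      assert (/ T ^ 3 <= / 5).
      { apply Rinv_le_contravar; [lra |]; apply (Rle_trans _ (T ^ 1)); [lra | apply Rle_pow; [lra | lia]]. }
      nra. }
assert (MF : mean w T (2 * T) (fun t => Re (F ((1 / 2)%R, t) * H ((1 / 2)%R, t))%C) (- V) (61 * u ^ 89))
  by exact mean_FH.
destruct MF as [J1 K1]; destruct mean_H2 as [J2 K2].
assert (Lo : RInt (fun t => -2 * (w t * Re (F ((1 / 2)%R, t) * H ((1 / 2)%R, t))%C) +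
    -1 * (w t * Cmod (H (1 / 2, t)) ^ 2)) T (2 * T) <= RInt (fun t => w t * Cmod (F (1 / 2, t)) ^ 2) T (2 * T)).
{ apply RInt_le; [lra | | exact I2 |].
  - apply ex_RInt_Rplus; apply ex_RInt_Rscal; assumption.
  - intros t Ht; pose proof (weight_range _ _ _ _ _ _ _ Hw t ltac:(lra)) as Wt.
    rewrite !Cmod_sq; set (f := F (1 / 2, t)); set (g := H (1 / 2, t)).
    pose proof (Rle_0_sqr (Re f + Re g)) as P1; pose proof (Rle_0_sqr (Im f - Im g)) as P2.
    unfold Rsqr in P1, P2; replace (Re (f * g)%C) with (Re f * Re g - Im f * Im g) by reflexivity.
    assert (P3 : 0 <= w t * (Re f * Re f + Im f * Im f + 2 * (Re f * Re g - Im f * Im g) +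
      (Re g * Re g + Im g * Im g))) by (apply Rmult_le_pos; lra).
    lra. }
rewrite (RInt_Rplus _ _ _ _ (ex_RInt_Rscal (-2) _ _ _ J1) (ex_RInt_Rscal (-1) _ _ _ J2)) in Lo.
rewrite (RInt_Rscal (-2) _ _ _ J1), (RInt_Rscal (-1) _ _ _ J2) in Lo.
set (A := RInt (fun t => w t * Re (F ((1 / 2)%R, t) * H ((1 / 2)%R, t))%C) T (2 * T) : R) in *.
set (B := RInt (fun t => w t * Cmod (H (1 / 2, t)) ^ 2) T (2 * T) : R) in *.
set (D := RInt (fun t => w t * Cmod (F (1 / 2, t)) ^ 2) T (2 * T) : R) in *.
change (-2 * A + -1 * B <= D) in Lo.
set (W := RInt w T (2 * T) : R) in *.
change (Rabs (A - - V * W) <= 61 * u ^ 89) in K1; change (Rabs (B - V * W) <= 4 * u ^ 16) in K2.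
change (T / 8 <= W) in HW.
change (D <= T * (2 * mollified_moment (Mp a n) T + 2 * (/ T) ^ 2)) in Mo.
apply Rabs_le_between in K1; apply Rabs_le_between in K2.
pose proof (u_pow 16 89 ltac:(lia)) as U1.
(* 126 = 2 * 61 + 4, the errors of [mean_FH] (used twice) and [mean_H2]. As u >= 100, they take at
   most T / 16 <= V T / 16, half of the main term. *)
assert (L1 : V * (T / 8) - 126 * u ^ 89 <= D).
{ assert (V * (T / 8) <= V * W) by (apply Rmult_le_compat_l; lra); lra. }
assert (L2 : 128 * u ^ 89 <= T / 16).
{ rewrite HTu; replace (u ^ 100) with (u ^ 9 * u ^ 2 * u ^ 89) by (rewrite <- !pow_add; reflexivity).
  pose proof (u_pow 0 9 ltac:(lia)); assert (10000 <= u ^ 2) by nra.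
  assert (10000 <= u ^ 9 * u ^ 2) by nra.
  assert (10000 * u ^ 89 <= u ^ 9 * u ^ 2 * u ^ 89) by (apply Rmult_le_compat_r; lra); lra. }
assert (L3 : T * (2 * mollified_moment (Mp a n) T + 2 * (/ T) ^ 2) <= 2 * T * mollified_moment (Mp a n) T + 1).
{ replace (T * (2 * mollified_moment (Mp a n) T + 2 * (/ T) ^ 2)) with
    (2 * T * mollified_moment (Mp a n) T + 2 * / T) by (field; lra).
  assert (/ T <= / 100) by (apply Rinv_le_contravar; lra); lra. }
assert (L4 : T / 16 <= V * (T / 16)) by nra.
apply (Rmult_le_reg_l (2 * T)); [lra |].
replace (2 * T * (V / 32)) with (V * (T / 16)) by field; lra.
Qed.

End PartA.

Lemma small_theta_bound (theta : R) : 0 < theta <= exp (- 8) / 80 -> forall K : R -> R,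
  exists T0 : R, forall T : R, T0 <= T -> forall a : nat -> C,
    a 1%nat = 1 ->
    (forall eps : R, 0 < eps -> forall n : nat, (1 <= n)%nat -> INR n <= Rpower T theta ->
       Cmod (a n) <= K eps * Rpower (INR n) eps) ->
    exp (- 8) / 2560 / theta <= mollified_moment (dirichlet_poly a (Rpower T theta)) T.
Proof.
intros Hth K.
assert (Hth1 : theta <= 1 / 100).
{ assert (exp (- 8) <= / 9); [| lra].
  replace (- 8) with (- (8)) by ring; rewrite exp_Ropp; apply Rinv_le_contravar; [lra | pose proof (exp_ineq1_le 8); lra]. }
set (K0 := Rabs (K 1)); pose proof (Rabs_pos (K 1) : 0 <= K0) as HK0.
destruct (pow_le_exp 2 10000) as [L1 [HL1 Q1]].
(* The summand 2 / theta ensures theta log T >= 2, so that n >= 3 as the sieve bound requires; 100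
   K0 gives K0 <= u, and 100 L1 gives (log T)^2 <= u. *)
set (L0 := 100 * L1 + 100 * K0 + 10000 + 2 / theta).
assert (P1 : 0 < 2 / theta) by (apply Rdiv_lt_0_compat; lra).
exists (exp L0); intros T HT a Ha1 Ha.
assert (HT0 : 0 < T) by (pose proof (exp_pos L0); lra).
set (L := ln T).
assert (EL : exp L = T) by (apply exp_ln, HT0).
assert (HL : L0 <= L) by (unfold L; rewrite <- (ln_exp L0); apply ln_le; [apply exp_pos | exact HT]).
unfold L0 in HL.
set (u := exp (L / 100)).
assert (HTu : T = u ^ 100).
{ unfold u; rewrite <- exp_INR_mult, <- EL; f_equal; replace (INR 100) with 100 by (simpl; lra); field. }
assert (Hu : 1 + L / 100 <= u) by (pose proof (exp_ineq1_le (L / 100)); unfold u; lra).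
assert (HLu : L ^ 2 <= u).
{ specialize (Q1 (L / 100) ltac:(lra)); fold u in Q1.
  replace (10000 * (L / 100) ^ 2) with (L ^ 2) in Q1 by field; exact Q1. }
set (Y := Rpower T theta).
assert (EY : Y = exp (theta * L)) by reflexivity.
assert (HthL : 2 <= theta * L).
{ apply (Rle_trans _ (theta * (2 / theta))); [apply Req_le; field; lra | apply Rmult_le_compat_l; lra]. }
assert (HY : 3 <= Y) by (rewrite EY; pose proof (exp_ineq1_le (theta * L)); lra).
set (n := nat_floor Y).
destruct (nat_floor_spec Y ltac:(lra)) as [N1 N2]; fold n in N1, N2.
assert (Hn : (3 <= n)%nat).
{ apply INR_le; replace (INR 3) with 3 by (simpl; lra).
  assert (INR 2 < INR n) as H2 by (simpl; lra); apply INR_lt in H2.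
  replace 3 with (INR 3) by (simpl; lra); apply le_INR; lia. }
assert (Hnu : INR n <= u).
{ eapply Rle_trans; [exact N1 |]; rewrite EY; apply exp_le.
  assert (0 <= (1 / 100 - theta) * L) by (apply Rmult_le_pos; lra); lra. }
assert (Hln : 1 <= ln (INR n) <= theta * L).
{ assert (INR 3 <= INR n) as H3 by (apply le_INR, Hn); replace (INR 3) with 3 in H3 by (simpl; lra).
  split.
  - rewrite <- (ln_exp 1); apply ln_le; [apply exp_pos | pose proof exp_le_3; lra].
  - rewrite <- (ln_exp (theta * L)), <- EY; apply ln_le; lra. }
assert (HaK : forall i, (i < n)%nat -> Cmod (a (S i)) <= K0 * INR (S i)).
{ intros i Hi; pose proof (INR_S_ge_1 i).
  assert (INR (S i) <= Y) by (eapply Rle_trans; [apply le_INR; exact Hi | exact N1]).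
  eapply Rle_trans; [apply (Ha 1 Rlt_0_1 (S i)); [lia | assumption] |].
  rewrite Rpower_1 by lra; apply Rmult_le_compat_r; [lra | apply Rle_abs]. }
assert (U5 : 1 <= u ^ 5) by (apply pow_R1_Rle; lra).
set (X := nat_floor (u ^ 5)).
destruct (nat_floor_spec (u ^ 5) ltac:(lra)) as [X1 X2]; fold X in X1, X2.
assert (HX : (1 <= X)%nat) by (destruct X; [simpl in X2; lra | lia]).
destruct (INR_unbounded (exp (12 * L) + u ^ 5)) as [N HN].
pose proof (exp_pos (12 * L)) as E12.
assert (HXN : (X <= N)%nat) by (apply INR_le; lra).
assert (HN12 : 12 * ln T <= ln (INR N)).
{ fold L; rewrite <- (ln_exp (12 * L)); apply ln_le; lra. }
(* Sieving goes exactly up to the length n of the mollifier, so that a coefficient a(m) with 2 <= m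
   <= n never meets a divisor of some k in the support. *)
set (h := fun i => indic (rough n i && negb (i =? 1)%nat)).
assert (Hh : forall i, h i = 0 \/ h i = 1) by (intros i; unfold h; destruct (_ && _)%bool; auto).
assert (Hh1 : h 1%nat = 0) by (unfold h; rewrite Bool.andb_false_r; reflexivity).
assert (Hrough : forall i m, h i <> 0 -> (2 <= m <= n)%nat -> ~ Nat.divide m i).
{ intros i m Hi; apply (proj1 (rough_spec n i)); unfold h in Hi.
  destruct (rough n i); [reflexivity | simpl in Hi; lra]. }
set (V := Rsum (fun i => h (S i) / INR (S i)) X).
assert (EV : V = rough_sum (fun k => / INR k) n X - 1).
{ unfold V, rough_sum; destruct X as [|X']; [lia |]; rewrite !Rsum_S_l, Hh1.
  assert (rough n 1 = true) as ->.
  { apply rough_spec; intros m Hm D; apply Nat.divide_1_r in D; lia. }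
  rewrite (Rsum_ext (fun k => h (S (S k)) / INR (S (S k)))
    (fun k => indic (rough n (S (S k))) * / INR (S (S k)))).
  - change (INR 1) with 1; simpl indic; rewrite Rinv_1; unfold Rdiv; ring.
  - intros i _; unfold h; change (S (S i) =? 1)%nat with false; rewrite Bool.andb_true_r; reflexivity. }
assert (HV : exp (- 8) / (80 * theta) <= V /\ 1 <= V).
(* This is where the range of theta comes from. As log X is about L / 20, the sieve gives at least 2
   exp(-8) / (80 theta); the omitted term k = 1 costs 1, hence at most half of it. *)
{ assert (B1 : 1 <= exp (- 8) / (80 * theta)).
  { apply (Rmult_le_reg_r (80 * theta)); [lra |].
    replace (exp (- 8) / (80 * theta) * (80 * theta)) with (exp (- 8)) by (field; lra); lra. }
  pose proof (rough_sum_ge n X Hn) as R1; rewrite <- (Rplus_0_r V), EV.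
  assert (B2 : L / 20 <= ln (INR (S X))).
  { replace (L / 20) with (INR 5 * (L / 100)) by (simpl; field).
    rewrite <- (ln_exp (INR 5 * (L / 100))), exp_INR_mult; fold u; apply ln_le; [lra |].
    rewrite S_INR; lra. }
  assert (B3 : exp (- 8) / (2 * (theta * L)) * (L / 20) <= exp (- 8) / (2 * ln (INR n)) * ln (INR (S X))).
  { pose proof (exp_pos (- 8)); apply Rmult_le_compat; [| lra | | exact B2].
    - apply Rlt_le, Rdiv_lt_0_compat; lra.
    - apply Rmult_le_compat_l; [lra | apply Rinv_le_contravar; lra]. }
  replace (exp (- 8) / (2 * (theta * L)) * (L / 20)) with (2 * (exp (- 8) / (80 * theta))) in B3
    by (field; lra).
  lra. }
destruct (weight_exists T (2 * T) (L ^ 2 / T)) as [w [w1 [w2 [Hw HwI]]]].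
{ apply Rdiv_lt_0_compat; [apply pow_lt |]; lra. }
{ lra. }
replace (L ^ 2 / T * (2 * T - T) / 4) with (L ^ 2 / 4) in Hw, HwI by (field; lra).
replace ((2 * T - T) / 8) with (T / 8) in HwI by (field; lra).
assert (He12 : 0 < exp (- (L ^ 2 / 4)) <= 1 / 12).
{ split; [apply exp_pos |].
  rewrite exp_Ropp; replace (1 / 12) with (/ 12) by field; apply Rinv_le_contravar; [lra |].
  pose proof (exp_ineq1_le (L ^ 2 / 4)); assert (49 <= L ^ 2) by (replace 49 with (7 ^ 2) by ring; apply pow_incr; lra); lra. }
pose proof (moment_rough T u L K0 (exp (- (L ^ 2 / 4))) a n N X h w w1 w2 HTu ltac:(lra) ltac:(lra) HLu
  ltac:(lra) ltac:(lia) Hnu Ha1 HaK X1 ltac:(lia) HN12 Hh Hh1 Hrough He12 Hw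
  (HwI (proj2 He12)) (proj2 HV)) as MR.
fold V in MR.
replace (dirichlet_poly a Y) with (Mp a n)
  by (apply functional_extensionality; intros s; symmetry; apply dirichlet_poly_Mp).
eapply Rle_trans; [| exact MR].
replace (exp (- 8) / 2560 / theta) with (exp (- 8) / (80 * theta) / 32) by (field; lra); lra.
Qed.

Theorem theorem1 :
  exists c : R, 0 < c /\
  forall theta : R, 0 < theta ->
  forall K : R -> R,
  exists T0 : R, forall T : R, T0 <= T ->
  forall a : nat -> C,
    a 1%nat = 1 ->
    (forall eps : R, 0 < eps ->
       forall n : nat, (1 <= n)%nat -> INR n <= Rpower T theta ->
         Cmod (a n) <= K eps * Rpower (INR n) eps) ->
    c / theta <= mollified_moment (dirichlet_poly a (Rpower T theta)) T.
Proof.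
destruct large_theta_bound as [c1 [Hc1 B]].
set (t0 := exp (- 8) / 80); assert (Ht0 : 0 < t0) by (pose proof (exp_pos (- 8)); unfold t0; lra).
assert (P : 0 < c1 * (t0 / (1 + t0))) by (apply Rmult_lt_0_compat; [| apply Rdiv_lt_0_compat]; lra).
(* For theta > t0 the bound c1 / (1 + theta) is converted to a multiple of 1 / theta, because theta
   / (1 + theta) increases with theta. *)
exists (Rmin (exp (- 8) / 2560) (c1 * (t0 / (1 + t0)))); split.
{ apply Rmin_pos; [unfold t0 in Ht0; lra | exact P]. }
intros theta Hth K; pose proof (Rinv_0_lt_compat theta Hth) as Hi.
destruct (Rle_lt_dec theta t0) as [H | H].
- destruct (small_theta_bound theta (conj Hth H) K) as [T0 HT0]; exists T0; intros T HT a Ha1 Ha.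
  eapply Rle_trans; [| exact (HT0 T HT a Ha1 Ha)].
  apply Rmult_le_compat_r; [lra | apply Rmin_l].
- destruct (B theta Hth K) as [T0 HT0]; exists T0; intros T HT a Ha1 Ha.
  eapply Rle_trans; [| exact (HT0 T HT a Ha1 Ha)].
  apply (Rle_trans _ (c1 * (t0 / (1 + t0)) / theta)); [apply Rmult_le_compat_r; [lra | apply Rmin_r] |].
  apply (Rmult_le_reg_r ((1 + t0) * theta * (1 + theta))); [nra |].
  replace (c1 * (t0 / (1 + t0)) / theta * ((1 + t0) * theta * (1 + theta))) with
    (c1 * (t0 * (1 + theta))) by (field; lra).
  replace (c1 / (1 + theta) * ((1 + t0) * theta * (1 + theta))) with (c1 * ((1 + t0) * theta)) by (field; lra).
  apply Rmult_le_compat_l; nra.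
Qed.
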